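(* Let $k$ be a field of characteristic $0$ and let $G$ be a connected reductive algebraic group over $k$. Then for every finite Galois extension $\ell/k$, the natural map $$H^1(\mathrm{Gal}(\ell/k), G(\ell)) \longrightarrow H^1(\mathrm{Gal}(\ell/k), G(\ell[t]))$$ is a bijection.
   Context: $H^1$ denotes nonabelian group cohomology (pointed set of equivalence classes of $1$-cocycles). The group $\mathrm{Gal}(\ell/k)$ acts on $\ell[t]$ through the coefficients (fixing $t$), hence acts on $G(\ell[t])$, and it acts on $G(\ell)$ as usual. The natural map is induced by the equivariant inclusion $G(\ell)\subset G(\ell[t])$. *)

(* Defs.v *)
From HB Require Import structures.
From mathcomp Require Import all_boot all_order all_algebra all_fingroup all_field.
From mathcomp Require Import mathcomp_extra boolp classical_sets topology.

Set Implicit Arguments.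
Unset Strict Implicit.
Unset Printing Implicit Defensive.

Import GRing.Theory.
Local Open Scope ring_scope.
Local Open Scope quotient_scope.

Definition restr (k K : fieldType) (i : {rmorphism k -> K})
  (R : comAlgType K) : Type := R.

Section RestrictionOfScalars.
Variables (k K : fieldType) (i : {rmorphism k -> K}).

Section Object.
Variable R : comAlgType K.

HB.instance Definition _ := GRing.ComNzRing.on (restr i R).

Definition restr_scale (a : k) (x : restr i R) : restr i R := i a *: (x : R).

Fact restr_scaleA a b x :
  restr_scale a (restr_scale b x) = restr_scale (a * b) x.
Proof. by rewrite /restr_scale rmorphM scalerA. Qed.

Fact restr_scale1 : left_id 1 restr_scale.
Proof. by move=> x; rewrite /restr_scale rmorph1 scale1r. Qed.

Fact restr_scaleDr : right_distributive restr_scale +%R.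
Proof. by move=> a x y; rewrite /restr_scale scalerDr. Qed.

Fact restr_scaleDl x : {morph restr_scale^~ x : a b / a + b}.
Proof. by move=> a b; rewrite /restr_scale rmorphD scalerDl. Qed.

HB.instance Definition _ := GRing.Zmodule_isLmodule.Build k (restr i R)
  restr_scaleA restr_scale1 restr_scaleDr restr_scaleDl.

Fact restr_scaleAl (a : k) (x y : restr i R) : a *: (x * y) = (a *: x) * y.
Proof. exact: scalerAl. Qed.

HB.instance Definition _ :=
  GRing.Lmodule_isLalgebra.Build k (restr i R) restr_scaleAl.
HB.instance Definition _ := GRing.Lalgebra_isComAlgebra.Build k (restr i R).

End Object.

Section Morphism.
Variables (R S : comAlgType K) (f : {lrmorphism R -> S}).

Definition restr_map (x : restr i R) : restr i S := f x.

Fact restr_map_zmod : zmod_morphism restr_map.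
Proof. exact: (rmorphB f). Qed.
Fact restr_map_monoid : monoid_morphism restr_map.
Proof. by split; [exact: rmorph1 | exact: (rmorphM f)]. Qed.
Fact restr_map_scale : scalable restr_map.
Proof. move=> a x; exact: (linearZZ f (i a) x). Qed.

HB.instance Definition _ :=
  GRing.isZmodMorphism.Build (restr i R) (restr i S) restr_map restr_map_zmod.
HB.instance Definition _ :=
  GRing.isMonoidMorphism.Build (restr i R) (restr i S) restr_map
    restr_map_monoid.
HB.instance Definition _ :=
  GRing.isScalable.Build k (restr i R) (restr i S) *:%R restr_map
    restr_map_scale.

End Morphism.
End RestrictionOfScalars.
Arguments restr_map {k K} i {R S} f x.

Record spec (A : comNzRingType) := Spec {
  spec_pred : A -> bool;
  spec_ideal : idealr_closed spec_pred;
  spec_prime : prime_idealr_closed spec_pred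
}.

HB.instance Definition _ A := gen_eqMixin (spec A).
HB.instance Definition _ A := gen_choiceMixin (spec A).

Section Zariski.
Variable A : comNzRingType.
Local Open Scope classical_set_scope.

(* The complement of the closed set V(E). *)
Definition zariski_open (E : set A) : set (spec A) :=
  [set p | exists2 a, E a & a \notin spec_pred p].

Fact zariski_openT : range zariski_open setT.
Proof.
exists setT => //; apply/seteqP; split=> // p _.
by exists 1 => //; case: (spec_ideal p).
Qed.

Fact zariski_openI : setI_closed (range zariski_open).
Proof.
move=> _ _ [E _ <-] [F _ <-].
exists [set x | exists a b, [/\ E a, F b & x = a * b]] => //.
apply/seteqP; split=> p /=.
  case=> _ [a [b [Ea Fb ->]]] abp; case: (spec_ideal p) => p0 _ pI.
  split; [exists a | exists b] => //; apply: contra abp => xp.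
    by rewrite mulrC -[b * a]addr0 pI.
  by rewrite -[a * b]addr0 pI.
case=> -[a Ea ap] [b Fb bp]; exists (a * b); first by exists a, b.
by apply/negP => abp; have := spec_prime abp; rewrite (negPf ap) (negPf bp).
Qed.

Fact zariski_open_bigU (I : Type) (f : I -> set (spec A)) :
  (forall i, range zariski_open (f i)) -> range zariski_open (\bigcup_i f i).
Proof.
move=> fo; exists [set a | exists i E, zariski_open E = f i /\ E a] => //.
apply/seteqP; split=> p /=.
  by case=> a [i [E [fE Ea]]] ap; exists i => //; rewrite -fE; exists a.
case=> i _; have [E _ fE] := fo i; rewrite -fE => -[a Ea ap].
by exists a => //; exists i, E.
Qed.

HB.instance Definition _ := isOpenTopological.Build (spec A)
  zariski_openT zariski_openI zariski_open_bigU.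

End Zariski.

Section GroupFunctors.
Local Open Scope group_scope.

(* The laws are stated up to pointwise equality of algebra morphisms. *)
Record groupFunctor (k : fieldType) := GroupFunctor {
  points :> comAlgType k -> groupType;
  fmap : forall R S : comAlgType k, {lrmorphism R -> S} ->
    points R -> points S;
  fmapM : forall (R S : comAlgType k) (f : {lrmorphism R -> S}),
    {morph fmap f : x y / x * y};
  fmap_id : forall (R : comAlgType k) (f : {lrmorphism R -> R}),
    f =1 id -> fmap f =1 id;
  fmap_comp : forall (R S T : comAlgType k) (f : {lrmorphism R -> S})
      (g : {lrmorphism S -> T}) (h : {lrmorphism R -> T}),
    h =1 g \o f -> fmap h =1 fmap g \o fmap f
}.
Arguments fmap {k} G {R S} f x : rename.

Definition represents (k : fieldType) (G : groupFunctor k)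
    (A : comAlgType k) (u : G A) : Prop :=
  forall (R : comAlgType k) (g : G R), exists f : {lrmorphism A -> R},
    fmap G f u = g /\
    forall f' : {lrmorphism A -> R}, fmap G f' u = g -> f' =1 f.

(* By Yoneda the representing pair is unique up to isomorphism, so "exists"
   and "forall" representing pairs agree for representable G. *)
Definition coordinate_ring (k : fieldType) (G : groupFunctor k)
    (P : comAlgType k -> Prop) : Prop :=
  exists (A : comAlgType k) (u : G A), represents u /\ P A.

Definition finitely_generated (k : fieldType) (A : comAlgType k) : Prop :=
  exists s : seq A, forall B : {pred A},
    subalg_closed B -> {subset s <= B} -> forall x, x \in B.

Definition affine_algebraic_group (k : fieldType) (G : groupFunctor k) : Prop :=
  coordinate_ring G (@finitely_generated k).

Definition connected_group (k : fieldType) (G : groupFunctor k) : Prop :=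
  coordinate_ring G (fun A => connected [set: spec A]%classic).

Definition reduced_group (k : fieldType) (G : groupFunctor k) : Prop :=
  coordinate_ring G
    (fun A => forall (x : A) (n : nat), (x ^+ n = 0)%R -> x = 0%R).

Definition trivial_group (k : fieldType) (G : groupFunctor k) : Prop :=
  forall (R : comAlgType k) (g : G R), g = 1.

Record groupFunctorHom (k : fieldType) (H G : groupFunctor k) := GroupFunctorHom {
  hom_app :> forall R : comAlgType k, H R -> G R;
  hom_appM : forall R : comAlgType k, {morph @hom_app R : x y / x * y};
  hom_nat : forall (R S : comAlgType k) (f : {lrmorphism R -> S}) (x : H R),
    hom_app (fmap H f x) = fmap G f (hom_app x)
}.

Definition closed_immersion (k : fieldType) (H G : groupFunctor k)
    (j : groupFunctorHom H G) : Prop :=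
  exists (A B : comAlgType k) (u : G A) (v : H B) (f : {lrmorphism A -> B}),
    [/\ represents u, represents v, fmap G f u = j B v
      & forall b, exists a, f a = b].

Definition normal_image (k : fieldType) (H G : groupFunctor k)
    (j : groupFunctorHom H G) : Prop :=
  forall (R : comAlgType k) (g : G R) (h : H R),
    exists h' : H R, j R h' = g * j R h * g^-1.

Record linear_rep (k : fieldType) (G : groupFunctor k) (n : nat) := LinearRep {
  rep_app :> forall R : comAlgType k, G R -> 'M[R]_n;
  rep_app1 : forall R : comAlgType k, rep_app (1 : G R) = (1%:M)%R;
  rep_appM : forall (R : comAlgType k) (x y : G R),
    rep_app (x * y) = (rep_app x *m rep_app y)%R;
  rep_nat : forall (R S : comAlgType k) (f : {lrmorphism R -> S}) (x : G R),
    rep_app (fmap G f x) = map_mx f (rep_app x)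
}.

Definition fixed_vector (k : fieldType) (G : groupFunctor k) (n : nat)
    (r : linear_rep G n) (v : 'cV[k]_n) : Prop :=
  forall (R : comAlgType k) (x : G R),
    (r R x *m map_mx (in_alg R) v = map_mx (in_alg R) v)%R.

Definition unipotent_group (k : fieldType) (G : groupFunctor k) : Prop :=
  forall (n : nat) (r : linear_rep G n.+1),
    exists2 v : 'cV[k]_n.+1, v != 0%R & fixed_vector r v.

Section BaseChange.
Variables (k K : fieldType) (i : {rmorphism k -> K}) (G : groupFunctor k).

Definition base_change_points (R : comAlgType K) : groupType := G (restr i R).

Definition base_change_fmap (R S : comAlgType K) (f : {lrmorphism R -> S}) :
  base_change_points R -> base_change_points S :=
  fmap G (restr_map i f : {lrmorphism restr i R -> restr i S}).

Fact base_change_fmapM (R S : comAlgType K) (f : {lrmorphism R -> S}) :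
  {morph base_change_fmap f : x y / x * y}.
Proof. exact: fmapM. Qed.

Fact base_change_id (R : comAlgType K) (f : {lrmorphism R -> R}) :
  f =1 id -> base_change_fmap f =1 id.
Proof. by move=> f1; apply: fmap_id => x; apply: f1. Qed.

Fact base_change_comp (R S T : comAlgType K) (f : {lrmorphism R -> S})
    (g : {lrmorphism S -> T}) (h : {lrmorphism R -> T}) :
  h =1 g \o f ->
  base_change_fmap h =1 base_change_fmap g \o base_change_fmap f.
Proof. by move=> hE; apply: fmap_comp => x; apply: hE. Qed.

Definition base_change : groupFunctor K :=
  GroupFunctor base_change_fmapM base_change_id base_change_comp.

End BaseChange.

(* Over an algebraically closed field, a reduced algebraic group is the same
   as a smooth one, so the condition says that the unipotent radical of the
   base change of G to an algebraic closure of k is trivial.  Neither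
   connectedness nor smoothness of G itself is included; the latter is
   automatic in characteristic 0 (Cartier). *)
Definition reductive_group (k : fieldType) (G : groupFunctor k) : Prop :=
  exists (K : closedFieldType) (i : {rmorphism k -> K}),
    (forall x : K, algebraicOver i x) /\
    forall (U : groupFunctor K) (j : groupFunctorHom U (base_change i G)),
      affine_algebraic_group U -> closed_immersion j -> normal_image j ->
      reduced_group U -> connected_group U -> unipotent_group U ->
      trivial_group U.

End GroupFunctors.
Arguments fmap {k} G {R S} f x : rename.

Section NonabelianH1.
Local Open Scope group_scope.

(* Elements of Gamma are multiplied as MathComp multiplies Galois
   automorphisms: x * y is the composite "x first, then y", usually written
   y \o x. *)
Record gammaGroup (Gamma : finGroupType) := GammaGroup {
  gg_sort :> groupType;
  gg_act : Gamma -> gg_sort -> gg_sort;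
  gg_act1 : gg_act 1 =1 id;
  gg_actM : forall x y, gg_act (x * y) =1 gg_act y \o gg_act x;
  gg_act_morph : forall x, {morph gg_act x : a b / a * b}
}.

Section H1.
Variables (Gamma : finGroupType) (M : gammaGroup Gamma).

(* With y \o x for x * y this is c (s \o t) = c s * s (c t). *)
Definition cocycle_pred : pred {ffun Gamma -> M} := fun c =>
  [forall x, forall y, c (x * y) == c y * gg_act y (c x)].

Definition cocycle := {c | cocycle_pred c}.
HB.instance Definition _ := Choice.on cocycle.

Lemma cocycleM (c : cocycle) x y :
  val c (x * y) = val c y * gg_act y (val c x).
Proof. by apply/eqP; have /forallP/(_ x)/forallP/(_ y) := valP c. Qed.

Definition cohomologous (c d : cocycle) : bool :=
  `[< exists a : M, forall x, val d x = a^-1 * val c x * gg_act x a >].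

Lemma gg_act1g x : gg_act x (1 : M) = 1.
Proof.
by apply: (mulgI (gg_act x 1)); rewrite -gg_act_morph !mulg1.
Qed.

Fact cohomologous_refl : reflexive cohomologous.
Proof.
by move=> c; apply/asboolP; exists 1 => x; rewrite gg_act1g invg1 mul1g mulg1.
Qed.

Fact cohomologous_imp_sym c d : cohomologous c d -> cohomologous d c.
Proof.
move=> /asboolP[a ad]; apply/asboolP; exists a^-1 => x.
by rewrite ad invgK !mulgA mulgV mul1g -mulgA -gg_act_morph mulgV gg_act1g mulg1.
Qed.

Fact cohomologous_sym : symmetric cohomologous.
Proof. by move=> c d; apply/idP/idP; apply: cohomologous_imp_sym. Qed.

Fact cohomologous_trans : transitive cohomologous.
Proof.
move=> d c e /asboolP[a ad] /asboolP[b be]; apply/asboolP; exists (a * b) => x.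
by rewrite be ad gg_act_morph invMg !mulgA.
Qed.

Canonical cohomologous_equiv :=
  EquivRel cohomologous cohomologous_refl cohomologous_sym cohomologous_trans.

Definition H1 := {eq_quot cohomologous}.

End H1.

Record gammaGroupHom (Gamma : finGroupType) (M N : gammaGroup Gamma) :=
  GammaGroupHom {
    gh_app :> M -> N;
    gh_appM : {morph gh_app : a b / a * b};
    gh_equivariant : forall x a, gh_app (gg_act x a) = gg_act x (gh_app a)
  }.

Section H1Map.
Variables (Gamma : finGroupType) (M N : gammaGroup Gamma).
Variable f : gammaGroupHom M N.

Fact cocycle_map_subproof (c : cocycle M) :
  cocycle_pred [ffun x => f (val c x)].
Proof.
apply/forallP => x; apply/forallP => y; rewrite !ffunE cocycleM.
by rewrite gh_appM gh_equivariant.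
Qed.

Definition cocycle_map (c : cocycle M) : cocycle N :=
  Sub [ffun x => f (val c x)] (cocycle_map_subproof c).

Definition H1_map (h : H1 M) : H1 N := \pi_(H1 N) (cocycle_map (generic_quotient.repr h)).

Lemma H1_map_pi (c : cocycle M) :
  H1_map (\pi_(H1 M) c) = \pi_(H1 N) (cocycle_map c).
Proof.
have f1 : f 1 = 1 by apply: (mulgI (f 1)); rewrite -gh_appM !mulg1.
have fV a : f a^-1 = (f a)^-1.
  by apply: (mulgI (f a)); rewrite -gh_appM !mulgV f1.
rewrite /H1_map; case: piP => d /eqmodP /asboolP[a ad].
apply/eqmodP/cohomologous_imp_sym/asboolP; exists (f a) => x.
by rewrite !SubK !ffunE ad !gh_appM fV gh_equivariant.
Qed.

End H1Map.
End NonabelianH1.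

Section GaloisPoints.
Variables (k : fieldType) (L : splittingFieldType k) (G : groupFunctor k).

(* gal_of {:L} is the type of k-automorphisms of L, and all of them fix the
   base field. *)
Lemma gal_fullE : 'Gal({:L} / 1)%g = [set: gal_of {:L}]%SET.
Proof.
apply/setP => s; rewrite inE gal_kHom ?sub1v // k1HomE.
exact: ahomWin.
Qed.

(* L[t] as an algebra over k rather than over L. *)
Definition polyk : comAlgType k := restr (in_alg L) {poly L}.

Definition polyC_k (a : L) : polyk := a%:P.

Fact polyC_k_zmod : zmod_morphism polyC_k.
Proof. exact: polyCB. Qed.
Fact polyC_k_monoid : monoid_morphism polyC_k.
Proof. by split; [| exact: polyCM]. Qed.
Fact polyC_k_scale : scalable polyC_k.
Proof.
move=> a x; rewrite [LHS](_ : _ = (a%:A * x)%:P); last by rewrite mulr_algl.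
by rewrite polyCM mul_polyC.
Qed.

HB.instance Definition _ := GRing.isZmodMorphism.Build L polyk polyC_k
  polyC_k_zmod.
HB.instance Definition _ := GRing.isMonoidMorphism.Build L polyk polyC_k
  polyC_k_monoid.
HB.instance Definition _ := GRing.isScalable.Build k L polyk *:%R polyC_k
  polyC_k_scale.

Section Automorphism.
Variable s : gal_of {:L}.

Definition gal_poly (p : polyk) : polyk := map_poly s (p : {poly L}).

Fact gal_poly_zmod : zmod_morphism gal_poly.
Proof. exact: (rmorphB (map_poly s)). Qed.
Fact gal_poly_monoid : monoid_morphism gal_poly.
Proof. by split; [exact: rmorph1 | exact: (rmorphM (map_poly s))]. Qed.
Fact gal_poly_scale : scalable gal_poly.
Proof.
move=> a p; have sa : s a%:A = a%:A by rewrite linearZ /= rmorph1.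
transitivity ((s a%:A *: map_poly s (p : {poly L})) : {poly L}).
  exact: (map_polyZ s a%:A (p : {poly L})).
by rewrite sa.
Qed.

HB.instance Definition _ := GRing.isZmodMorphism.Build polyk polyk gal_poly
  gal_poly_zmod.
HB.instance Definition _ := GRing.isMonoidMorphism.Build polyk polyk gal_poly
  gal_poly_monoid.
HB.instance Definition _ := GRing.isScalable.Build k polyk polyk *:%R gal_poly
  gal_poly_scale.

End Automorphism.

Lemma galM_full (s t : gal_of {:L}) a : (s * t)%g a = t (s a).
Proof. by rewrite galM ?memvf. Qed.

Definition act_field (s : gal_of {:L}) : G L -> G L :=
  fmap G (s : {lrmorphism L -> L}).

Fact act_field1 : act_field 1%g =1 id.
Proof. by apply: fmap_id => a; exact: gal_id. Qed.
Fact act_fieldM s t : act_field (s * t)%g =1 act_field t \o act_field s.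
Proof. by apply: fmap_comp => a; exact: galM_full. Qed.
Fact act_field_morph s : {morph act_field s : a b / (a * b)%g}.
Proof. exact: fmapM. Qed.

Definition field_points : gammaGroup (gal_of {:L}) :=
  GammaGroup act_field1 act_fieldM act_field_morph.

Definition act_poly (s : gal_of {:L}) : G polyk -> G polyk :=
  fmap G (gal_poly s : {lrmorphism polyk -> polyk}).

Fact act_poly1 : act_poly 1%g =1 id.
Proof.
apply: fmap_id => p; apply/polyP => n.
by rewrite coef_map [LHS]gal_id.
Qed.
Fact act_polyM s t : act_poly (s * t)%g =1 act_poly t \o act_poly s.
Proof.
apply: fmap_comp => p; apply/polyP => n.
by rewrite /= !coef_map [LHS]galM_full.
Qed.
Fact act_poly_morph s : {morph act_poly s : a b / (a * b)%g}.
Proof. exact: fmapM. Qed.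

Definition poly_points : gammaGroup (gal_of {:L}) :=
  GammaGroup act_poly1 act_polyM act_poly_morph.

Definition const_points_app : field_points -> poly_points :=
  fmap G (polyC_k : {lrmorphism L -> polyk}).

Fact const_points_appM : {morph const_points_app : a b / (a * b)%g}.
Proof. exact: fmapM. Qed.

Fact const_points_equivariant s a :
  const_points_app (gg_act s a) = gg_act s (const_points_app a).
Proof.
have E : polyC_k \o (s : L -> L) =1 gal_poly s \o polyC_k.
  by move=> b; rewrite /= /gal_poly map_polyC.
pose h : {lrmorphism L -> polyk} := polyC_k \o (s : {lrmorphism L -> L}).
transitivity (fmap G h a); first by symmetry; apply: fmap_comp.
by apply: fmap_comp.
Qed.

Definition const_points : gammaGroupHom field_points poly_points :=
  GammaGroupHom const_points_appM const_points_equivariant.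

End GaloisPoints.

(* Main.v *)
(* Embed G as a closed subgroup of GL_n, with Lie algebra gg, and put s = [gg, gg].
   Reductivity enters only in the form that gg contains no nonzero G-stable space of commuting
   nilpotent matrices: its exponential would be a normal vector group. Cartan's criterion then
   shows that the Killing form of s is nondegenerate, and that an element d of G(l[t]) which
   commutes with s and has d(0) = 1 is trivial.
   Let c be a cocycle in G(l[t]). Twisting s (x) l[t] by Ad c and taking Galois invariants
   (Hilbert 90 over l[t]) gives a Lie algebra over k[t] whose Killing form has a nonzero constant
   discriminant, and such a Lie algebra comes from k: among the bases with rational weights a_i for
   which the structure constants x_ij^l have degree at most a_i + a_j - a_l, take one with minimal
   sum of weights. If the sum is positive, the leading coefficients form a Lie algebra with
   degenerate Killing form, and an abelian ideal of it allows to lower the weights; if it is zero,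
   the grading is inner and can be made trivial.
   Hence Ad c is, up to a coboundary F(t) with F(0) = 1, the constant cocycle Ad c(0). The
   automorphism F is Ad g, where g solves g' = Y g, g(0) = 1, with ad Y = F^-1 F'. The power series
   g is polynomial by induction on invariant subspaces and Schur's lemma, and it lies in G. By
   rigidity g carries c to c(0). *)

Require Import Defs.
From HB Require Import structures.
From mathcomp Require Import all_boot all_order all_algebra all_fingroup all_field.
From mathcomp Require Import zify ring lra.
From mathcomp Require Import boolp.
From mathcomp Require mpoly.

Set Implicit Arguments.
Unset Strict Implicit.
Unset Printing Implicit Defensive.

Import (canonicals) mpoly.
Import Order.TTheory GRing.Theory Num.Theory.
Local Open Scope ring_scope.
Local Open Scope quotient_scope.

(** * Bilinear spans and traces *)

(** Evaluation at t = 0 is an equivariant retraction onto G(l); this alone gives injectivity. For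
    surjectivity, [Ad] sees a point of G only up to the centralizer of [gg, gg], so solving the
    problem for Ad c leaves an error d: this is why rigidity is needed. The weights come from the
    point at infinity of the line. In the basis t^(-a_i) e_i the structure constants are regular
    there, their leading coefficients are the fibre, and the Killing discriminant acquires the
    factor t^(-2 sum a_i). So the sum is never negative, and is positive exactly when the fibre
    degenerates. An integral step may exceed the slack that an ideal leaves, so weights are
    rational; linear programming bounds their denominators, and the descent stops. A power series
    solution of a linear equation need not be polynomial. Here g intertwines two representations,
    and both Y and the intertwining relations have coefficients independent of the representation.
    They pass to subquotients, where Y, a sum of brackets, has trace zero. Points over all
    k-algebras R are compared with data over k by dual numbers and by linear functionals R -> k. *)

Section Bspan.
Variables (k : fieldType) (p q r : nat).
Variable f : 'rV[k]_p -> 'rV[k]_q -> 'rV[k]_r.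
Hypothesis fl : forall v, linear (f^~ v).
Hypothesis fr : forall u, linear (f u).

Definition bspan m1 m2 (U : 'M_(m1, p)) (V : 'M_(m2, q)) : 'M_r :=
  (\sum_i \sum_j <<f (row i U) (row j V)>>)%MS.

Lemma bilin_sum m1 m2 (U : 'M_(m1, p)) (V : 'M_(m2, q)) (a : 'rV_m1) (b : 'rV_m2) :
  f (a *m U) (b *m V) = \sum_i \sum_j (a 0 i * b 0 j) *: f (row i U) (row j V).
Proof.
pose L v : {linear 'rV_p -> 'rV_r} := HB.pack (f^~ v) (GRing.isLinear.Build _ _ _ _ _ (fl v)).
pose Rt u : {linear 'rV_q -> 'rV_r} := HB.pack (f u) (GRing.isLinear.Build _ _ _ _ _ (fr u)).
rewrite mulmx_sum_row -[LHS]/(L _ _) linear_sum; apply: eq_bigr => i _.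
rewrite linearZ /= mulmx_sum_row -[f _ _]/(Rt _ _) linear_sum scaler_sumr.
by apply: eq_bigr => j _; rewrite linearZ scalerA.
Qed.

Lemma bspan_in m1 m2 (U : 'M_(m1, p)) (V : 'M_(m2, q)) u v :
  (u <= U)%MS -> (v <= V)%MS -> (f u v <= bspan U V)%MS.
Proof.
case/submxP => a -> /submxP[b ->]; rewrite bilin_sum.
apply: summx_sub => i _; apply: summx_sub => j _; apply: scalemx_sub.
rewrite /bspan; apply: (sumsmx_sup i) => //; apply: (sumsmx_sup j) => //.
by rewrite genmxE.
Qed.

Lemma bspanP m1 m2 m3 (U : 'M_(m1, p)) (V : 'M_(m2, q)) (W : 'M_(m3, r)) :
  (forall u v, (u <= U)%MS -> (v <= V)%MS -> (f u v <= W)%MS) ->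
  (bspan U V <= W)%MS.
Proof.
move=> h; apply/sumsmx_subP => i _; apply/sumsmx_subP => j _.
by rewrite genmxE; apply: h; apply: row_sub.
Qed.

Lemma bspan_sum m1 m2 (U : 'M_(m1, p)) (V : 'M_(m2, q)) w :
  (w <= bspan U V)%MS -> exists c : 'M_(m1, m2),
    w = \sum_i \sum_j c i j *: f (row i U) (row j V).
Proof.
case/sub_sumsmxP => u ->.
have h i : exists c : 'rV_m2, u i *m (\sum_j <<f (row i U) (row j V)>>)%MS =
   \sum_j c 0 j *: f (row i U) (row j V).
  have : (u i *m (\sum_j <<f (row i U) (row j V)>>)%MS <=
           \sum_j <<f (row i U) (row j V)>>)%MS by apply: submxMl.
  case/sub_sumsmxP => z ->.
  have hz j : exists c, z j *m <<f (row i U) (row j V)>>%MS = c *: f (row i U) (row j V).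
    apply/sub_rVP; apply: submx_trans (submxMl _ _) _; by rewrite genmxE.
  have hz' j : {c | z j *m <<f (row i U) (row j V)>>%MS == c *: f (row i U) (row j V)}.
    by apply: sigW; have [c e] := hz j; exists c; apply/eqP.
  exists (\row_j sval (hz' j)); apply: eq_bigr => j _; rewrite mxE.
  exact: (eqP (svalP (hz' j))).
have h' i : {c : 'rV_m2 | u i *m (\sum_j <<f (row i U) (row j V)>>)%MS ==
   \sum_j c 0 j *: f (row i U) (row j V)}.
  by apply: sigW; have [c e] := h i; exists c; apply/eqP.
exists (\matrix_(i, j) sval (h' i) 0 j); apply: eq_bigr => i _.
rewrite [LHS](eqP (svalP (h' i))).
by apply: eq_bigr => j _; rewrite mxE.
Qed.

End Bspan.

Section Traces.
Variable k : fieldType.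

(** Rank factorization replaces eigenvalues: a singular A is C R through a smaller size, and R C has
    the same trace and is again nilpotent. *)
Lemma mxtrace_nilp n (A : 'M[k]_n) N : (iter N (mulmx A) 1%:M = 0) -> \tr A = 0.
Proof.
elim/ltn_ind: n A N => n IH A N hN.
case: (posnP n) => [n0|n_gt0]; first by move: A {IH hN}; rewrite n0 => A; rewrite /mxtrace big_ord0.
case: (ltnP (\rank A) n) => [rkA|rkA]; last first.
  have uA : A \in unitmx by rewrite -row_full_unit /row_full eqn_leq rank_leq_row.
  have: iter N (mulmx A) 1%:M \in unitmx.
    by elim: {hN}N => [|N IHN]; rewrite ?unitmx1 //= unitmx_mul uA.
  rewrite hN unitmxE /= => h.
  case: n A {IH hN rkA uA} n_gt0 h => // n A _.
  by rewrite det0 unitr0.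
have [r [C [R [ltr eA]]]] : exists r, exists C : 'M_(n, r), exists R : 'M_(r, n), (r < n)%N /\ A = C *m R.
  by exists (\rank A), (col_base A), (row_base A); rewrite mulmx_base.
subst A; rewrite mxtrace_mulC; apply: (IH _ ltr _ N.+1).
have e M : iter M.+1 (mulmx (R *m C)) 1%:M = R *m iter M (mulmx (C *m R)) 1%:M *m C.
  elim: M => [|M IHM]; first by rewrite /= !mulmx1.
  by rewrite iterS IHM iterS !mulmxA.
by rewrite e hN mulmx0 mul0mx.
Qed.

(** With A = C R a product of full rank factors, idempotency forces R C to be the identity of size
    [\rank A]. *)
Lemma mxtrace_idem n (A : 'M[k]_n) : A *m A = A -> \tr A = (\rank A)%:R.
Proof.
move=> AA; have [C [R [eA hC hR]]] : exists C : 'M_(n, \rank A), exists R : 'M_(\rank A, n),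
    [/\ A = C *m R, row_full C & row_free R].
  exists (col_base A), (row_base A); rewrite mulmx_base; split=> //.
    exact: col_base_full.
  exact: row_base_free.
have RC : R *m C = 1%:M.
  have : C *m (R *m C) *m R = C *m 1%:M *m R by rewrite mulmx1 !mulmxA -mulmxA -eA AA.
  by move/(row_free_inj hR)/(row_full_inj hC).
by rewrite [in LHS]eA mxtrace_mulC RC mxtrace1.
Qed.

(* Fitting: a polynomial in A without constant term is the projection on the
   part where A is invertible. *)
Lemma nilp_of_traces n (A : 'M[k]_n.+1) : [pchar k] =i pred0 ->
  (forall m, (0 < m)%N -> \tr (A ^+ m) = 0) -> A ^+ n.+1 = 0.
Proof.
move=> ch0 trA.
have trP (P : {poly k}) : P.[0] = 0 -> \tr (horner_mx A P) = 0.
  move=> P0; rewrite -[P]coefK poly_def rmorph_sum raddf_sum /=.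
  rewrite big1 // => -[[|i] /= _] _; rewrite linearZ linearZ /= rmorphXn /= horner_mx_X.
    by rewrite -horner_coef0 P0 mul0r.
  by rewrite trA // mulr0.
have [a [h]] := multiplicity_XsubC (char_poly A) 0.
rewrite monic_neq0 ?char_poly_monic //= subr0 => h0 hA.
have hX : horner_mx A 'X^a = A ^+ a by rewrite rmorphXn /= horner_mx_X.
have CH : horner_mx A h * A ^+ a = 0.
  by rewrite -hX -rmorphM /= -hA Cayley_Hamilton.
have natr0 m : (m%:R == 0 :> k) = (m == 0)%N by rewrite (pcharf0P k).1.
case: (posnP a) => [a0|a_gt0].
  have hn0 : h.[0] != 0 by [].
  have P0 : (1 - h.[0]^-1 *: h).[0] = 0 by rewrite !hornerE mulVf ?subrr.
  have := trP _ P0; rewrite rmorphB rmorph1 /= linearZ /=.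
  by move: CH; rewrite a0 expr0 mulr1 => ->; rewrite scaler0 subr0 mxtrace1 => /eqP; rewrite natr0.
have cop : coprimep h ('X^a) by rewrite coprimep_expr // -['X]subr0 coprimep_XsubC.
have [[u v] /= e1] := Bezout_eq1_coprimepP _ _ cop.
set P := v * 'X^a in e1.
have eP : horner_mx A P *m horner_mx A P = horner_mx A P.
  apply/eqP; rewrite -subr_eq0 -[_ *m _]/(_ * _) -rmorphM -rmorphB /=.
  have -> : P * P - P = - (u * v) * (h * 'X^a).
    rewrite -[X in _ - X]mulr1 -mulrBr -e1 opprD addrCA subrr addr0 /P; ring.
  by rewrite rmorphM /= -hA Cayley_Hamilton mulr0.
have := mxtrace_idem eP; rewrite trP; last by rewrite hornerM hornerXn expr0n gtn_eqF ?mulr0.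
move/esym/eqP; rewrite natr0 mxrank_eq0 => /eqP P0.
have : horner_mx A (u * h + P) = 1 by rewrite e1 rmorph1.
rewrite rmorphD /= P0 addr0 rmorphM /= => uh1.
have Aa : A ^+ a = 0 by rewrite -[LHS]mul1r -uh1 -mulrA CH mulr0.
have lea : (a <= n.+1)%N.
  have hn0 : h != 0 by apply: contraNneq h0 => ->; rewrite root0.
  have := size_char_poly A; rewrite hA size_mul // ?monic_neq0 ?monicXn //.
  rewrite size_polyXn; move: hn0; rewrite -size_poly_gt0.
  by move: (size h) => s; lia.
by rewrite -[X in A ^+ X](subnK lea) exprD Aa mulr0.
Qed.
End Traces.

(** * Engel's theorem *)

(** W grows by one vector satisfying P until none is left outside; the rank bounds the process. The
    Lie algebra of G and its centre become row spaces in this way. *)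
Lemma subspace_mx (k : fieldType) n (P : 'rV[k]_n -> Prop) :
  P 0 -> (forall a u v, P u -> P v -> P (a *: u + v)) ->
  exists W : 'M[k]_n, forall v, P v <-> (v <= W)%MS.
Proof.
move=> P0 PL.
suff h d (W : 'M_n) : (n - \rank W <= d)%N -> (forall v, (v <= W)%MS -> P v) ->
    exists W : 'M_n, forall v, P v <-> (v <= W)%MS.
  by apply: (h n 0); [rewrite mxrank0 subn0 | move=> v; rewrite submx0 => /eqP ->].
elim: d W => [|d IH] W hd hW.
  exists W => v; split=> [_|/hW //]; apply: submx_full.
  by rewrite /row_full eqn_leq rank_leq_row -subn_eq0 -leqn0.
have [[v Pv vW]|h] := pselect (exists2 v, P v & ~~ (v <= W)%MS); last first.
  by exists W => v; split=> [Pv|/hW //]; apply: contra_notT h => vW; exists v.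
apply: (IH (W + v)%MS); last first.
  move=> u /sub_addsmxP[[a b] /= ->].
  have /hW Pa : (a *m W <= W)%MS by apply: submxMl.
  rewrite addrC; have [c ->] : exists c, b *m v = c *: v.
    by exists (b 0 0); rewrite [b]mx11_scalar mul_scalar_mx mxE eqxx mulr1n.
  exact: PL.
have : (\rank W < \rank (W + v)%MS)%N.
  by apply: rank_ltmx; rewrite ltmxE // addsmxSl /= addsmx_sub submx_refl.
by move: hd (rank_leq_row (W + v)%MS); lia.
Qed.

Section NilWords.
Variables (k : fieldType) (q : nat).
Local Notation M := ('M[k]_q.+1).
Implicit Types (A B X Y : M) (s t : seq M).

Definition comm A B : M := A * B - B * A.

Definition memW p (W : 'M[k]_(p, q.+1 * q.+1)) A := (mxvec A <= W)%MS.

Definition lieW p (W : 'M[k]_(p, q.+1 * q.+1)) :=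
  forall A B, memW W A -> memW W B -> memW W (comm A B).

(** Stronger than nilpotency of each element: the associative algebra generated by W is nilpotent.
    This is the form of Engel's theorem that truncated exponentials require. *)
Definition nilw p (W : 'M[k]_(p, q.+1 * q.+1)) N :=
  forall s, all (memW W) s -> size s = N -> \prod_(A <- s) A = 0.

Section W.
Variables (p : nat) (W : 'M[k]_(p, q.+1 * q.+1)).

Lemma memWP (a : k) A B : memW W A -> memW W B -> memW W (a *: A + B).
Proof. by move=> hA hB; rewrite /memW linearP addmx_sub ?scalemx_sub. Qed.

Lemma memW0 : memW W 0. Proof. by rewrite /memW linear0 sub0mx. Qed.

Lemma memWZ (a : k) A : memW W A -> memW W (a *: A).
Proof. by move=> hA; rewrite -[_ *: _]addr0 memWP ?memW0. Qed.

Lemma nilw_le N N' : (N <= N')%N -> nilw W N -> nilw W N'.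
Proof.
move=> le nW s sW sz; rewrite -(cat_take_drop N s) big_cat /= nW ?mul0r //.
  by apply/allP => A /mem_take; move/allP: sW; apply.
by rewrite size_takel ?sz.
Qed.

(** The left annihilators of words of length i form an increasing filtration, which plays the part
    of an invariant flag. *)
Definition lann i Y := forall s, all (memW W) s -> size s = i -> Y * \prod_(A <- s) A = 0.

Lemma lannS i Y : lann i Y -> lann i.+1 Y.
Proof.
move=> h s; case/lastP: s => // s b; rewrite all_rcons size_rcons => /andP[_ hs] [sz].
by rewrite -cats1 big_cat mulrA h ?mul0r.
Qed.

Lemma lannP i a Y Z : lann i Y -> lann i Z -> lann i (a *: Y + Z).
Proof. by move=> hY hZ s hs sz; rewrite mulrDl -scalerAl hY ?hZ ?scaler0 ?addr0. Qed.

Lemma lann_b i Y b : memW W b -> lann i.+1 Y -> lann i (Y * b).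
Proof.
move=> hb hY s hs sz; rewrite -mulrA; have := hY (b :: s).
by rewrite big_cons; apply; rewrite /= ?hb ?sz.
Qed.

(** In Y x b the letter b is moved past x at the price of the bracket [x, b], which lies again in
    W. *)
Lemma lann_x i Y x : (forall b, memW W b -> memW W (comm x b)) -> lann i Y -> lann i (Y * x).
Proof.
move=> hx; elim: i Y => [|i IH] Y hY s.
  by move=> hs sz; rewrite -mulrA; case: s hs sz => // _ _;
     rewrite big_nil mulr1; have := hY [::]; rewrite big_nil mulr1 => -> //; rewrite mul0r.
case: s => // b s /= /andP[hb hs] [sz]; rewrite big_cons.
have -> : Y * x * (b * \prod_(A <- s) A) =
    Y * b * x * \prod_(A <- s) A + Y * (comm x b * \prod_(A <- s) A).
  by rewrite /comm mulrBl mulrBr !mulrA addrC subrK.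
rewrite (IH (Y * b)) //; last exact: lann_b.
by have := hY (comm x b :: s); rewrite big_cons => ->; rewrite ?addr0 /= ?hx ?sz.
Qed.

Hypothesis lW : lieW W.

(** Expanding the iterated bracket moves each letter of s to the left or to the right of x. With 2N
    letters available, one side ends up with at least N of them. *)
Lemma adword_zero N x s Y t u : nilw W N -> all (memW W) s -> all (memW W) t -> all (memW W) u ->
  (N + N <= size s + size t + size u)%N -> Y = foldl comm x s ->
  (\prod_(A <- t) A) * Y * (\prod_(A <- u) A) = 0.
Proof.
move=> nW; elim/last_ind: s Y t u => [|s b IH] Y t u hs ht hu le ->.
  have [lt|lt] : (N <= size t)%N \/ (N <= size u)%N by move: le => /=; lia.
    by rewrite (nilw_le lt nW ht) // !mul0r.
  by rewrite (nilw_le lt nW hu) // mulr0.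
move: hs; rewrite all_rcons => /andP[hb hs].
rewrite foldl_rcons {1}/comm mulrBr mulrBl.
have := IH _ t (b :: u) hs ht _ _ erefl; rewrite big_cons => e1.
have := IH _ (rcons t b) u hs _ hu _ erefl; rewrite -cats1 big_cat big_seq1 /= => e2.
rewrite -!mulrA [_ * (b * _)]mulrA in e1 *; rewrite !mulrA in e1 e2 *.
rewrite e1 ?e2 ?subrr //=; move: le; rewrite ?size_rcons ?size_cat ?all_cat /= ?hb ?hu ?ht //=; lia.
Qed.

End W.

(** On the filtration by [lann], letters of W lower the level while x preserves it. A word of r
    letters therefore acts on a graded piece as a multiple of x^r = 0, and r * N letters descend
    through all N levels. *)
Lemma nilw_extend p (W : 'M[k]_(p, q.+1 * q.+1)) x N r :
  (forall b, memW W b -> memW W (comm x b)) -> nilw W N -> x ^+ r = 0 ->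
  nilw (W + mxvec x)%MS (r * N).
Proof.
move=> hx nW xr.
pose W' := (W + mxvec x)%MS.
have dec A : memW W' A -> exists b c, memW W b /\ A = b + c *: x.
  case/sub_addsmxP => -[a b] /= e; exists (vec_mx (a *m W)), (b 0 0); split.
    by rewrite /memW vec_mxK submxMl.
  apply: (can_inj mxvecK); rewrite e linearD linearZ /= vec_mxK; congr (_ + _).
  by rewrite [b]mx11_scalar mul_scalar_mx mxE eqxx mulr1n.
have stepK i Y A : memW W' A -> lann W i Y -> lann W i (Y * A).
  case/dec => b [c [hb ->]] hY; rewrite mulrDr -scalerAr addrC.
  apply: lannP; first exact: lann_x.
  by case: i hY => [hY|i hY]; [move: (hY [::]); rewrite big_nil mulr1 => -> //; rewrite mul0r =>
      s _ _; rewrite mul0r | apply: lannS; apply: lann_b].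
have red i Y s : all (memW W') s -> lann W i.+1 Y ->
    exists c, lann W i (Y * \prod_(A <- s) A - c *: (Y * x ^+ size s)).
  elim/last_ind: s => [|s A IH] hs hY.
    by exists 1; rewrite big_nil expr0 scale1r subrr => t _ _; rewrite mul0r.
  move: hs; rewrite all_rcons => /andP[hA hs]; have [c hc] := IH hs hY.
  have [b [d [hb eA]]] := dec _ hA; exists (c * d).
  have -> : Y * \prod_(A0 <- rcons s A) A0 - (c * d) *: (Y * x ^+ size (rcons s A)) =
     1 *: ((Y * \prod_(A <- s) A - c *: (Y * x ^+ size s)) * A) + c *: ((Y * x ^+ size s) * b).
    rewrite -cats1 big_cat big_seq1 /= size_cat addn1 exprSr scale1r mulrBl !mulrA -addrA.
    congr (_ + _); move: (Y * x ^+ size s) => Z.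
    by rewrite eA mulrDr -scalerAr -!scalerAl scalerA [d * c]mulrC opprD addrAC addNr add0r.
  apply: lannP; first exact: stepK.
  have h : lann W i.+1 (Y * x ^+ size s).
    by elim: (size s) => [|j IHj]; rewrite ?expr0 ?mulr1 // exprSr mulrA; apply: lann_x.
  by rewrite -[_ *: _]addr0; apply: lannP; [exact: lann_b | move=> t _ _; rewrite mul0r].
have main i Y s : all (memW W') s -> size s = (r * i)%N -> lann W i Y -> Y * \prod_(A <- s) A = 0.
  elim: i Y s => [|i IH] Y s hs sz hY.
    rewrite muln0 in sz; case: s sz hs => // _ _.
    by have := hY [::]; rewrite big_nil mulr1 => -> //; rewrite mulr1.
  rewrite -(cat_take_drop r s) big_cat /= mulrA; apply: IH.
  - by move: hs; rewrite -{1}(cat_take_drop r s) all_cat => /andP[].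
  - by rewrite size_drop sz mulnS addKn.
  have szr : size (take r s) = r by rewrite size_takel // sz mulnS leq_addr.
  have [|c] := @red i Y (take r s) _ hY.
    by move: hs; rewrite -{1}(cat_take_drop r s) all_cat => /andP[].
  by rewrite szr xr mulr0 scaler0 subr0.
move=> s hs sz; have := main N 1 s hs sz; rewrite mul1r; apply=> t ht szt.
by rewrite mul1r nW.
Qed.

(** A subalgebra B with nilpotent words grows by one dimension at a time; [nilw_extend] does the
    step once an element of W outside B that normalizes B is found. *)
Theorem engel p (W : 'M[k]_(p, q.+1 * q.+1)) : lieW W ->
  (forall A, memW W A -> exists r, A ^+ r = 0) -> exists N, nilw W N.
Proof.
move=> lW nilA.
suff h d (B : 'M[k]_(q.+1 * q.+1)) N : (\rank W - \rank B <= d)%N -> (B <= W)%MS ->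
    lieW B -> nilw B N -> exists N, nilw W N.
  apply: (h _ 0 1%N (leqnn _)); rewrite ?sub0mx //.
    by move=> A C; rewrite /memW !submx0 !mxvec_eq0 => /eqP -> /eqP ->; rewrite /comm mulr0 subrr.
  by case=> // A [|//]; rewrite /= /memW submx0 mxvec_eq0 andbT => /eqP ->; rewrite big_seq1.
elim: d B N => [|d IH] B N hd BW lB nB.
  have WB : (W <= B)%MS by rewrite -(geq_leqif (mxrank_leqif_sup BW)) -subn_eq0 -leqn0.
  by exists N => s hs; apply: nB; apply: sub_all hs => A; move/submx_trans; apply.
have [WB|/row_subPn[i0 hi0]] := boolP (W <= B)%MS.
  by exists N => s hs; apply: nB; apply: sub_all hs => A; move/submx_trans; apply.
set x0 := vec_mx (row i0 W).
have x0W : memW W x0 by rewrite /memW vec_mxK row_sub.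
have x0B : ~~ memW B x0 by rewrite /memW vec_mxK.
have sub A : memW B A -> memW W A by move/submx_trans; apply.
(* If no chain of brackets starting at [x0] reaches a normalizer of B, it can be prolonged outside B
   forever; but at length 2N it vanishes by [adword_zero]. *)
have alt j : (exists x, [/\ memW W x, ~~ memW B x & forall b, memW B b -> memW B (comm x b)]) \/
   (exists s, [/\ all (memW B) s, size s = j, memW W (foldl comm x0 s) & ~~ memW B (foldl comm x0 s)]).
  elim: j => [|j [|[s [hs sz h1 h2]]]]; [by right; exists [::] | by left |].
  have [h|h] := pselect (forall b, memW B b -> memW B (comm (foldl comm x0 s) b)).
    by left; exists (foldl comm x0 s).
  move/existsNP: h => [b] /not_implyP[hb /negP nb]; right; exists (rcons s b).
  rewrite all_rcons hb hs size_rcons sz foldl_rcons; split=> //.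
  by apply: lW => //; apply: sub.
have [[x [xW xB hx]]|[s [hs sz _]]] := alt (N + N)%N; last first.
  have := @adword_zero _ B N x0 s _ [::] [::] nB hs isT isT _ erefl.
  by rewrite !big_nil mul1r mulr1 /= !addn0 sz leqnn => -> //; rewrite memW0.
have [r xr] := nilA _ xW.
apply: (IH (B + mxvec x)%MS (r * N)%N).
- have : (\rank B < \rank (B + mxvec x)%MS)%N.
    by apply: rank_ltmx; rewrite ltmxE // addsmxSl /= addsmx_sub submx_refl.
  have : (\rank (B + mxvec x)%MS <= \rank W)%N by rewrite mxrankS // addsmx_sub BW.
  by move: hd; lia.
- by rewrite addsmx_sub BW.
- have dec A : memW (B + mxvec x)%MS A -> exists b c, memW B b /\ A = b + c *: x.
    case/sub_addsmxP => -[a b] /= e; exists (vec_mx (a *m B)), (b 0 0); split.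
      by rewrite /memW vec_mxK submxMl.
    apply: (can_inj mxvecK); rewrite e linearD linearZ /= vec_mxK; congr (_ + _).
    by rewrite [b]mx11_scalar mul_scalar_mx mxE eqxx mulr1n.
  move=> A C /dec[b [c [hb ->]]] /dec[b' [c' [hb' ->]]].
  apply: (submx_trans _ (addsmxSl _ _)).
  have -> : comm (b + c *: x) (b' + c' *: x) = comm b b' + (c *: comm x b' + (- c') *: comm x b).
    rewrite /comm !mulrDl !mulrDr -!scalerAl -!scalerAr !scalerBr !scalerA !scaleNr.
    move: (b * b') (b' * b) (x * b') (b * x) (x * b) (b' * x) (x * x) => z1 z2 z3 z4 z5 z6 z7.
    by apply/matrixP => i j; rewrite !mxE; ring.
  rewrite -[comm b b']scale1r; apply: memWP; first exact: lB.
  by apply: memWP; [exact: hx | apply: memWZ; apply: hx].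
- exact: nilw_extend.
Qed.

End NilWords.

(** * Cartan's criterion *)

Section Interp.
Variable K : fieldType.

Lemma coprime_prod_XsubC (S : seq K) N c : c \notin S ->
  coprimep (('X - c%:P) ^+ N) (\prod_(m <- S) ('X - m%:P) ^+ N).
Proof.
move=> cS; apply: coprimep_expl; elim: S cS => [|m S IH]; first by rewrite big_nil coprimep1.
rewrite inE negb_or big_cons coprimepMr => /andP[cm cS]; rewrite IH // andbT.
by apply: coprimep_expr; rewrite coprimep_XsubC2 // subr_eq0 eq_sym.
Qed.

(** The Chinese remainder theorem, one node at a time, from a Bezout relation between (X - c)^N and
    the product of the other factors. *)
Lemma interpolate (S : seq K) (N : nat) (g : K -> K) : uniq S ->
  exists P : {poly K}, forall c, c \in S -> (('X - c%:P) ^+ N %| P - (g c)%:P)%R.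
Proof.
elim: S => [|c S IH] /=; first by exists 0.
case/andP=> cS /IH[P hP].
have := coprime_prod_XsubC N cS; case/Bezout_eq1_coprimepP => -[u v] /= e.
set D := \prod_(m <- S) _ in e.
exists (P + v * D * ((g c)%:P - P)) => d; rewrite inE => /orP[/eqP ->|dS].
  have -> : P + v * D * ((g c)%:P - P) - (g c)%:P = ((P - (g c)%:P) * u) * ('X - c%:P) ^+ N.
    have eu : u * ('X - c%:P) ^+ N = 1 - v * D by rewrite -e addrK.
    by rewrite -[_ * u * _]mulrA eu; ring.
  exact: dvdp_mull.
rewrite addrAC dvdp_addr ?hP //; apply: dvdp_mulr; apply: dvdp_mull.
by rewrite /D (big_rem d) //=; apply: dvdp_mulr.
Qed.

Lemma dvdp_prod_XsubC (S : seq K) N (P : {poly K}) : uniq S ->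
  (forall c, c \in S -> (('X - c%:P) ^+ N %| P)%R) -> (\prod_(c <- S) ('X - c%:P) ^+ N %| P)%R.
Proof.
elim: S => [|c S IH] /=; first by rewrite big_nil dvd1p.
case/andP=> cS uS h; rewrite big_cons Gauss_dvdp ?coprime_prod_XsubC //.
by rewrite h ?mem_head // IH // => d dS; rewrite h // inE dS orbT.
Qed.

Lemma horner_mx_eq0 n (A : 'M[K]_n.+1) (rs S : seq K) (P : {poly K}) :
  char_poly A = \prod_(c <- rs) ('X - c%:P) -> uniq S -> {subset rs <= S} ->
  (forall c, c \in S -> (('X - c%:P) ^+ n.+1 %| P)%R) -> horner_mx A P = 0.
Proof.
move=> hA uS sub hP.
suff /dvdpP[T ->] : (char_poly A %| P)%R by rewrite rmorphM /= Cayley_Hamilton mulr0.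
apply: dvdp_trans (dvdp_prod_XsubC uS hP).
have szrs : size rs = n.+1.
  by have := size_char_poly A; rewrite hA size_prod_XsubC => -[].
rewrite hA prodrXl -szrs; elim: {hA szrs} rs sub => [|c rs IH] sub; first by rewrite big_nil dvd1p.
rewrite big_cons exprS dvdp_mul ?IH //; last by move=> d h; apply: sub; rewrite inE h orbT.
by rewrite (big_rem c) /= ?dvdp_mulr // sub ?mem_head.
Qed.

Lemma horner_mx_eigen n (A : 'M[K]_n.+1) (v : 'rV_n.+1) a (P : {poly K}) : v *m A = a *: v ->
  v *m horner_mx A P = P.[a] *: v.
Proof.
move=> h; elim/poly_ind: P => [|P c IH]; first by rewrite rmorph0 horner0 mulmx0 scale0r.
rewrite rmorphD rmorphM /= horner_mx_X horner_mx_C mulmxDr [_ * A]/(_ *m A) mulmxA IH.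
by rewrite -scalemxAl h mul_mx_scalar !hornerE scalerDl scalerA.
Qed.

End Interp.

Lemma intr_char0 (K : fieldType) (z : int) : [pchar K] =i pred0 ->
  (z%:~R == 0 :> K) = (z == 0).
Proof.
move=> ch0; case: z => n; first by rewrite -pmulrn (pcharf0P K).1.
by rewrite NegzE mulrNz oppr_eq0 -pmulrn (pcharf0P K).1.
Qed.

Section RatMorphism.
Variables (K : fieldType) (ch0 : [pchar K] =i pred0).

Let ratrE (n d : int) : d != 0 -> ratr (n%:~R / d%:~R : rat) = n%:~R / d%:~R :> K.
Proof.
move=> d0; rewrite /ratr; set x : rat := _ / _.
have h : numq x * d = n * denq x.
  apply: (@intr_inj rat); rewrite !intrM numqE mulrAC; congr (_ * _).
  by rewrite /x divfK // intr_eq0.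
apply/eqP; rewrite eqr_div ?intr_char0 ?denq_eq0 //; apply/eqP.
by rewrite -!intrM h.
Qed.

Fact ratr_char0_zmod : zmod_morphism (@ratr K).
Proof.
move=> x y; rewrite -{1}[x]divq_num_den -{1}[y]divq_num_den.
have dx : denq x != 0 by rewrite denq_eq0.
have dy : denq y != 0 by rewrite denq_eq0.
rewrite -mulNr addf_div ?intr_eq0 // -mulrNz -!intrM -intrD ratrE ?mulf_neq0 //.
by rewrite /ratr -mulNr addf_div ?intr_char0 // -mulrNz -!intrM -intrD.
Qed.

Fact ratr_char0_monoid : monoid_morphism (@ratr K).
Proof.
split=> [|x y]; first by rewrite /ratr divr1.
rewrite -{1}[x]divq_num_den -{1}[y]divq_num_den.
have dx : denq x != 0 by rewrite denq_eq0.
have dy : denq y != 0 by rewrite denq_eq0.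
rewrite mulf_div -!intrM ratrE ?mulf_neq0 //.
by rewrite /ratr mulf_div -!intrM.
Qed.

(** Denominators stay nonzero in characteristic 0, so the prime field embeds; rational functionals
    of eigenvalues and rational weights act through this map. *)
Definition rat_morph : {rmorphism rat -> K} :=
  HB.pack (@ratr K) (GRing.isZmodMorphism.Build _ _ _ ratr_char0_zmod)
    (GRing.isMonoidMorphism.Build _ _ _ ratr_char0_monoid).

End RatMorphism.

(* A family of scalars that is not identically zero is detected by a rational
   linear functional: the vectors f below are the functionals on its Q-span. *)
Lemma rational_functional (K : fieldType) (h : {rmorphism rat -> K}) r (c : 'I_r -> K) :
  (forall f : 'rV[rat]_r,
     (forall v : 'rV[rat]_r, \sum_i h (v 0 i) * c i = 0 -> \sum_i v 0 i * f 0 i = 0) -> f = 0) ->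
  forall i, c i = 0.
Proof.
move=> hf i0.
pose P (v : 'rV[rat]_r) := \sum_i h (v 0 i) * c i = 0.
have [|a u v|W hW] := @subspace_mx _ _ P.
- by apply: big1 => i _; rewrite mxE rmorph0 mul0r.
- rewrite /P => hu hv.
  transitivity (\sum_i (h a * (h (u 0 i) * c i) + h (v 0 i) * c i)).
    have e i : h ((a *: u + v) 0 i) * c i = h a * (h (u 0 i) * c i) + h (v 0 i) * c i.
      by rewrite !mxE rmorphD rmorphM mulrDl mulrA.
    exact: (eq_bigr _ (fun i _ => e i)).
  by rewrite big_split -mulr_sumr /= hu hv mulr0 addr0.
have full : row_full W.
  rewrite -[row_full _]/(\rank W == r) -mxrank_tr -[_ == _]/(row_free W^T) -kermx_eq0.
  apply/eqP/row_matrixP => i; rewrite row0; apply: hf => v /hW/submxP[d ->].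
  have : row i (kermx W^T) *m W^T = 0 by rewrite -row_mul mulmx_ker row0.
  move/(congr1 trmx); rewrite trmx_mul trmxK trmx0 => e.
  have := congr1 (mulmx d) e; rewrite mulmx0 mulmxA => /matrixP/(_ 0 0).
  by rewrite !mxE => e2; rewrite -[RHS]e2; apply: eq_bigr => j _; rewrite !mxE.
have := (hW (delta_mx 0 i0)).2 (submx_full _ full).
rewrite /P (bigD1 i0) //= mxE !eqxx rmorph1 mul1r big1 ?addr0 // => j ji.
by rewrite mxE (negPf ji) andbF rmorph0 mul0r.
Qed.

Definition glbr (k : fieldType) q (u v : 'rV[k]_(q.+1 * q.+1)) := mxvec (comm (vec_mx u) (vec_mx v)).

Lemma comm_linear_l (k : fieldType) q (B : 'M[k]_q.+1) : linear (fun A => comm A B).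
Proof.
move=> a A C; rewrite /comm mulrDl mulrDr -scalerAl -scalerAr scalerBr opprD.
by rewrite addrACA.
Qed.

Lemma comm_linear_r (k : fieldType) q (B : 'M[k]_q.+1) : linear (comm B).
Proof.
move=> a A C; rewrite /comm mulrDl mulrDr -scalerAl -scalerAr scalerBr opprD.
by rewrite addrACA.
Qed.

HB.instance Definition _ (k : fieldType) q (B : 'M[k]_q.+1) :=
  GRing.isLinear.Build k _ _ _ (comm B) (comm_linear_r B).

Lemma glbr_linear_l (k : fieldType) q (v : 'rV[k]_(q.+1 * q.+1)) : linear (@glbr k q ^~ v).
Proof. by move=> a u w; rewrite /glbr linearP comm_linear_l linearP. Qed.

Lemma glbr_linear_r (k : fieldType) q (v : 'rV[k]_(q.+1 * q.+1)) : linear (@glbr k q v).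
Proof. by move=> a u w; rewrite /glbr linearP comm_linear_r linearP. Qed.

Section SemisimplePart.
Variables (K : closedFieldType) (ch0 : [pchar K] =i pred0) (n : nat) (X : 'M[K]_n.+1).

Definition adm := lin_mx (comm X).

Definition hadm (Q : {poly K}) : 'M[K]_(n.+1 * n.+1) := horner_mx adm Q.
Definition adact (Q : {poly K}) (Y : 'M[K]_n.+1) : 'M[K]_n.+1 := vec_mx (mxvec Y *m hadm Q).

Lemma adact_lin Q : linear (adact Q).
Proof. by move=> a Y Z; rewrite /adact linearP mulmxDl -scalemxAl linearP. Qed.

Lemma adactC c Y : adact c%:P Y = c *: Y.
Proof. by rewrite /adact /hadm horner_mx_C mul_mx_scalar linearZ /= mxvecK. Qed.

Lemma adactD P Q Y : adact (P + Q) Y = adact P Y + adact Q Y.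
Proof. by rewrite /adact /hadm rmorphD mulmxDr linearD. Qed.

Lemma adactM P Q Y : adact (P * Q) Y = adact Q (adact P Y).
Proof. by rewrite /adact vec_mxK -mulmxA /hadm -[horner_mx adm P *m _]/(_ * _) -rmorphM. Qed.

Lemma adactX Y : adact 'X Y = X * Y - Y * X.
Proof. by rewrite /adact /hadm horner_mx_X mul_vec_lin mxvecK. Qed.

(** Here ad X - (l - m) is left multiplication by X - l minus right multiplication by X - m. The two
    commute, so their exponents add; the induction replaces the binomial expansion. *)
Lemma adact_gen a b (l m : K) (Y : 'M[K]_n.+1) :
  (X - l%:M) ^+ a * Y = 0 -> Y * (X - m%:M) ^+ b = 0 ->
  adact (('X - (l - m)%:P) ^+ (a + b)) Y = 0.
Proof.
have z P : adact P 0 = 0.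
  by rewrite /adact linear0 mul0mx linear0.
move e : (a + b)%N => N; elim: N a b e Y => [|N IH] a b e Y.
  by move: e; case: a => // _; rewrite expr0 mul1r => -> _; rewrite z.
move=> h1 h2.
have [a0|a_gt0] := posnP a; first by move: h1; rewrite a0 expr0 mul1r => ->; rewrite z.
have [b0|b_gt0] := posnP b; first by move: h2; rewrite b0 expr0 mulr1 => ->; rewrite z.
rewrite exprS adactM.
have -> : adact ('X - (l - m)%:P) Y = (-1) *: (Y * (X - m%:M)) + (X - l%:M) * Y.
  rewrite -rmorphN /= adactD adactC adactX scaleN1r mulrBl mulrBr.
  rewrite [l%:M * Y]mul_scalar_mx [Y * m%:M]mul_mx_scalar /comm.
  by move: (X * Y) (Y * X) => Z1 Z2; apply/matrixP => i j; rewrite !mxE; ring.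
have e1 : adact (('X - (l - m)%:P) ^+ N) (Y * (X - m%:M)) = 0.
  apply: (IH a b.-1); first by move: e a_gt0 b_gt0; lia.
    by rewrite mulrA h1 mul0r.
  by rewrite -mulrA -exprS prednK.
have e2 : adact (('X - (l - m)%:P) ^+ N) ((X - l%:M) * Y) = 0.
  apply: (IH a.-1 b); first by move: e a_gt0 b_gt0; lia.
    by rewrite mulrA -exprSr prednK.
  by rewrite -mulrA h2 mulr0.
by rewrite adact_lin e1 e2 scaler0 addr0.
Qed.

Variable rs : seq K.
Hypothesis char_X : char_poly X = \prod_(c <- rs) ('X - c%:P).
Let S := undup rs.
Let N := n.+1.

Let horner0X P : (forall c, c \in S -> (('X - c%:P) ^+ N %| P)%R) -> horner_mx X P = 0.
Proof.
by apply: horner_mx_eq0 char_X (undup_uniq _) _ => c; rewrite mem_undup.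
Qed.

(** The polynomials interpolate the indicator functions of the eigenvalues to order N, the largest
    possible multiplicity; evaluated at X they are the projectors on the generalized eigenspaces. *)
Lemma spectral_projectors : exists E : K -> {poly K},
  [/\ forall c d, c \in S -> d \in S -> (('X - d%:P) ^+ N %| E c - ((c == d)%:R)%:P)%R,
      \sum_(c <- S) horner_mx X (E c) = 1 &
      forall c, c \in S -> (X - c%:M) ^+ N * horner_mx X (E c) = 0].
Proof.
have /choice[E hE] : forall c, exists P : {poly K}, forall d, d \in S ->
    (('X - d%:P) ^+ N %| P - ((c == d)%:R)%:P)%R.
  by move=> c; apply: interpolate; apply: undup_uniq.
exists E; split=> [c d _|//|c cS]; first exact: hE.
  apply/eqP; rewrite -subr_eq0 -rmorph_sum -(rmorph1 (horner_mx X)) -rmorphB; apply/eqP.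
  apply: horner0X => d dS; rewrite (big_rem d) //= addrAC.
  rewrite dvdp_addr; last by have := hE d d dS; rewrite eqxx.
  rewrite big_seq; apply: (big_ind (fun P => ('X - d%:P) ^+ N %| P)%R) => [||c].
  - exact: dvdp0.
  - by move=> P Q hP hQ; rewrite dvdp_addr.
  rewrite mem_rem_uniq ?undup_uniq // inE => /andP[/negPf cd _].
  by have := hE c d dS; rewrite cd subr0.
have -> : (X - c%:M) ^+ N = horner_mx X (('X - c%:P) ^+ N).
  by rewrite rmorphXn rmorphB /= horner_mx_X horner_mx_C.
rewrite -rmorphM; apply: horner0X => d dS; have [->|cd] := eqVneq c d.
  by rewrite dvdp_mulr.
by rewrite dvdp_mull //; have := hE c d dS; rewrite (negPf cd) subr0.
Qed.

(* The rational multiples of the semisimple part: s acts on End V through a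
   polynomial in ad X. *)
Lemma replica (h : {rmorphism rat -> K}) (f : 'rV[rat]_(size S)) :
  (forall v : 'rV[rat]_(size S), \sum_i h (v 0 i) * S`_i = 0 -> \sum_i v 0 i * f 0 i = 0) ->
  (forall Q s, (forall Y, s * Y - Y * s = adact Q Y) -> \tr (s * X) = 0) -> f = 0.
Proof.
move=> hf htr; have [E [hE sumE nilE]] := spectral_projectors.
pose e c := horner_mx X (E c).
pose g c : K := if [pick i : 'I_(size S) | S`_i == c] is Some i then h (f 0 i) else 0.
have uS : uniq S by apply: undup_uniq.
have gS (i : 'I_(size S)) : g S`_i = h (f 0 i).
  rewrite /g; case: pickP => [j /eqP eij|/(_ i)]; last by rewrite eqxx.
  by congr (h (f 0 _)); apply/val_inj/eqP; rewrite /= -(nth_uniq 0 (ltn_ord j) (ltn_ord i) uS) eij.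
pose s := \sum_(c <- S) g c *: e c.
have ortho c d : c \in S -> d \in S -> e c * e d = (c == d)%:R *: e c.
  move=> cS dS; apply/eqP; rewrite -subr_eq0 /e -rmorphM -linearZ -rmorphB; apply/eqP.
  apply: horner0X => m mS.
  have -> : E c * E d - (c == d)%:R *: E c =
     (E c - ((c == m)%:R)%:P) * (E d - ((c == d)%:R)%:P) + ((c == m)%:R)%:P * (E d - ((c == d)%:R)%:P).
    by rewrite -mul_polyC; ring.
  rewrite dvdp_addr; last by rewrite dvdp_mulr // hE.
  have [cm|cm] := eqVneq c m; last by rewrite mul0r dvdp0.
  by rewrite mul1r cm eq_sym; apply: hE; rewrite // -cm.
have gE c : c \in S -> exists i : 'I_(size S), c = S`_i.
  move=> cS; have lt : (index c S < size S)%N by rewrite index_mem.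
  by exists (Ordinal lt); rewrite nth_index.
have se d : d \in S -> s * e d = g d *: e d.
  move=> dS; rewrite mulr_suml (bigD1_seq d) //= -scalerAl ortho // eqxx scale1r.
  rewrite big_seq_cond big1 ?addr0 // => c /andP[cS /negPf cd].
  by rewrite -scalerAl ortho // cd scale0r scaler0.
have es d : d \in S -> e d * s = g d *: e d.
  move=> dS; rewrite mulr_sumr (bigD1_seq d) //= -scalerAr ortho // eqxx scale1r.
  rewrite big_seq_cond big1 ?addr0 // => c /andP[cS /negPf cd].
  by rewrite -scalerAr ortho // eq_sym cd scale0r scaler0.
(* By [hf] the functional f respects all rational relations between eigenvalues, so g c - g d
   depends only on c - d and can be interpolated by a single polynomial in ad X. *)
pose g2 nu : K := if [pick ij : 'I_(size S) * 'I_(size S) | S`_(ij.1) - S`_(ij.2) == nu] is Some ij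
  then h (f 0 ij.1 - f 0 ij.2) else 0.
have g2E (i j : 'I_(size S)) : g2 (S`_i - S`_j) = h (f 0 i - f 0 j).
  rewrite /g2; case: pickP => [[i' j'] /= /eqP e1|/(_ (i, j))]; last by rewrite eqxx.
  congr (h _); apply/eqP; rewrite -subr_eq0; apply/eqP.
  pose D (l m : 'I_(size S)) : rat := (m == l)%:R.
  pose v : 'rV[rat]_(size S) := \row_m (D i' m - D j' m - (D i m - D j m)).
  have sumd (F : 'I_(size S) -> rat) l : \sum_m D l m * F m = F l.
    rewrite (bigD1 l) //= /D eqxx mul1r big1 ?addr0 // => m ml.
    by rewrite (negPf ml) mul0r.
  have sumd' l : \sum_m h (D l m) * S`_m = S`_l.
    rewrite (bigD1 l) //= /D eqxx rmorph1 mul1r big1 ?addr0 // => m ml.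
    by rewrite (negPf ml) rmorph0 mul0r.
  have := hf v.
  have -> : \sum_m h (v 0 m) * S`_m = S`_i' - S`_j' - (S`_i - S`_j).
    rewrite -!sumd' -!sumrB; apply: eq_bigr => m _.
    by rewrite mxE !rmorphB; ring.
  have -> : \sum_m v 0 m * f 0 m = f 0 i' - f 0 j' - (f 0 i - f 0 j).
    rewrite -!(sumd (f 0)) -!sumrB; apply: eq_bigr => m _.
    by rewrite mxE; ring.
  by rewrite e1 subrr; apply.
(* The order is 2N because [adact_gen] adds the exponents of the left and of the right factor. *)
have [Q hQ] := interpolate (N + N) g2 (undup_uniq [seq c - d | c <- S, d <- S]).
have trs : \tr (s * X) = 0.
  apply: (htr Q) => Y.
  have dec : Y = \sum_(c <- S) \sum_(d <- S) e c * Y * e d.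
    rewrite (eq_bigr (fun c => e c * Y)); first by rewrite -mulr_suml sumE mul1r.
    by move=> c _; rewrite -mulr_sumr sumE mulr1.
  have eqL c d : c \in S -> d \in S ->
      s * (e c * Y * e d) - (e c * Y * e d) * s = adact Q (e c * Y * e d).
    move=> cS dS; rewrite !mulrA se // -[_ * e d * s]mulrA es //.
    rewrite -!scalerAl -!scalerAr -scalerBl; set Y' := e c * Y * e d.
    have /hQ/dvdpP[T eT] : c - d \in undup [seq c - d | c <- S, d <- S].
      by rewrite mem_undup; apply/allpairsP; exists (c, d).
    have -> : Q = (g2 (c - d))%:P + ('X - (c - d)%:P) ^+ (N + N) * T.
      by rewrite mulrC -eT addrC subrK.
    rewrite adactD adactM adactC adact_gen.
    - have [i ->] := gE c cS; have [j ->] := gE d dS.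
      by rewrite g2E !gS rmorphB /adact linear0 mul0mx linear0 addr0.
    - by rewrite /Y' !mulrA nilE ?mul0r.
    - have Xe : (X - d%:M) ^+ N * e d = e d * (X - d%:M) ^+ N.
        apply: commr_sym; apply: commrX; apply: commrB; last exact: comm_mx_scalar.
        by apply: comm_horner_mx.
      by rewrite /Y' -[_ * e d * _]mulrA -Xe nilE ?mulr0.
  have ad0 : adact Q 0 = 0 by rewrite /adact linear0 mul0mx linear0.
  have adD Y1 Y2 : adact Q (Y1 + Y2) = adact Q Y1 + adact Q Y2.
    by have := adact_lin Q 1 Y1 Y2; rewrite !scale1r.
  rewrite -/(comm s Y) dec linear_sum (big_morph _ adD ad0); apply: eq_big_seq => c cS.
  rewrite linear_sum (big_morph _ adD ad0); apply: eq_big_seq => d dS.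
  exact: eqL.
have tre c : c \in S -> \tr (e c * X) = (\rank (e c))%:R * c.
  move=> cS.
  have ee : e c * e c = e c by rewrite ortho // eqxx scale1r.
  have comX : X * e c = e c * X by apply: comm_mx_horner.
  have -> : e c * X = c *: e c + (X - c%:M) * e c.
    by rewrite mulrBl [c%:M * _]mul_scalar_mx addrC subrK comX.
  rewrite mxtraceD mxtraceZ mxtrace_idem // mulrC (@mxtrace_nilp _ _ _ N) ?addr0 //.
  have -> M : iter M (mulmx ((X - c%:M) * e c)) 1%:M = ((X - c%:M) * e c) ^+ M.
    by elim: M => // M IHM; rewrite iterS IHM exprS.
  rewrite exprMn_comm.
    by rewrite /N [e c ^+ _]exprS mulrA nilE // mul0r.
  by apply/commr_sym/commrB; [apply/commr_sym | apply: comm_mx_scalar].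
have rk_gt0 c : c \in S -> (0 < \rank (e c))%N.
  move=> cS; rewrite lt0n mxrank_eq0; apply/eqP => e0.
  have : eigenvalue X c.
    by rewrite eigenvalue_root_char char_X root_prod_XsubC -mem_undup.
  case/eigenvalueP => v vX; case/negP.
  have := horner_mx_eigen (E c) vX; rewrite -/(e c) e0 mulmx0.
  have /dvdpP[T eT] := hE c c cS cS; rewrite eqxx in eT.
  have -> : (E c).[c] = 1.
    by rewrite -[E c](subrK 1%:P) eT !hornerE subrr expr0n mulr0 add0r.
  by rewrite scale1r => <-.
(* Applying f to the relation tr(s X) = 0 between eigenvalues gives a sum of ranks times rational
   squares; positivity in the rationals does what complex conjugation does in the classical
   proof. *)
have : \sum_(i < size S) (\rank (e S`_i))%:R * f 0 i * f 0 i = 0.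
  have := hf (\row_(i < size S) ((\rank (e S`_i))%:R * f 0 i)).
  rewrite (eq_bigr (fun i : 'I_(size S) => g S`_i * \tr (e S`_i * X))).
    rewrite -(big_mkord xpredT (fun i => g S`_i * \tr (e S`_i * X))).
    rewrite -(big_nth 0 xpredT (fun c => g c * \tr (e c * X))).
    have -> : \sum_(c <- S) g c * \tr (e c * X) = \tr (s * X).
      rewrite mulr_suml raddf_sum; apply: eq_bigr => c _.
      by rewrite -scalerAl /= mxtraceZ.
    by move/(_ trs) => h1; rewrite -[RHS]h1; apply: eq_bigr => i _; rewrite mxE.
  move=> i _; rewrite mxE tre ?mem_nth // gS rmorphM rmorph_nat.
  by rewrite mulrA [h _ * _]mulrC.
move/eqP; rewrite psumr_eq0 => [/allP h0|i _]; last first.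
  by rewrite -mulrA mulr_ge0 ?ler0n // -expr2 sqr_ge0.
apply/rowP => i; rewrite mxE; have := h0 i (mem_index_enum _).
rewrite -mulrA mulf_eq0 pnatr_eq0 -[_ == 0%N]negbK -lt0n rk_gt0 ?mem_nth //=.
by rewrite mulf_eq0 orbb => /eqP.
Qed.
End SemisimplePart.

Lemma pchar0_fmorph (k : fieldType) (R : nzRingType) (iota : {rmorphism k -> R}) :
  [pchar k] =i pred0 -> [pchar R] =i pred0.
Proof.
move=> ch0 p; apply/negbTE/negP => pR; have := ch0 p; rewrite !inE => /negP; apply.
move: pR; rewrite !inE => /andP[-> /eqP h] /=.
by rewrite -(fmorph_eq0 iota) rmorph_nat h.
Qed.

Section Cartan.
Variables (k : fieldType) (K : closedFieldType) (iota : {rmorphism k -> K}).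
Hypothesis ch0 : [pchar k] =i pred0.
Variables (q p : nat) (W : 'M[k]_(p, q.+1 * q.+1)).
Hypotheses (lW : lieW W) (perfW : (W <= bspan (@glbr k q) W W)%MS).
Hypothesis trW : forall A B, memW W A -> memW W B -> \tr (A * B) = 0.

(** By [replica] and [rational_functional] it suffices that tr(s X) = 0 whenever [s, Y] is a
    polynomial in ad X applied to Y. As W is perfect, X is a sum of brackets [U, V], and tr(s
    [U, V]) = tr([s, U] V). *)
Lemma cartan_nil A : memW W A -> exists r, A ^+ r = 0.
Proof.
move=> AW; set X := map_mx iota A.
have chK := pchar0_fmorph iota ch0.
have [rs hX] := closed_field_poly_normal (char_poly X).
rewrite (monicP (char_poly_monic X)) scale1r in hX.
have hr := replica hX (h := rat_morph chK).
have all0 : forall i : 'I_(size (undup rs)), (undup rs)`_i = 0.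
  apply: (rational_functional (h := rat_morph chK)) => f hf; apply: hr hf _ => Q s sQ.
  (* W lives over k and the polynomial over K, so the vanishing is proved coefficient by
     coefficient, without extending W to K. *)
  have tr0 Q' U V : memW W U -> memW W V -> \tr (adact X Q' (map_mx iota U) * map_mx iota V) = 0.
    move=> hU hV; elim/poly_ind: Q' U hU => [|Q' c IH] U hU.
      by rewrite /adact /hadm rmorph0 mulmx0 linear0 mul0r mxtrace0.
    rewrite adactD mulrDl mxtraceD adactC -scalerAl mxtraceZ.
    have -> : map_mx iota U * map_mx iota V = map_mx iota (U * V).
      by rewrite -[RHS]/(map_mx iota (U *m V)) map_mxM.
    rewrite trace_map_mx trW // rmorph0 mulr0 addr0.
    rewrite mulrC adactM adactX.
    have -> : X * map_mx iota U - map_mx iota U * X = map_mx iota (comm A U).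
      by rewrite /comm map_mxB -[map_mx iota (A * U)]/(map_mx iota (A *m U)) -[map_mx iota (U * A)]/(map_mx iota (U *m A)) !map_mxM.
    by apply: IH; apply: lW.
  have [c ec] := bspan_sum (submx_trans AW perfW).
  have -> : X = \sum_i \sum_j iota (c i j) *: comm (map_mx iota (vec_mx (row i W))) (map_mx iota (vec_mx (row j W))).
    rewrite /X; have -> : A = \sum_i \sum_j c i j *: comm (vec_mx (row i W)) (vec_mx (row j W)).
      apply: (can_inj mxvecK); rewrite ec !linear_sum; apply: eq_bigr => i _.
      by rewrite linear_sum; apply: eq_bigr => j _; rewrite linearZ.
    rewrite map_mx_sum; apply: eq_bigr => i _; rewrite map_mx_sum; apply: eq_bigr => j _.
    by rewrite map_mxZ /comm map_mxB; congr (_ *: (_ - _)); apply: map_mxM.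
  rewrite mulr_sumr raddf_sum big1 // => i _; rewrite mulr_sumr raddf_sum big1 // => j _ /=.
  set U := map_mx iota _; set V := map_mx iota (_ (row j W)).
  have -> : \tr (s * (iota (c i j) *: comm U V)) = iota (c i j) * \tr (adact X Q U * V).
    rewrite -scalerAr mxtraceZ -sQ /comm mulrBr mulrBl !raddfB /=; congr (_ * (_ - _)).
      by rewrite mulrA.
    by rewrite mulrA -[U * s * V]mulrA mxtrace_mulC.
  by rewrite /U /V tr0 ?mulr0 // /memW vec_mxK row_sub.
have rs0 c : c \in rs -> c = 0.
  rewrite -mem_undup => h; have lt : (index c (undup rs) < size (undup rs))%N by rewrite index_mem.
  by have := all0 (Ordinal lt); rewrite /= nth_index.
exists q.+1; apply: (map_mx_inj (f := iota)); rewrite map_mx0 rmorphXn /= -/X.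
have := Cayley_Hamilton X; rewrite hX.
have -> : \prod_(c <- rs) ('X - c%:P) = 'X^(size rs).
  rewrite big_seq (eq_bigr (fun=> 'X)); last by move=> c /rs0 ->; rewrite subr0.
  by rewrite -big_seq big_const_seq count_predT iter_mulr_1.
have -> : size rs = q.+1 by have := size_char_poly X; rewrite hX size_prod_XsubC => -[].
by rewrite rmorphXn /= horner_mx_X.
Qed.

(** In a perfect space each element is a sum of words of length two, so a length at which all words
    vanish can be lowered down to one. *)
Lemma perfect_nilw N : nilw W N -> W = 0.
Proof.
have red M : nilw W M.+2 -> nilw W M.+1.
  move=> nW [|A s] //= /andP[AW sW] [sz].
  have [c ec] := bspan_sum (submx_trans AW perfW).
  have -> : A = \sum_i \sum_j c i j *: comm (vec_mx (row i W)) (vec_mx (row j W)).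
    apply: (can_inj mxvecK); rewrite ec !linear_sum; apply: eq_bigr => i _.
    by rewrite linear_sum; apply: eq_bigr => j _; rewrite linearZ.
  rewrite big_cons mulr_suml big1 // => i _; rewrite mulr_suml big1 // => j _.
  set U := vec_mx _; set V := vec_mx _.
  have UW : memW W U by rewrite /memW vec_mxK row_sub.
  have VW : memW W V by rewrite /memW vec_mxK row_sub.
  have := nW [:: U, V & s]; have := nW [:: V, U & s].
  rewrite !big_cons /= UW VW sW sz => /(_ isT erefl) e1 /(_ isT erefl) e2.
  by rewrite -scalerAl /comm mulrBl -!mulrA e1 e2 subrr scaler0.
move=> h; have {h} : nilw W N.+1 by apply: nilw_le h.
elim: N => [h|N IH /red //]; apply/row_matrixP => i; rewrite row0.
apply: (can_inj vec_mxK); rewrite linear0.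
have := h [:: vec_mx (row i W)]; rewrite big_seq1; apply=> //=.
by rewrite /memW vec_mxK row_sub.
Qed.

Theorem cartan_perfect : W = 0.
Proof. by have [N /perfect_nilw] := engel lW cartan_nil. Qed.

End Cartan.

(** * Structure constants *)

Section Lie.
Variables (R : comNzRingType) (m : nat).
Implicit Types (x : 'I_m -> 'M[R]_m) (u v w : 'rV[R]_m).

(* x i is the matrix of [e_i, .] acting on row vectors *)
Definition adv x u : 'M[R]_m := \sum_i u 0 i *: x i.
Definition br x u v := v *m adv x u.

(** Rows are acted on from the right, so w times [adv x v *m adv x u] is [u, [v, w]]; the second
    clause is the Jacobi identity, stated as ad being a morphism. *)
Definition lie x :=
  (forall u v, br x u v = - br x v u) /\
  (forall u v, adv x (br x u v) = adv x v *m adv x u - adv x u *m adv x v).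

Lemma adv_linear x : linear (adv x).
Proof.
move=> a u v; rewrite /adv scaler_sumr -big_split; apply: eq_bigr => i _ /=.
by rewrite !mxE scalerDl scalerA.
Qed.
HB.instance Definition _ x := GRing.isLinear.Build R _ _ _ (adv x) (adv_linear x).

Lemma adv_delta x i : adv x (delta_mx 0 i) = x i.
Proof.
rewrite /adv (bigD1 i) //= mxE !eqxx scale1r big1 ?addr0 // => j ji.
by rewrite mxE (negPf ji) andbF scale0r.
Qed.

Lemma br_linear_l x v : linear ((br x)^~ v).
Proof. by move=> a u w; rewrite /br linearP mulmxDr -scalemxAr. Qed.

Lemma br_linear_r x u : linear (br x u).
Proof. by move=> a v w; rewrite /br mulmxDl -scalemxAl. Qed.

Definition lie_consts x :=
  (forall i j l, x i j l = - x j i l) /\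
  (forall i j q l, \sum_p x i j p * x p q l =
     \sum_p x j q p * x i p l - \sum_p x i q p * x j p l).

Lemma br_delta x i j : br x (delta_mx 0 i) (delta_mx 0 j) = row j (x i).
Proof. by rewrite /br adv_delta rowE. Qed.

(** The identities between entries survive maps such as leading coefficients, which are
    multiplicative only in bounded degree. *)
Lemma lieP x : lie x <-> lie_consts x.
Proof.
split=> [[h1 h2]|[h1 h2]]; split.
- move=> i j l; have := h1 (delta_mx 0 i) (delta_mx 0 j); rewrite !br_delta.
  by move/rowP/(_ l); rewrite !mxE.
- move=> i j q l; have := h2 (delta_mx 0 i) (delta_mx 0 j); rewrite br_delta !adv_delta.
  move/matrixP/(_ q l); rewrite /adv summxE !mxE => e.
  by rewrite -[RHS]e; apply: eq_bigr => p _; rewrite !mxE.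
- move=> u v; rewrite /br /adv mulmx_sumr mulmx_sumr -sumrN; apply/rowP => l.
  rewrite !summxE.
  have e (w z : 'rV[R]_m) : \sum_i (w *m (z 0 i *: x i)) 0 l = \sum_i \sum_j z 0 i * w 0 j * x i j l.
    apply: eq_bigr => i _; rewrite -scalemxAr !mxE mulr_sumr; apply: eq_bigr => j _.
    by rewrite mulrA.
  rewrite e -[RHS](_ : - (\sum_i (u *m (v 0 i *: x i)) 0 l) = _); last first.
    by rewrite -sumrN; apply: eq_bigr => i _; rewrite [RHS]mxE.
  rewrite e exchange_big -sumrN; apply: eq_bigr => j _; rewrite -sumrN; apply: eq_bigr => i _.
  by rewrite h1 mulrN [u 0 i * _]mulrC.
- move=> u v; have h i j : adv x (row j (x i)) = x j *m x i - x i *m x j.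
    apply/matrixP => q l; transitivity (\sum_p x i j p * x p q l); last by rewrite h2 !mxE.
    by rewrite /adv summxE; apply: eq_bigr => p _; rewrite !mxE.
  have -> : br x u v = \sum_i \sum_j (u 0 i * v 0 j) *: row j (x i).
    rewrite /br /adv mulmx_sumr; apply: eq_bigr => i _.
    rewrite -scalemxAr mulmx_sum_row scaler_sumr; apply: eq_bigr => j _.
    by rewrite scalerA.
  have -> : adv x v *m adv x u = \sum_i \sum_j (u 0 i * v 0 j) *: (x j *m x i).
    rewrite [adv x u]/adv mulmx_sumr; apply: eq_bigr => i _.
    rewrite /adv mulmx_suml; apply: eq_bigr => j _.
    by rewrite -scalemxAl -scalemxAr scalerA mulrC.
  have -> : adv x u *m adv x v = \sum_i \sum_j (u 0 i * v 0 j) *: (x i *m x j).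
    rewrite [adv x u]/adv mulmx_suml; apply: eq_bigr => i _.
    rewrite /adv mulmx_sumr; apply: eq_bigr => j _.
    by rewrite -scalemxAl -scalemxAr scalerA.
  rewrite linear_sum -sumrB; apply: eq_bigr => i _; rewrite linear_sum -sumrB.
  by apply: eq_bigr => j _; rewrite linearZ /= h scalerBr.
Qed.

(* change of basis: the new basis is Q *m e, with Q' the inverse of Q *)
Definition chg (Q Q' : 'M[R]_m) x i := Q *m adv x (row i Q) *m Q'.

Lemma adv_chg Q Q' x u : adv (chg Q Q' x) u = Q *m adv x (u *m Q) *m Q'.
Proof.
have -> : adv x (u *m Q) = \sum_i u 0 i *: adv x (row i Q).
  by rewrite mulmx_sum_row linear_sum; apply: eq_bigr => i _; rewrite linearZ.
rewrite {1}/adv mulmx_sumr mulmx_suml.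
by apply: eq_bigr => i _; rewrite -scalemxAr -scalemxAl.
Qed.

Lemma br_chg Q Q' x u v : br (chg Q Q' x) u v = br x (u *m Q) (v *m Q) *m Q'.
Proof. by rewrite /br adv_chg !mulmxA. Qed.

Lemma lie_chg Q Q' x : Q *m Q' = 1%:M -> lie x -> lie (chg Q Q' x).
Proof.
move=> QQ' [h1 h2]; have Q'Q := mulmx1C QQ'; split=> u v.
  by rewrite !br_chg h1 mulNmx.
rewrite br_chg !adv_chg -[_ *m Q' *m Q]mulmxA Q'Q mulmx1 h2 mulmxBr mulmxBl !mulmxA.
by congr (_ - _); rewrite -[_ *m Q' *m Q]mulmxA Q'Q mulmx1.
Qed.

Definition kill x : 'M[R]_m := \matrix_(i, j) \tr (x i *m x j).

Lemma killE x u v : (u *m kill x *m v^T) 0 0 = \tr (adv x u *m adv x v).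
Proof.
transitivity (\sum_i \sum_j u 0 i * v 0 j * \tr (x i *m x j)); last first.
  rewrite {1}/adv mulmx_suml raddf_sum; apply: eq_bigr => i _ /=.
  rewrite /adv mulmx_sumr raddf_sum; apply: eq_bigr => j _ /=.
  by rewrite -scalemxAl -scalemxAr !mxtraceZ mulrA.
rewrite exchange_big mxE; apply: eq_bigr => j _; rewrite !mxE mulr_suml.
by apply: eq_bigr => i _; rewrite !mxE mulrAC.
Qed.

Lemma kill_chg Q Q' x : Q *m Q' = 1%:M -> kill (chg Q Q' x) = Q *m kill x *m Q^T.
Proof.
move=> QQ'; have Q'Q := mulmx1C QQ'; apply/matrixP => i j.
have -> : (Q *m kill x *m Q^T) i j = (row i Q *m kill x *m (row j Q)^T) 0 0.
  by rewrite tr_row -!row_mul !mxE; apply: eq_bigr => l _; rewrite !mxE.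
rewrite killE mxE /chg; set A := adv x (row i Q); set B := adv x (row j Q).
have -> : Q *m A *m Q' *m (Q *m B *m Q') = Q *m (A *m B *m Q').
  by rewrite !mulmxA -[_ *m Q' *m Q]mulmxA Q'Q mulmx1.
by rewrite mxtrace_mulC -!mulmxA Q'Q mulmx1.
Qed.

Definition derivation x (D : 'M[R]_m) :=
  forall u, adv x u *m D = D *m adv x u + adv x (u *m D).

Lemma derivation_adv x h : lie x -> derivation x (adv x h).
Proof. by move=> [_ h2] u; rewrite -[u *m _]/(br x h u) h2 addrC subrK. Qed.

(** The form u -> tr(D ad u) is represented by some h for the Killing form. For E = D - ad h, the
    derivation property turns tr(ad(u E) ad v) into the trace of E against ad of a bracket, which is
    zero; so E vanishes. *)
Lemma derivation_inner x K' D : lie x -> kill x *m K' = 1%:M -> derivation x D ->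
  exists h, D = adv x h.
Proof.
move=> lx KK' dD.
pose t : 'rV[R]_m := \row_j \tr (D *m x j).
pose h := t *m K'^T; exists h.
have symK : (kill x)^T = kill x.
  by apply/matrixP => i j; rewrite !mxE mxtrace_mulC.
have K'K : K'^T *m kill x = 1%:M by rewrite -{1}symK -trmx_mul KK' trmx1.
have trD u : \tr (D *m adv x u) = \tr (adv x h *m adv x u).
  rewrite -killE /h -(mulmxA t) K'K mulmx1 mxE /adv mulmx_sumr raddf_sum.
  by apply: eq_bigr => j _ /=; rewrite -scalemxAr mxtraceZ !mxE mulrC.
have trE u : \tr ((D - adv x h) *m adv x u) = 0 by rewrite mulmxBl raddfB /= trD subrr.
set E := D - adv x h in trE.
have dE u : adv x u *m E - E *m adv x u = adv x (u *m E).
  rewrite /E mulmxBl !mulmxBr dD (derivation_adv h lx) [adv x (_ - _)]linearB /=.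
  move: (D *m _) (adv x h *m _) (adv x (u *m D)) (adv x (u *m _)) => Z1 Z2 Z3 Z4.
  by apply/matrixP => i j; rewrite !mxE; ring.
suff E0 : E = 0 by apply/eqP; rewrite -subr_eq0 -/E E0.
apply/row_matrixP => i; rewrite row0 rowE; set u := delta_mx _ _.
have k0 v : (u *m E *m kill x *m v^T) 0 0 = 0.
  rewrite killE -dE mulmxBl raddfB /= -mulmxA mxtrace_mulC -mulmxA -[_ *m adv x u *m _]mulmxA.
  by rewrite -raddfB -mulmxBr /=; have [_ /(_ u v) <-] := lx.
have {}k0 : u *m E *m kill x = 0.
  apply/rowP => j; have := k0 (delta_mx 0 j).
  by rewrite trmx_delta -colE mxE => ->; rewrite mxE.
by rewrite -[LHS]mulmx1 -KK' mulmxA k0 mul0mx.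
Qed.

End Lie.

(** * Lie algebras over k[t] with unimodular Killing form are constant *)

Section Degree.
Variable k : fieldType.
Implicit Types (p q : {poly k}) (r s : rat).

(** The bound is rational because it will be a combination of weights; a negative bound forces p =
    0, while 0 satisfies every bound. *)
Definition degle p r := forall N, p`_N != 0 -> N%:R <= r.

Lemma degle0 r : degle 0 r. Proof. by move=> N; rewrite coef0 eqxx. Qed.

Lemma degleC c : degle c%:P 0.
Proof. by move=> [|N]; rewrite coefC //= eqxx. Qed.

Lemma degle_le p r s : r <= s -> degle p r -> degle p s.
Proof. by move=> rs h N /h hN; apply: le_trans rs. Qed.

Lemma degleD p q r : degle p r -> degle q r -> degle (p + q) r.
Proof.
move=> hp hq N; rewrite coefD => h.
have [p0|/hp //] := eqVneq p`_N 0.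
by apply: hq; rewrite p0 add0r in h.
Qed.

Lemma degleN p r : degle p r -> degle (- p) r.
Proof. by move=> h N; rewrite coefN oppr_eq0 => /h. Qed.

Lemma degle_sum (I : Type) (t : seq I) (P : pred I) (F : I -> {poly k}) r :
  (forall i, P i -> degle (F i) r) -> degle (\sum_(i <- t | P i) F i) r.
Proof.
move=> h; apply: (big_ind (fun p => degle p r)) => //; first exact: degle0.
by move=> p q; apply: degleD.
Qed.

Lemma degleM p q r s : degle p r -> degle q s -> degle (p * q) (r + s).
Proof.
move=> hp hq N; rewrite coefM => h.
have [i] : exists i : 'I_N.+1, p`_i * q`_(N - i) != 0.
  apply/existsP; apply: contraNT h => /existsPn h.
  by apply/eqP/big1 => i _; apply/eqP; have := h i; rewrite negbK.
rewrite mulf_eq0 negb_or => /andP[/hp h1 /hq h2].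
have -> : N%:R = (i : nat)%:R + (N - i)%:R :> rat by rewrite -natrD subnKC // -ltnS.
exact: lerD.
Qed.

Lemma degle_neg p r : degle p r -> r < 0 -> p = 0.
Proof.
move=> h r0; apply/polyP => N; rewrite coef0; apply/eqP; apply: contraTT r0 => /h h1.
by rewrite -leNgt (le_trans _ h1).
Qed.

Lemma degle_const p : degle p 0 -> p = (p`_0)%:P.
Proof.
move=> h; apply/polyP => -[|N]; rewrite coefC //=; apply/eqP.
by apply/negPn/negP => /h; rewrite lern0.
Qed.

(* L r extracts from polynomials of degree at most r some multiplicative
   symbol: the coefficient of t^r (top), or the value of constants if r = 0 (bot). *)
Definition symbol (L : {poly k} -> rat -> k) :=
  [/\ forall p q r, L (p + q) r = L p r + L q r,
      forall c, L c%:P 0 = c &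
      forall p q r s, degle p r -> degle q s -> L (p * q) (r + s) = L p r * L q s].

Definition top p r := if r == (Num.truncn r)%:R then p`_(Num.truncn r) else 0.
Definition bot p r := if r == 0 then p`_0 else 0.

Lemma topE p (N : nat) : top p N%:R = p`_N.
Proof. by rewrite /top Num.Theory.natrK eqxx. Qed.

Lemma top_notnat p r : (forall N : nat, r <> N%:R) -> top p r = 0.
Proof. by move=> h; rewrite /top; case: eqP => // /h. Qed.

Lemma natP r : (exists N : nat, r = N%:R) \/ (forall N : nat, r <> N%:R).
Proof.
have [/eqP e|h] := boolP (r == (Num.truncn r)%:R); first by left; exists (Num.truncn r).
by right => N e; case/negP: h; rewrite e Num.Theory.natrK.
Qed.

Lemma top_symbol : symbol top.
Proof.
split=> [p q r|c|p q r s hp hq].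
- by rewrite /top; case: ifP => _; rewrite ?coefD ?addr0.
- by rewrite -[0]/(0%:R) topE coefC.
have [[i er]|hr] := natP r; last first.
  rewrite (top_notnat _ hr) mul0r.
  have [[N e]|h] := natP (r + s); last by rewrite top_notnat.
  rewrite e topE coefM big1 // => j _; apply/eqP/negPn/negP.
  rewrite mulf_eq0 negb_or => /andP[/hp h1 /hq h2].
  have e2 : (j : nat)%:R + (N - j)%:R = N%:R :> rat by rewrite -natrD subnKC // -ltnS.
  by apply: (hr j); apply/eqP; rewrite eq_le h1 andbT; move: h1 h2 e e2; lra.
subst r; have [[j es]|hs] := natP s; last first.
  rewrite (top_notnat _ hs) mulr0.
  have [[N e]|h] := natP (i%:R + s); last by rewrite top_notnat.
  have [lt|lt] := ltnP N i.
    have s0 : s < 0.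
      have : (N%:R < i%:R :> rat) by rewrite ltr_nat.
      by move: e; lra.
    by rewrite (degle_neg hq s0) mulr0 /top coef0; case: ifP.
  case: (hs (N - i)%N); move: e; rewrite natrB // => <-; lra.
subst s; rewrite -natrD !topE coefM.
have hi : (i < (i + j).+1)%N by rewrite ltnS leq_addr.
rewrite (bigD1 (Ordinal hi)) //= addKn big1 ?addr0 // => l li; apply/eqP/negPn/negP.
rewrite mulf_eq0 negb_or => /andP[/hp h1 /hq h2].
case/negP: li; apply/eqP/val_inj => /=; move: h1 h2. rewrite !ler_nat.
by have := ltn_ord l; lia.
Qed.

Lemma bot_symbol : symbol bot.
Proof.
split=> [p q r|c|p q r s hp hq].
- by rewrite /bot; case: ifP => _; rewrite ?coefD ?addr0.
- by rewrite /bot eqxx coefC.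
rewrite /bot; have [r0|r0|->] := ltgtP r 0; last by rewrite add0r; case: ifP; rewrite ?mulr0 // coef0M.
  by rewrite (degle_neg hp r0) mul0r coef0; case: ifP; rewrite mul0r.
rewrite mul0r; case: eqP => // e; have s0 : s < 0 by move: e r0; lra.
by rewrite (degle_neg hq s0) mulr0 coef0.
Qed.

(** The gap is r minus the degree of p; for p = 0 the value 1 is an arbitrary choice. *)
Lemma top_gap p r : degle p r -> top p r = 0 -> exists2 d, 0 < d & degle p (r - d).
Proof.
move=> h t0; have [->|p0] := eqVneq p 0; first by exists 1 => //; apply: degle0.
have hl : p`_(size p).-1 != 0 by rewrite -lead_coefE lead_coef_eq0.
have := h _ hl; rewrite le_eqVlt => /orP[/eqP e|lt].
  by move: t0; rewrite -e topE => e0; rewrite e0 eqxx in hl.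
exists (r - (size p).-1%:R); first by rewrite subr_gt0.
move=> N hN; rewrite opprB addrC subrK ler_nat.
have : (N < size p)%N by rewrite ltnNge; apply: contraNN hN => /leq_sizeP ->.
by case: (size p).
Qed.

Section Symbol.
Variable L : {poly k} -> rat -> k.
Hypothesis sL : symbol L.

Lemma symD p q r : L (p + q) r = L p r + L q r. Proof. by case: sL. Qed.
Lemma symC c : L c%:P 0 = c. Proof. by case: sL. Qed.
Lemma symM p q r s : degle p r -> degle q s -> L (p * q) (r + s) = L p r * L q s.
Proof. by case: sL => _ _; apply. Qed.
Lemma sym0 r : L 0 r = 0.
Proof. by apply: (@addrI _ (L 0 r)); rewrite -symD !addr0. Qed.
Lemma symN p r : L (- p) r = - L p r.
Proof. by apply/eqP; rewrite -addr_eq0 addrC -symD subrr sym0. Qed.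
Lemma sym_sum (I : Type) (t : seq I) (P : pred I) (F : I -> {poly k}) r :
  L (\sum_(i <- t | P i) F i) r = \sum_(i <- t | P i) L (F i) r.
Proof. by apply: (big_morph (L ^~ r)) => [p q|]; rewrite ?symD ?sym0. Qed.

Lemma prod_sym (I : Type) (t : seq I) (F : I -> {poly k}) (r : I -> rat) :
  (forall i, degle (F i) (r i)) ->
  degle (\prod_(i <- t) F i) (\sum_(i <- t) r i) /\
  L (\prod_(i <- t) F i) (\sum_(i <- t) r i) = \prod_(i <- t) L (F i) (r i).
Proof.
move=> h; elim: t => [|i t [IH1 IH2]].
  by rewrite !big_nil; split; [exact: degleC | exact: symC].
by rewrite !big_cons; split; [exact: degleM | rewrite symM // IH2].
Qed.

Section Graded.
Variables (m : nat).

(** Matrices compatible with row weights r and column weights c; they compose, and [LM] extracts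
    their symbols. *)
Definition grM n l (r : 'I_n -> rat) (c : 'I_l -> rat) (M : 'M[{poly k}]_(n, l)) :=
  forall i j, degle (M i j) (r i - c j).
Definition LM n l (r : 'I_n -> rat) (c : 'I_l -> rat) (M : 'M[{poly k}]_(n, l)) :=
  \matrix_(i, j) L (M i j) (r i - c j).

Lemma grM_mul n l o (r : 'I_n -> rat) (c : 'I_l -> rat) (d : 'I_o -> rat) A B :
  grM r c A -> grM c d B -> grM r d (A *m B).
Proof.
move=> hA hB i j; rewrite mxE; apply: degle_sum => p _.
by rewrite -[r i](subrK (c p)) -addrA; apply: degleM.
Qed.

Lemma LM_mul n l o (r : 'I_n -> rat) (c : 'I_l -> rat) (d : 'I_o -> rat) A B :
  grM r c A -> grM c d B -> LM r d (A *m B) = LM r c A *m LM c d B.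
Proof.
move=> hA hB; apply/matrixP => i j; rewrite !mxE sym_sum; apply: eq_bigr => p _.
by rewrite !mxE -symM // addrA subrK.
Qed.

Lemma grM1 (r : 'I_m -> rat) : grM r r 1%:M.
Proof.
move=> i j; rewrite mxE; case: eqP => [->|_]; last by rewrite mulr0n; apply: degle0.
by rewrite subrr; apply: degleC.
Qed.

(** Every permutation contributes a product of the same total weight, the sum of r minus the sum of
    c. *)
Lemma det_gr n (r c : 'I_n -> rat) (M : 'M[{poly k}]_n) : grM r c M ->
  degle (\det M) (\sum_i r i - \sum_i c i) /\
  L (\det M) (\sum_i r i - \sum_i c i) = \det (LM r c M).
Proof.
move=> hM.
have e (s : 'S_n) : \sum_i r i - \sum_i c i = \sum_i (r i - c (s i)).
  by rewrite sumrB; congr (_ - _); rewrite (reindex_inj (@perm_inj _ s)).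
have sgn (s : 'S_n) : degle ((-1) ^+ s) 0 /\ L ((-1) ^+ s) 0 = (-1) ^+ s.
  have -> : (-1) ^+ s = ((-1) ^+ s : k)%:P :> {poly k} by rewrite rmorphXn rmorphN1.
  by split; [exact: degleC | exact: symC].
split; rewrite /determinant.
  apply: degle_sum => s _; rewrite (e s) -[X in degle _ X]add0r.
  apply: degleM; first by case: (sgn s).
  by case: (@prod_sym _ (index_enum 'I_n) (fun i => M i (s i)) (fun i => r i - c (s i))) => // i; apply: hM.
rewrite sym_sum; apply: eq_bigr => s _; rewrite (e s) -[X in L _ X]add0r.
have [h1 h2] := @prod_sym _ (index_enum 'I_n) (fun i => M i (s i)) (fun i => r i - c (s i)) (fun i => hM i (s i)).
rewrite symM ?h2; [|by case: (sgn s)|exact: h1].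
by case: (sgn s) => _ ->; congr (_ * _); apply: eq_bigr => i _; rewrite mxE.
Qed.

End Graded.
End Symbol.

(** A cofactor omits one row and one column, so when the total weights agree its bound is c_i - r_j.
    Thus the inverse of a graded matrix of determinant 1 is graded. *)
Lemma adj_gr n (r c : 'I_n -> rat) (M : 'M[{poly k}]_n) : grM r c M ->
  \sum_i r i = \sum_i c i -> grM c r (\adj M).
Proof.
move=> hM e i j; rewrite mxE /cofactor.
have -> : (-1) ^+ (j + i) = ((-1) ^+ (j + i) : k)%:P :> {poly k} by rewrite rmorphXn rmorphN1.
rewrite -[X in degle _ X]add0r; apply: degleM; first exact: degleC.
case: n r c M hM e i j => [|n] r c M hM e i j; first by case: i.
have h : grM (fun a => r (lift j a)) (fun b => c (lift i b)) (row' j (col' i M)).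
  by move=> p q; rewrite !mxE; apply: hM.
have [] := det_gr top_symbol h => h1 _; apply: degle_le h1.
rewrite (bigD1_ord j) // (bigD1_ord i) //= in e.
by move: e; lra.
Qed.

End Degree.

Section Descent.
Variables (k : fieldType) (K : closedFieldType) (iota : {rmorphism k -> K}).
Hypothesis ch0 : [pchar k] =i pred0.
(** Cartan's criterion, applied to the matrices ad u with u in W, gives ad u = 0; then W = [W, W] =
    0. *)
Lemma perfect_null m (y : 'I_m -> 'M[k]_m) (W : 'M[k]_m) : lie y -> (forall u v, (u <= W)%MS -> (v <= W)%MS -> \tr (adv y u *m adv y v) = 0) ->
  (bspan (br y) W W <= W)%MS -> (W <= bspan (br y) W W)%MS -> W = 0.
Proof.
move=> ly null sub perf.
have fl := br_linear_l y; have fr := br_linear_r y.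
have : forall u, (u <= W)%MS -> adv y u = 0.
  case: m y W ly null sub perf fl fr => [|q] x W lx null sub perf fl fr; first by move=> u _; apply/matrixP => -[].
  pose phi u : 'rV[k]_(q.+1 * q.+1) := mxvec (adv x u).
  have phil : linear phi by move=> a u v; rewrite /phi linearP linearP.
  pose Phi : {linear 'rV[k]_q.+1 -> 'rV[k]_(q.+1 * q.+1)} :=
    HB.pack phi (GRing.isLinear.Build _ _ _ _ phi phil).
  pose A := W *m lin1_mx Phi.
  have inA u : (u <= W)%MS -> (phi u <= A)%MS.
    by case/submxP => D ->; rewrite -[phi _]/(Phi _) -mul_rV_lin1 -mulmxA submxMl.
  have Ain B : memW A B -> exists2 u, (u <= W)%MS & B = adv x u.
    case/submxP => D e; exists (D *m W); first exact: submxMl.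
    by apply: (can_inj mxvecK); rewrite e mulmxA mul_rV_lin1.
  have cm u v : comm (adv x u) (adv x v) = adv x (br x v u).
    by case: lx => _ h; rewrite h /comm.
  suff A0 : A = 0.
    move=> u /inA; rewrite A0 => /submxP[D h].
    by apply: (can_inj mxvecK); rewrite linear0 -/(phi u) h mulmx0.
  apply: (cartan_perfect iota ch0).
  - move=> B C /Ain[u hu ->] /Ain[v hv ->]; rewrite cm; apply: inA.
    by apply: submx_trans sub; apply: bspan_in.
  - apply/rV_subP => a /submxP[D ->].
    have -> : D *m A = phi (D *m W) by rewrite /A mulmxA mul_rV_lin1.
    have : (D *m W <= bspan (br x) W W)%MS by apply: submx_trans perf; apply: submxMl.
    case/bspan_sum => c ->; rewrite -[phi _]/(Phi _) linear_sum; apply: summx_sub => i _.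
    rewrite linear_sum; apply: summx_sub => j _; rewrite linearZ; apply: scalemx_sub.
    have -> : Phi (br x (row i W) (row j W)) = glbr (phi (row j W)) (phi (row i W)).
      by rewrite /glbr /phi !mxvecK cm.
    apply: bspan_in; [exact: glbr_linear_l | exact: glbr_linear_r | |]; apply: inA; exact: row_sub.
  - by move=> B C /Ain[u hu ->] /Ain[v hv ->]; apply: null.
move=> ad0; apply/eqP; rewrite -submx0; apply: submx_trans perf _.
by apply: bspanP => u v hu _; rewrite /br ad0 // mulmx0 sub0mx.
Qed.

Variables (m : nat) (y : 'I_m -> 'M[k]_m).
Hypothesis ly : lie y.

Definition ideal (W : 'M[k]_m) := forall u w, (w <= W)%MS -> (br y u w <= W)%MS.

Definition brspan (U V : 'M[k]_m) : 'M[k]_m := bspan (br y) U V.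

Lemma jacobi u v w : br y u (br y v w) = br y (br y u v) w + br y v (br y u w).
Proof.
rewrite /br -!mulmxA -mulmxDr; congr (_ *m _).
by rewrite -[v *m _]/(br y u v); case: ly => _ ->; rewrite subrK.
Qed.

Lemma brspan_ideal W : ideal W -> ideal (brspan W W).
Proof.
move=> iW u w /bspan_sum[c ->].
rewrite -[br y u]/(mulmxr (adv y u)) !linear_sum; apply: summx_sub => i _.
rewrite !linear_sum; apply: summx_sub => j _.
rewrite linearZ; apply: scalemx_sub.
rewrite /= -[_ *m adv y u]/(br y u _) jacobi addmx_sub //; apply: bspan_in.
all: try exact: (br_linear_l y). all: try exact: (br_linear_r y).
all: try exact: row_sub. all: by apply: iW; exact: row_sub.
Qed.

Lemma brspan_sub W : ideal W -> (brspan W W <= W)%MS.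
Proof. by move=> iW; apply: bspanP => u v _ hv; apply: iW. Qed.

(** As long as W is not abelian it is replaced by its derived space, strictly smaller because a
    perfect null ideal vanishes. P carries the invariance wanted later: homogeneity for the weights,
    or stability under G. *)
Lemma abelian_descent (P : 'M[k]_m -> Prop) W :
  (forall W, ideal W -> P W -> P (brspan W W)) ->
  W != 0 -> ideal W -> P W ->
  (forall u v, (u <= W)%MS -> (v <= W)%MS -> \tr (adv y u *m adv y v) = 0) ->
  exists W', [/\ W' != 0, (W' <= W)%MS, ideal W', P W' &
    forall u v, (u <= W')%MS -> (v <= W')%MS -> br y u v = 0].
Proof.
move=> PB; have [d] := ubnP (\rank W); elim: d W => // d IH W ltd W0 iW PW null.
have sub := brspan_sub iW.
have [B0|B0] := eqVneq (brspan W W) 0.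
  exists W; split=> // u v hu hv; apply/eqP; rewrite -submx0 -B0.
  by apply: bspan_in => //; [exact: br_linear_l | exact: br_linear_r].
have [perf|nperf] := boolP (W <= brspan W W)%MS.
  by rewrite (perfect_null ly null sub perf) eqxx in W0.
have [|||||W' [h1 h2 h3 h4 h5]] := IH (brspan W W).
- have : (\rank (brspan W W) < \rank W)%N by apply: rank_ltmx; rewrite ltmxE sub.
  by move: ltd; lia.
- by [].
- exact: brspan_ideal.
- exact: PB.
- by move=> u v hu hv; apply: null; apply: submx_trans sub.
by exists W'; split=> //; apply: submx_trans sub.
Qed.

Lemma radical_ideal : ideal (kermx (kill y)).
Proof.
move=> u w /sub_kermxP hw; apply/sub_kermxP.
apply/rowP => j; rewrite [RHS]mxE.
have -> : (br y u w *m kill y) 0 j = (br y u w *m kill y *m (delta_mx (0 : 'I_1) j)^T) 0 0.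
  by rewrite trmx_delta -colE [RHS]mxE.
rewrite killE; case: (ly) => _ h; rewrite h mulmxBl raddfB /= -[adv y u *m _ *m _]mulmxA.
rewrite [X in _ - X]mxtrace_mulC -!mulmxA -raddfB -mulmxBr /= -h -killE.
by rewrite hw mul0mx mxE.
Qed.

Lemma radical_null u v : (u <= kermx (kill y))%MS -> (v <= kermx (kill y))%MS ->
  \tr (adv y u *m adv y v) = 0.
Proof. by move=> /sub_kermxP hu _; rewrite -killE hu mul0mx mxE. Qed.

End Descent.

(** * Vertices of rational linear programs, with uniformly bounded denominators *)

Section LinearProgram.
Variables (q m : nat) (Nu : 'M[rat]_(q, m)) (w : 'rV[rat]_m).
Implicit Types (J S : {set 'I_q}) (a b : 'cV[rat]_m) (d : 'I_q -> int).

Definition rows_of J := \matrix_(t, j) (if t \in J then Nu t j else 0).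

Definition feasible S d a := forall t, t \in S -> (d t)%:~R <= (Nu *m a) t 0.

Lemma common_denominator (y : 'rV[rat]_q) :
  exists2 D : nat, (0 < D)%N & forall t : 'I_q, exists z : int, D%:R * y 0 t = z%:~R.
Proof.
exists (\prod_(t < q) `|denq (y 0%R t)|)%N; first by apply: prodn_gt0 => t; rewrite absz_gt0 denq_neq0.
move=> t; rewrite (bigD1 t) //=; set X := (\prod_(i < q | _) _)%N.
exists (numq (y 0 t) * X%:Z); rewrite natrM -{2}[y 0 t]divq_num_den intrM -pmulrn.
have -> : ((`|denq (y 0%R t)|%N)%:R : rat) = (denq (y 0 t))%:~R by rewrite pmulrn gtz0_abs ?denq_gt0.
have : (denq (y 0 t))%:~R != 0 :> rat by rewrite intr_eq0 denq_neq0.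
by move: (_%:~R : rat) (_%:~R : rat) (X%:R : rat) => D' N' X' D0; field.
Qed.

Definition active S d a := [set t in S | (Nu *m a) t 0 == (d t)%:~R].

(** As long as w is not a combination of the active rows, some direction leaves these unchanged and
    decreases w. Following it activates another constraint, because w is bounded below on the
    feasible set. *)
Lemma vertex S d a : feasible S d a -> (forall b, feasible S d b -> 0 <= (w *m b) 0 0) ->
  exists a', [/\ feasible S d a', (w *m a') 0 0 <= (w *m a) 0 0 & (w <= rows_of (active S d a'))%MS].
Proof.
move=> + bnd; have [N] := ubnP (q - #|active S d a|); elim: N a => // N IH a ltN fa.
have [h|h] := boolP (w <= rows_of (active S d a))%MS; first by exists a.
set J := active S d a in h ltN.
have [dir dJ dw] : exists2 dir : 'cV[rat]_m, (forall t, t \in J -> (Nu *m dir) t 0 = 0) & (w *m dir) 0 0 < 0.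
  have [j hj] : exists j, (w *m cokermx (rows_of J)) 0 j != 0.
    apply/existsP; apply: contraNT h => /existsPn h; rewrite submxE; apply/eqP/rowP => j.
    by rewrite [RHS]mxE; apply/eqP; have := h j; rewrite negbK.
  pose v := col j (cokermx (rows_of J)).
  have wv : (w *m v) 0 0 = (w *m cokermx (rows_of J)) 0 j by rewrite /v colE mulmxA -colE mxE.
  have vJ t : t \in J -> (Nu *m v) t 0 = 0.
    move=> tJ; have : (rows_of J *m v) t 0 = 0 by rewrite /v colE mulmxA mulmx_coker mul0mx mxE.
    by move=> <-; rewrite !mxE; apply: eq_bigr => l _; rewrite [rows_of J t l]mxE tJ.
  have [lt|gt|e] := ltgtP ((w *m v) 0 0) 0; last by rewrite -wv e eqxx in hj.
    by exists v.
  by exists (- v) => [t tJ|]; rewrite mulmxN mxE ?vJ ?oppr0 // oppr_lt0.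
pose bad := [pred t in S | (Nu *m dir) t 0 < 0].
have addE s t : (Nu *m (a + s *: dir)) t 0 = (Nu *m a) t 0 + s * (Nu *m dir) t 0.
  by rewrite mulmxDr -scalemxAr !mxE.
have addw s : (w *m (a + s *: dir)) 0 0 = (w *m a) 0 0 + s * (w *m dir) 0 0.
  by rewrite mulmxDr -scalemxAr !mxE.
have [t0 bt0|nobad] := pickP bad; last first.
  (* If nothing blocks the way, this step length brings w down to its slope along [dir], which is
     negative. *)
  pose s := (w *m a) 0 0 / - (w *m dir) 0 0 + 1.
  have s0 : 0 <= s by rewrite addr_ge0 // divr_ge0 ?bnd // oppr_ge0 ltW.
  have /bnd : feasible S d (a + s *: dir).
    move=> t tS; rewrite addE; apply: (le_trans (fa t tS)); rewrite lerDl mulr_ge0 //.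
    by have := nobad t; rewrite inE tS /= => /negbT; rewrite -leNgt.
  rewrite addw /s mulrDl mul1r invrN mulrN mulNr divfK ?lt_eqF // addrA subrr add0r.
  by rewrite leNgt dw.
pose ratio t := ((Nu *m a) t 0 - (d t)%:~R) / - (Nu *m dir) t 0.
have [t1 bt1 min1] := arg_minP ratio bt0.
have {}min1 t : bad t -> ratio t1 <= ratio t by apply: min1.
pose a' := a + ratio t1 *: dir.
move: bt1; rewrite inE => /andP[t1S t1d].
have r0 : 0 <= ratio t1 by rewrite divr_ge0 ?subr_ge0 ?fa // oppr_ge0 ltW.
have fa' : feasible S d a'.
  move=> t tS; rewrite addE; have [tb|tb] := boolP ((Nu *m dir) t 0 < 0); last first.
    by apply: (le_trans (fa t tS)); rewrite lerDl mulr_ge0 // leNgt.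
  have : ratio t1 <= ratio t by apply: min1; rewrite inE tS.
  by rewrite {2}/ratio ler_pdivlMr ?oppr_gt0 // mulrN; lra.
have [|a'' [h1 h2 h3]] := IH a' _ fa'; last first.
  exists a''; split=> //; apply: le_trans h2 _.
  by rewrite addw gerDl mulr_ge0_le0 // ltW.
have sub : J :|: [set t1] \subset active S d a'.
  apply/subsetP => t; rewrite !inE => /orP[|/eqP ->].
    move=> tJ; have := dJ t; rewrite inE tJ addE => /(_ isT) ->; rewrite mulr0 addr0.
    by case/andP: tJ => -> ->.
  have x0 : (Nu *m dir) t1 0 != 0 by rewrite lt_eqF.
  rewrite t1S addE /ratio; apply/eqP; move: x0.
  by move: ((Nu *m dir) t1 0) ((Nu *m a) t1 0) => X A X0; field.
have t1J : t1 \notin J.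
  by apply/negP => /dJ e; rewrite e ltxx in t1d.
have := subset_leq_card sub; rewrite setUC cardsU1 t1J.
have : (#|active S d a'| <= q)%N by rewrite -[X in (_ <= X)%N]card_ord max_card.
by move: ltN; lia.
Qed.

(** At a vertex w is a rational combination of active rows, and these take the integral values d, so
    the denominator of the value comes from the combination. There are finitely many active sets J,
    hence one D serves for all S and d. *)
Lemma lp_round : exists2 D : nat, (0 < D)%N & forall S d a, feasible S d a ->
  (forall b, feasible S d b -> 0 <= (w *m b) 0 0) ->
  exists a', [/\ feasible S d a', (w *m a') 0 0 <= (w *m a) 0 0 &
    exists z : int, D%:R * (w *m a') 0 0 = z%:~R].
Proof.
have /fin_all_exists2[DJ DJ0 hDJ] : forall J, exists2 D : nat, (0 < D)%N &
    (w <= rows_of J)%MS -> forall d a, (forall t, t \in J -> (Nu *m a) t 0 = (d t)%:~R) ->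
      exists z : int, D%:R * (w *m a) 0 0 = z%:~R.
  move=> J; have [/submxP[y ->]|h] := boolP (w <= rows_of J)%MS; last by exists 1%N.
  have [D D0 hD] := common_denominator y; exists D => // _ d a ha.
  have hz t : {z : int | D%:R * y 0 t == z%:~R} by apply: sigW; have [z e] := hD t; exists z; apply/eqP.
  exists (\sum_(t in J) sval (hz t) * d t); rewrite -mulmxA mxE mulr_sumr rmorph_sum /=.
  rewrite [RHS]big_mkcond; apply: eq_bigr => t _; rewrite mulrA.
  have := svalP (hz t); move: (sval (hz t)) => z /eqP ->.
  case: ifP => tJ.
    rewrite intrM -ha //; congr (_ * _); rewrite !mxE; apply: eq_bigr => l _.
    by rewrite [rows_of J t l]mxE tJ.
  rewrite mxE big1 ?mulr0 // => l _; by rewrite mxE tJ mul0r.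
exists (\prod_J DJ J)%N; first exact: prodn_gt0.
move=> S d a fa bnd; have [a' [h1 h2 h3]] := vertex fa bnd; exists a'; split=> //.
have [|z e] := hDJ _ h3 d a'; first by move=> t; rewrite inE => /andP[_ /eqP].
rewrite (bigD1 (active S d a')) //=; set X := (\prod_(J | _) _)%N.
by exists (z * X%:Z); rewrite natrM mulrAC e intrM.
Qed.

End LinearProgram.

(** * Weights on structure constants, and the Lie algebra at infinity *)

Section Graded.
Variables (k : fieldType) (m : nat).
Implicit Types (x : 'I_m -> 'M[{poly k}]_m) (a : 'I_m -> rat).

(** Equivalently, the structure constants in the basis t^(-a_i) e_i are regular at t = infinity.
    With [top], [LS] is the Lie algebra in the fibre there; with [bot], it keeps the constants at
    the places where the bound is 0. *)
Definition grS a x := forall i j l, degle (x i j l) (a i + a j - a l).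
Definition LS (L : {poly k} -> rat -> k) a x i := LM L (fun j => a i + a j) a (x i).

Lemma symM_eq L p q r s t : symbol L -> degle p r -> degle q s -> t = r + s ->
  L (p * q) t = L p r * L q s :> k.
Proof. by move=> sL hp hq ->; apply: symM. Qed.

Lemma lie_LS L a x : symbol L -> lie x -> grS a x -> lie (LS L a x).
Proof.
move=> sL /lieP[h1 h2] gx; apply/lieP; split=> [i j l|i j q l].
  by rewrite !mxE h1 symN // [a i + a j]addrC.
pose r := a i + a j + a q - a l.
transitivity (L (\sum_p x i j p * x p q l) r).
  rewrite sym_sum //; apply: eq_bigr => p _; rewrite !mxE.
  by rewrite (symM_eq sL (gx i j p) (gx p q l)) //; rewrite /r; ring.
rewrite h2 symD // symN // !sym_sum //; congr (_ - _); apply: eq_bigr => p _; rewrite !mxE.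
  by rewrite (symM_eq sL (gx j q p) (gx i p l)) //; rewrite /r; ring.
by rewrite (symM_eq sL (gx i q p) (gx j p l)) //; rewrite /r; ring.
Qed.

Lemma kill_gr a x : grS a x -> grM a (fun j => - a j) (kill x).
Proof.
move=> gx i j; rewrite mxE; apply: degle_sum => p _; rewrite mxE; apply: degle_sum => q _.
have -> : a i - - a j = (a i + a p - a q) + (a j + a q - a p) by ring.
by apply: degleM.
Qed.

Lemma kill_LS L a x : symbol L -> grS a x ->
  kill (LS L a x) = LM L a (fun j => - a j) (kill x).
Proof.
move=> sL gx; apply/matrixP => i j; rewrite !mxE sym_sum //; apply: eq_bigr => p _.
rewrite !mxE sym_sum //; apply: eq_bigr => q _; rewrite !mxE.
by rewrite (symM_eq sL (gx i p q) (gx j q p)) //; ring.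
Qed.

Definition unimodular x := exists2 c : k, c != 0 & \det (kill x) = c%:P.

Section Weights.
Variables (a : 'I_m -> rat) (x : 'I_m -> 'M[{poly k}]_m).
Hypotheses (ux : unimodular x) (gx : grS a x).

Lemma det_kill L : symbol L -> exists2 c : k, c != 0 &
  degle c%:P (\sum_i a i + \sum_i a i) /\
  L c%:P (\sum_i a i + \sum_i a i) = \det (kill (LS L a x)).
Proof.
move=> sL; have [c c0 e] := ux; exists c => //; rewrite kill_LS // -e.
by have := det_gr sL (kill_gr gx); rewrite sumrN opprK.
Qed.

(** The Killing determinant has weight twice the sum of the a_i, yet it is a nonzero constant. The
    sign of the sum thus decides whether its symbol survives, which also yields the next two
    lemmas. *)
Lemma weight_ge0 : 0 <= \sum_i a i.
Proof.
have [c c0 [h _]] := det_kill (top_symbol k).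
by have := h 0%N; rewrite coefC /= => /(_ c0); lra.
Qed.

Lemma weight0_kill L : symbol L -> \sum_i a i = 0 -> \det (kill (LS L a x)) != 0.
Proof. by move=> sL e; have [c c0 [_ <-]] := det_kill sL; rewrite e addr0 symC. Qed.

Lemma weight_gt0_kill : 0 < \sum_i a i -> \det (kill (LS (@top k) a x)) = 0.
Proof.
move=> gt; have [c c0 [_ <-]] := det_kill (top_symbol k).
have [[N e]|h] := natP (\sum_i a i + \sum_i a i); last by rewrite top_notnat.
rewrite e topE coefC; case: N e => // e.
by exfalso; move: e gt; lra.
Qed.

End Weights.

Lemma chg_comp (R : comNzRingType) (Q1 Q1' Q2 Q2' : 'M[R]_m) (x : 'I_m -> 'M[R]_m) i :
  chg Q2 Q2' (chg Q1 Q1' x) i = chg (Q2 *m Q1) (Q1' *m Q2') x i.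
Proof. by rewrite /chg adv_chg row_mul !mulmxA. Qed.

Lemma unimodular_chg Q Q' x : Q *m Q' = 1%:M -> unimodular x -> unimodular (chg Q Q' x).
Proof.
move=> QQ' [c c0 e]; rewrite /unimodular kill_chg // !det_mulmx det_tr e.
have /eqP : \det Q * \det Q' = 1 by rewrite -det_mulmx QQ' det1.
move/eqP/(f_equal (fun p : {poly k} => p \is a GRing.unit)); rewrite unitr1 unitrM => /andP[uQ _].
move: uQ; rewrite poly_unitE => /andP[/size_poly1P[d d0 ->] _].
by exists (d * c * d); rewrite ?mulf_neq0 // !polyCM.
Qed.

Lemma grM_shift n l (r : 'I_n -> rat) (c : 'I_l -> rat) s (M : 'M[{poly k}]_(n, l)) :
  grM r c M -> grM (fun i => s + r i) (fun j => s + c j) M.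
Proof. by move=> h i j; rewrite opprD addrACA subrr add0r; apply: h. Qed.

Lemma LM_shift L n l (r : 'I_n -> rat) (c : 'I_l -> rat) s (M : 'M[{poly k}]_(n, l)) :
  LM L (fun i => s + r i) (fun j => s + c j) M = LM L r c M.
Proof. by apply/matrixP => i j; rewrite !mxE opprD addrACA subrr add0r. Qed.

Lemma adv_gr a x (u : 'rV[{poly k}]_m) s : grS a x -> (forall i, degle (u 0 i) (s - a i)) ->
  grM (fun j => s + a j) a (adv x u).
Proof.
move=> gx gu j l; rewrite /adv summxE; apply: degle_sum => i _; rewrite mxE.
have -> : s + a j - a l = (s - a i) + (a i + a j - a l) by ring.
exact: degleM.
Qed.

Lemma LM_adv L a x (u : 'rV[{poly k}]_m) s : symbol L -> grS a x ->
  (forall i, degle (u 0 i) (s - a i)) ->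
  LM L (fun j => s + a j) a (adv x u) = adv (LS L a x) (\row_i L (u 0 i) (s - a i)).
Proof.
move=> sL gx gu; apply/matrixP => j l; rewrite mxE /adv !summxE sym_sum //.
apply: eq_bigr => i _; rewrite !mxE (symM_eq sL (gu i) (gx i j l)) //; ring.
Qed.

Lemma grS_chg a x Q Q' : grM a a Q -> grM a a Q' -> grS a x -> grS a (chg Q Q' x).
Proof.
move=> gQ gQ' gx i; rewrite -[forall j l, _]/(grM (fun j => a i + a j) a (chg Q Q' x i)).
apply: grM_mul gQ'; apply: grM_mul (grM_shift (a i) gQ) _; apply: adv_gr => // j.
by rewrite mxE; apply: gQ.
Qed.

Lemma LS_chg L a x Q Q' i : symbol L -> grM a a Q -> grM a a Q' -> grS a x ->
  LS L a (chg Q Q' x) i = chg (LM L a a Q) (LM L a a Q') (LS L a x) i.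
Proof.
move=> sL gQ gQ' gx; rewrite /LS /chg.
have gA : grM (fun j => a i + a j) a (adv x (row i Q)).
  by apply: adv_gr => // j; rewrite mxE; apply: gQ.
rewrite (LM_mul sL (grM_mul (grM_shift (a i) gQ) gA) gQ') (LM_mul sL (grM_shift (a i) gQ) gA).
rewrite LM_shift LM_adv //; last by move=> j; rewrite mxE; apply: gQ.
by congr (_ *m adv _ _ *m _); apply/rowP => j; rewrite !mxE.
Qed.

End Graded.

Lemma positive_lower_bound (T : finType) (d : T -> rat) : (forall t, 0 < d t) ->
  exists2 e, 0 < e & forall t, e <= d t.
Proof.
move=> d0; pose s := 1 + \sum_t (d t)^-1.
have s0 : 0 < s by rewrite ltr_pwDl // sumr_ge0 // => t _; rewrite invr_ge0 ltW.
exists s^-1; first by rewrite invr_gt0.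
move=> t; rewrite -[d t]invrK lef_pV2 ?posrE ?invr_gt0 //.
rewrite /s (bigD1 t) //= addrCA lerDl addr_ge0 // sumr_ge0 // => i _.
by rewrite invr_ge0 ltW.
Qed.

Definition frac (r : rat) : rat := r - (Num.floor r)%:~R.

Lemma fracP r s : r - s \is a Num.int -> frac r = frac s.
Proof.
case/intrP => z e; have -> : r = s + z%:~R by rewrite -e addrC subrK.
by rewrite /frac floorDrz ?intr_int // intrKfloor intrD; ring.
Qed.

Section Homogeneous.
Variables (k : fieldType) (m : nat) (a : 'I_m -> rat) (y : 'I_m -> 'M[k]_m).
Hypothesis gy : forall i j l, y i j l != 0 -> a i + a j - a l \is a Num.int.

(** By [gy] the Lie algebra y is graded by rationals modulo integers; these are the projections on
    the homogeneous parts, with classes represented by fractional parts. *)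
Definition proj (c : rat) (u : 'rV[k]_m) : 'rV[k]_m :=
  \row_i (if frac (a i) == c then u 0 i else 0).

Fact proj_linear c : linear (proj c).
Proof.
move=> b u v; apply/rowP => i; rewrite !mxE.
by case: ifP; rewrite ?mulr0 ?addr0.
Qed.
HB.instance Definition _ c := GRing.isLinear.Build k _ _ _ (proj c) (proj_linear c).

Definition classes := undup [seq frac (a i) | i : 'I_m].

Lemma proj_sum u : u = \sum_(c <- classes) proj c u.
Proof.
apply/rowP => i; rewrite summxE (bigD1_seq (frac (a i))) ?undup_uniq //=; last first.
  by rewrite mem_undup; apply/mapP; exists i; rewrite ?mem_enum.
rewrite mxE eqxx big1 ?addr0 // => c /negPf ci.
by rewrite mxE eq_sym ci.
Qed.

Definition homog (W : 'M[k]_m) := forall c u, (u <= W)%MS -> (proj c u <= W)%MS.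

Lemma brE u v l : br y u v 0 l = \sum_i \sum_j u 0 i * v 0 j * y i j l.
Proof.
rewrite /br /adv mulmx_sumr summxE; apply: eq_bigr => i _.
rewrite -scalemxAr mxE mxE mulr_sumr; apply: eq_bigr => j _.
by rewrite mulrA.
Qed.

Lemma proj_br c d e u v : proj e (br y (proj c u) (proj d v)) =
  if frac (c + d) == e then br y (proj c u) (proj d v) else 0.
Proof.
apply/rowP => l; rewrite [LHS]mxE.
have [h|h] := eqVneq (br y (proj c u) (proj d v) 0 l) 0.
  by rewrite h; case: ifP => _; case: ifP; rewrite ?h ?mxE.
suff -> : frac (a l) = frac (c + d) by case: ifP; rewrite ?mxE.
have [i /existsP[j]] : exists i, [exists j, (proj c u 0 i * proj d v 0 j * y i j l != 0)].
  apply/existsP; apply: contraNT h; rewrite negb_exists => /forallP h; rewrite brE.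
  apply/eqP/big1 => i _; apply: big1 => j _; apply/eqP.
  by have := h i; rewrite negb_exists => /forallP/(_ j); rewrite negbK.
rewrite !mulf_eq0 !negb_or !mxE.
case: ifP => [/eqP <-|_]; last by rewrite eqxx.
case: ifP => [/eqP <-|_]; last by rewrite eqxx andbF.
case/andP => _ /gy/intrP[z e2]; apply: fracP; rewrite /frac.
have -> : a l - (a i - (Num.floor (a i))%:~R + (a j - (Num.floor (a j))%:~R)) =
   (Num.floor (a i) + Num.floor (a j) - z)%:~R by rewrite intrB intrD -e2; ring.
exact: intr_int.
Qed.

Lemma homog_brspan W : homog W -> homog (brspan y W W).
Proof.
move=> hW e w /bspan_sum[C ->]; rewrite linear_sum; apply: summx_sub => i _.
rewrite linear_sum; apply: summx_sub => j _; rewrite linearZ; apply: scalemx_sub.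
have -> : br y (row i W) (row j W) =
    \sum_(c <- classes) \sum_(d <- classes) br y (proj c (row i W)) (proj d (row j W)).
  rewrite {1}[row j W]proj_sum exchange_big /= {1}/br mulmx_suml; apply: eq_bigr => d _.
  have -> : adv y (row i W) = \sum_(c <- classes) adv y (proj c (row i W)).
    by rewrite {1}[row i W]proj_sum linear_sum.
  by rewrite mulmx_sumr.
rewrite /= linear_sum; apply: summx_sub => c _; rewrite linear_sum; apply: summx_sub => d _.
rewrite /= proj_br; case: ifP => _; last exact: sub0mx.
apply: bspan_in; [exact: br_linear_l | exact: br_linear_r | |]; apply: hW; exact: row_sub.
Qed.

(** The Killing form pairs a class only with its opposite, so the equations of the radical split by
    classes. *)
Lemma homog_radical : homog (kermx (kill y)).
Proof.
move=> c u /sub_kermxP hu; apply/sub_kermxP; apply/rowP => j; rewrite [RHS]mxE mxE.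
have kg i : kill y i j != 0 -> frac (a i) = frac (- a j).
  rewrite mxE => h.
  have [p /existsP[q]] : exists p, [exists q, (y i p q * y j q p != 0)].
    apply/existsP; apply: contraNT h; rewrite negb_exists => /forallP h; apply/eqP.
    rewrite /mxtrace big1 // => p _; rewrite mxE big1 // => q _; apply/eqP.
    by have := h p; rewrite negb_exists => /forallP/(_ q); rewrite negbK.
  rewrite mulf_eq0 negb_or => /andP[/gy h1 /gy h2]; apply: fracP.
  have -> : a i - - a j = (a i + a p - a q) + (a j + a q - a p) by ring.
  exact: rpredD.
have [e|/negPf e] := eqVneq (frac (- a j)) c.
  have : (u *m kill y) 0 j = 0 by rewrite hu mxE.
  rewrite mxE => hs; rewrite -[RHS]hs; apply: eq_bigr => i _; rewrite mxE.
  by have [->|/kg ->] := eqVneq (kill y i j) 0; rewrite ?mulr0 // e eqxx.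
apply: big1 => i _; rewrite mxE; have [->|/kg ->] := eqVneq (kill y i j) 0.
  by rewrite mulr0.
by rewrite e mul0r.
Qed.

(** The condition under which a constant matrix can be homogenized by natural powers of t, as
    [hlift] does. *)
Definition lower_supp (q : 'M[k]_m) := forall j l, q j l != 0 -> exists N : nat, a j - a l = N%:R.

Lemma lower_supp_mul q r : lower_supp q -> lower_supp r -> lower_supp (q *m r).
Proof.
move=> hq hr j l; rewrite mxE => h.
have [p] : exists p, q j p * r p l != 0.
  apply/existsP; apply: contraNT h; rewrite negb_exists => /forallP h.
  by apply/eqP/big1 => p _; apply/eqP; have := h p; rewrite negbK.
rewrite mulf_eq0 negb_or => /andP[/hq[N1 e1] /hr[N2 e2]].
by exists (N1 + N2)%N; rewrite natrD -e1 -e2; ring.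
Qed.

(* Echelon form: pivots are taken where the weight is largest, so that the
   change of basis only adds vectors of smaller weight. *)
Lemma echelon W : homog W -> exists q q' : 'M[k]_m, exists N : {set 'I_m},
  [/\ q *m q' = 1%:M, lower_supp q, lower_supp q',
      (forall j, j \in N -> (row j q <= W)%MS) &
      (forall (w : 'rV_m) j, (w <= W)%MS -> j \notin N -> (w *m q') 0 j = 0)].
Proof.
move=> hW.
suff H d (q q' : 'M[k]_m) (N : {set 'I_m}) : (m - #|N| < d)%N ->
  q *m q' = 1%:M -> lower_supp q -> lower_supp q' -> (forall j, j \in N -> (row j q <= W)%MS) ->
  exists q q' : 'M[k]_m, exists N : {set 'I_m},
  [/\ q *m q' = 1%:M, lower_supp q, lower_supp q',
      (forall j, j \in N -> (row j q <= W)%MS) &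
      (forall (w : 'rV_m) j, (w <= W)%MS -> j \notin N -> (w *m q') 0 j = 0)].
  have s1 : lower_supp 1%:M.
    by move=> j l; rewrite mxE; have [->|] := eqVneq j l; [exists 0%N; rewrite subrr | rewrite mulr0n eqxx].
  by apply: (H _ 1%:M 1%:M set0 (ltnSn _)); rewrite ?mulmx1 // => j; rewrite inE.
elim: d q q' N => // d IH q q' N ltd qq' sq sq' qN.
have [[w [j [wW jN nz]]]|none] := pselect (exists (w : 'rV_m) j, [/\ (w <= W)%MS, j \notin N & (w *m q') 0 j != 0]); last first.
  exists q, q', N; split=> // w j wW jN; apply/eqP/negPn/negP => h; apply: none.
  by exists w, j.
have [c hc] : exists c, (proj c w *m q') 0 j != 0.
  apply: contrapT => /forallNP h; move/eqP: nz; apply; rewrite [w]proj_sum mulmx_suml summxE.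
  by apply: big1 => c _; apply/eqP/negPn/negP/h.
pose nu := proj c w *m q'.
have nuc l : nu 0 l != 0 -> frac (a l) = c.
  rewrite mxE => h.
  have [i] : exists i, proj c w 0 i * q' i l != 0.
    apply/existsP; apply: contraNT h; rewrite negb_exists => /forallP h.
    by apply/eqP/big1 => p _; apply/eqP; have := h p; rewrite negbK.
  rewrite mulf_eq0 negb_or mxE; case: ifP => [/eqP <-|_]; last by rewrite eqxx.
  case/andP => _ /sq'[M e]; apply: fracP; have -> : a l - a i = - (M%:R) by rewrite -e; ring.
  by rewrite rpredN; apply: intr_int M.
(* Coordinates at earlier pivots are removed by subtracting rows of q that already lie in W. *)
pose nu1 : 'rV_m := \row_l (if l \in N then 0 else nu 0 l).
have nu1W : (nu1 *m q <= W)%MS.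
  have -> : nu1 = nu - \sum_(l in N) nu 0 l *: delta_mx 0 l.
    apply/rowP => l; rewrite [LHS]mxE [RHS]mxE [X in _ + X]mxE summxE.
    rewrite (eq_bigr (fun p => if p == l then nu 0 l else 0)); last first.
      by move=> p _; rewrite !mxE eqxx [l == p]eq_sym; case: eqP => [->|]; rewrite ?mulr1 ?mulr0.
    rewrite -big_mkcondr; case: ifP => lN.
      by rewrite (big_pred1 l) ?subrr // => p /=; case: eqP => [->|]; rewrite ?andbT ?andbF.
    by rewrite big_pred0 ?subr0 // => p; case: eqP => [->|]; rewrite ?andbF ?lN.
  rewrite mulmxBl addmx_sub //.
    by rewrite /nu -mulmxA (mulmx1C qq') mulmx1; apply: hW.
  rewrite eqmx_opp mulmx_suml; apply: summx_sub => l lN; rewrite -scalemxAl scalemx_sub //.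
  by rewrite -rowE qN.
have [j0 nzj0 maxj0] : exists2 j0, nu1 0 j0 != 0 & forall l, nu1 0 l != 0 -> a l <= a j0.
  have nzj : nu1 0 j != 0 by rewrite mxE (negPf jN).
  by case: (@arg_maxP _ _ _ j (fun l => nu1 0 l != 0) a nzj) => j0 h1 h2; exists j0.
have j0N : j0 \notin N by apply: contraNN nzj0 => h; rewrite mxE h.
(* All weights in the support have fractional part c, so they differ by integers, and maximality of
   [j0] makes the differences natural numbers. *)
have supp1 l : nu1 0 l != 0 -> exists M : nat, a j0 - a l = M%:R.
  move=> hl; have nn l' : nu1 0 l' != 0 -> nu 0 l' != 0 by rewrite mxE; case: ifP; rewrite ?eqxx.
  have e : frac (a l) = frac (a j0) by rewrite !nuc ?nn.
  have /natrP[M e2] : a j0 - a l \is a Num.nat.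
    rewrite natrEint subr_ge0 maxj0 // andbT.
    have -> : a j0 - a l = (Num.floor (a j0) - Num.floor (a l))%:~R.
      by rewrite intrB; move: e; rewrite /frac; lra.
    exact: intr_int.
  by exists M.
pose T : 'M[k]_m := \matrix_(i, l) if i == j0 then nu1 0 l else (i == l)%:R.
pose T' : 'M[k]_m := \matrix_(i, l) if i == j0 then
   (if l == j0 then (nu1 0 j0)^-1 else - (nu1 0 l / nu1 0 j0)) else (i == l)%:R.
have TT' : T *m T' = 1%:M.
  apply/matrixP => i l; rewrite [LHS]mxE [RHS]mxE.
  have [->|ij0] := eqVneq i j0; last first.
    rewrite (bigD1 i) //= big1 ?addr0; last by move=> p pi; rewrite !mxE (negPf ij0) eq_sym (negPf pi) mul0r.
    by rewrite !mxE (negPf ij0) eqxx mul1r.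
  rewrite (bigD1 j0) //= [T j0 j0]mxE [T' j0 l]mxE !eqxx.
  have [->|lj] := eqVneq l j0.
    rewrite mulfV // big1 ?addr0 ?eqxx // => p pj; rewrite !mxE (negPf pj) mulr0 //.
  rewrite (bigD1 l) //= [T j0 l]mxE [T' l l]mxE !eqxx (negPf lj) mulr1 big1 ?addr0; last first.
    by move=> p /andP[pj pl]; rewrite !mxE (negPf pj) (negPf pl) mulr0.
  by rewrite mulrN mulrCA mulfV // mulr1 addNr.
have sT : lower_supp T.
  move=> i l; rewrite mxE; case: ifP => [/eqP -> /supp1 //|_].
  by have [->|] := eqVneq i l; [exists 0%N; rewrite subrr | rewrite eqxx].
have sT' : lower_supp T'.
  move=> i l; rewrite mxE; case: ifP => [/eqP ->|_]; last first.
    by have [->|] := eqVneq i l; [exists 0%N; rewrite subrr | rewrite eqxx].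
  case: ifP => [/eqP -> _|_]; first by exists 0%N; rewrite subrr.
  by rewrite oppr_eq0 mulf_eq0 negb_or => /andP[/supp1].
apply: (IH (T *m q) (q' *m T') (j0 |: N)).
- have : (#|j0 |: N| <= m)%N by rewrite -[X in (_ <= X)%N]card_ord max_card.
  rewrite cardsU1 j0N add1n; move: ltd; move: #|_| => n0; lia.
- by rewrite mulmxA -[T *m q *m q']mulmxA qq' mulmx1.
- exact: lower_supp_mul.
- exact: lower_supp_mul.
move=> i; rewrite in_setU1 row_mul; have [-> _|ij0 /= iN] := eqVneq i j0.
  have -> : row j0 T = nu1 by apply/rowP => l; rewrite !mxE eqxx.
  by [].
have -> : row i T = delta_mx 0 i.
  by apply/rowP => l; rewrite !mxE (negPf ij0) eqxx [l == i]eq_sym.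
by rewrite -rowE qN.
Qed.

End Homogeneous.

Section Lift.
Variables (k : fieldType) (m : nat) (a : 'I_m -> rat).

(** Homogenization of q, undone by [top]. The truncation is exact wherever [lower_supp] allows a
    nonzero entry. *)
Definition hlift (q : 'M[k]_m) : 'M[{poly k}]_m :=
  \matrix_(j, l) (q j l *: 'X^(Num.truncn (a j - a l))).

Lemma hlift_gr q : lower_supp a q -> grM a a (hlift q).
Proof.
move=> hq j l; rewrite mxE; have [->|nz] := eqVneq (q j l) 0.
  by rewrite scale0r; apply: degle0.
have [N ->] := hq _ _ nz; rewrite Num.Theory.natrK => M.
by rewrite coefZ coefXn; have [->|_] := eqVneq M N; rewrite ?mulr0 ?eqxx.
Qed.

Lemma hlift_top q : lower_supp a q -> LM (@top k) a a (hlift q) = q.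
Proof.
move=> hq; apply/matrixP => j l; rewrite !mxE; have [->|nz] := eqVneq (q j l) 0.
  by rewrite scale0r /top coef0; case: ifP.
have [N ->] := hq _ _ nz; rewrite Num.Theory.natrK topE coefZ coefXn eqxx mulr1 //.
Qed.

Lemma hliftM q r : lower_supp a q -> lower_supp a r -> hlift (q *m r) = hlift q *m hlift r.
Proof.
move=> hq hr; apply/matrixP => j l; rewrite !mxE scaler_suml; apply: eq_bigr => p _.
rewrite !mxE; have [->|nz] := eqVneq (q j p) 0; first by rewrite mul0r !scale0r mul0r.
have [->|nz'] := eqVneq (r p l) 0; first by rewrite mulr0 !scale0r mulr0.
have [N1 e1] := hq _ _ nz; have [N2 e2] := hr _ _ nz'.
have -> : a j - a l = (N1 + N2)%:R by rewrite natrD -e1 -e2; ring.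
by rewrite e1 e2 !Num.Theory.natrK exprD -scalerAl -scalerAr scalerA.
Qed.

Lemma hlift1 : hlift 1%:M = 1%:M.
Proof.
apply/matrixP => j l; rewrite !mxE; case: eqP => [->|_]; last by rewrite !mulr0n scale0r.
by rewrite subrr (Num.Theory.natrK 0) expr0 scale1r.
Qed.

End Lift.

Section Lower.
Variables (k : fieldType) (K : closedFieldType) (iota : {rmorphism k -> K}).
Hypothesis ch0 : [pchar k] =i pred0.
Variable m : nat.
Implicit Types (x : 'I_m -> 'M[{poly k}]_m) (a : 'I_m -> rat).

(** The leading Lie algebra y has degenerate Killing form, hence a homogeneous abelian ideal. In a
    basis adapted to it, with positions N, the brackets [N, N] and the components of [e_i, N]
    outside N vanish at leading order, so the weights on N can drop by some e > 0 within the degree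
    bounds. *)
Lemma lower_weight x a : lie x -> unimodular x -> grS a x -> 0 < \sum_i a i ->
  exists Q Q' a', [/\ Q *m Q' = 1%:M, grS a' (chg Q Q' x) & \sum_i a' i < \sum_i a i].
Proof.
move=> lx ux gx gt0.
pose y := LS (@top k) a x.
have ly : lie y := lie_LS (top_symbol k) lx gx.
have gy i j l : y i j l != 0 -> a i + a j - a l \is a Num.int.
  rewrite mxE; have [[N ->] _|h] := natP (a i + a j - a l); first exact: intr_int N.
  by rewrite top_notnat ?eqxx.
have dy : \det (kill y) = 0 by apply: weight_gt0_kill.
have R0 : kermx (kill y) != 0.
  rewrite kermx_eq0; apply/negP; rewrite -row_leq_rank => h.
  have : kill y \in unitmx by rewrite -row_full_unit /row_full eqn_leq rank_leq_row.
  by rewrite unitmxE dy unitr0.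
have [W [W0 _ iW hW abW]] := abelian_descent iota ch0 ly (P := homog a)
   (fun W _ => homog_brspan gy (W := W)) R0 (radical_ideal ly) (homog_radical gy)
   (radical_null (y := y)).
have [q [q' [N [qq' sq sq' qN Nq]]]] := echelon hW.
pose Q := hlift a q; pose Q' := hlift a q'.
have QQ' : Q *m Q' = 1%:M by rewrite -hliftM // qq' hlift1.
have gx2 : grS a (chg Q Q' x) by apply: grS_chg => //; apply: hlift_gr.
pose x2 := chg Q Q' x; pose y2 := chg q q' y.
have ey2 i j l : top (x2 i j l) (a i + a j - a l) = y2 i j l.
  have := LS_chg i (top_symbol k) (hlift_gr sq) (hlift_gr sq') gx.
  by rewrite !hlift_top // => e; rewrite /y2 /y -e [RHS]mxE.
have by2 i j : row j (y2 i) = br y (row i q) (row j q) *m q'.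
  by rewrite -br_delta /y2 br_chg -!rowE.
have N0 : (0 < #|N|)%N.
  rewrite card_gt0; apply: contraNneq W0 => N0; apply/eqP/row_matrixP => i; rewrite row0.
  rewrite -[row i W]mulmx1 -(mulmx1C qq') mulmxA (_ : row i W *m q' = 0) ?mul0mx //.
  by apply/rowP => j; rewrite [RHS]mxE; apply: Nq; [exact: row_sub | rewrite N0 inE].
have z1 i j l : j \in N -> l \notin N -> y2 i j l = 0.
  move=> jN lN; have -> : y2 i j l = row j (y2 i) 0 l by rewrite [RHS]mxE.
  by rewrite by2 Nq // iW // qN.
have ly2 := lie_chg qq' ly.
have anti i j l : y2 i j l = - y2 j i l by case/lieP: ly2 => h _; apply: h.
have z2 i j l : i \in N -> j \in N -> y2 i j l = 0.
  move=> iN jN; have -> : y2 i j l = row j (y2 i) 0 l by rewrite [RHS]mxE.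
  by rewrite by2 abW ?qN // mul0mx mxE.
(* A slack of 2e is asked for, since a triple with two indices in N and the third outside has its
   bound lowered by 2e. *)
have [e e0 he] : exists2 e, 0 < e & forall i j l, y2 i j l = 0 ->
    degle (x2 i j l) (a i + a j - a l - (e + e)).
  have /fin_all_exists2[d d0 hd] : forall t : 'I_m * 'I_m * 'I_m, exists2 d, 0 < d &
      y2 t.1.1 t.1.2 t.2 = 0 -> degle (x2 t.1.1 t.1.2 t.2) (a t.1.1 + a t.1.2 - a t.2 - d).
    move=> [[i j] l] /=; have [y0|y0] := eqVneq (y2 i j l) 0; last first.
      by exists 1 => // h; rewrite h eqxx in y0.
    have [|d d0 hd] := top_gap (gx2 i j l); first by rewrite ey2.
    by exists d.
  have [e e0 he] := positive_lower_bound d0; exists (e / 2); first by lra.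
  move=> i j l h; apply: degle_le (hd (i, j, l) h) => /=.
  by have := he (i, j, l); lra.
pose a' i := a i - (if i \in N then e else 0).
exists Q, Q', a'; split=> //.
  move=> i j l; rewrite /a'.
  case iN: (i \in N); case jN: (j \in N); case lN: (l \in N).
  - apply: degle_le (he _ _ _ (z2 _ _ _ iN jN)); lra.
  - apply: degle_le (he _ _ _ (z2 _ _ _ iN jN)); lra.
  - apply: degle_le (gx2 i j l); lra.
  - apply: degle_le (he i j l _); first by lra.
    by rewrite anti z1 ?oppr0 ?lN.
  - apply: degle_le (gx2 i j l); lra.
  - apply: degle_le (he i j l _); first by lra.
    by rewrite z1 ?lN.
  - apply: degle_le (gx2 i j l); lra.
  - apply: degle_le (gx2 i j l); lra.
rewrite sumrB gtrDl oppr_lt0 -big_mkcond sumr_const pmulrn_rgt0 //.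
Qed.

(** For fixed x the degree conditions are linear inequalities in a whose coefficients depend only on
    m, and [weight_ge0] bounds the sum from below. So D depends on m alone and survives all changes
    of basis. *)
Lemma round_weight : exists2 D : nat, (0 < D)%N & forall x a, unimodular x -> grS a x ->
  exists a', [/\ grS a' x, \sum_i a' i <= \sum_i a i & exists z : int, D%:R * \sum_i a' i = z%:~R].
Proof.
pose T := ('I_m * 'I_m * 'I_m)%type.
pose q := #|{: T}|.
pose nu (t : T) (p : 'I_m) : rat := (p == t.1.1)%:R + (p == t.1.2)%:R - (p == t.2)%:R.
pose Nu : 'M[rat]_(q, m) := \matrix_(t, p) nu (enum_val t) p.
pose w : 'rV[rat]_m := const_mx 1.
have nuE (b : 'cV[rat]_m) t : (Nu *m b) t 0 =
    b (enum_val t).1.1 0 + b (enum_val t).1.2 0 - b (enum_val t).2 0.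
  have d (i : 'I_m) : \sum_p (p == i)%:R * b p 0 = b i 0.
    rewrite (bigD1 i) //= eqxx mul1r big1 ?addr0 // => p /negPf ->; by rewrite mul0r.
  rewrite mxE -!d -big_split -sumrB; apply: eq_bigr => p _.
  by rewrite mxE /nu !mulrDl mulNr.
have wE (b : 'cV[rat]_m) : (w *m b) 0 0 = \sum_i b i 0.
  by rewrite mxE; apply: eq_bigr => i _; rewrite mxE mul1r.
have [D D0 hD] := lp_round Nu w; exists D => // x a ux gx.
pose xt (t : 'I_q) := x (enum_val t).1.1 (enum_val t).1.2 (enum_val t).2.
pose S := [set t | xt t != 0].
pose d (t : 'I_q) : int := (size (xt t)).-1.
have feasE b : feasible Nu S d b <-> grS (fun i => b i 0) x.
  split=> h.
    move=> i j l N hN; have xn0 : x i j l != 0 by apply: contraNneq hN => ->; rewrite coef0.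
    have := h (enum_rank (i, j, l)); rewrite inE /d /xt nuE enum_rankK /= => /(_ xn0).
    apply: le_trans; rewrite -pmulrn ler_nat.
    have : (N < size (x i j l))%N by rewrite ltnNge; apply: contraNN hN => /leq_sizeP ->.
    by case: (size _).
  move=> t; rewrite inE nuE => xn0; have := h (enum_val t).1.1 (enum_val t).1.2 (enum_val t).2.
  move/(_ (size (xt t)).-1); rewrite -pmulrn; apply.
  by rewrite -/(xt t) -lead_coefE lead_coef_eq0.
pose b : 'cV[rat]_m := \col_i a i.
have gb : grS (fun i => b i 0) x by move=> i j l; rewrite !mxE.
have [|b' [h1 h2 h3]] := hD S d b ((feasE b).2 gb).
  by move=> b' /feasE gb'; rewrite wE; apply: weight_ge0 ux gb'.
exists (fun i => b' i 0); split; first exact/feasE.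
  by move: h2; rewrite !wE; congr (_ <= _); apply: eq_bigr => i _; rewrite mxE.
by move: h3; rewrite wE.
Qed.

(** Lowering and rounding alternate: after each round D times the sum of the weights is an integer,
    nonnegative and strictly smaller. *)
Lemma weight_zero x : lie x -> unimodular x -> exists Q Q' a,
  [/\ Q *m Q' = 1%:M, grS a (chg Q Q' x) & \sum_i a i = 0].
Proof.
move=> lx ux; have [D D0 hD] := round_weight.
have chg_id z i : chg 1%:M 1%:M z i = z i :> 'M[{poly k}]_m.
  by rewrite /chg mul1mx mulmx1 rowE mulmx1 adv_delta.
suff H N x0 a0 : lie x0 -> unimodular x0 -> grS a0 x0 -> D%:R * \sum_i a0 i < N%:R ->
    (exists z : int, D%:R * \sum_i a0 i = z%:~R) -> exists Q Q' a,
    [/\ Q *m Q' = 1%:M, grS a (chg Q Q' x0) & \sum_i a i = 0].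
  (* Equal weights s give the bound s + s - s = s, at least every degree. *)
  pose s : rat := \sum_i \sum_j \sum_l (size (x i j l))%:R.
  have gs : grS (fun=> s) x.
    move=> i j l N hN; rewrite addrK /s (bigD1 i) //= (bigD1 j) //= (bigD1 l) //=.
    have : (N <= size (x i j l))%N.
      by rewrite leqNgt; apply: contraNN hN => /ltnW/leq_sizeP ->.
    rewrite -(ler_nat rat) => /le_trans; apply; rewrite -!addrA lerDl !addr_ge0 //.
    - by apply: sumr_ge0.
    - by apply: sumr_ge0 => ? _; apply: sumr_ge0.
    - by apply: sumr_ge0 => ? _; apply: sumr_ge0 => ? _; apply: sumr_ge0.
  have [a' [ga' _ ia']] := hD x _ ux gs.
  have [N ltN] : exists N : nat, D%:R * \sum_i a' i < N%:R.
    exists (Num.bound `|D%:R * \sum_i a' i|).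
    by apply: le_lt_trans (ler_norm _) _; apply: archi_boundP.
  exact: H ga' ltN ia'.
elim: N x0 a0 => [|N IH] x0 a0 lx0 ux0 gx0 ltN iz.
  by have := weight_ge0 ux0 gx0; move: ltN; rewrite pmulr_rlt0 ?ltr0n // leNgt => ->.
have [e|ne] := eqVneq (\sum_i a0 i) 0.
  exists 1%:M, 1%:M, a0; rewrite mulmx1; split=> // i j l; rewrite chg_id; exact: gx0.
have gt0 : 0 < \sum_i a0 i by rewrite lt_def ne (weight_ge0 ux0 gx0).
have [Q1 [Q1' [a1 [QQ1 g1 lt1]]]] := lower_weight lx0 ux0 gx0 gt0.
have ux1 := unimodular_chg QQ1 ux0; have lx1 := lie_chg QQ1 lx0.
have [a2 [g2 le2 iz2]] := hD _ _ ux1 g1.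
have [|Q2 [Q2' [a3 [QQ2 g3 s3]]]] := IH _ _ lx1 ux1 g2 _ iz2.
  have lt2 : D%:R * \sum_i a2 i < D%:R * \sum_i a0 i.
    by rewrite ltr_pM2l ?ltr0n // (le_lt_trans le2).
  case: iz iz2 => z ez [z2 ez2]; move: lt2 ltN; rewrite ez ez2 ltr_int => lt2.
  rewrite [N.+1%:R]pmulrn [N%:R]pmulrn !ltr_int; lia.
exists (Q2 *m Q1), (Q1' *m Q2'), a3; split=> //.
  by rewrite mulmxA -[Q2 *m Q1 *m Q1']mulmxA QQ1 mulmx1.
by move=> i j l; rewrite -chg_comp; apply: g3.
Qed.

End Lower.

Lemma derivation_diag (R : comNzRingType) m (x : 'I_m -> 'M[R]_m) (d : 'I_m -> R) :
  (forall i j l, x i j l * d l = (d i + d j) * x i j l) <->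
  derivation x (diag_mx (\row_i d i)).
Proof.
have dd n (B : 'M[R]_(n, m)) j l : (B *m diag_mx (\row_i d i)) j l = B j l * d l.
  rewrite mxE (bigD1 l) //= !mxE eqxx mulr1n big1 ?addr0 // => p pl.
  by rewrite !mxE (negPf pl) mulr0n mulr0.
have dd' (B : 'M[R]_m) j l : (diag_mx (\row_i d i) *m B) j l = d j * B j l.
  rewrite mxE (bigD1 j) //= !mxE eqxx mulr1n big1 ?addr0 // => p pj.
  by rewrite !mxE eq_sym (negPf pj) mulr0n mul0r.
split=> h; last first.
  move=> i j l; have /matrixP/(_ j l) := h (delta_mx 0 i).
  rewrite adv_delta dd mxE dd'.
  have -> : adv x (delta_mx 0 i *m diag_mx (\row_i0 d i0)) j l = d i * x i j l.
    rewrite (_ : _ *m _ = d i *: delta_mx 0 i); first by rewrite linearZ /= adv_delta mxE.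
    apply/rowP => p; rewrite dd !mxE /=.
    by have [->|_] := eqVneq p i; rewrite ?mulr1 ?mul1r ?mul0r ?mulr0.
  by rewrite mulrDl addrC.
move=> u; apply/matrixP => j l; rewrite dd mxE dd' /adv !summxE mulr_suml mulr_sumr -big_split.
apply: eq_bigr => i _ /=; have sc (c : R) (B : 'M[R]_m) : (c *: B) j l = c * B j l by rewrite mxE.
rewrite !sc.
by rewrite dd -mulrA h; ring.
Qed.

Section Constant.
Variables (k : fieldType) (ch0 : [pchar k] =i pred0).
Let h : {rmorphism rat -> k} := rat_morph ch0.

(** The grading of w by a is a derivation, inner because w has nondegenerate Killing form. Its lift
    A = ad h1 to k[t] is diag(a) up to entries that lower the weight strictly, so A is
    diagonalizable over k[t]. In an eigenbasis a structure constant is nonzero only if a_l = a_i +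
    a_j, and then its degree bound is 0. *)
Lemma weight_zero_constant m (x : 'I_m -> 'M[{poly k}]_m) (a : 'I_m -> rat) :
  lie x -> unimodular x -> grS a x -> \sum_i a i = 0 ->
  exists Q Q', Q *m Q' = 1%:M /\ forall i j l, (size (chg Q Q' x i j l) <= 1)%N.
Proof.
case: m x a => [|m] x a lx ux gx a0; first by exists 1%:M, 1%:M; rewrite mulmx1; split=> // -[].
have sB := bot_symbol k.
pose w := LS (@bot k) a x.
have lw : lie w := lie_LS sB lx gx.
have uw : kill w \in unitmx by rewrite unitmxE unitfE; apply: weight0_kill.
pose D : 'M[k]_m.+1 := diag_mx (\row_i h (a i)).
have w0 i j l : w i j l != 0 -> a l = a i + a j.
  rewrite mxE /bot; case: ifP => [/eqP e _|]; last by rewrite eqxx.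
  by apply/esym/eqP; rewrite -subr_eq0 e.
have dD : derivation w D.
  apply/derivation_diag => i j l; have [->|/w0 ->] := eqVneq (w i j l) 0.
    by rewrite mul0r mulr0.
  by rewrite rmorphD mulrC.
have [h0 eD] := derivation_inner lw (mulmxV uw) dD.
(* Only coordinates of weight 0 are kept, which makes [h1] homogeneous; the others cannot reach the
   diagonal, where D is supported. *)
pose h1 : 'rV[{poly k}]_m.+1 := \row_i (if a i == 0 then (h0 0 i)%:P else 0).
pose A := adv x h1.
have gh1 i : degle (h1 0 i) (0 - a i).
  rewrite mxE; case: ifP => [/eqP ->|_]; last exact: degle0.
  by rewrite subrr; apply: degleC.
have gA : grM a a A.
  by have := adv_gr gx gh1 => H j l; have := H j l; rewrite add0r.
have bA : LM (@bot k) a a A = D.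
  apply/matrixP => j l; have [ajl|ajl] := eqVneq (a j) (a l); last first.
    rewrite mxE /bot subr_eq0 (negPf ajl) /D !mxE.
    by rewrite (_ : (j == l) = false) ?mulr0n //; apply: contraNF ajl => /eqP ->.
  have := LM_adv sB gx gh1 => /matrixP/(_ j l); rewrite mxE add0r => e.
  rewrite mxE e eD /adv !summxE; apply: eq_bigr => i _.
  rewrite mxE [RHS]mxE -/w; have [->|/w0 e2] := eqVneq (w i j l) 0; first by rewrite !mulr0.
  have ai : a i = 0 by move: e2; rewrite ajl; lra.
  by congr (_ * _); rewrite mxE mxE ai eqxx subrr symC.
pose vals := undup [seq a i | i : 'I_m.+1].
have inv i : a i \in vals by rewrite mem_undup map_f ?mem_enum.
pose X c : {poly {poly k}} := 'X - ((h c)%:P)%:P.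
(* Lagrange polynomials of the distinct weights; evaluated at A they project on the eigenspaces. *)
pose P c : {poly {poly k}} := \prod_(c' <- rem c vals) (((h (c - c'))^-1%:P)%:P * X c').
have F c : horner_mx A (X c) = A - ((h c)%:P)%:M by rewrite rmorphB /= horner_mx_X horner_mx_C.
have gr1 := grM1 a.
have scC (c : k) : grM a a ((c%:P)%:M : 'M_m.+1) /\ LM (@bot k) a a (c%:P)%:M = c%:M.
  split=> [j l|]; last apply/matrixP => j l; rewrite !mxE.
    by case: eqP => [->|_]; rewrite ?subrr ?mulr1n ?mulr0n; [exact: degleC | exact: degle0].
  by case: eqP => [->|_]; rewrite ?subrr ?mulr1n ?mulr0n ?symC ?sym0.
have gF c : grM a a (horner_mx A (X c)) /\
    LM (@bot k) a a (horner_mx A (X c)) = diag_mx (\row_i (h (a i) - h c)).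
  rewrite F; split=> [j l|].
    by rewrite !mxE; apply: degleD; [exact: gA | apply: degleN; have := (scC (h c)).1 j l; rewrite mxE].
  have -> : LM (@bot k) a a (A - ((h c)%:P)%:M) = LM (@bot k) a a A - LM (@bot k) a a ((h c)%:P)%:M.
    by apply/matrixP => j l; rewrite !mxE symD // symN.
  rewrite bA (scC _).2; apply/matrixP => j l; rewrite !mxE.
  by case: eqP => [->|_]; rewrite ?mulr1n ?mulr0n ?subrr.
have gP c : grM a a (horner_mx A (P c)) /\ LM (@bot k) a a (horner_mx A (P c)) =
   diag_mx (\row_i \prod_(c' <- rem c vals) ((h (c - c'))^-1 * (h (a i) - h c'))).
  rewrite /P; elim: (rem c vals) => [|c' s [IH1 IH2]].
    rewrite big_nil rmorph1; split; first exact: gr1.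
    have := (scC 1).2; rewrite polyC1 => ->; apply/matrixP => j l; rewrite !mxE big_nil.
    by [].
  have [g1 g2] := gF c'; have [g3 g4] := scC (h (c - c'))^-1.
  rewrite big_cons !rmorphM /= horner_mx_C.
  have g5 : grM a a (((h (c - c'))^-1%:P)%:M * horner_mx A (X c')) by apply: grM_mul g3 g1.
  split; first exact: grM_mul g5 IH1.
  rewrite (LM_mul sB g5 IH1) (LM_mul sB g3 g1) IH2 g2 g4.
  rewrite mul_scalar_mx -scalemxAl mulmx_diag.
  apply/matrixP => j l; rewrite !mxE big_cons; case: eqP => [->|_]; last by rewrite !mulr0n mulr0.
  by rewrite !mulr1n mulrA.
(* Ordered by weight, A is block triangular with scalar diagonal blocks, so the product of the A - c
   over the distinct weights, largest first, annihilates every row. *)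
have kills : horner_mx A (\prod_(c <- vals) X c) = 0.
  have FE c j l : horner_mx A (X c) j l != 0 -> a l < a j \/ (l = j /\ a j != c).
    have [g1 g2] := gF c; move=> nz.
    have [lt|gt|e] := ltgtP (a l) (a j); [by left| |].
      by move: nz; rewrite (degle_neg (g1 j l)) ?eqxx // subr_lt0.
    right; have d0 : degle (horner_mx A (X c) j l) 0 by have := g1 j l; rewrite e subrr.
    move: nz; rewrite (degle_const d0) polyC_eq0.
    have -> : (horner_mx A (X c) j l)`_0 = LM (@bot k) a a (horner_mx A (X c)) j l.
      by rewrite mxE /bot e subrr eqxx.
    rewrite g2 !mxE; have [->|_] := eqVneq j l; last by rewrite mulr0n eqxx.
    by rewrite mulr1n subr_eq0 => ne; split=> //; apply: contraNneq ne => ->.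
  pose s := sort >=%O vals.
  have ps : perm_eq s vals by rewrite perm_sort.
  rewrite -(perm_big _ ps) rmorph_prod /=.
  have down (v : 'rV[{poly k}]_m.+1) (t : seq rat) : sorted >=%O t -> uniq t ->
      (forall l, v 0 l != 0 -> a l \in t) -> (forall l c, c \in t -> a l <= c -> a l \in t) ->
      v *m \prod_(c <- t) horner_mx A (X c) = 0.
    elim: t v => [|c t IH] v st ut sv dt.
      by rewrite big_nil mulmx1; apply/rowP => l; rewrite mxE; apply/eqP/negPn/negP => /sv.
    rewrite big_cons -[_ * _]/(_ *m _) mulmxA; apply: IH.
    - exact: path_sorted st.
    - by case/andP: ut.
    - move=> l nz; have [j hj] : exists j, v 0 j * horner_mx A (X c) j l != 0.
        apply/existsP; apply: contraNT nz; rewrite negb_exists mxE => /forallP nz.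
        by apply/eqP/big1 => p _; apply/eqP; have := nz p; rewrite negbK.
      move: hj; rewrite mulf_eq0 negb_or => /andP[/sv jt /FE [lt|[-> ne]]]; last first.
        by move: jt; rewrite inE (negPf ne).
      have := dt l _ jt (ltW lt); rewrite inE => /orP[/eqP e|//].
      have jc : a j <= c.
        move: jt; rewrite inE => /orP[/eqP -> //|jt].
        by move: st; rewrite /= (path_sortedE ge_trans) => /andP[/allP/(_ _ jt)].
      by move: lt; rewrite e ltNge jc.
    move=> l d dt' le; have := dt l d; rewrite inE dt' orbT => /(_ isT le).
    rewrite inE => /orP[/eqP e|//].
    have dc : d <= c by move: st; rewrite /= (path_sortedE ge_trans) => /andP[/allP/(_ _ dt')].
    have : d = c by apply/eqP; rewrite eq_le dc -e le.
    by move=> ed; move: ut; rewrite /= -ed dt'.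
  apply/row_matrixP => j; rewrite rowE row0; apply: down.
  - by apply: sort_sorted => b c; apply: le_total.
  - by rewrite (perm_uniq ps) undup_uniq.
  - by move=> l _; rewrite (perm_mem ps).
  - by move=> l c _ _; rewrite (perm_mem ps).
(* Row j comes from the projector for the eigenvalue a_j, so that Q A = diag(a) Q; its symbol is the
   identity, hence det Q = 1. *)
pose Q : 'M[{poly k}]_m.+1 := \matrix_(j, l) (horner_mx A (P (a j))) j l.
have gQ : grM a a Q by move=> j l; rewrite mxE; apply: (gP _).1.
have hinj : injective h by apply: fmorph_inj.
have bQ : LM (@bot k) a a Q = 1%:M.
  apply/matrixP => j l; rewrite [LHS]mxE [Q j l]mxE.
  have := (gP (a j)).2 => /matrixP/(_ j l); rewrite mxE => ->; rewrite !mxE.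
  have [->|_] := eqVneq j l; last by rewrite !mulr0n.
  rewrite mulr1n big_seq big1 // => c'; rewrite mem_rem_uniq ?undup_uniq // inE => /andP[ne _].
  by rewrite -rmorphB mulVf // fmorph_eq0 subr_eq0 eq_sym.
have dQ : \det Q = 1.
  have [d1 d2] := det_gr sB gQ; rewrite bQ det1 a0 subrr in d1 d2.
  have b0 : bot (\det Q) 0 = (\det Q)`_0 by rewrite /bot eqxx.
  by rewrite (degle_const d1) -b0 d2.
have QA : Q *m A = diag_mx (\row_i (h (a i))%:P) *m Q.
  apply/row_matrixP => j; rewrite !row_mul row_diag_mx mxE.
  have -> : row j Q = row j (horner_mx A (P (a j))) by apply/rowP => l; rewrite !mxE.
  rewrite -scalemxAl -rowE; apply/eqP; rewrite -subr_eq0 -row_mul.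
  have -> : (h (a j))%:P *: row j Q = row j (horner_mx A (P (a j)) *m ((h (a j))%:P)%:M).
    by rewrite mul_mx_scalar; apply/rowP => l; rewrite !mxE.
  rewrite -linearB /= -mulmxBr -F.
  have -> : horner_mx A (P (a j)) *m horner_mx A (X (a j)) =
     horner_mx A ((\prod_(c' <- rem (a j) vals) ((h (a j - c'))^-1%:P)%:P) * \prod_(c <- vals) X c).
    rewrite -[_ *m _]/(_ * _) -rmorphM /P big_split /= -mulrA [_ * X (a j)]mulrC.
    by rewrite (perm_big _ (perm_to_rem (inv j))) big_cons.
  by rewrite rmorphM /= kills mulr0 linear0 eqxx.
pose Q' := \adj Q.
have QQ' : Q *m Q' = 1%:M by rewrite mul_mx_adj dQ.
have gQ' : grM a a Q' by apply: adj_gr.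
exists Q, Q'; split=> // i j l.
have gx' := grS_chg gQ gQ' gx.
have dD' : derivation (chg Q Q' x) (diag_mx (\row_i (h (a i))%:P)).
  have -> : diag_mx (\row_i (h (a i))%:P) = adv (chg Q Q' x) (h1 *m Q').
    by rewrite adv_chg -[h1 *m Q' *m Q]mulmxA (mulmx1C QQ') mulmx1 -/A QA -mulmxA QQ' mulmx1.
  by apply: derivation_adv; apply: lie_chg.
have /derivation_diag/(_ i j l) := dD'.
set z := chg Q Q' x i j l => ez.
have : z * ((h (a l - (a i + a j)))%:P) = 0.
  by rewrite !(rmorphB, rmorphD) /= mulrBr ez; ring.
move/eqP; rewrite mulf_eq0 => /orP[/eqP ->|]; first by rewrite size_poly0.
rewrite polyC_eq0 fmorph_eq0 subr_eq0 => /eqP e.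
have := gx' i j l; rewrite -/z e subrr => /degle_const ->.
exact: size_polyC_leq1.
Qed.
End Constant.

Theorem lie_poly_constant (k : fieldType) (K : closedFieldType) (iota : {rmorphism k -> K}) m
    (x : 'I_m -> 'M[{poly k}]_m) : [pchar k] =i pred0 -> lie x -> unimodular x ->
  exists Q Q', Q *m Q' = 1%:M /\ forall i j l, (size (chg Q Q' x i j l) <= 1)%N.
Proof.
move=> ch0 lx ux; have [Q1 [Q1' [a [QQ1 g1 s1]]]] := weight_zero iota ch0 lx ux.
have [Q2 [Q2' [QQ2 h]]] :=
  weight_zero_constant ch0 (lie_chg QQ1 lx) (unimodular_chg QQ1 ux) g1 s1.
exists (Q2 *m Q1), (Q1' *m Q2'); split; last by move=> i j l; rewrite -chg_comp.
by rewrite mulmxA -[Q2 *m Q1 *m Q1']mulmxA QQ1 mulmx1.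
Qed.

(** * Formal power series and linear differential equations *)

Record fps (R : comNzRingType) := Fps { fcoef : nat -> R }.
HB.instance Definition _ R := gen_eqMixin (fps R).
HB.instance Definition _ R := gen_choiceMixin (fps R).

Section PowerSeries.
Variable R : comNzRingType.
Implicit Types (f g h : fps R) (p q : {poly R}).
Local Notation "f `[ i ]" := (fcoef f i) (at level 2, format "f `[ i ]").

Lemma fpsP f g : (forall i, f`[i] = g`[i]) -> f = g.
Proof. by case: f => f; case: g => g /= h; congr Fps; apply/funext. Qed.

Definition fadd f g := Fps (fun i => f`[i] + g`[i]).
Definition fopp f := Fps (fun i => - f`[i]).
Definition fzero : fps R := Fps (fun=> 0).
Definition fone : fps R := Fps (fun i => (i == 0%N)%:R).
Definition fmul f g := Fps (fun n => \sum_(i < n.+1) f`[i] * g`[n - i]).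

(** Identities of power series up to order n are read off these polynomials, which is how the ring
    laws are proved. *)
Definition ftrunc n f : {poly R} := \poly_(i < n.+1) f`[i].

Lemma coef_ftrunc n f i : (i <= n)%N -> (ftrunc n f)`_i = f`[i].
Proof. by move=> h; rewrite coef_poly ltnS h. Qed.

Lemma coefM_eq p p' q q' n : (forall i, (i <= n)%N -> p`_i = p'`_i) ->
  (forall i, (i <= n)%N -> q`_i = q'`_i) -> (p * q)`_n = (p' * q')`_n.
Proof.
move=> hp hq; rewrite !coefM; apply: eq_bigr => i _.
by rewrite hp ?hq ?leq_subr // -ltnS.
Qed.

Lemma fmulE n i f g : (i <= n)%N -> (fmul f g)`[i] = (ftrunc n f * ftrunc n g)`_i.
Proof.
move=> le; rewrite coefM; apply: eq_bigr => j _.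
rewrite !coef_ftrunc //; first by apply: leq_trans le; rewrite leq_subr.
by apply: leq_trans le; rewrite -ltnS.
Qed.

Fact faddA : associative fadd. Proof. by move=> f g h; apply: fpsP => i /=; rewrite addrA. Qed.
Fact faddC : commutative fadd. Proof. by move=> f g; apply: fpsP => i /=; rewrite addrC. Qed.
Fact fadd0 : left_id fzero fadd. Proof. by move=> f; apply: fpsP => i /=; rewrite add0r. Qed.
Fact faddN : left_inverse fzero fopp fadd.
Proof. by move=> f; apply: fpsP => i /=; rewrite addNr. Qed.
HB.instance Definition _ := GRing.isZmodule.Build (fps R) faddA faddC fadd0 faddN.

Fact fmulA : associative fmul.
Proof.
move=> f g h; apply: fpsP => n; rewrite !(fmulE (n := n)) //.
transitivity (ftrunc n f * (ftrunc n g * ftrunc n h))`_n.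
  by apply: coefM_eq => // i le; rewrite coef_ftrunc // (fmulE (n := n)).
rewrite mulrA; apply: coefM_eq => // i le; rewrite coef_ftrunc // (fmulE (n := n)) //.
Qed.

Fact fmulC : commutative fmul.
Proof. by move=> f g; apply: fpsP => n; rewrite !(fmulE (n := n)) // mulrC. Qed.

Fact fmul1 : left_id fone fmul.
Proof.
move=> f; apply: fpsP => n /=; rewrite big_ord_recl subn0 mul1r big1 ?addr0 //.
by move=> i _; rewrite mul0r.
Qed.

Fact fmulDl : left_distributive fmul fadd.
Proof.
move=> f g h; apply: fpsP => n /=; rewrite -big_split; apply: eq_bigr => i _.
by rewrite mulrDl.
Qed.

Fact fone_neq0 : fone != 0.
Proof. by apply/eqP => /(congr1 (fun f => f`[0])) /= /eqP; rewrite oner_eq0. Qed.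

HB.instance Definition _ := GRing.Zmodule_isComNzRing.Build (fps R) fmulA fmulC fmul1 fmulDl fone_neq0.

Lemma fcoefD f g i : (f + g)`[i] = f`[i] + g`[i]. Proof. by []. Qed.
Lemma fcoef0 i : (0 : fps R)`[i] = 0. Proof. by []. Qed.
Lemma fcoefM f g n : (f * g)`[n] = \sum_(i < n.+1) f`[i] * g`[n - i]. Proof. by []. Qed.
Lemma fcoef_sum (I : Type) (r : seq I) (P : pred I) (F : I -> fps R) i :
  (\sum_(j <- r | P j) F j)`[i] = \sum_(j <- r | P j) (F j)`[i].
Proof. by apply: (big_morph (fun f => f`[i])). Qed.
Lemma fcoef0M f g : (f * g)`[0] = f`[0] * g`[0].
Proof. by rewrite fcoefM big_ord_recl big_ord0 addr0. Qed.

Definition pfps p : fps R := Fps (fun i => p`_i).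

Fact pfps_zmod : zmod_morphism pfps.
Proof. by move=> p q; apply: fpsP => i /=; rewrite coefB. Qed.
Fact pfps_monoid : monoid_morphism pfps.
Proof.
by split=> [|p q]; apply: fpsP => i /=; rewrite ?coef1 // coefM.
Qed.
HB.instance Definition _ := GRing.isZmodMorphism.Build {poly R} (fps R) pfps pfps_zmod.
HB.instance Definition _ := GRing.isMonoidMorphism.Build {poly R} (fps R) pfps pfps_monoid.

Lemma pfps_inj : injective pfps.
Proof. by move=> p q e; apply/polyP => i; rewrite -[p`_i]/((pfps p)`[i]) e. Qed.

Definition fderiv f := Fps (fun i => f`[i.+1] *+ i.+1).

Fact fderiv_zmod : zmod_morphism fderiv.
Proof. by move=> f g; apply: fpsP => i; exact: mulrnBl. Qed.
HB.instance Definition _ := GRing.isZmodMorphism.Build (fps R) (fps R) fderiv fderiv_zmod.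

Lemma fderivM f g : fderiv (f * g) = fderiv f * g + f * fderiv g.
Proof.
apply: fpsP => n.
transitivity ((fmul f g)`[n.+1] *+ n.+1); first by [].
transitivity ((fmul (fderiv f) g)`[n] + (fmul f (fderiv g))`[n]); last by [].
rewrite (fmulE (n := n.+1)) // -coef_deriv derivM coefD !(fmulE (n := n)) //.
congr (_ + _); apply: coefM_eq => i le.
- by rewrite coef_deriv !coef_ftrunc.
- by rewrite !coef_ftrunc // ltnW.
- by rewrite !coef_ftrunc // ltnW.
- by rewrite coef_deriv !coef_ftrunc.
Qed.

Lemma fderiv_pfps p : fderiv (pfps p) = pfps p^`().
Proof. by apply: fpsP => i /=; rewrite coef_deriv. Qed.

End PowerSeries.

Definition fmap_fps (R S : comNzRingType) (phi : {rmorphism R -> S}) (f : fps R) : fps S :=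
  Fps (fun i => phi (fcoef f i)).

Section FMap.
Variables (R S : comNzRingType) (phi : {rmorphism R -> S}).
Fact fmap_fps_zmod : zmod_morphism (fmap_fps phi).
Proof. by move=> f g; apply: fpsP => i /=; rewrite rmorphB. Qed.
Fact fmap_fps_monoid : monoid_morphism (fmap_fps phi).
Proof.
split=> [|f g]; apply: fpsP => i /=; first by rewrite rmorph_nat.
by rewrite rmorph_sum; apply: eq_bigr => j _; rewrite rmorphM.
Qed.
HB.instance Definition _ := GRing.isZmodMorphism.Build (fps R) (fps S) (fmap_fps phi) fmap_fps_zmod.
HB.instance Definition _ := GRing.isMonoidMorphism.Build (fps R) (fps S) (fmap_fps phi) fmap_fps_monoid.
Lemma fmap_fps_pfps p : fmap_fps phi (pfps p) = pfps (map_poly phi p).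
Proof. by apply: fpsP => i /=; rewrite coef_map. Qed.
Lemma fmap_fps_deriv f : fmap_fps phi (fderiv f) = fderiv (fmap_fps phi f).
Proof. by apply: fpsP => i /=; rewrite rmorphMn. Qed.
End FMap.

Section ODE.
Variable k : fieldType.
Hypothesis ch0 : [pchar k] =i pred0.

Lemma natSn0 i : i.+1%:R != 0 :> k.
Proof. by rewrite (pcharf0P k).1. Qed.

Lemma pfps_reg (p : {poly k}) (f : fps k) : p != 0 -> pfps p * f = 0 -> f = 0.
Proof.
move=> p0 pf0.
have [d hd mind] : exists2 d, p`_d != 0 & forall i, (i < d)%N -> p`_i = 0.
  have ex : exists i, p`_i != 0.
    by exists (size p).-1; rewrite -lead_coefE lead_coef_eq0.
  case: (ex_minnP ex) => d hd mind; exists d => // i ltd; apply/eqP; apply: contraTT ltd.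
  by move/mind; rewrite -leqNgt.
apply: fpsP => n; rewrite fcoef0; elim/ltn_ind: n => n IH.
have := congr1 (fun f => fcoef f (d + n)%N) pf0; rewrite fcoefM fcoef0.
have lt : (d < (d + n).+1)%N by rewrite ltnS leq_addr.
rewrite (bigD1 (Ordinal lt)) //= addKn big1 ?addr0; first by move/eqP; rewrite mulf_eq0 (negPf hd) => /eqP.
move=> i ne; have [ltd|ged] := ltnP i d; first by rewrite mind ?mul0r.
have gtd : (d < i)%N by rewrite ltn_neqAle ged andbT eq_sym; move: ne; rewrite -val_eqE.
by rewrite IH ?mulr0 //; move: gtd (ltn_ord i); lia.
Qed.

Lemma fderiv_eq0 (f : fps k) : fderiv f = 0 -> f = pfps (fcoef f 0)%:P.
Proof.
move=> h; apply: fpsP => -[|i] /=; rewrite coefC //=.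
have := congr1 (fun f => fcoef f i) h; rewrite /= -mulr_natr => /eqP.
by rewrite mulf_eq0 (negPf (natSn0 i)) orbF => /eqP.
Qed.

Lemma ode_unique n l (Y : 'M[fps k]_n) (M : 'M[fps k]_(n, l)) :
  map_mx (@fderiv k) M = Y *m M -> (forall i j, fcoef (M i j) 0 = 0) -> M = 0.
Proof.
move=> h M0.
suff H N i j : fcoef (M i j) N = 0.
  by apply/matrixP => i j; apply: fpsP => N; rewrite H mxE.
elim/ltn_ind: N i j => -[|N] IH i j //.
have /matrixP/(_ i j) := h; rewrite !mxE => /(congr1 (fun f => fcoef f N)).
rewrite fcoef_sum big1 => [|p _]; last first.
  by rewrite fcoefM big1 // => q _; rewrite IH ?mulr0 // ltnS leq_subr.
by move/eqP; rewrite /= -mulr_natr mulf_eq0 (negPf (natSn0 N)) orbF => /eqP.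
Qed.

Lemma ode_exists n (Y : 'M[fps k]_n) :
  exists M : 'M[fps k]_n, map_mx (@fderiv k) M = Y *m M /\
    forall i j, fcoef (M i j) 0 = (i == j)%:R.
Proof.
pose Yc p : 'M[k]_n := \matrix_(i, j) fcoef (Y i j) p.
(* [G N] is the table of coefficients up to order N: a new coefficient needs all the earlier ones,
   and later tables leave old entries unchanged. *)
pose fix G N : nat -> 'M[k]_n := if N is N'.+1 then
  fun i => if i == N then (N%:R)^-1 *: \sum_(j < N) Yc j *m G N' (N' - j)%N else G N' i
  else fun=> 1%:M.
have Gst N d i : (i <= N)%N -> G (d + N)%N i = G N i.
  by elim: d => //= d IH le; rewrite ltn_eqF ?IH // ltnS (leq_trans le) ?leq_addl.
have Gst' N i : (i <= N)%N -> G N i = G i i.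
  by move=> le; rewrite -(subnK le) Gst.
exists (\matrix_(i, j) Fps (fun N => G N N i j)); split; last by move=> i j; rewrite mxE /= mxE.
apply/matrixP => i j; rewrite !mxE; apply: fpsP => N /=; rewrite eqxx.
rewrite mxE -mulrnAl -[X in X * _]mulr_natr mulVf ?natSn0 // mul1r summxE fcoef_sum.
under [RHS]eq_bigr => p _ do rewrite mxE fcoefM /=.
rewrite exchange_big; apply: eq_bigr => p _; rewrite mxE; apply: eq_bigr => q _.
by rewrite mxE Gst' ?leq_subr.
Qed.

End ODE.

Section DerivDet.
Variables (R : comNzRingType) (d : R -> R).
Hypothesis dD : {morph d : x y / x + y}.
Hypothesis dM : forall x y, d (x * y) = d x * y + x * d y.

Let d0 : d 0 = 0. Proof. by apply: (@addrI _ (d 0)); rewrite -dD !addr0. Qed.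
Let d1 : d 1 = 0.
Proof. by apply: (@addrI _ (d 1)); rewrite addr0 -[in RHS](mulr1 1) dM mulr1 mul1r. Qed.
Let dN x : d (- x) = - d x.
Proof. by apply/eqP; rewrite -addr_eq0 addrC -dD subrr d0. Qed.

Lemma deriv_prod (I : eqType) (r : seq I) (F : I -> R) : uniq r ->
  d (\prod_(i <- r) F i) = \sum_(i <- r) \prod_(p <- r) (if p == i then d (F p) else F p).
Proof.
elim: r => [|i r IH] /=; first by rewrite !big_nil d1.
case/andP=> ir ur; rewrite !big_cons dM eqxx IH //; congr (_ + _).
  congr (_ * _); rewrite !big_seq; apply: eq_bigr => p pr.
  by case: eqP => // e; move: ir; rewrite -e pr.
rewrite mulr_sumr !big_seq; apply: eq_bigr => j jr.
by rewrite big_cons; case: eqP => // e; move: ir; rewrite e jr.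
Qed.

(** Jacobi's formula: by the Leibniz rule the rows are differentiated one at a time. *)
Lemma deriv_det n (M : 'M[R]_n) : d (\det M) = \tr (map_mx d M *m \adj M).
Proof.
pose N i : 'M[R]_n := \matrix_(p, q) if p == i then d (M p q) else M p q.
transitivity (\sum_i \det (N i)).
  rewrite /determinant (big_morph d dD d0) exchange_big; apply: eq_bigr => s _.
  have ds x : d ((-1) ^+ s * x) = (-1) ^+ s * d x.
    by case: (s : bool); rewrite ?expr0 ?expr1 ?mul1r ?mulN1r ?dN.
  rewrite ds deriv_prod ?index_enum_uniq // mulr_sumr; apply: eq_bigr => i _.
  by congr (_ * _); apply: eq_bigr => p _; rewrite mxE.
apply: eq_bigr => i _; rewrite (expand_det_row _ i) [RHS]mxE; apply: eq_bigr => j _.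
rewrite !mxE eqxx; congr (_ * _); rewrite /cofactor; congr (_ * \det _).
by apply/matrixP => p q; rewrite !mxE eq_sym (negPf (neq_lift _ _)).
Qed.
End DerivDet.

Section Matrices.
Variable K : fieldType.
Hypothesis ch0 : [pchar K] =i pred0.

Local Notation S := (map_mx (@pfps K)).
Local Notation C := (map_mx (@polyC K)).
Local Notation D := (map_mx (@fderiv K)).

Lemma DM n l o (A : 'M[fps K]_(n, l)) (B : 'M[fps K]_(l, o)) : D (A *m B) = D A *m B + A *m D B.
Proof.
apply/matrixP => i j; rewrite !mxE raddf_sum -big_split; apply: eq_bigr => p _ /=.
by rewrite !mxE fderivM.
Qed.

Lemma DS n l (A : 'M[{poly K}]_(n, l)) : D (S A) = S (map_mx (@deriv K) A).
Proof. by apply/matrixP => i j; rewrite !mxE fderiv_pfps. Qed.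

Lemma DSC n l (A : 'M[K]_(n, l)) : D (S (C A)) = 0.
Proof. by rewrite DS; apply/matrixP => i j; rewrite !mxE derivC rmorph0. Qed.

Definition integ (p : {poly K}) : {poly K} :=
  \poly_(i < (size p).+1) (if i is i'.+1 then p`_i' / i%:R else 0).

Lemma deriv_integ p : (integ p)^`() = p.
Proof.
apply/polyP => i; rewrite coef_deriv coef_poly; case: ifP => [_|/negbT].
  by rewrite -mulrnAr -[X in _ * X]mulr_natr mulVf ?mulr1 ?natSn0.
by rewrite ltnS -leqNgt => h; rewrite mul0rn nth_default.
Qed.

(** The inverse is part of the notion because the off-diagonal block of a reducible system is
    integrated after multiplication by it. *)
Definition polynomial_unit n (g : 'M[fps K]_n) :=
  exists h h' : 'M[{poly K}]_n, g = S h /\ h *m h' = 1%:M.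

Section System.
Variables (m : nat) (Phi c : 'I_m -> 'I_m -> {poly K}).

Definition esys n (b : 'I_m -> 'M[K]_n) j := \sum_i Phi i j *: C (b i).
Definition Ysys n (b : 'I_m -> 'M[K]_n) :=
  \sum_i \sum_j c i j *: C (b i *m b j - b j *m b i).

(** g conjugates the constant representation b into its twist by [Phi] and solves the equation with
    coefficient Y. Since [Phi] and [c] involve neither n nor b, the same system holds on
    subrepresentations and quotients; writing Y by brackets makes its trace zero on each. *)
Definition solves n (b : 'I_m -> 'M[K]_n) (g : 'M[fps K]_n) :=
  [/\ D g = S (Ysys b) *m g, forall i j, fcoef (g i j) 0 = (i == j)%:R &
      forall j, S (esys b j) *m g = g *m S (C (b j))].

Lemma trY n (b : 'I_m -> 'M[K]_n) : \tr (Ysys b) = 0.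
Proof.
rewrite raddf_sum big1 // => i _; rewrite raddf_sum big1 // => j _.
by rewrite /= mxtraceZ trace_map_mx raddfB /= mxtrace_mulC subrr rmorph0 mulr0.
Qed.

Lemma solves_conj n (b : 'I_m -> 'M[K]_n) g (P P' : 'M[K]_n) : P *m P' = 1%:M -> solves b g ->
  solves (fun i => P *m b i *m P') (S (C P) *m g *m S (C P')).
Proof.
move=> PP' [h1 h2 h3]; have P'P := mulmx1C PP'.
have SC (A B : 'M[K]_n) : S (C (A *m B)) = S (C A) *m S (C B) :> 'M[fps K]_n by rewrite !map_mxM.
have SPP : S (C P') *m S (C P) = 1%:M by rewrite -SC P'P !map_mx1.
have eY : Ysys (fun i => P *m b i *m P') = C P *m Ysys b *m C P'.
  rewrite /Ysys mulmx_sumr mulmx_suml; apply: eq_bigr => i _.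
  rewrite mulmx_sumr mulmx_suml; apply: eq_bigr => j _.
  rewrite -scalemxAr -scalemxAl -!map_mxM; congr (_ *: map_mx _ _).
  by rewrite mulmxBr mulmxBl !mulmxA -![_ *m P' *m P]mulmxA P'P !mulmx1.
have ee j : esys (fun i => P *m b i *m P') j = C P *m esys b j *m C P'.
  rewrite /esys mulmx_sumr mulmx_suml; apply: eq_bigr => i _.
  by rewrite -scalemxAr -scalemxAl -!map_mxM.
split=> [|i j|j].
- rewrite !DM !DSC mul0mx mulmx0 add0r addr0 h1 eY !map_mxM.
  by rewrite !mulmxA -[_ *m S (C P') *m S (C P)]mulmxA SPP mulmx1.
- rewrite mxE fcoef_sum -[RHS](_ : (P *m P') i j = _); last by rewrite PP' mxE.
  have f0 (A : 'M[K]_n) p q : fcoef (S (C A) p q) 0 = A p q by rewrite !mxE /= coefC.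
  rewrite mxE; apply: eq_bigr => l _; rewrite fcoef0M f0; congr (_ * _).
  rewrite mxE fcoef_sum (bigD1 l) // fcoef0M f0 h2 eqxx mulr1 big1 => [|p pl]; first exact: addr0.
  by rewrite fcoef0M h2 (negPf pl) mulr0.
- rewrite ee !map_mxM !mulmxA -[_ *m S (C P') *m S (C P)]mulmxA SPP mulmx1.
  by rewrite -[_ *m S (esys b j) *m g]mulmxA h3 -[_ *m S (C P') *m S (C P)]mulmxA SPP mulmx1 !mulmxA.
Qed.

Lemma polynomial_unit_conj n (g : 'M[fps K]_n) (P P' : 'M[K]_n) : P *m P' = 1%:M ->
  polynomial_unit (S (C P) *m g *m S (C P')) -> polynomial_unit g.
Proof.
move=> PP' [h [h' [e hh']]]; have P'P := mulmx1C PP'.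
have CPP : C P *m C P' = 1%:M by rewrite -map_mxM PP' map_mx1.
have CPP' : C P' *m C P = 1%:M by rewrite -map_mxM P'P map_mx1.
exists (C P' *m h *m C P), (C P' *m h' *m C P); split.
  rewrite !map_mxM -e !mulmxA -map_mxM CPP' map_mx1 mul1mx -mulmxA.
  by rewrite -map_mxM CPP' map_mx1 mulmx1.
by rewrite !mulmxA -[_ *m C P *m C P']mulmxA CPP mulmx1 -[_ *m h *m h']mulmxA hh' mulmx1 CPP'.
Qed.

Section Triangular.
Variables (r s : nat) (b1 : 'I_m -> 'M[K]_r) (b2 : 'I_m -> 'M[K]_(s, r)) (b3 : 'I_m -> 'M[K]_s).
Let b i : 'M[K]_(r + s) := block_mx (b1 i) 0 (b2 i) (b3 i).

(** One corner of g vanishes by uniqueness, and the diagonal blocks solve the systems of [b1] and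
    [b3]. The remaining block follows by variation of constants, since a polynomial has a polynomial
    antiderivative. *)
Lemma triangular_poly (g : 'M[fps K]_(r + s)) : solves b g ->
  (forall g1, solves b1 g1 -> polynomial_unit g1) ->
  (forall g3, solves b3 g3 -> polynomial_unit g3) -> polynomial_unit g.
Proof.
move=> [h1 h2 h3] IH1 IH3.
have subs p q (f : 'I_p -> 'I_(r + s)) (h : 'I_q -> 'I_(r + s)) (F : 'I_m -> 'M[{poly K}]_(r + s)) :
    mxsub f h (\sum_i F i) = \sum_i mxsub f h (F i).
  by apply/matrixP => i j; rewrite !(mxE, summxE); apply: eq_bigr => l _; rewrite mxE.
have eY : Ysys b = block_mx (Ysys b1) 0 (dlsubmx (Ysys b)) (Ysys b3).
  have subY p q (f : 'I_p -> 'I_(r + s)) (h : 'I_q -> 'I_(r + s)) : mxsub f h (Ysys b) =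
      \sum_i \sum_j c i j *: C (mxsub f h (b i *m b j - b j *m b i)).
    rewrite /Ysys subs; apply: eq_bigr => i _; rewrite subs; apply: eq_bigr => j _.
    by apply/matrixP => a d; rewrite !mxE.
  have bb i j : b i *m b j - b j *m b i = block_mx (b1 i *m b1 j - b1 j *m b1 i) 0
      (b2 i *m b1 j + b3 i *m b2 j - (b2 j *m b1 i + b3 j *m b2 i)) (b3 i *m b3 j - b3 j *m b3 i).
    rewrite !mulmx_block opp_block_mx add_block_mx; congr block_mx.
    - by rewrite !mul0mx !addr0.
    - by rewrite !mulmx0 !mul0mx !addr0 subrr.
    - by rewrite !mulmx0 !add0r.
  rewrite -[LHS]submxK; congr block_mx.
  - rewrite ulsubmxEsub subY; apply: eq_bigr => i _; apply: eq_bigr => j _.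
    by rewrite -ulsubmxEsub bb block_mxKul.
  - rewrite ursubmxEsub subY big1 // => i _; rewrite big1 // => j _.
    by rewrite -ursubmxEsub bb block_mxKur map_mx0 scaler0.
  - rewrite drsubmxEsub subY; apply: eq_bigr => i _; apply: eq_bigr => j _.
    by rewrite -drsubmxEsub bb block_mxKdr.
have ee j : esys b j = block_mx (esys b1 j) 0 (dlsubmx (esys b j)) (esys b3 j).
  have sube p q (f : 'I_p -> 'I_(r + s)) (h : 'I_q -> 'I_(r + s)) : mxsub f h (esys b j) =
      \sum_i Phi i j *: C (mxsub f h (b i)).
    rewrite /esys subs; apply: eq_bigr => i _.
    by apply/matrixP => a d; rewrite !mxE.
  rewrite -[LHS]submxK; congr block_mx.
  - by rewrite ulsubmxEsub sube; apply: eq_bigr => i _; rewrite -ulsubmxEsub block_mxKul.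
  - by rewrite ursubmxEsub sube big1 // => i _; rewrite -ursubmxEsub block_mxKur map_mx0 scaler0.
  - by rewrite drsubmxEsub sube; apply: eq_bigr => i _; rewrite -drsubmxEsub block_mxKdr.
set Y2 := dlsubmx (Ysys b) in eY.
pose g1 := ulsubmx g; pose u := ursubmx g; pose g2 := dlsubmx g; pose g3 := drsubmx g.
have eg : g = block_mx g1 u g2 g3 by rewrite submxK.
have S0 q t : S (0 : 'M_(q, t)) = 0 by apply/matrixP => i j; rewrite !mxE rmorph0.
move: h1; rewrite eY {1 2}eg map_block_mx map_block_mx S0 mulmx_block.
case/eq_block_mx => e1 e2 e3 e4; rewrite !mul0mx !addr0 in e1 e2.
have u0 : u = 0.
  apply: (ode_unique ch0 e2) => i j; rewrite mxE mxE h2.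
  by rewrite (_ : (_ == _) = false) // eq_lrshift.
have [|f1 [f1' [eg1 ff1]]] := IH1 g1.
  split=> // [i j|j].
    by rewrite !mxE h2 eq_lshift.
  have := h3 j; rewrite ee {1 2}eg !map_block_mx !S0 !mulmx_block u0.
  by case/eq_block_mx => + _ _ _; rewrite !mul0mx !addr0.
have [|f3 [f3' [eg3 ff3]]] := IH3 g3.
  split=> // [|i j|j].
  - by rewrite e4 u0 mulmx0 add0r.
  - by rewrite !mxE h2 eq_rshift.
  have := h3 j; rewrite ee {1 2}eg !map_block_mx !S0 !mulmx_block u0.
  by case/eq_block_mx => _ _ _; rewrite map_mx0 S0 !mulmx0 !add0r.
have ff3' := mulmx1C ff3.
(* Variation of constants: the derivative of w is the polynomial matrix f3' Y2 f1. *)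
pose w := S f3' *m g2.
have ew : g2 = S f3 *m w by rewrite /w mulmxA -map_mxM ff3 map_mx1 mul1mx.
have Dw : D w = S (f3' *m Y2 *m f1).
  have : D g2 = D (S f3) *m w + S f3 *m D w by rewrite {1}ew DM.
  have -> : D (S f3) = S (Ysys b3) *m S f3.
    by rewrite -eg3 e4 u0 mulmx0 add0r.
  rewrite -mulmxA -ew e3 addrC => /addrI e5.
  by rewrite !map_mxM -eg1 -mulmxA e5 mulmxA -map_mxM ff3' map_mx1 mul1mx.
pose J := map_mx integ (f3' *m Y2 *m f1).
have [W eW] : exists W : 'M[{poly K}]_(s, r), w = S W.
  exists (\matrix_(i, j) (J i j + (fcoef ((w - S J) i j) 0)%:P)).
  apply/matrixP => i j; have : fderiv ((w - S J) i j) = 0.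
    have -> : fderiv ((w - S J) i j) = (D w - D (S J)) i j by rewrite !mxE raddfB.
    rewrite Dw DS !mxE.
    by rewrite deriv_integ subrr.
  move/(fderiv_eq0 ch0) => e5; rewrite [RHS]mxE [X in pfps X]mxE rmorphD /= -e5.
  have e6 (A B : 'M[fps K]_(s, r)) : (A - B) i j = A i j - B i j by rewrite !mxE.
  by rewrite e6 [S J i j]mxE addrC subrK.
exists (block_mx f1 0 (f3 *m W) f3), (block_mx f1' 0 (- (W *m f1')) f3'); split.
  by rewrite map_block_mx S0 eg u0 eg1 eg3 ew eW map_mxM.
rewrite mulmx_block !mul0mx !mulmx0 !addr0 !add0r ff1 ff3 mulmxN mulmxA subrr.
by rewrite -scalar_mx_block.
Qed.

End Triangular.
End System.
End Matrices.

Lemma fraction_repr (R : idomainType) (x : {fraction R}) :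
  exists2 d : R, d != 0 & exists n, tofrac d * x = tofrac n.
Proof.
elim/quotW: x => x; exists \d_x; first exact: denom_ratioP.
exists \n_x; unlock FracField.tofrac; rewrite -[LHS]FracField.pi_mul.
apply/eqmodP; rewrite /= FracField.equivfE /FracField.mulf.
by rewrite !numden_Ratio ?mul1r ?oner_neq0 ?denom_ratioP // mulr1 mulrC.
Qed.

Lemma clear_denominators (R : idomainType) p q (M : 'M[{fraction R}]_(p, q)) :
  exists2 d : R, d != 0 & exists N : 'M[R]_(p, q), tofrac d *: M = map_mx (@tofrac R) N.
Proof.
have /fin_all_exists2[d d0 hd] : forall t : 'I_p * 'I_q, exists2 d : R, d != 0 &
    exists n, tofrac d * M t.1 t.2 = tofrac n by move=> t; apply: fraction_repr.
have /fin_all_exists[n hn] := hd.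
exists (\prod_t d t); first by rewrite prodf_seq_neq0; apply/allP => t _; apply: d0.
exists (\matrix_(i, j) (\prod_(t | t != (i, j)) d t * n (i, j))).
apply/matrixP => i j; rewrite !mxE rmorphM /= -(hn (i, j)) /= (bigD1 (i, j)) //= rmorphM /=.
by rewrite mulrA; congr (_ * _); rewrite mulrC.
Qed.

Section Linear.
Variable K : fieldType.
Local Notation S := (map_mx (@pfps K)).
Local Notation T := (map_mx (@tofrac {poly K})).

(** If A has full row rank over K(t), a nonzero polynomial multiple of v vanishes, which excludes v
    != 0. Otherwise A has a kernel over K(t), and denominators can be cleared. *)
Lemma polynomial_solution p N (A : 'M[{poly K}]_(p, N)) (v : 'rV[fps K]_p) :
  v != 0 -> v *m S A = 0 -> exists2 w : 'rV[{poly K}]_p, w != 0 & w *m A = 0.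
Proof.
move=> v0 vA.
have Tinj n m : injective (T : 'M_(n, m) -> _).
  move=> M1 M2 /matrixP e; apply/matrixP => i j; have := e i j; rewrite !mxE => /eqP.
  by rewrite tofrac_eq => /eqP.
have [k0|] := eqVneq (kermx (T A)) 0.
  have fr : row_free (T A) by rewrite -kermx_eq0 k0.
  have [d d0 [B eB]] := clear_denominators (pinvmx (T A)).
  have AB : A *m B = d%:M.
    by apply: Tinj; rewrite map_mxM -eB -scalemxAr mulmxVp // map_scalar_mx scalemx1.
  case/eqP: v0; apply/rowP => i; rewrite mxE; apply: (pfps_reg d0).
  have : v *m S A *m S B = 0 by rewrite vA mul0mx.
  rewrite -mulmxA -map_mxM AB map_scalar_mx mul_mx_scalar => /rowP/(_ i).
  by rewrite !mxE.
case/rowV0Pn => u /sub_kermxP uA u0.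
have [d d0 [w ew]] := clear_denominators u; exists w.
  apply: contraNneq u0 => w0; move: ew; rewrite w0 map_mx0 => /eqP.
  by rewrite scaler_eq0 tofrac_eq0 (negPf d0).
by apply: Tinj; rewrite map_mxM -ew -scalemxAl uA scaler0 map_mx0.
Qed.

Lemma polynomial_intertwiner n m (E B : 'I_m -> 'M[{poly K}]_n) (g : 'M[fps K]_n) :
  g != 0 -> (forall j, S (E j) *m g = g *m S (B j)) ->
  exists2 h : 'M[{poly K}]_n, h != 0 & forall j, E j *m h = h *m B j.
Proof.
move=> g0 hg.
pose A := \mxrow_(j < m) (lin_mulmx (E j) - lin_mulmxr (B j)).
have SA : S A = \mxrow_(j < m) (lin_mulmx (S (E j)) - lin_mulmxr (S (B j))).
  apply/mxrowP => j; rewrite mxrowK.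
  have -> : submxrow (S A) j = S (submxrow A j) by apply/matrixP => a b; rewrite !mxE.
  rewrite mxrowK map_mxB; congr (_ - _).
    by apply: map_lin_mx => M; rewrite map_mxM.
  by apply: map_lin_mx => M; rewrite /mulmxr map_mxM.
have eA (R : comNzRingType) (E' B' : 'I_m -> 'M[R]_n) M :
    mxvec M *m \mxrow_(j < m) (lin_mulmx (E' j) - lin_mulmxr (B' j)) =
    \mxrow_(j < m) (mxvec (E' j *m M - M *m B' j)).
  rewrite mul_mxrow; apply: eq_mxrow => j.
  by rewrite mulmxBr !mul_vec_lin /= linearB.
have [||w w0 wA] := @polynomial_solution _ _ A (mxvec g).
- by rewrite mxvec_eq0.
- rewrite SA eA -[RHS](mxrow0 (q_ := fun=> (n * n)%N)); apply: eq_mxrow => j.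
  by rewrite hg subrr linear0.
exists (vec_mx w); first by rewrite vec_mx_eq0.
move=> j; apply/eqP; rewrite -subr_eq0 -mxvec_eq0; apply/eqP.
move: wA; rewrite -{1}[w]vec_mxK eA -[RHS](mxrow0 (q_ := fun=> (n * n)%N)).
by move/eq_mxrowP/(_ j).
Qed.

End Linear.

Section Irreducible.
Variable K : closedFieldType.
Hypothesis ch0 : [pchar K] =i pred0.
Local Notation S := (map_mx (@pfps K)).
Local Notation C := (map_mx (@polyC K)).
Local Notation D := (map_mx (@fderiv K)).
Variables (m : nat) (Phi c : 'I_m -> 'I_m -> {poly K}).

(** A common zero of all entries is divided out; the total size of the entries bounds the number of
    divisions. *)
Lemma nonvanishing_intertwiner n (E B : 'I_m -> 'M[{poly K}]_n) (h : 'M[{poly K}]_n) :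
  h != 0 -> (forall j, E j *m h = h *m B j) ->
  exists h' : 'M[{poly K}]_n, (forall t, map_mx (horner_eval t) h' != 0) /\
    (forall j, E j *m h' = h' *m B j).
Proof.
have [N] := ubnP (\sum_i \sum_j size (h i j)); elim: N h => // N IH h ltN h0 hE.
have [[t /eqP ht]|none] := pselect (exists t, map_mx (horner_eval t) h == 0); last first.
  by exists h; split=> // t; apply/negP => ht; apply: none; exists t.
have div i j : {q | h i j == q * ('X - t%:P)}.
  apply: sigW; have : root (h i j) t.
    by have /matrixP/(_ i j) := ht; rewrite !mxE /root /horner_eval => ->.
  by case/factor_theorem => q e; exists q; apply/eqP.
pose q := \matrix_(i, j) sval (div i j).
have eq : h = ('X - t%:P) *: q.
  apply/matrixP => i j; rewrite !mxE mulrC; exact/eqP/(svalP (div i j)).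
have X0 : 'X - t%:P != 0 by rewrite polyXsubC_eq0.
have q0 : q != 0 by apply: contraNneq h0 => q0; rewrite eq q0 scaler0.
have cancelX (M1 M2 : 'M[{poly K}]_n) : ('X - t%:P) *: M1 = ('X - t%:P) *: M2 -> M1 = M2.
  by move=> /matrixP e; apply/matrixP => i j; have := e i j; rewrite !mxE => /(mulfI X0).
apply: (IH q) => // [|j]; last by apply: cancelX; rewrite scalemxAr scalemxAl -eq.
have szq i j : (size (q i j) <= size (h i j) ?= iff (q i j == 0%R))%N.
  have -> : h i j = q i j * ('X - t%:P) by rewrite eq !mxE mulrC.
  have [->|qij0] := eqVneq (q i j) 0; first by rewrite mul0r size_poly0; split.
  by rewrite size_Mmonic ?monicXsubC // size_XsubC addn2 /=; split; rewrite ?leqnSn // ltn_eqF.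
have [i0 [j0 q00]] : exists i0 j0, q i0 j0 != 0.
  apply: contrapT => /forallNP hn; case/eqP: q0; apply/matrixP => i j; rewrite [RHS]mxE.
  by apply/eqP/negPn/negP => hq; apply: (hn i); exists j.
rewrite -ltnS; apply: leq_trans ltN; rewrite ltnS.
rewrite (bigD1 i0) //= [X in (_ < X)%N](bigD1 i0) //=.
rewrite (bigD1 j0) //= [X in (_ < X + _)%N](bigD1 j0) //= -!addnA -addSn; apply: leq_add.
  by have [le e] := szq i0 j0; rewrite ltn_neqAle le e q00.
apply: leq_add; first by apply: leq_sum => j _; case: (szq i0 j).
by apply: leq_sum => i _; apply: leq_sum => j _; case: (szq i j).
Qed.

Lemma fcoefMC (f : fps K) a N : fcoef (f * pfps a%:P) N = fcoef f N * a.
Proof.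
rewrite fcoefM big_ord_recr /= subnn coefC eqxx big1 ?add0r // => r _.
by rewrite coefC subn_eq0 leqNgt ltn_ord mulr0.
Qed.

(** Schur's lemma: an eigenspace of X is invariant, hence everything. *)
Lemma commutant_scalar n (b : 'I_m -> 'M[K]_n) (X : 'M[K]_n) : (0 < n)%N ->
  (forall U : 'M[K]_n, (forall j, (U *m b j <= U)%MS) -> U = 0 \/ row_full U) ->
  (forall j, X *m b j = b j *m X) -> exists a, X = a%:M.
Proof.
case: n b X => // n b X _ irr Xb.
have [a ra] : exists a, root (char_poly X) a.
  by apply/closed_rootP; rewrite size_char_poly.
exists a; have ev : eigenvalue X a by rewrite eigenvalue_root_char.
have [|k0|] := irr (kermx (X - a%:M)).
- move=> j; apply/sub_kermxP; rewrite -mulmxA.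
  have -> : b j *m (X - a%:M) = (X - a%:M) *m b j.
    by rewrite mulmxBr mulmxBl Xb scalar_mxC.
  by rewrite mulmxA mulmx_ker mul0mx.
- by move: ev; rewrite /eigenvalue /eigenspace k0 eqxx.
move=> full; apply/eqP; rewrite -subr_eq0; apply/eqP/row_matrixP => i; rewrite row0.
rewrite rowE; apply/sub_kermxP; exact: submx_full.
Qed.

(** For a polynomial intertwiner h that vanishes at no point, the row space of h(t) is invariant, so
    h(t) is always invertible and det h is constant. Then h^-1 g commutes with b, hence is a scalar
    series f, and traces in the equation for g give f' = 0. *)
Lemma irreducible_poly n (b : 'I_m -> 'M[K]_n) (g : 'M[fps K]_n) : (0 < n)%N ->
  (forall U : 'M[K]_n, (forall j, (U *m b j <= U)%MS) -> U = 0 \/ row_full U) ->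
  solves Phi c b g -> polynomial_unit g.
Proof.
move=> n0 irr [h1 h2 h3].
have i0 : 'I_n := Ordinal n0.
have g0 : g != 0.
  apply/eqP => g0; have := h2 i0 i0; rewrite g0 mxE eqxx fcoef0 => /eqP.
  by rewrite eq_sym oner_eq0.
have [h hn0 hE] := polynomial_intertwiner g0 h3.
have {h hn0 hE} [h [hnz hE]] := nonvanishing_intertwiner hn0 hE.
have ev0 (A : 'M[K]_n) t : map_mx (horner_eval t) (C A) = A.
  by apply/matrixP => i j; rewrite !mxE /horner_eval hornerC.
have uh t : map_mx (horner_eval t) h \in unitmx.
  have [|h0|] := irr (map_mx (horner_eval t) h).
  - move=> j; have := congr1 (map_mx (horner_eval t)) (hE j).
    by rewrite !map_mxM ev0 => <-; apply: submxMl.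
  - by have := hnz t; rewrite h0 eqxx.
  by rewrite row_full_unit.
have [d d0 ed] : exists2 d, d != 0 & \det h = d%:P.
  have : size (\det h) == 1%N.
    apply/negPn/negP => /closed_rootP[t]; rewrite /root => /eqP e.
    have h0 : horner_eval t (\det h) = 0 := e.
    by have := uh t; rewrite unitmxE det_map_mx (_ : _ (\det h) = 0) ?unitr0 // -[RHS]h0.
  by move/size_poly1P => [d d0 ->]; exists d.
pose h' := (d^-1%:P) *: \adj h.
have hh' : h *m h' = 1%:M.
  by rewrite /h' -scalemxAr mul_mx_adj ed scale_scalar_mx -polyCM mulVf.
have h'h := mulmx1C hh'.
pose X := S h' *m g.
have gX : g = S h *m X by rewrite mulmxA -map_mxM hh' map_mx1 mul1mx.
have Xb j : X *m S (C (b j)) = S (C (b j)) *m X.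
  rewrite /X -mulmxA -h3 !mulmxA -!map_mxM; congr (map_mx _ _ *m _).
  by rewrite -[LHS]mulmx1 -hh' mulmxA -[h' *m _ *m h]mulmxA hE [h' *m _]mulmxA h'h mul1mx.
(* The b_j being constant, Schur's lemma applies to each coefficient of X separately. *)
have [f ef] : exists f : fps K, X = f%:M.
  have hN N : {a | map_mx (fun f => fcoef f N) X == a%:M}.
    apply: sigW; have [|a e] := commutant_scalar (X := map_mx (fun f => fcoef f N) X) n0 irr.
      move=> j; have /matrixP e := Xb j; apply/matrixP => p q.
      have := congr1 (fun f => fcoef f N) (e p q).
      rewrite [in LHS]mxE [X in _ = fcoef X N]mxE !fcoef_sum => e2.
      rewrite mxE [RHS]mxE; transitivity (\sum_l fcoef (X p l * S (C (b j)) l q) N).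
        by apply: eq_bigr => l _; rewrite [map_mx _ X _ _]mxE [S _ l q]mxE [C _ l q]mxE fcoefMC.
      rewrite e2; apply: eq_bigr => l _.
      by rewrite [map_mx _ X _ _]mxE [S _ p l]mxE [C _ p l]mxE mulrC fcoefMC mulrC.
    by exists a; apply/eqP.
  exists (Fps (fun N => sval (hN N))); apply/matrixP => i j; apply: fpsP => N.
  have /matrixP/(_ i j) := eqP (svalP (hN N)); rewrite !mxE => ->.
  by case: eqP => _.
pose Z := Ysys c b - map_mx (@deriv K) h *m h'.
have eZ : (fderiv f)%:M = f *: S Z.
  have e1 : D g = S (map_mx (@deriv K) h) *m X + S h *m (fderiv f)%:M.
    rewrite {1}gX DM DS ef; congr (_ + _ *m _); apply/matrixP => i j; rewrite !mxE.
    by rewrite raddfMn.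
  have e2 : S h *m (fderiv f)%:M = f *: (S (Ysys c b *m h) - S (map_mx (@deriv K) h)).
    have := e1; rewrite h1 {1}gX ef !mul_mx_scalar => /eqP.
    rewrite addrC -subr_eq => /eqP <-.
    by rewrite -scalemxAr map_mxM scalerBr.
  have : S h' *m (S h *m (fderiv f)%:M) = (fderiv f)%:M.
    by rewrite mulmxA -map_mxM h'h map_mx1 mul1mx.
  have e3 : S h *m (fderiv f)%:M *m S h' = (fderiv f)%:M.
    by rewrite mul_mx_scalar -scalemxAl -map_mxM hh' map_mx1 scalemx1.
  move=> _; rewrite -e3 e2 -scalemxAl -map_mxB -map_mxM /Z; congr (_ *: map_mx _ _).
  by rewrite mulmxBl -[_ *m h *m h']mulmxA hh' mulmx1.
(* Y has trace 0, and the derivative of h times its inverse has as trace the logarithmic derivative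
   of det h, a constant. *)
have trZ : \tr Z = 0.
  rewrite /Z raddfB /= trY /h' -scalemxAr mxtraceZ.
  have := deriv_det (@derivD K) (@derivM K) h.
  by rewrite ed derivC => <-; rewrite mulr0 subr0.
have f'0 : fderiv f = 0.
  have := congr1 mxtrace eZ; rewrite mxtrace_scalar mxtraceZ trace_map_mx trZ rmorph0 mulr0.
  move=> e; apply: fpsP => N; have := congr1 (fun f => fcoef f N) e.
  have -> : fcoef (fderiv f *+ n) N = fcoef (fderiv f) N *+ n.
    by elim: (n) => // r IH; rewrite !mulrS fcoefD IH.
  rewrite fcoef0 -mulr_natr => /eqP; rewrite mulf_eq0 (pcharf0P K).1 // (gtn_eqF n0) orbF => /eqP.
  by [].
have ef0 := fderiv_eq0 ch0 f'0.
have a0 : fcoef f 0 != 0.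
  apply: contraNneq g0 => e; rewrite gX ef ef0 e rmorph0 rmorph0.
  by rewrite mulmx0.
set a := fcoef f 0 in ef0 a0.
exists (a%:P *: h), (a^-1%:P *: h'); split.
  rewrite gX ef ef0 mul_mx_scalar; apply/matrixP => i j; rewrite !mxE rmorphM //.
by rewrite -scalemxAl -scalemxAr hh' scalerA -polyCM mulfV // scale1r.
Qed.

(** Induction on n: an invariant subspace makes the system triangular with smaller diagonal blocks,
    and without one [irreducible_poly] applies. *)
Theorem ode_polynomial n (b : 'I_m -> 'M[K]_n) (g : 'M[fps K]_n) :
  solves Phi c b g -> polynomial_unit g.
Proof.
elim/ltn_ind: n b g => n IH b g sg.
have [n0|n0] := posnP n.
  by exists 1%:M, 1%:M; split; rewrite ?mulmx1 //; apply/matrixP => i; have := ltn_ord i; rewrite [X in (_ < X)%N]n0.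
have [[U [Ub U0 Uf]]|irr] := pselect (exists U : 'M[K]_n,
    [/\ forall j, (U *m b j <= U)%MS, U != 0 & ~~ row_full U]); last first.
  apply: irreducible_poly n0 _ sg => U Ub; have [->|U0] := eqVneq U 0; first by left.
  by right; apply/negPn/negP => Uf; apply: irr; exists U.
have [r [s [e [B [B' [rB sB Bst]]]]]] : exists r s, exists e : (r + s)%N = n, exists (B : 'M[K]_(r, n)) (B' : 'M[K]_(s, n)),
    [/\ (0 < r)%N, (0 < s)%N & (row_full (col_mx B B') /\ forall j, (B *m b j <= B)%MS)].
  exists (\rank U), (\rank (U^C)%MS).
  have e : (\rank U + \rank (U^C)%MS)%N = n.
    by rewrite mxrank_compl subnKC // rank_leq_col.
  exists e, (row_base U), (row_base (U^C)%MS); split.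
  - by rewrite lt0n mxrank_eq0.
  - by rewrite mxrank_compl subn_gt0 ltn_neqAle rank_leq_col andbT.
  split; last by move=> j; rewrite (eqmxMr _ (eq_row_base U)) eq_row_base.
  rewrite -sub1mx -addsmxE.
  by rewrite (adds_eqmx (eq_row_base U) (eq_row_base (U^C)%MS)) sub1mx addsmx_compl_full.
case: n / e b g U B B' n0 IH sg Ub U0 Uf Bst => b g U B B' n0 IH sg Ub U0 Uf [full Bst].
pose P := col_mx B B'.
have uP : P \in unitmx by rewrite -row_full_unit.
have PP' : P *m invmx P = 1%:M by apply: mulmxV.
apply: (polynomial_unit_conj PP').
have sg' := solves_conj PP' sg.
pose bb i := P *m b i *m invmx P.
have ebb i : bb i = block_mx (ulsubmx (bb i)) 0 (dlsubmx (bb i)) (drsubmx (bb i)).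
  rewrite -[LHS]submxK; congr block_mx.
  have -> : ursubmx (bb i) = rsubmx (B *m b i *m invmx P).
    by rewrite /ursubmx /bb /P mul_col_mx mul_col_mx col_mxKu.
  have /submxP[X ->] := Bst i.
  have -> : B = usubmx P by rewrite col_mxKu.
  have -> : X *m usubmx P *m invmx P = X *m usubmx (P *m invmx P).
    by rewrite -mulmxA -mul_usub_mx.
  by rewrite PP' scalar_mx_block /block_mx col_mxKu mul_mx_row row_mxKr mulmx0.
have {}sg' : solves Phi c (fun i => block_mx (ulsubmx (bb i)) 0 (dlsubmx (bb i)) (drsubmx (bb i)))
     (S (C P) *m g *m S (C (invmx P))).
  by rewrite (_ : (fun i => _) = bb) //; apply/funext => i.
apply: (triangular_poly ch0 sg') => [g1|g3]; apply: IH.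
  by rewrite -{1}[r]addn0 ltn_add2l.
by rewrite -{1}[s]add0n ltn_add2r.
Qed.

End Irreducible.

(** * Functionals, tensor products, and the closed embedding into GL_n *)

From mathcomp Require Import classical_sets topology.
Import Defs.

Section Functionals.
Variables (k : fieldType) (V : lmodType k).

Definition subspace (P : V -> Prop) := P 0 /\ forall (a : k) u v, P u -> P v -> P (a *: u + v).

(* A subspace maximal among those avoiding w is a hyperplane. *)
Lemma separating_functional (P : V -> Prop) (w : V) : subspace P -> ~ P w ->
  exists2 f : {linear V -> k^o}, f w = 1 & forall v, P v -> f v = 0.
Proof.
move=> [P0 PL] Pw.
pose good (H : set V) := [/\ subspace H, (forall v, P v -> H v) & ~ H w].
have [H [[[H0 HL] PH Hw] Hmax]] : exists H, good H /\ forall H', good H' -> (H `<=` H')%classic -> H' = H.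
  have [|] := @Zorn_bigcup V [set H : set V | H = set0 \/ good H]%classic.
    move=> F FG Ft; have [[H0 [FH0 ne]]|h] := pselect (exists H, F H /\ H <> set0); last first.
      left; apply/seteqP; split=> // x [H FH Hx]; exfalso; apply: h; exists H; split=> // e.
      by move: Hx; rewrite e.
    have gF H : F H -> H <> set0 -> good H by move=> /FG[].
    right; split.
    - split; first by exists H0 => //; case: (gF _ FH0 ne) => -[].
      move=> a u v [X FX Xu] [Y FY Yv].
      have nX : X <> set0 by move=> e; move: Xu; rewrite e.
      have nY : Y <> set0 by move=> e; move: Yv; rewrite e.
      have [[[_ gX] _ _] [[_ gY] _ _]] := (gF _ FX nX, gF _ FY nY).
      have [XY|YX] := Ft _ _ FX FY.
        by exists Y => //; apply: gY => //; apply: XY.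
      by exists X => //; apply: gX => //; apply: YX.
    - by move=> v Pv; exists H0 => //; case: (gF _ FH0 ne) => _ h _; apply: h.
    - by case=> X FX Xw; have nX : X <> set0 by [move=> e; move: Xw; rewrite e]; case: (gF _ FX nX).
  move=> H [GH Hmax].
  have gP : good P by split.
  have nH : H <> set0.
    move=> e; apply: (Hmax P); last by right.
    by rewrite properEneq e; split; [apply/eqP => e'; move: P0; rewrite -[P 0]/((P : set V) 0) -e' | apply: sub0set].
  case: GH => // gH; exists H; split=> // H' gH' HH'.
  by apply: contrapT => ne; apply: (Hmax H'); [rewrite properEneq; split=> //; apply/eqP => e; apply: ne | right].
have decomp x : {c : k | H (x - c *: w)}.
  apply: cid; apply: contrapT => nx.
  pose H' : set V := [set v | exists c : k, H (v - c *: x)]%classic.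
  have e : H' = H.
    apply: Hmax; last by move=> v Hv; exists 0; rewrite scale0r subr0.
    split.
    - split; first by exists 0; rewrite scale0r subr0.
      move=> a u v [c Hu] [d Hv]; exists (a * c + d).
      have -> : a *: u + v - (a * c + d) *: x = a *: (u - c *: x) + (v - d *: x).
        by rewrite scalerBr scalerA scalerDl opprD addrACA.
      exact: HL.
    - by move=> v /PH Hv; exists 0; rewrite scale0r subr0.
    - case=> c Hc; have [c0|c0] := eqVneq c 0; first by move: Hc; rewrite c0 scale0r subr0.
      apply: nx; exists c^-1.
      have -> : x - c^-1 *: w = (- c^-1) *: (w - c *: x) + 0.
        by rewrite addr0 scalerBr scalerA mulNr mulVf // scaleN1r opprK scaleNr addrC.
      exact: HL.
  have : H x by rewrite -e; exists 1; rewrite scale1r subrr.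
  by move=> Hx; apply: nx; exists 0; rewrite scale0r subr0.
have uniq x c : H (x - c *: w) -> sval (decomp x) = c.
  move=> Hc; have Hd := svalP (decomp x); set d := sval _ in Hd *.
  apply: contrapT => ne; apply: Hw.
  have -> : w = (c - d)^-1 *: ((-1) *: (x - c *: w) + (x - d *: w)) + 0.
    rewrite addr0 scaleN1r opprB addrA subrK -scalerBl scalerA mulVf ?scale1r //.
    by rewrite subr_eq0; apply/eqP => e; apply: ne.
  by apply: (HL) => //; apply: HL.
pose f x : k^o := sval (decomp x).
have fl : linear f.
  move=> a u v; apply: uniq.
  have -> : a *: u + v - (a *: f u + f v) *: w = a *: (u - f u *: w) + (v - f v *: w).
    by rewrite scalerBr scalerA scalerDl opprD addrACA.
  by apply: HL; apply: (svalP (decomp _)).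
pose F : {linear V -> k^o} := HB.pack f (GRing.isLinear.Build _ _ _ _ f fl).
exists F; rewrite /F /=.
  by apply: uniq; rewrite scale1r subrr.
by move=> v Pv; apply: uniq; rewrite scale0r subr0; apply: PH.
Qed.

Lemma functional_neq0 (v : V) : v != 0 -> exists f : {linear V -> k^o}, f v = 1.
Proof.
move=> v0; have [||f fv _] := @separating_functional (fun x => x = 0) v.
- by split=> // a u w -> ->; rewrite scaler0 addr0.
- by move=> e; rewrite e eqxx in v0.
by exists f.
Qed.

Definition lin_indep n (w : 'I_n -> V) := forall a : 'I_n -> k, \sum_i a i *: w i = 0 -> forall i, a i = 0.

Lemma dual_functional n (w : 'I_n -> V) i : lin_indep w ->
  exists f : {linear V -> k^o}, forall j, f (w j) = (j == i)%:R.
Proof.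
move=> iw; have [||f fw fP] := @separating_functional
    (fun x => exists2 a : 'I_n -> k, a i = 0 & x = \sum_j a j *: w j) (w i).
- split; first by exists (fun=> 0) => //; rewrite big1 // => j _; rewrite scale0r.
  move=> c u v [a a0 ->] [b b0 ->]; exists (fun j => c * a j + b j); first by rewrite a0 b0 mulr0 addr0.
  by rewrite scaler_sumr -big_split; apply: eq_bigr => j _; rewrite scalerDl scalerA.
- case=> a a0 e; have := iw (fun j => a j - (j == i)%:R) _ i.
  rewrite eqxx a0 sub0r => h; suff: (-1 : k) = 0 by move/eqP; rewrite oppr_eq0 oner_eq0.
  apply: h; under eq_bigr => j _ do rewrite scalerBl.
  rewrite sumrB -e (bigD1 i) //= eqxx scale1r big1 ?addr0 ?subrr // => j ji.
  by rewrite (negPf ji) scale0r.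
exists f => j; have [->|ji] := eqVneq j i; first by [].
apply: fP; exists (fun l => (l == j)%:R); first by rewrite eq_sym (negPf ji).
rewrite (bigD1 j) //= eqxx scale1r big1 ?addr0 // => l lj.
by rewrite (negPf lj) scale0r.
Qed.

End Functionals.

(** * Tensor products of algebras *)

Section Tensor.
Variables (k : fieldType) (A R : comAlgType k).

Definition bilin (V : lmodType k) (B : A -> R -> V) :=
  (forall r, linear (B^~ r)) /\ (forall a, linear (B a)).

Definition teval (V : lmodType k) (B : A -> R -> V) (s : seq (A * R)) := \sum_(x <- s) B x.1 x.2.

(** Formal sums are identified when all bilinear maps agree on them: the universal property holds by
    construction, and identities are checked after an arbitrary bilinear map. *)
Definition teq (s t : seq (A * R)) : bool :=
  `[< forall (V : lmodType k) (B : A -> R -> V), bilin B -> teval B s = teval B t >].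

Lemma teq_refl : reflexive teq. Proof. by move=> s; apply/asboolP. Qed.
Lemma teq_sym : symmetric teq.
Proof. by move=> s t; apply/asboolP/asboolP => h V B /h. Qed.
Lemma teq_trans : transitive teq.
Proof.
by move=> s t u /asboolP h1 /asboolP h2; apply/asboolP => V B bB; rewrite h1 // h2.
Qed.
Canonical teq_equiv := EquivRel teq teq_refl teq_sym teq_trans.

Definition tensor := {eq_quot teq}.
HB.instance Definition _ := Choice.on tensor.

Definition tev (V : lmodType k) (B : A -> R -> V) (x : tensor) : V := teval B (generic_quotient.repr x).

Lemma tev_pi (V : lmodType k) (B : A -> R -> V) s : bilin B -> tev B (\pi_tensor s) = teval B s.
Proof.
move=> bB; rewrite /tev; have /eqmodP/asboolP h : \pi_tensor (generic_quotient.repr (\pi_tensor s)) = \pi_tensor s :> tensor by rewrite reprK.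
exact: h.
Qed.

Lemma tensorP (x y : tensor) :
  (forall (V : lmodType k) (B : A -> R -> V), bilin B -> tev B x = tev B y) -> x = y.
Proof.
move=> h; rewrite -[x]reprK -[y]reprK; apply/eqmodP/asboolP => V B bB; exact: h.
Qed.

Definition tpure a r : tensor := \pi_tensor [:: (a, r)].
Definition tadd (x y : tensor) : tensor := \pi_tensor (generic_quotient.repr x ++ generic_quotient.repr y).
Definition topp (x : tensor) : tensor := \pi_tensor (map (fun p => (- p.1, p.2)) (generic_quotient.repr x)).
Definition tscale (c : k) (x : tensor) : tensor := \pi_tensor (map (fun p => (c *: p.1, p.2)) (generic_quotient.repr x)).
Definition tmul (x y : tensor) : tensor :=
  \pi_tensor [seq (p.1 * q.1, p.2 * q.2) | p <- generic_quotient.repr x, q <- generic_quotient.repr y].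

Section Ev.
Variables (V : lmodType k) (B : A -> R -> V).
Hypothesis bB : bilin B.

Let Bl r : {linear A -> V} := HB.pack (B^~ r) (GRing.isLinear.Build _ _ _ _ _ (bB.1 r)).

Lemma tev_pure a r : tev B (tpure a r) = B a r.
Proof. by rewrite tev_pi // /teval big_seq1. Qed.
Lemma tev_add x y : tev B (tadd x y) = tev B x + tev B y.
Proof. by rewrite tev_pi // /teval big_cat. Qed.
Lemma tev_opp x : tev B (topp x) = - tev B x.
Proof.
by rewrite tev_pi // /teval big_map -sumrN; apply: eq_bigr => p _; rewrite -[LHS]/(Bl _ _) raddfN.
Qed.
Lemma tev_scale c x : tev B (tscale c x) = c *: tev B x.
Proof.
by rewrite tev_pi // /teval big_map scaler_sumr; apply: eq_bigr => p _; rewrite -[LHS]/(Bl _ _) linearZ.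
Qed.
Lemma tev_zero : tev B (\pi_tensor [::]) = 0.
Proof. by rewrite tev_pi // /teval big_nil. Qed.
Lemma tev_mul x y : tev B (tmul x y) =
  tev (fun a r => tev (fun a' r' => B (a * a') (r * r')) y) x.
Proof. by rewrite tev_pi // /teval big_allpairs_dep. Qed.

Lemma bilin_mul a r : bilin (fun a' r' => B (a * a') (r * r')).
Proof.
split=> [r' c u v|a' c u v].
  by rewrite mulrDr -scalerAr; apply: bB.1.
by rewrite mulrDr -scalerAr; apply: bB.2.
Qed.

Lemma bilin_tev y : bilin (fun a r => tev (fun a' r' => B (a * a') (r * r')) y).
Proof.
split=> [r c u v|a c u v]; rewrite /tev /teval scaler_sumr -big_split; apply: eq_bigr => p _ /=.
  by rewrite mulrDl -scalerAl; apply: bB.1.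
by rewrite mulrDl -scalerAl; apply: bB.2.
Qed.

End Ev.

Lemma eq_tev (V : lmodType k) (B B' : A -> R -> V) x : (forall a r, B a r = B' a r) -> tev B x = tev B' x.
Proof. by move=> h; apply: eq_bigr => p _; apply: h. Qed.

Let taddA : associative tadd.
Proof. by move=> x y z; apply: tensorP => V B bB; rewrite !tev_add // addrA. Qed.
Let taddC : commutative tadd.
Proof. by move=> x y; apply: tensorP => V B bB; rewrite !tev_add // addrC. Qed.
Let tadd0 : left_id (\pi_tensor [::] : tensor) tadd.
Proof. by move=> x; apply: tensorP => V B bB; rewrite tev_add // tev_zero // add0r. Qed.
Let taddN : left_inverse (\pi_tensor [::] : tensor) topp tadd.
Proof. by move=> x; apply: tensorP => V B bB; rewrite tev_add // tev_opp // tev_zero // addNr. Qed.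
HB.instance Definition _ := GRing.isZmodule.Build tensor taddA taddC tadd0 taddN.

Let tmulA : associative tmul.
Proof.
move=> x y z; apply: tensorP => V B bB.
rewrite tev_mul // tev_mul // tev_mul; last exact: bilin_tev.
apply: eq_tev => a r; rewrite tev_mul; last exact: bilin_mul.
by apply: eq_tev => a' r'; apply: eq_tev => a'' r''; rewrite !mulrA.
Qed.
Let tmulC : commutative tmul.
Proof.
move=> x y; apply: tensorP => V B bB; rewrite !tev_mul // /tev /teval exchange_big.
by apply: eq_bigr => p _; apply: eq_bigr => q _ /=; rewrite mulrC [_.2 * _]mulrC.
Qed.
Let tmul1 : left_id (tpure 1 1) tmul.
Proof.
move=> x; apply: tensorP => V B bB; rewrite tev_mul // tev_pure; last exact: bilin_tev.
by apply: eq_tev => a r; rewrite !mul1r.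
Qed.
Let tmulDl : left_distributive tmul tadd.
Proof.
move=> x y z; apply: tensorP => V B bB.
by rewrite tev_add // !tev_mul // tev_add //; apply: bilin_tev.
Qed.

Lemma bilin_functional (f : {linear A -> k^o}) : bilin (fun a (r : R) => (f a : k) *: r).
Proof.
by split=> [r c u v|a c u v]; rewrite ?linearP ?scalerDl ?scalerDr ?scalerA // mulrC.
Qed.

Let tone_neq0 : tpure 1 1 != (\pi_tensor [::] : tensor).
Proof.
have [f f1] := functional_neq0 (oner_neq0 A).
apply/eqP => e; have := congr1 (tev (fun a (r : R) => (f a : k) *: r)) e.
rewrite tev_pure ?tev_zero; try exact: bilin_functional.
by rewrite f1 scale1r => /eqP; rewrite oner_eq0.
Qed.
HB.instance Definition _ := GRing.Zmodule_isComNzRing.Build tensor tmulA tmulC tmul1 tmulDl tone_neq0.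

Let tscaleA a b x : tscale a (tscale b x) = tscale (a * b) x.
Proof. by apply: tensorP => V B bB; rewrite !tev_scale // scalerA. Qed.
Let tscale1 : left_id 1 tscale.
Proof. by move=> x; apply: tensorP => V B bB; rewrite tev_scale // scale1r. Qed.
Let tscaleDr : right_distributive tscale +%R.
Proof. by move=> a x y; apply: tensorP => V B bB; rewrite tev_scale // !tev_add // !tev_scale // scalerDr. Qed.
Let tscaleDl x : {morph tscale^~ x : a b / a + b}.
Proof. by move=> a b; apply: tensorP => V B bB; rewrite tev_add // !tev_scale // scalerDl. Qed.
HB.instance Definition _ := GRing.Zmodule_isLmodule.Build k tensor tscaleA tscale1 tscaleDr tscaleDl.
Let tscaleAl (a : k) (x y : tensor) : a *: (x * y) = (a *: x) * y.
Proof.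
apply: tensorP => V B bB; rewrite tev_scale // !tev_mul // tev_scale //.
exact: bilin_tev.
Qed.
HB.instance Definition _ := GRing.Lmodule_isLalgebra.Build k tensor tscaleAl.
HB.instance Definition _ := GRing.Lalgebra_isComAlgebra.Build k tensor.

Definition tinl (a : A) : tensor := tpure a 1.
Definition tinr (r : R) : tensor := tpure 1 r.

Fact tinl_linear : linear tinl.
Proof.
move=> c u v; apply: tensorP => V B bB; rewrite tev_add // tev_scale // !tev_pure //.
exact: bB.1.
Qed.
Fact tinl_monoid : monoid_morphism tinl.
Proof.
split=> // a b; apply: tensorP => V B bB; rewrite tev_mul // !tev_pure ?mulr1 //.
- exact: bilin_mul. - exact: bilin_tev.
Qed.
Fact tinr_linear : linear tinr.
Proof.
move=> c u v; apply: tensorP => V B bB; rewrite tev_add // tev_scale // !tev_pure //.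
exact: bB.2.
Qed.
Fact tinr_monoid : monoid_morphism tinr.
Proof.
split=> // a b; apply: tensorP => V B bB; rewrite tev_mul // !tev_pure ?mulr1 //.
- exact: bilin_mul. - exact: bilin_tev.
Qed.
HB.instance Definition _ := GRing.isLinear.Build k A tensor _ tinl tinl_linear.
HB.instance Definition _ := GRing.isMonoidMorphism.Build A tensor tinl tinl_monoid.
HB.instance Definition _ := GRing.isLinear.Build k R tensor _ tinr tinr_linear.
HB.instance Definition _ := GRing.isMonoidMorphism.Build R tensor tinr tinr_monoid.

Lemma tensor_span (x : tensor) : exists s : seq (A * R), x = \sum_(p <- s) tinl p.1 * tinr p.2.
Proof.
exists (generic_quotient.repr x); apply: tensorP => V B bB.
rewrite {1}/tev /teval; elim: (generic_quotient.repr x) => [|p s IH].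
  by rewrite !big_nil tev_zero.
rewrite !big_cons tev_add // -IH; congr (_ + _).
rewrite tev_mul // !tev_pure ?mul1r ?mulr1 //.
- exact: bilin_mul. - exact: bilin_tev.
Qed.

Lemma tensor_contract (f : {linear A -> k^o}) : exists C : {linear tensor -> R},
  forall a r, C (tinl a * tinr r) = (f a : k) *: r.
Proof.
have bf := bilin_functional f; have l : linear (tev (fun a (r : R) => (f a : k) *: r)).
  by move=> c x y; rewrite tev_add // tev_scale.
pose F : {linear tensor -> R} := HB.pack (tev (fun a (r : R) => (f a : k) *: r)) (GRing.isLinear.Build _ _ _ _ _ l).
exists F => a r; rewrite /F /=.
rewrite tev_mul // !tev_pure ?mul1r ?mulr1 //.
- exact: (bilin_mul bf). - exact: (bilin_tev bf).
Qed.

Lemma tensor_copair (S : comAlgType k) (f : {lrmorphism A -> S}) (g : {lrmorphism R -> S}) :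
  exists h : {lrmorphism tensor -> S}, (forall a, h (tinl a) = f a) /\ (forall r, h (tinr r) = g r).
Proof.
have bB : bilin (fun a r => f a * g r).
  by split=> [r c u v|a c u v]; rewrite linearP ?mulrDl ?mulrDr ?scalerAl -?scalerAr ?scalerAl.
have l : linear (tev (fun a r => f a * g r)).
  by move=> c x y; rewrite tev_add // tev_scale.
have m : monoid_morphism (tev (fun a r => f a * g r)).
  split; first by rewrite tev_pure // !rmorph1 mulr1.
  move=> x y; rewrite tev_mul // /tev /teval mulr_suml; apply: eq_bigr => p _.
  by rewrite mulr_sumr; apply: eq_bigr => q _ /=; rewrite !rmorphM mulrACA.
pose h : {lrmorphism tensor -> S} := HB.pack (tev (fun a r => f a * g r))
  (GRing.isLinear.Build _ _ _ _ _ l) (GRing.isMonoidMorphism.Build _ _ _ m).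
exists h; split=> [a|r]; rewrite /h /= tev_pure // rmorph1 ?mulr1 ?mul1r //.
Qed.

End Tensor.

Arguments tinl {k A} R a.
Arguments tinr {k} A {R} r.

Definition base_alg (k : fieldType) (R : comAlgType k) (a : k^o) : R := a%:A.
Section BaseAlg.
Variables (k : fieldType) (R : comAlgType k).
Fact base_alg_linear : linear (@base_alg k R).
Proof. by move=> a u v; rewrite /base_alg scalerDl scalerA. Qed.
Fact base_alg_monoid : monoid_morphism (@base_alg k R).
Proof. by split=> [|u v]; rewrite /base_alg ?scale1r // -scalerAl mul1r scalerA. Qed.
HB.instance Definition _ := GRing.isLinear.Build k k^o R _ (@base_alg k R) base_alg_linear.
HB.instance Definition _ := GRing.isMonoidMorphism.Build k^o R (@base_alg k R) base_alg_monoid.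
End BaseAlg.

Section Pexp.
Variables (k : fieldType) (n : nat).

(** Polynomial functions on matrices are kept as syntax, so that equations of G, their differentials
    and their derivatives along vector fields come from structural recursion, over all algebras at
    once. *)
Inductive pexp := PC of k | PX of 'I_n & 'I_n | PD of pexp & pexp | PM of pexp & pexp.

Fixpoint peval (R : comAlgType k) (M : 'M[R]_n) (t : pexp) : R :=
  match t with
  | PC a => a%:A
  | PX i j => M i j
  | PD p q => peval M p + peval M q
  | PM p q => peval M p * peval M q
  end.

Lemma peval_map (R S : comAlgType k) (f : {lrmorphism R -> S}) (M : 'M[R]_n) t :
  f (peval M t) = peval (map_mx f M) t.
Proof.
elim: t => [a|i j|p IHp q IHq|p IHp q IHq] /=.
- exact: rmorph_alg.
- by rewrite mxE.
- by rewrite rmorphD; congr (_ + _).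
- by rewrite rmorphM; congr (_ * _).
Qed.

End Pexp.

Lemma independent_spanning (k : fieldType) (V : lmodType k) (s : seq V) :
  exists N (e : 'I_N -> V), lin_indep e /\ forall v, v \in s -> exists a : 'I_N -> k, v = \sum_l a l *: e l.
Proof.
elim: s => [|x s [N [e [ie he]]]]; first by exists 0%N, (fun=> 0); split=> // a _ [].
have [[a ea]|nx] := pselect (exists a : 'I_N -> k, x = \sum_l a l *: e l).
  by exists N, e; split=> // v; rewrite inE => /orP[/eqP ->|/he //]; exists a.
exists N.+1, (fun l => if unlift ord0 l is Some l' then e l' else x); split.
  move=> a; rewrite big_ord_recl unlift_none; under eq_bigr => l _ do rewrite liftK.
  move=> e0; have a0 : a ord0 = 0.
    apply: contrapT => a0; apply: nx; exists (fun l => - (a ord0)^-1 * a (lift ord0 l)).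
    transitivity ((a ord0)^-1 *: (a ord0 *: x)).
      by rewrite scalerA mulVf ?scale1r //; apply/eqP.
    rewrite (eqP (_ : a ord0 *: x == - \sum_(l < N) a (lift ord0 l) *: e l)); last by rewrite -addr_eq0 e0.
    by rewrite scalerN scaler_sumr -sumrN; apply: eq_bigr => l _; rewrite scalerA mulNr scaleNr.
  move: e0; rewrite a0 scale0r add0r => /ie h i.
  by case: (unliftP ord0 i) => [j|] ->.
move=> v; rewrite inE => /orP[/eqP ->|/he[a ->]].
  exists (fun l => (l == ord0)%:R); rewrite big_ord_recl unlift_none eqxx scale1r big1 ?addr0 // => l _.
  by rewrite scale0r.
exists (fun l => if unlift ord0 l is Some l' then a l' else 0).
rewrite big_ord_recl unlift_none scale0r add0r; apply: eq_bigr => l _.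
by rewrite liftK.
Qed.

(** Contraction with dual functionals isolates each coefficient. The matrix entries of a comodule
    are compared in this way. *)
Lemma tensor_indep (k : fieldType) (A R : comAlgType k) n (w : 'I_n -> A) (c d : 'I_n -> R) :
  lin_indep w ->
  \sum_i tinl R (w i) * tinr A (c i) = \sum_i tinl R (w i) * tinr A (d i) -> c =1 d.
Proof.
move=> iw e i; have [f hf] := dual_functional i iw.
have [C hC] := tensor_contract R f.
have h c' : C (\sum_i tinl R (w i) * tinr A (c' i)) = c' i.
  rewrite linear_sum (bigD1 i) //= hC hf eqxx scale1r big1 ?addr0 // => j ji.
  by rewrite hC hf (negPf ji) scale0r.
by have := congr1 C e; rewrite !h.
Qed.

Section Evaluation.
Variables (k : fieldType) (G : groupFunctor k) (A : comAlgType k) (u : G A).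
Hypothesis repu : represents u.

Definition ev (R : comAlgType k) (g : G R) : {lrmorphism A -> R} := sval (cid (repu g)).

Lemma fmap_ev R (g : G R) : fmap G (ev g) u = g.
Proof. by rewrite /ev; case: cid => f []. Qed.

Lemma ev_uniq R (g : G R) (f : {lrmorphism A -> R}) : fmap G f u = g -> f =1 ev g.
Proof. by rewrite /ev; case: cid => f0 [_ h] /= /h. Qed.

Lemma evZ R (g : G R) (c : k) a : ev g (c *: a) = c *: ev g a.
Proof. by rewrite linearZ. Qed.

Lemma ev_inj R (g h : G R) : ev g =1 ev h -> g = h.
Proof.
move=> e; rewrite -[g]fmap_ev -[h]fmap_ev.
have := @fmap_comp k G _ _ _ (idfun : {lrmorphism A -> A}) (ev h) (ev g).
by move=> -> //=; rewrite fmap_id.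
Qed.

Lemma ev_fmap (R S : comAlgType k) (f : {lrmorphism R -> S}) (g : G R) a :
  ev (fmap G f g) a = f (ev g a).
Proof.
pose h : {lrmorphism A -> S} := f \o ev g.
rewrite -[RHS]/(h a); symmetry; apply: ev_uniq.
by rewrite (@fmap_comp k G _ _ _ (ev g) f h) //= fmap_ev.
Qed.

Lemma ev_univ a : ev u a = a.
Proof. by symmetry; apply: (ev_uniq (f := idfun)); apply: fmap_id. Qed.

(** Computed once on the product of two universal points over the tensor square, then specialized
    along the morphism that g and h induce. *)
Lemma comultiplication a : exists s : seq (A * A), forall (R : comAlgType k) (g h : G R),
  ev (g * h)%g a = \sum_(p <- s) ev g p.1 * ev h p.2.
Proof.
pose T : comAlgType k := tensor A A.
pose ul : G T := fmap G (tinl A : {lrmorphism A -> T}) u.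
pose ur : G T := fmap G (tinr A : {lrmorphism A -> T}) u.
have [s es] := tensor_span (ev (ul * ur)%g a).
exists s => R g h; have [H [Hl Hr]] := tensor_copair (ev g) (ev h).
have -> : (g * h)%g = fmap G H (ul * ur)%g.
  rewrite fmapM; congr (_ * _)%g.
    rewrite -[LHS]fmap_ev; apply: fmap_comp => b; exact: (esym (Hl b)).
  rewrite -[LHS]fmap_ev; apply: fmap_comp => b; exact: (esym (Hr b)).
rewrite ev_fmap es rmorph_sum; apply: eq_bigr => p _.
by rewrite rmorphM; congr (_ * _); [apply: Hl | apply: Hr].
Qed.

Lemma ev1E : exists eps : A -> k, forall (R : comAlgType k) a, ev (1%g : G R) a = (eps a)%:A.
Proof.
exists (fun a => ev (1%g : G k^o) a) => R a.
have -> : (1%g : G R) = fmap G (@base_alg k R : {lrmorphism k^o -> R}) 1%g.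
  by apply: (mulgI (fmap G (@base_alg k R : {lrmorphism k^o -> R}) 1%g)); rewrite -fmapM !mulg1.
by rewrite ev_fmap.
Qed.

Section Subcomodule.
Variables (N : nat) (e : 'I_N -> A).
Hypothesis ie : lin_indep e.

Let good (f : A) := exists c : 'I_N -> A, forall (R : comAlgType k) (g h : G R),
  ev (g * h)%g f = \sum_l ev g (e l) * ev h (c l).

Let goodv (v : 'rV[k]_N) := good (\sum_l v 0 l *: e l).

Let goodv0 : goodv 0.
Proof.
exists (fun=> 0) => R g h; rewrite [X in ev _ X]big1; last by move=> l _; rewrite mxE scale0r.
by rewrite rmorph0 big1 // => l _; rewrite rmorph0 mulr0.
Qed.

Let goodvP a v w : goodv v -> goodv w -> goodv (a *: v + w).
Proof.
move=> [c hc] [d hd]; exists (fun l => a *: c l + d l) => R g h.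
transitivity (ev (g * h)%g (a *: (\sum_l v 0 l *: e l) + \sum_l w 0 l *: e l)).
  congr (ev _ _); rewrite scaler_sumr -big_split; apply: eq_bigr => l _ /=.
  by rewrite !mxE scalerDl scalerA.
rewrite linearP /= hc hd scaler_sumr -big_split; apply: eq_bigr => l _ /=.
by rewrite linearP /= mulrDr scalerAr.
Qed.

(** Coassociativity: for a universal third point x, the value of f at (g h) x = g (h x), contracted
    with [phi] in the variable x, shows that the coproduct of the new element again has its left
    factors in the span of e. *)
Lemma good_contract (f : A) (c : 'I_N -> A) (phi : {linear A -> k^o}) :
  (forall (R : comAlgType k) (g h : G R), ev (g * h)%g f = \sum_l ev g (e l) * ev h (c l)) ->
  good (\sum_l (phi (c l) : k) *: e l).
Proof.
move=> hc.
have /fin_all_exists[s hs] : forall l, exists s : seq (A * A), forall (R : comAlgType k) (g h : G R),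
    ev (g * h)%g (c l) = \sum_(p <- s) ev g p.1 * ev h p.2 by move=> l; apply: comultiplication.
exists (fun l => \sum_(p <- s l) (phi p.2 : k) *: p.1) => R g h.
pose T : comAlgType k := tensor A R.
pose x : G T := fmap G (tinl R : {lrmorphism A -> T}) u.
pose r (y : G R) : G T := fmap G (tinr A : {lrmorphism R -> T}) y.
have [C hC] := tensor_contract R phi.
have hr y a : ev (r y) a = tinr A (ev y a) by rewrite /r ev_fmap.
have hx a : ev x a = tinl R a by rewrite /x ev_fmap ev_univ.
have rM : (r g * r h)%g = r (g * h)%g by rewrite /r fmapM.
have := congr1 C (congr1 (fun y => ev y f) (mulgA (r g) (r h) x)).
rewrite rM !hc !linear_sum /= => e2.
transitivity (\sum_l C (ev (r (g * h)%g) (e l) * ev x (c l))).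
  by apply: eq_bigr => l _; rewrite linearZ hr hx mulrC hC.
rewrite -e2; apply: eq_bigr => l _.
rewrite hs hr mulr_sumr linear_sum rmorph_sum mulr_sumr; apply: eq_bigr => p _.
by rewrite hr hx mulrA -rmorphM mulrC hC scalerAr; congr (_ * _); symmetry; apply: evZ.
Qed.

(** Local finiteness: the elements of the span of e whose coproduct keeps its left factors in that
    span form a subcomodule, and [rho] is its matrix of coefficients. *)
Lemma subcomodule : exists n (w : 'I_n -> A) (rho : 'I_n -> 'I_n -> A),
  [/\ lin_indep w,
      forall (R : comAlgType k) (g h : G R) j, ev (g * h)%g (w j) = \sum_i ev g (w i) * ev h (rho i j) &
      forall f, good f -> exists a : 'I_n -> k, f = \sum_i a i *: w i].
Proof.
have [W hW] := subspace_mx goodv0 goodvP.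
pose B := row_base W; pose n := \rank W.
pose w (i : 'I_n) := \sum_l B i l *: e l.
have sumw (a : 'rV_n) : \sum_i a 0 i *: w i = \sum_l (a *m B) 0 l *: e l.
  transitivity (\sum_l \sum_i (a 0 i * B i l) *: e l).
    rewrite exchange_big; apply: eq_bigr => i _; rewrite scaler_sumr; apply: eq_bigr => l _.
    by rewrite scalerA.
  by apply: eq_bigr => l _; rewrite mxE scaler_suml.
have iw : lin_indep w.
  move=> a; pose v := \row_i a i.
  have -> : \sum_i a i *: w i = \sum_i v 0 i *: w i by apply: eq_bigr => i _; rewrite mxE.
  rewrite sumw => /ie h i; have : v *m B = 0 by apply/rowP => l; rewrite h mxE.
  rewrite -[RHS](mul0mx _ B) => /(row_free_inj (row_base_free _))/rowP/(_ i).
  by rewrite !mxE.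
have gw i : good (w i).
  have : goodv (row i B) by apply/hW; rewrite -(eq_row_base W) row_sub.
  rewrite /goodv /w; under eq_bigr => l _ do rewrite mxE.
  by [].
have inW f c phi : (forall (R : comAlgType k) (g h : G R), ev (g * h)%g f = \sum_l ev g (e l) * ev h (c l)) ->
    ((\row_l (phi (c l) : k)) <= B)%MS \/ ~ linear (phi : A -> k^o).
  move=> hc; have [lp|] := pselect (linear (phi : A -> k^o)); [left|by right].
  pose F : {linear A -> k^o} := HB.pack phi (GRing.isLinear.Build _ _ _ _ phi lp).
  rewrite eq_row_base; apply/hW; have := good_contract F hc.
  by rewrite /goodv; under [in X in _ -> X]eq_bigr => l _ do rewrite mxE.
have [c hc] := fin_all_exists gw.
pose rho i j := \sum_l pinvmx B l i *: c j l.
exists n, w, rho; split=> //.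
  move=> R g h j; rewrite hc.
  have ec l : c j l = \sum_i B i l *: rho i j.
    pose d := c j l - \sum_i B i l *: rho i j.
    have [|d0] := eqVneq d 0; first by move/eqP; rewrite subr_eq0 => /eqP.
    have [phi hphi] := functional_neq0 d0; exfalso.
    have [/mulmxKpV/rowP/(_ l)|[]] := inW _ _ phi (hc j); last exact: linearP.
    move=> e1; suff : phi d = 0 by rewrite hphi => /eqP; rewrite oner_eq0.
    rewrite linearB /= linear_sum; apply/eqP; rewrite subr_eq0; apply/eqP.
    move: e1; rewrite !mxE => <-; apply: eq_bigr => i _.
    rewrite !mxE /rho linearZ linear_sum /= mulrC; congr (_ * _); apply: eq_bigr => q _.
    by rewrite mxE linearZ mulrC.
  transitivity (\sum_l \sum_i ev g (e l) * (B i l *: ev h (rho i j))).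
    apply: eq_bigr => l _; rewrite ec linear_sum mulr_sumr; apply: eq_bigr => i _.
    by rewrite linearZ.
  rewrite exchange_big; apply: eq_bigr => i _.
  have -> : ev g (w i) = \sum_l B i l *: ev g (e l) by rewrite linear_sum; apply: eq_bigr => l _; apply: evZ.
  by rewrite mulr_suml; apply: eq_bigr => l _; rewrite -scalerAl scalerAr.
move=> f [c' hc']; have [eps heps] := ev1E.
have ef : f = \sum_l eps (c' l) *: e l.
  rewrite -{1}[f]ev_univ -[u in LHS]mulg1 hc'; apply: eq_bigr => l _.
  by rewrite ev_univ heps mulr_algr.
have : goodv (\row_l eps (c' l)).
  rewrite /goodv; under eq_bigr => l _ do rewrite mxE.
  by rewrite -ef; exists c'.
move/hW; rewrite -(eq_row_base W) -/B => /submxP[a ea].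
exists (fun i => a 0 i); rewrite sumw -ea ef.
by apply: eq_bigr => l _; rewrite mxE.
Qed.

End Subcomodule.
End Evaluation.

(** Closedness is meant in the space of all matrices, not only of invertible ones, so that equations
    of G are plain polynomials in the entries. *)
Definition faithful_closed (k : fieldType) (G : groupFunctor k) n (r : linear_rep G n) :=
  (forall R, injective (r R)) /\
  forall (R : comAlgType k) (M : 'M[R]_n),
    (forall t, (forall (S : comAlgType k) (g : G S), peval (r S g) t = 0) -> peval M t = 0) ->
    exists g : G R, r R g = M.

Theorem embedding (k : fieldType) (G : groupFunctor k) :
  affine_algebraic_group G -> exists n (r : linear_rep G n.+1), faithful_closed r.
Proof.
move=> [A [u [repu [gs hgs]]]].
(* The element 1 is adjoined so that the comodule has positive dimension. *)
pose fs := 1 :: gs.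
have /fin_all_exists[s hs] : forall j : 'I_(size fs), exists s : seq (A * A),
    forall (R : comAlgType k) (g h : G R), ev repu (g * h)%g (fs`_j) = \sum_(p <- s) ev repu g p.1 * ev repu h p.2.
  by move=> j; apply: comultiplication.
have [N [e [ie he]]] := independent_spanning (flatten [seq map fst (s j) | j <- enum 'I_(size fs)]).
have [n [w [rho [iw hw spanw]]]] := subcomodule repu ie.
have {}spanw f : f \in fs -> exists a : 'I_n -> k, f = \sum_i a i *: w i.
  move=> /(nthP 0)[j0 ltj <-]; pose j := Ordinal ltj; apply: spanw.
  have /fin_all_exists[x hx] : forall q : 'I_(size (s j)), exists a : 'I_N -> k,
      (nth (0, 0) (s j) q).1 = \sum_l a l *: e l.
    move=> q; apply: he; apply/flattenP; exists (map fst (s j)).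
      by apply: (map_f (fun j => map fst (s j))); rewrite mem_enum.
    by apply: map_f; apply: mem_nth.
  exists (fun l => \sum_q x q l *: (nth (0, 0) (s j) q).2) => R g h.
  rewrite (hs j) (big_nth (0, 0)) big_mkord.
  transitivity (\sum_(q < size (s j)) \sum_l ev repu g (e l) * (x q l *: ev repu h (nth (0, 0) (s j) q).2)).
    apply: eq_bigr => q _; rewrite hx linear_sum mulr_suml; apply: eq_bigr => l _.
    by rewrite linearZ /= -scalerAl scalerAr.
  rewrite exchange_big; apply: eq_bigr => l _; rewrite linear_sum mulr_sumr; apply: eq_bigr => q _.
  by rewrite linearZ.
case: n w rho iw hw spanw => [|n] w rho iw hw spanw.
  have [|a /eqP] := spanw 1; first by rewrite inE eqxx.
  by rewrite big_ord0 oner_eq0.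
pose r (R : comAlgType k) (g : G R) : 'M[R]_n.+1 := \matrix_(i, j) ev repu g (rho i j).
have uniq (R : comAlgType k) (j : 'I_n.+1) (c d : 'I_n.+1 -> R) :
  \sum_i tinl R (w i) * tinr A (c i) = \sum_i tinl R (w i) * tinr A (d i) -> c =1 d.
  exact: tensor_indep.
(* The universal point x, placed over a tensor product, turns a value at x y into a sum of w_i
   tensored with matrix entries of y; independence of the w_i then yields that r is
   multiplicative. *)
pose x (R : comAlgType k) : G (tensor A R) := fmap G (tinl R : {lrmorphism A -> tensor A R}) u.
pose q (R : comAlgType k) (y : G R) : G (tensor A R) := fmap G (tinr A : {lrmorphism R -> tensor A R}) y.
have qM R y y' : q R (y * y')%g = (q R y * q R y')%g by rewrite /q fmapM.
have hq R y a : ev repu (q R y) a = tinr A (ev repu y a) by rewrite /q ev_fmap.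
have hx R a : ev repu (x R) a = tinl R a by rewrite /x ev_fmap ev_univ.
have r1 (R : comAlgType k) : r R 1%g = 1%:M.
  apply/matrixP => i j; rewrite !mxE.
  apply: (tensor_indep iw (c := fun i => ev repu (1%g : G R) (rho i j)) (d := fun i => (i == j)%:R)).
  transitivity (ev repu (x R * q R 1)%g (w j)).
    by rewrite hw; apply: eq_bigr => l _; rewrite hq hx.
  have -> : q R 1%g = 1%g by apply: (mulgI (q R 1%g)); rewrite -qM !mulg1.
  rewrite mulg1 hx (bigD1 j) //= eqxx rmorph1 mulr1 big1 ?addr0 // => l lj.
  by rewrite (negPf lj) rmorph0 mulr0.
have rM (R : comAlgType k) (y z : G R) : r R (y * z)%g = r R y *m r R z.
  apply/matrixP => i j; rewrite !mxE.
  apply: (tensor_indep iw (c := fun i => ev repu (y * z)%g (rho i j))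
    (d := fun i => \sum_l r R y i l * r R z l j)).
  transitivity (ev repu (x R * (q R y * q R z))%g (w j)).
    by rewrite -qM hw; apply: eq_bigr => l _; rewrite hq hx.
  rewrite mulgA hw.
  transitivity (\sum_l \sum_i tinl R (w i) * tinr A (ev repu y (rho i l) * ev repu z (rho l j))).
    apply: eq_bigr => l _; rewrite hw mulr_suml; apply: eq_bigr => i' _.
    by rewrite !hq hx rmorphM mulrA.
  rewrite exchange_big; apply: eq_bigr => i' _; rewrite rmorph_sum mulr_sumr; apply: eq_bigr => l _.
  by rewrite !mxE.
have rnat (R S : comAlgType k) (f : {lrmorphism R -> S}) (y : G R) :
    r S (fmap G f y) = map_mx f (r R y).
  by apply/matrixP => i j; rewrite !mxE ev_fmap.
pose rep : linear_rep G n.+1 := LinearRep r1 rM rnat.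
(* The functions that are polynomial in the matrix entries form a subalgebra containing the
   generators, hence all of A. *)
pose B : {pred A} := [pred a | `[< exists t, forall (R : comAlgType k) (g : G R), ev repu g a = peval (r R g) t >]].
have Ball a : exists t, forall (R : comAlgType k) (g : G R), ev repu g a = peval (r R g) t.
  apply/asboolP; rewrite -[asbool _]/(a \in B); apply: hgs.
    split.
    - by apply/asboolP; exists (PC n.+1 1) => R g; rewrite rmorph1 /= scale1r.
    - move=> c a1 a2 /asboolP[t1 h1] /asboolP[t2 h2]; apply/asboolP.
      by exists (PD (PM (PC n.+1 c) t1) t2) => R g; rewrite linearP /= h1 h2 mulr_algl.
    - move=> a1 a2 /asboolP[t1 h1] /asboolP[t2 h2]; apply/asboolP.
      by exists (PM t1 t2) => R g; rewrite rmorphM /= h1 h2.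
  move=> f ff; have [|c ->] := spanw f; first by rewrite inE ff orbT.
  apply/asboolP.
  have wB j : exists t, forall (R : comAlgType k) (g : G R), ev repu g (w j) = peval (r R g) t.
    have [eps heps] := ev1E repu.
    pose fix T (l : seq 'I_n.+1) := if l is i :: l' then PD (PM (PC n.+1 (eps (w i))) (PX k i j)) (T l') else PC n.+1 0.
    exists (T (enum 'I_n.+1)) => R g.
    rewrite -[g in LHS]mul1g hw -big_enum.
    elim: (enum _) => [|i l IH]; first by rewrite big_nil /= scale0r.
    by rewrite big_cons IH /= heps mxE.
  have [t ht] := fin_all_exists wB.
  pose fix T (l : seq 'I_n.+1) := if l is i :: l' then PD (PM (PC n.+1 (c i)) (t i)) (T l') else PC n.+1 0.
  exists (T (enum 'I_n.+1)) => R g.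
  rewrite linear_sum -big_enum; elim: (enum _) => [|i l IH]; first by rewrite big_nil /= scale0r.
  by rewrite big_cons IH /= linearZ /= ht mulr_algl.
exists n, rep; split.
  move=> R y z e0; apply: (ev_inj (repu := repu)) => a; have [t ht] := Ball a.
  by rewrite !ht (e0 : r R y = r R z).
move=> R M hM.
(* The equations satisfied by M say that evaluation at M factors through functions on G; this
   defines an algebra morphism on A, that is, a point. *)
have wd t t' : (forall (S : comAlgType k) (g : G S), peval (r S g) t = peval (r S g) t') -> peval M t = peval M t'.
  move=> h; have := hM (PD t (PM (PC n.+1 (-1)) t')) _; rewrite /= mulr_algl scaleN1r => /(_ _)/eqP.
  rewrite subr_eq0 => e0; apply/eqP/e0 => S g; rewrite /= mulr_algl scaleN1r.
  by apply/eqP; rewrite subr_eq0; apply/eqP/h.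
have hB a : {t | forall (S : comAlgType k) (g : G S), ev repu g a = peval (r S g) t} by apply: cid; apply: Ball.
pose psi a := peval M (sval (hB a)).
have psiE a t : (forall (S : comAlgType k) (g : G S), ev repu g a = peval (r S g) t) -> psi a = peval M t.
  by move=> h; apply: wd => S g; rewrite -h -(svalP (hB a)).
have psil : linear psi.
  move=> c a b; rewrite (psiE _ (PD (PM (PC n.+1 c) (sval (hB a))) (sval (hB b)))) /= ?mulr_algl // => S g.
  by rewrite linearP /= mulr_algl -!(svalP (hB _)).
have psim : monoid_morphism psi.
  split; first by rewrite (psiE _ (PC n.+1 1)) /= ?scale1r // => S g; rewrite rmorph1 scale1r.
  move=> a b; rewrite (psiE _ (PM (sval (hB a)) (sval (hB b)))) // => S g.
  by rewrite rmorphM /= -!(svalP (hB _)).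
pose Psi : {lrmorphism A -> R} := HB.pack psi (GRing.isLinear.Build _ _ _ _ _ psil)
  (GRing.isMonoidMorphism.Build _ _ _ psim).
exists (fmap G Psi u); apply/matrixP => i j; rewrite mxE ev_fmap ev_univ /Psi /=.
by rewrite (psiE _ (PX k i j)) // => S g; rewrite /= mxE.
Qed.

Definition hev (k : fieldType) (R : comAlgType k) (a : R) (p : {poly k}) : R := horner_alg a p.
Section Hev.
Variables (k : fieldType) (R : comAlgType k) (a : R).
Fact hev_linear : linear (hev a).
Proof.
by move=> c p q; rewrite /hev rmorphD -[c *: p]mul_polyC rmorphM /= horner_algC mulr_algl.
Qed.
Fact hev_monoid : monoid_morphism (hev a).
Proof. by split; [exact: rmorph1 | exact: rmorphM]. Qed.
HB.instance Definition _ := GRing.isLinear.Build k {poly k} R _ (hev a) hev_linear.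
HB.instance Definition _ := GRing.isMonoidMorphism.Build {poly k} R (hev a) hev_monoid.
Lemma hevX : hev a 'X = a. Proof. exact: horner_algX. Qed.
Lemma hevC c : hev a c%:P = c%:A. Proof. exact: horner_algC. Qed.
Lemma hevA c : hev a c%:A = c%:A. Proof. by rewrite alg_polyC hevC. Qed.
End Hev.

(** * The Lie algebra *)

Section InR.
Variables (k : fieldType).
Implicit Types (R S : comAlgType k).

(* v lies in the base change to R of the row space of W. *)
Definition inR R p q (W : 'M[k]_(p, q)) (v : 'rV[R]_q) :=
  exists a : 'rV[R]_p, v = a *m map_mx (in_alg R) W.

Lemma inR0 R p q (W : 'M[k]_(p, q)) : inR W (0 : 'rV[R]_q).
Proof. by exists 0; rewrite mul0mx. Qed.

Lemma inRP R p q (W : 'M[k]_(p, q)) (a : R) (u v : 'rV[R]_q) : inR W u -> inR W v -> inR W (a *: u + v).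
Proof. by move=> [b ->] [c ->]; exists (a *: b + c); rewrite mulmxDl -scalemxAl. Qed.

Lemma inRZ R p q (W : 'M[k]_(p, q)) (a : R) (u : 'rV[R]_q) : inR W u -> inR W (a *: u).
Proof. by move=> h; rewrite -[_ *: _]addr0; apply: inRP => //; apply: inR0. Qed.

Lemma inRD R p q (W : 'M[k]_(p, q)) (u v : 'rV[R]_q) : inR W u -> inR W v -> inR W (u + v).
Proof. by move=> hu hv; rewrite -[u]scale1r; apply: inRP. Qed.

Lemma inR_sum R p q (W : 'M[k]_(p, q)) (I : Type) (s : seq I) (P : pred I) (F : I -> 'rV[R]_q) :
  (forall i, P i -> inR W (F i)) -> inR W (\sum_(i <- s | P i) F i).
Proof. by move=> h; apply: big_ind => //; [apply: inR0 | apply: inRD]. Qed.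

Lemma inR_sub R p p' q (W : 'M[k]_(p, q)) (W' : 'M[k]_(p', q)) (v : 'rV[R]_q) :
  (W <= W')%MS -> inR W v -> inR W' v.
Proof. by move=> /submxP[D ->] [a ->]; exists (a *m map_mx (in_alg R) D); rewrite map_mxM mulmxA. Qed.

Lemma inR_base R p q (W : 'M[k]_(p, q)) (v : 'rV[k]_q) : (v <= W)%MS -> inR W (map_mx (in_alg R) v).
Proof. by move=> /submxP[a ->]; exists (map_mx (in_alg R) a); rewrite map_mxM. Qed.

Lemma inR_linear R S p q (W : 'M[k]_(p, q)) (f : {linear R -> S}) (v : 'rV[R]_q) :
  inR W v -> inR W (map_mx f v).
Proof.
move=> [a ->]; exists (map_mx f a); apply/rowP => j; rewrite !mxE linear_sum; apply: eq_bigr => i _.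
by rewrite !mxE mulr_algr mulr_algr linearZ.
Qed.

(** Kernels commute with extension of scalars: over k, the matrix 1 - F F^+, with F^+ the
    pseudo-inverse, maps into the kernel of F and fixes it. *)
Lemma inR_ker R q q' (F : 'M[k]_(q, q')) (v : 'rV[R]_q) :
  v *m map_mx (in_alg R) F = 0 <-> inR (kermx F) v.
Proof.
split=> [h|[a ->]]; last by rewrite -mulmxA -map_mxM mulmx_ker map_mx0 mulmx0.
have : (1%:M - F *m pinvmx F <= kermx F)%MS.
  by rewrite sub_kermx mulmxBl mul1mx mulmxKpV ?subrr.
move=> /submxP[X e]; exists (v *m map_mx (in_alg R) X).
by rewrite -mulmxA -map_mxM -e map_mxB map_mx1 map_mxM mulmxBr mulmx1 mulmxA h mul0mx subr0.
Qed.

Lemma in_alg_inj R : injective (in_alg R).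
Proof. exact: (fmorph_inj (in_alg R : {rmorphism k -> R})). Qed.

Lemma inR_coker R p q (W : 'M[k]_(p, q)) (v : 'rV[R]_q) :
  v *m map_mx (in_alg R) (cokermx W) = 0 <-> inR W v.
Proof.
split=> [/inR_ker|[a ->]]; last by rewrite -mulmxA -map_mxM mulmx_coker map_mx0 mulmx0.
by apply: inR_sub; rewrite submxE mulmx_ker.
Qed.

Lemma inR_down R p q (W : 'M[k]_(p, q)) (v : 'rV[k]_q) : inR W (map_mx (in_alg R) v) -> (v <= W)%MS.
Proof.
move=> /inR_coker; rewrite -map_mxM submxE => /matrixP h; apply/eqP/matrixP => i j.
by apply: (@in_alg_inj R); have := h i j; rewrite mxE [RHS]mxE => ->; rewrite [X in in_alg R X]mxE rmorph0.
Qed.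

Lemma inR_gen R p q (W : 'M[k]_(p, q)) (v : 'rV[R]_q) : inR W v ->
  exists a : 'I_p -> R, v = \sum_i a i *: map_mx (in_alg R) (row i W).
Proof.
move=> [a ->]; exists (fun i => a 0 i); rewrite mulmx_sum_row; apply: eq_bigr => i _.
by rewrite map_row.
Qed.

End InR.

(** The dual numbers over R: the pair (x, y) stands for x + e y with e^2 = 0. *)
Definition dual (k : fieldType) (R : comAlgType k) : Type := (R * R)%type.

Section Dual.
Variables (k : fieldType) (R : comAlgType k).
HB.instance Definition _ := GRing.Lmodule.on (dual R).

Definition dmul (x y : dual R) : dual R := (x.1 * y.1, x.1 * y.2 + x.2 * y.1).
Definition done1 : dual R := (1, 0).

Let dmulA : associative dmul.
Proof.
move=> x y z; rewrite /dmul /=; congr (_, _); first by rewrite mulrA.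
by rewrite mulrDl mulrDr !mulrA addrA.
Qed.
Let dmulC : commutative dmul.
Proof.
move=> [a b] [c d]; rewrite /dmul /= [a * c]mulrC [a * d]mulrC [b * c]mulrC.
by rewrite [d * a + _]addrC.
Qed.
Let dmul1 : left_id done1 dmul.
Proof. by move=> [a b]; rewrite /dmul /= !mul1r mul0r addr0. Qed.
Let dmulDl : left_distributive dmul +%R.
Proof. by move=> x y z; rewrite /dmul /=; congr (_, _); rewrite /= !mulrDl // addrACA. Qed.
Let done_neq0 : done1 != 0.
Proof. by apply/eqP => -[/eqP]; rewrite oner_eq0. Qed.
HB.instance Definition _ := GRing.Zmodule_isComNzRing.Build (dual R) dmulA dmulC dmul1 dmulDl done_neq0.
Let dscaleAl (a : k) (x y : dual R) : a *: (x * y) = (a *: x : dual R) * y.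
Proof.
transitivity ((a *: (x.1 * y.1), a *: (x.1 * y.2 + x.2 * y.1)) : dual R); first by [].
by rewrite scalerDr !scalerAl.
Qed.
HB.instance Definition _ := GRing.Lmodule_isLalgebra.Build k (dual R) dscaleAl.
HB.instance Definition _ := GRing.Lalgebra_isComAlgebra.Build k (dual R).

Lemma dual_mulE (x y : dual R) : x * y = (x.1 * y.1, x.1 * y.2 + x.2 * y.1).
Proof. by []. Qed.

Section Lift.
Variable D : {linear R -> R}.
Hypothesis DM : forall x y, D (x * y) = D x * y + x * D y.
Definition dlift (x : R) : dual R := (x, D x).
Lemma dlift_lrmorphism : exists f : {lrmorphism R -> dual R}, forall x, f x = (x, D x).
Proof.
have D1 : D 1 = 0 by apply: (@addrI _ (D 1)); rewrite addr0 -[in RHS](mulr1 1) DM mulr1 mul1r.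
have l : linear dlift by move=> a x y; rewrite /dlift linearP.
have m : monoid_morphism dlift.
  by split=> [|x y]; rewrite /dlift ?D1 // DM dual_mulE /= addrC.
pose f : {lrmorphism R -> dual R} := HB.pack dlift (GRing.isLinear.Build _ _ _ _ _ l)
   (GRing.isMonoidMorphism.Build _ _ _ m).
by exists f.
Qed.
End Lift.

Lemma dual_const : exists f : {lrmorphism R -> dual R}, forall x, f x = (x, 0).
Proof.
have h (x y : R) : (\0 : {linear R -> R}) (x * y) = \0 x * y + x * (\0 : {linear R -> R}) y.
  by rewrite /= mul0r mulr0 addr0.
have [f hf] := dlift_lrmorphism h; by exists f.
Qed.

End Dual.

Section Gradients.
Variables (k : fieldType) (N : nat).
Implicit Types (R S : comAlgType k).

(** The differential of t at M in direction X, that is, the e-part of t at M + e X; see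
    [peval_dual]. *)
Fixpoint dval R (M X : 'M[R]_N) (t : pexp k N) : R :=
  match t with
  | PC a => 0
  | PX i j => X i j
  | PD p q => dval M X p + dval M X q
  | PM p q => dval M X p * peval M q + peval M p * dval M X q
  end.

Lemma dval_derivation R (D : {linear R -> R}) (DM : forall x y, D (x * y) = D x * y + x * D y) (M : 'M[R]_N) t :
  D (peval M t) = dval M (map_mx D M) t.
Proof.
have D1 : D 1 = 0 by apply: (@addrI _ (D 1)); rewrite addr0 -[in RHS](mulr1 1) DM mulr1 mul1r.
elim: t => [a|i j|p IHp q IHq|p IHp q IHq] /=.
- by rewrite linearZ /= D1 scaler0.
- by rewrite mxE.
- by rewrite linearD IHp IHq.
- by rewrite DM IHp IHq.
Qed.

Lemma dval_linear R (M : 'M[R]_N) t (a : R) X Y : dval M (a *: X + Y) t = a * dval M X t + dval M Y t.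
Proof.
elim: t => [b|i j|p IHp q IHq|p IHp q IHq] /=.
- by rewrite mulr0 addr0.
- by rewrite !mxE.
- by rewrite IHp IHq mulrDr addrACA.
- by rewrite IHp IHq mulrDl mulrDr mulrDr addrACA !mulrA [_ * a]mulrC.
Qed.

Lemma peval_dual R (M X : 'M[R]_N) t :
  peval (\matrix_(i, j) ((M i j, X i j) : dual R)) t = (peval M t, dval M X t).
Proof.
elim: t => [a|i j|p IHp q IHq|p IHp q IHq] /=.
- by congr (_, _); rewrite /= scaler0.
- by rewrite mxE.
- by rewrite IHp IHq.
- by rewrite IHp IHq dual_mulE /= addrC.
Qed.

Fixpoint val1 (t : pexp k N) : k :=
  match t with
  | PC a => a
  | PX i j => (i == j)%:R
  | PD p q => val1 p + val1 q
  | PM p q => val1 p * val1 q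
  end.

Lemma peval1 R t : peval (1%:M : 'M[R]_N) t = (val1 t)%:A.
Proof.
elim: t => [a|i j|p IHp q IHq|p IHp q IHq] //=.
- by rewrite mxE scaler_nat.
- by rewrite IHp IHq scalerDl.
- by rewrite IHp IHq -scalerAl mul1r scalerA.
Qed.

Fixpoint grad (t : pexp k N) : 'M[k]_N :=
  match t with
  | PC a => 0
  | PX i j => delta_mx i j
  | PD p q => grad p + grad q
  | PM p q => val1 q *: grad p + val1 p *: grad q
  end.

Lemma dval1 R (X : 'M[R]_N) t :
  dval 1%:M X t = (mxvec X *m map_mx (in_alg R) (mxvec (grad t))^T) 0 0.
Proof.
have h (Y : 'M[k]_N) : (mxvec X *m map_mx (in_alg R) (mxvec Y)^T) 0 0 = \sum_i \sum_j X i j * (Y i j)%:A.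
  rewrite pair_big /= mxE (reindex _ (curry_mxvec_bij N N)) /=.
  by apply: eq_bigr => -[i j] _ /=; rewrite !mxE !mxvecE.
rewrite h; elim: t => [a|i j|p IHp q IHq|p IHp q IHq] /=.
- by rewrite big1 // => i _; rewrite big1 // => j _; rewrite mxE scale0r mulr0.
- rewrite (bigD1 i) //= (bigD1 j) //= mxE !eqxx scale1r mulr1 !big1 ?addr0 // => [i' ni|j' nj].
    by rewrite big1 // => j' _; rewrite mxE (negPf ni) scale0r mulr0.
  by rewrite mxE (negPf nj) andbF scale0r mulr0.
- rewrite IHp IHq -big_split; apply: eq_bigr => i _ /=; rewrite -big_split; apply: eq_bigr => j _ /=.
  by rewrite mxE scalerDl mulrDr.
rewrite IHp IHq !peval1 mulr_algr mulr_algl !scaler_sumr -big_split; apply: eq_bigr => i _ /=.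
rewrite !scaler_sumr -big_split; apply: eq_bigr => j _ /=.
by rewrite !mxE scalerDl -!scalerA mulrDr -!scalerAr.
Qed.

Fixpoint psum (s : seq (k * pexp k N)) : pexp k N :=
  if s is (a, t) :: s' then PD (PM (PC N a) t) (psum s') else PC N 0.

Lemma peval_psum R (M : 'M[R]_N) s : peval M (psum s) = \sum_(p <- s) p.1 *: peval M p.2.
Proof.
elim: s => [|[a t] s IH] /=; first by rewrite big_nil scale0r.
by rewrite big_cons IH mulr_algl.
Qed.

(** Derivative along the right-invariant vector field M -> X M, again as an expression, so that it
    can be iterated. *)
Fixpoint pderiv (X : 'M[k]_N) (t : pexp k N) : pexp k N :=
  match t with
  | PC a => PC N 0
  | PX i j => psum [seq (X i l, PX k l j) | l <- enum 'I_N]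
  | PD p q => PD (pderiv X p) (pderiv X q)
  | PM p q => PD (PM (pderiv X p) q) (PM p (pderiv X q))
  end.

Lemma peval_pderiv R (X : 'M[k]_N) (M : 'M[R]_N) t :
  peval M (pderiv X t) = dval M (map_mx (in_alg R) X *m M) t.
Proof.
elim: t => [a|i j|p IHp q IHq|p IHp q IHq] /=.
- by rewrite scale0r.
- rewrite peval_psum big_map big_enum /= mxE; apply: eq_bigr => l _.
  by rewrite !mxE mulr_algl.
- by rewrite IHp IHq.
- by rewrite IHp IHq.
Qed.

End Gradients.

Section LieAlgebra.
Variables (k : fieldType) (G : groupFunctor k) (n : nat) (r : linear_rep G n.+1).
Hypothesis fc : faithful_closed r.
Local Notation N := n.+1.
Implicit Types (R S : comAlgType k).

Definition inG R (M : 'M[R]_N) := exists g : G R, r R g = M.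
Definition Inull t := forall S (g : G S), peval (r S g) t = 0.

Lemma inGP R (M : 'M[R]_N) : inG M <-> forall t, Inull t -> peval M t = 0.
Proof. by split=> [[g <-] t ht|h]; [apply: ht | apply: fc.2]. Qed.

Lemma repV R (g : G R) : r R (g^-1)%g *m r R g = 1%:M.
Proof. by rewrite -rep_appM mulVg rep_app1. Qed.
Lemma repVr R (g : G R) : r R g *m r R (g^-1)%g = 1%:M.
Proof. by rewrite -rep_appM mulgV rep_app1. Qed.

Lemma inG1 R : inG (1%:M : 'M[R]_N). Proof. by exists 1%g; rewrite rep_app1. Qed.
Lemma inGM R (A B : 'M[R]_N) : inG A -> inG B -> inG (A *m B).
Proof. by move=> [g <-] [h <-]; exists (g * h)%g; rewrite rep_appM. Qed.
Lemma inG_map R S (f : {lrmorphism R -> S}) (A : 'M[R]_N) : inG A -> inG (map_mx f A).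
Proof. by move=> [g <-]; exists (fmap G f g); rewrite rep_nat. Qed.

(** The tangent space at 1 is cut out by the gradients of the equations of G. These have
    coefficients in k, so its formation commutes with extension to R. *)
Lemma gg_exists : exists W : 'M[k]_(N * N), forall R (X : 'M[R]_N),
  inR W (mxvec X) <-> forall t, Inull t -> dval 1%:M X t = 0.
Proof.
have [||D hD] := @subspace_mx k (N * N) (fun v => exists2 t, Inull t & mxvec (grad t) = v).
- by exists (PC N 0); [move=> S g /=; rewrite scale0r | rewrite /= linear0].
- move=> a u v [t ht <-] [t' ht' <-]; exists (PD (PM (PC N a) t) t').
    by move=> S g /=; rewrite ht ht' mulr0 addr0.
  rewrite /= linearD scaler0 add0r linearZ //.
exists (kermx D^T) => R X; rewrite -inR_ker; split=> [h t ht|h].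
  have /submxP[a e] : (mxvec (grad t) <= D)%MS by apply/hD; exists t.
  by rewrite dval1 e trmx_mul map_mxM mulmxA h mul0mx mxE.
apply/rowP => j; have [t ht e] : exists2 t, Inull t & mxvec (grad t) = row j D by apply/hD; apply: row_sub.
have := h t ht; rewrite dval1 e mxE => h0; rewrite mxE [RHS]mxE -[RHS]h0.
by apply: eq_bigr => i _; rewrite !mxE.
Qed.

Definition gg : 'M[k]_(N * N) := sval (cid gg_exists).

Lemma ggP R (X : 'M[R]_N) : inR gg (mxvec X) <-> forall t, Inull t -> dval 1%:M X t = 0.
Proof. by rewrite /gg; case: cid => W h /=. Qed.

Definition dualmx R (M X : 'M[R]_N) : 'M[dual R]_N := \matrix_(i, j) ((M i j, X i j) : dual R).

Lemma dualmxM R (M X M' X' : 'M[R]_N) :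
  dualmx M X *m dualmx M' X' = dualmx (M *m M') (M *m X' + X *m M').
Proof.
apply/matrixP => i j; rewrite !mxE.
rewrite [LHS]surjective_pairing; congr (_, _).
  rewrite (big_morph (fst : dual R -> R) (id1 := 0) (op1 := +%R)) //.
  by apply: eq_bigr => l _; rewrite !mxE.
rewrite (big_morph (snd : dual R -> R) (id1 := 0) (op1 := +%R)) //= -big_split /=.
by apply: eq_bigr => l _; rewrite !mxE.
Qed.

Lemma inG_dual R (M X : 'M[R]_N) :
  inG (dualmx M X) <-> inG M /\ forall t, Inull t -> dval M X t = 0.
Proof.
split=> [/inGP h|[/inGP h1 h2]].
  split; first by apply/inGP => t /h; rewrite peval_dual => -[].
  by move=> t /h; rewrite peval_dual => -[].
by apply/inGP => t ht; rewrite peval_dual h1 // h2.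
Qed.

Lemma inG_tangent R (X : 'M[R]_N) : inR gg (mxvec X) <-> inG (dualmx 1%:M X).
Proof.
rewrite inG_dual ggP; split=> [h|[]] //; split=> //; exact: inG1.
Qed.

Lemma dual_const_mx R (M : 'M[R]_N) : inG M -> inG (dualmx M 0).
Proof.
move=> hM; have [f hf] := dual_const R; have := inG_map f hM.
by congr inG; apply/matrixP => i j; rewrite !mxE hf.
Qed.

Lemma tangent_translate R (X M : 'M[R]_N) t : inR gg (mxvec X) -> inG M -> Inull t ->
  dval M (X *m M) t = 0.
Proof.
move=> /inG_tangent hX /dual_const_mx hM ht.
by have := inGM hX hM; rewrite dualmxM mul1mx mulmx0 add0r => /inG_dual[_]; apply.
Qed.

Lemma pderiv_null (X : 'M[k]_N) t : (mxvec X <= gg)%MS -> Inull t -> Inull (pderiv X t).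
Proof.
move=> hX ht S g; rewrite peval_pderiv tangent_translate //; last by exists g.
by rewrite -map_mxvec; apply: inR_base.
Qed.

Definition Ad R (g : G R) (X : 'M[R]_N) := r R g *m X *m r R (g^-1)%g.

Lemma Ad_linear R (g : G R) : linear (Ad g).
Proof. by move=> a X Y; rewrite /Ad mulmxDr mulmxDl -scalemxAr -scalemxAl. Qed.
HB.instance Definition _ R (g : G R) := GRing.isLinear.Build R _ _ _ (Ad g) (Ad_linear g).

Lemma AdM R (g : G R) X Y : Ad g (X *m Y) = Ad g X *m Ad g Y.
Proof. by rewrite /Ad !mulmxA -[_ *m r R (g^-1)%g *m r R g]mulmxA repV mulmx1. Qed.

Lemma Ad_gg R (g : G R) (X : 'M[R]_N) : inR gg (mxvec X) -> inR gg (mxvec (Ad g X)).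
Proof.
move=> /inG_tangent hX; apply/inG_tangent.
have hg : inG (dualmx (r R g) 0) by apply: dual_const_mx; exists g.
have hg' : inG (dualmx (r R (g^-1)%g) 0) by apply: dual_const_mx; exists (g^-1)%g.
have := inGM (inGM hg hX) hg'; rewrite !dualmxM mulmx1 mul0mx addr0 mulmx0 add0r.
by rewrite repVr.
Qed.

(** D defines a morphism from R to its dual numbers, sending g to g + e D g; multiplied by the
    inverse of g, this becomes the tangent vector 1 + e (D g) g^-1. *)
Lemma log_derivative R (D : {linear R -> R}) (DM : forall x y, D (x * y) = D x * y + x * D y) (g : G R) :
  inR gg (mxvec (map_mx D (r R g) *m r R (g^-1)%g)).
Proof.
have [f hf] := dlift_lrmorphism DM; apply/inG_tangent.
have h : inG (dualmx (r R g) (map_mx D (r R g))).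
  have : inG (map_mx f (r R g)) by apply: inG_map; exists g.
  by congr inG; apply/matrixP => i j; rewrite !mxE hf.
have hg' : inG (dualmx (r R (g^-1)%g) 0) by apply: dual_const_mx; exists (g^-1)%g.
by have := inGM h hg'; rewrite dualmxM mulmx0 add0r repVr.
Qed.

(* The functions f(g), for f in the ideal of G, span a D-stable subspace that vanishes
   under ev0, hence is 0. *)
Lemma inG_ode R S (D : {linear R -> R}) (DM : forall x y, D (x * y) = D x * y + x * D y)
    (ev0 : {lrmorphism R -> S}) (sep : forall f, (forall m, ev0 (iter m D f) = 0) -> f = 0)
    (M Y : 'M[R]_N) :
  map_mx D M = Y *m M -> inR gg (mxvec Y) -> inG (map_mx ev0 M) -> inG M.
Proof.
move=> eM /inR_gen[y ey] /inGP h0; apply/inGP => t ht; apply: sep.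
have eY : Y = \sum_i y i *: map_mx (in_alg R) (vec_mx (row i gg)).
  apply: (can_inj mxvecK); rewrite ey linear_sum; apply: eq_bigr => i _.
  by rewrite linearZ /= -map_mxvec vec_mxK.
suff h m f : (exists s : seq {p : R * pexp k N | `[< Inull p.2 >]}, f = \sum_(p <- s) (val p).1 * peval M (val p).2) ->
    ev0 (iter m D f) = 0.
  move=> m; apply: h; have ht' : `[< Inull ((1 : R), t).2 >] by apply/asboolP.
  exists [:: exist (fun p : R * pexp k N => `[< Inull p.2 >]) (1, t) ht'].
  by rewrite big_seq1 mul1r.
elim: m f => [|m IH] f [s ->].
  rewrite /= rmorph_sum big1 // => -[[a t'] /= /asboolP ht'] _.
  by rewrite rmorphM /= peval_map h0 // mulr0.
rewrite iterSr; apply: IH.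
have hs (p : {p : R * pexp k N | `[< Inull p.2 >]}) : exists s' : seq {p : R * pexp k N | `[< Inull p.2 >]},
    D ((val p).1 * peval M (val p).2) = \sum_(p <- s') (val p).1 * peval M (val p).2.
  case: p => -[a t'] /= ht'; have ht0 := ht'; move/asboolP: ht0 => /= ht0.
  have hi i : `[< Inull (a * y i, pderiv (vec_mx (row i gg)) t').2 >].
    by apply/asboolP; apply: pderiv_null => //; rewrite vec_mxK row_sub.
  exists (exist (fun p : R * pexp k N => `[< Inull p.2 >]) (D a, t') ht' ::
     [seq exist (fun p : R * pexp k N => `[< Inull p.2 >]) _ (hi i) | i <- enum 'I_(N * N)]).
  rewrite big_cons /= big_map big_enum /= DM; congr (_ + _).
  rewrite (dval_derivation DM) eM eY mulmx_suml.
  have -> : forall F : 'I_(N * N) -> 'M[R]_N, dval M (\sum_i F i) t' = \sum_i dval M (F i) t'.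
    move=> F; apply: (big_morph (fun X => dval M X t')) => [X Z|].
      by have := dval_linear M t' 1 X Z; rewrite scale1r mul1r.
    by have := dval_linear M t' (-1) 0 0; rewrite scaler0 addr0 mulN1r addNr.
  rewrite mulr_sumr; apply: eq_bigr => i _; rewrite -scalemxAl.
  have -> : forall (b : R) X, dval M (b *: X) t' = b * dval M X t'.
    move=> b X; have := dval_linear M t' b X 0; rewrite addr0 => ->.
    by have := dval_linear M t' (-1) 0 0; rewrite scaler0 addr0 mulN1r addNr => ->; rewrite addr0.
  by rewrite mulrA peval_pderiv.
elim: s => [|p s [s' es']]; first by exists [::]; rewrite !big_nil linear0.
have [s'' e''] := hs p; exists (s'' ++ s'); rewrite big_cons linearD big_cat /= es'.
by rewrite e''.
Qed.

End LieAlgebra.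

(** * Commutative unipotent subgroups *)

Section Exponential.
Variables (k : fieldType) (n : nat).
Hypothesis ch0 : [pchar k] =i pred0.

Section Algebra.
Variable R : comAlgType k.
Implicit Types X Y : 'M[R]_n.+1.

Definition invfact m : R := ((m`!)%:R^-1 : k)%:A.

Definition expm T X : 'M[R]_n.+1 := \sum_(m < T) invfact m *: X ^+ m.

Lemma triangular_exchange (V : zmodType) (F : nat -> nat -> V) T :
  (forall i j, (T <= i + j)%N -> F i j = 0) ->
  \sum_(m < T) \sum_(i < m.+1) F (m - i)%N i = \sum_(i < T) \sum_(j < T) F j i.
Proof.
move=> F0.
transitivity (\sum_(m < T) \sum_(i < T | (i <= m)%N) F (m - i)%N i).
  by apply: eq_bigr => m _; rewrite (big_ord_widen T (fun i => F (m - i)%N i)).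
rewrite (exchange_big_dep predT) //=; apply: eq_bigr => i _.
have lei : (i <= T)%N by apply: ltnW.
rewrite -(big_mkord (fun m => (i <= m)%N) (fun m => F (m - i)%N i)) -(big_mkord predT (fun j => F j i)).
rewrite (big_cat_nat (n := i)) // big_nat_cond big1 ?add0r; last first.
  by move=> m; rewrite andbC => /andP[h] /andP[_]; rewrite ltnNge h.
rewrite [RHS](big_cat_nat (n := (T - i)%N)) ?leq_subr //=.
rewrite [X in _ = _ + X]big_nat_cond [X in _ = _ + X]big1 ?addr0; last first.
  by move=> j /andP[/andP[h _] _]; apply: F0; rewrite addnC -leq_subLR.
rewrite -{1}[nat_of_ord i]/(0 + i)%N big_addn big_nat_cond [RHS]big_nat_cond.
by rewrite add0r; apply: eq_big => j; rewrite ?leq_addl ?addnK.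
Qed.

(** Exact despite the truncation: the products left out vanish by hypothesis. *)
Lemma expmD T X Y : GRing.comm X Y -> (forall i j, (T <= i + j)%N -> X ^+ i * Y ^+ j = 0) ->
  expm T (X + Y) = expm T X * expm T Y.
Proof.
move=> cXY XY0.
pose F i j := (invfact i * invfact j) *: (X ^+ i * Y ^+ j).
transitivity (\sum_(m < T) \sum_(i < m.+1) F (m - i)%N i).
  apply: eq_bigr => m _; rewrite exprDn_comm // scaler_sumr; apply: eq_bigr => i _.
  rewrite -scaler_nat scalerA; congr (_ *: _).
  have lei : (i <= m)%N by rewrite -ltnS.
  rewrite /invfact -[in LHS](scaler_nat ('C(m, i)) (1 : R)) -!scalerAl -!scalerAr !mul1r !scalerA.
  congr (_ *: _); rewrite -(bin_fact lei) !natrM !invfM.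
  rewrite mulrAC mulVf ?mul1r; first by rewrite mulrC.
  by rewrite (pcharf0P k).1 // -lt0n bin_gt0.
rewrite triangular_exchange; last by move=> i j h; rewrite /F XY0 // scaler0.
rewrite exchange_big /expm mulr_suml; apply: eq_bigr => i _; rewrite mulr_sumr; apply: eq_bigr => j _.
by rewrite -scalerAl -scalerAr scalerA.
Qed.

Lemma expm0 T : expm T.+1 0 = 1.
Proof.
rewrite /expm big_ord_recl expr0 /invfact fact0 invr1 !scale1r big1 ?addr0 // => i _.
by rewrite expr0n scaler0.
Qed.

End Algebra.

Lemma expm_map (R S : comAlgType k) (f : {lrmorphism R -> S}) T (X : 'M[R]_n.+1) :
  map_mx f (expm T X) = expm T (map_mx f X).
Proof.
rewrite /expm map_mx_sum; apply: eq_bigr => m _; rewrite map_mxZ rmorphXn /=.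
by congr (_ *: _); rewrite /invfact rmorph_alg.
Qed.

Section Words.
Variables (p : nat) (W : 'M[k]_(p, n.+1 * n.+1)) (T : nat).
Hypothesis nW : nilw W T.

Lemma nil_words (R : comAlgType k) (s : seq 'M[R]_n.+1) :
  (forall X, X \in s -> inR W (mxvec X)) -> (T <= size s)%N -> \prod_(X <- s) X = 0.
Proof.
move=> hs ls.
suff h (t : seq 'M[k]_n.+1) : all (memW W) t -> (T <= size t + size s)%N ->
    (\prod_(X <- t) map_mx (in_alg R) X) * \prod_(X <- s) X = 0.
  by have := h [::] isT ls; rewrite big_nil mul1r.
elim: s t hs {ls} => [|Y s IH] t hs ht lt.
  rewrite big_nil mulr1; have := nilw_le _ nW; rewrite addn0 in lt; move=> /(_ _ lt t ht erefl) e.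
  have := congr1 (map_mx (in_alg R)) e; rewrite map_mx0 => <-.
  elim: t {ht lt e} => [|Z t IHt]; first by rewrite !big_nil map_mx1.
  by rewrite !big_cons IHt -[RHS]/(map_mx _ (_ *m _)) map_mxM.
have [a ea] := inR_gen (hs Y (mem_head _ _)).
have -> : Y = \sum_i a i *: map_mx (in_alg R) (vec_mx (row i W)).
  apply: (can_inj mxvecK); rewrite ea linear_sum; apply: eq_bigr => i _.
  by rewrite linearZ /= -map_mxvec vec_mxK.
rewrite big_cons mulrA mulr_sumr mulr_suml big1 // => i _.
rewrite -scalerAr -scalerAl.
have := IH (t ++ [:: vec_mx (row i W)]); rewrite big_cat big_seq1 /=.
move=> ->; rewrite ?scaler0 //.
- by move=> X hX; apply: hs; rewrite inE hX orbT.
- by rewrite all_cat ht /= /memW vec_mxK row_sub.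
- by rewrite size_cat addn1 addSn -addnS.
Qed.

Lemma nil_pow (R : comAlgType k) (X Y : 'M[R]_n.+1) i j : inR W (mxvec X) -> inR W (mxvec Y) ->
  (T <= i + j)%N -> X ^+ i * Y ^+ j = 0.
Proof.
move=> hX hY h; have := @nil_words R (nseq i X ++ nseq j Y).
rewrite big_cat !big_nseq !iter_mulr_1 => -> //.
  by move=> Z; rewrite mem_cat !mem_nseq => /orP[] /andP[_ /eqP ->].
by rewrite size_cat !size_nseq.
Qed.

End Words.
End Exponential.

HB.instance Definition _ (k : fieldType) n := gen_eqMixin (pexp k n).
HB.instance Definition _ (k : fieldType) n := gen_choiceMixin (pexp k n).

(* The coordinate ring of a family of matrices: polynomial expressions up to
   equality of all their values. *)
Section Semantic.
Variables (K : fieldType) (N : nat) (P : forall R : comAlgType K, 'M[R]_N -> Prop).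

Definition pequiv (s t : pexp K N) : bool :=
  `[< forall (R : comAlgType K) (M : 'M[R]_N), P M -> peval M s = peval M t >].

Lemma pequiv_refl : reflexive pequiv. Proof. by move=> s; apply/asboolP. Qed.
Lemma pequiv_sym : symmetric pequiv.
Proof. by move=> s t; apply/asboolP/asboolP => h R M /h. Qed.
Lemma pequiv_trans : transitive pequiv.
Proof. by move=> s t u /asboolP h1 /asboolP h2; apply/asboolP => R M hM; rewrite h1 // h2. Qed.
Canonical pequiv_equiv := EquivRel pequiv pequiv_refl pequiv_sym pequiv_trans.

(** The base point [M0] keeps 1 different from 0 in the quotient. *)
Definition cring (M0 : {M0 : 'M[K^o]_N | P M0}) := {eq_quot pequiv}.

Section Ring.
Variable M0 : {M0 : 'M[K^o]_N | P M0}.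
Local Notation A := (cring M0).
HB.instance Definition _ := Choice.on A.

Definition qev (R : comAlgType K) (M : 'M[R]_N) (x : A) : R := peval M (generic_quotient.repr x).

Lemma qev_pi (R : comAlgType K) (M : 'M[R]_N) t : P M -> qev M (\pi_A t) = peval M t.
Proof.
move=> hM; have /eqmodP/asboolP h : \pi_A (generic_quotient.repr (\pi_A t)) = \pi_A t by rewrite reprK.
exact: h.
Qed.

Lemma cringP (x y : A) : (forall (R : comAlgType K) (M : 'M[R]_N), P M -> qev M x = qev M y) -> x = y.
Proof. by move=> h; rewrite -[x]reprK -[y]reprK; apply/eqmodP/asboolP. Qed.

Definition qadd (x y : A) : A := \pi_A (PD (generic_quotient.repr x) (generic_quotient.repr y)).
Definition qmul (x y : A) : A := \pi_A (PM (generic_quotient.repr x) (generic_quotient.repr y)).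
Definition qscale (c : K) (x : A) : A := \pi_A (PM (PC N c) (generic_quotient.repr x)).

Section Ev.
Variables (R : comAlgType K) (M : 'M[R]_N).
Hypothesis hM : P M.
Lemma qevD x y : qev M (qadd x y) = qev M x + qev M y. Proof. exact: qev_pi. Qed.
Lemma qevM x y : qev M (qmul x y) = qev M x * qev M y. Proof. exact: qev_pi. Qed.
Lemma qevZ c x : qev M (qscale c x) = c *: qev M x.
Proof. by rewrite qev_pi //= mulr_algl. Qed.
Lemma qevC c : qev M (\pi_A (PC N c)) = c%:A. Proof. exact: qev_pi. Qed.
End Ev.

Let qaddA : associative qadd.
Proof. by move=> x y z; apply: cringP => R M hM; rewrite !qevD // addrA. Qed.
Let qaddC : commutative qadd.
Proof. by move=> x y; apply: cringP => R M hM; rewrite !qevD // addrC. Qed.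
Let qadd0 : left_id (\pi_A (PC N 0)) qadd.
Proof. by move=> x; apply: cringP => R M hM; rewrite qevD // qevC // scale0r add0r. Qed.
Let qaddN : left_inverse (\pi_A (PC N 0)) (qscale (-1)) qadd.
Proof. by move=> x; apply: cringP => R M hM; rewrite qevD // qevZ // qevC // scale0r scaleN1r addNr. Qed.
HB.instance Definition _ := GRing.isZmodule.Build A qaddA qaddC qadd0 qaddN.

Let qmulA : associative qmul.
Proof. by move=> x y z; apply: cringP => R M hM; rewrite !qevM // mulrA. Qed.
Let qmulC : commutative qmul.
Proof. by move=> x y; apply: cringP => R M hM; rewrite !qevM // mulrC. Qed.
Let qmul1 : left_id (\pi_A (PC N 1)) qmul.
Proof. by move=> x; apply: cringP => R M hM; rewrite qevM // qevC // scale1r mul1r. Qed.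
Let qmulDl : left_distributive qmul qadd.
Proof. by move=> x y z; apply: cringP => R M hM; rewrite qevM // !qevD // !qevM // mulrDl. Qed.
Let qone_neq0 : \pi_A (PC N 1) != \pi_A (PC N 0).
Proof.
apply/eqP => e; have := congr1 (qev (sval M0)) e; rewrite !(qevC (svalP M0)).
by rewrite scale1r scale0r => /eqP; rewrite oner_eq0.
Qed.
HB.instance Definition _ := GRing.Zmodule_isComNzRing.Build A qmulA qmulC qmul1 qmulDl qone_neq0.

Let qscaleA a b x : qscale a (qscale b x) = qscale (a * b) x.
Proof. by apply: cringP => R M hM; rewrite !qevZ // scalerA. Qed.
Let qscale1 : left_id 1 qscale.
Proof. by move=> x; apply: cringP => R M hM; rewrite qevZ // scale1r. Qed.
Let qscaleDr : right_distributive qscale +%R.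
Proof. by move=> a x y; apply: cringP => R M hM; rewrite qevZ // !qevD // !qevZ // scalerDr. Qed.
Let qscaleDl x : {morph qscale^~ x : a b / a + b}.
Proof. by move=> a b; apply: cringP => R M hM; rewrite qevD // !qevZ // scalerDl. Qed.
HB.instance Definition _ := GRing.Zmodule_isLmodule.Build K A qscaleA qscale1 qscaleDr qscaleDl.
Let qscaleAl (a : K) (x y : A) : a *: (x * y) = (a *: x : A) * y.
Proof. by apply: cringP => R M hM; rewrite qevZ // !qevM // qevZ // scalerAl. Qed.
HB.instance Definition _ := GRing.Lmodule_isLalgebra.Build K A qscaleAl.
HB.instance Definition _ := GRing.Lalgebra_isComAlgebra.Build K A.

Lemma qev_lrmorphism (R : comAlgType K) (M : 'M[R]_N) : P M ->
  exists f : {lrmorphism A -> R}, forall x, f x = qev M x.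
Proof.
move=> hM; have l : linear (qev M : A -> R) by move=> c x y; rewrite qevD // qevZ.
have m : monoid_morphism (qev M : A -> R) by split=> [|x y]; rewrite ?qevC ?scale1r // qevM.
pose f : {lrmorphism A -> R} := HB.pack (qev M) (GRing.isLinear.Build _ _ _ _ _ l)
  (GRing.isMonoidMorphism.Build _ _ _ m).
by exists f.
Qed.

Definition generic_mx : 'M[A]_N := \matrix_(i, j) \pi_A (PX K i j).

Lemma qev_generic (R : comAlgType K) (M : 'M[R]_N) : P M -> map_mx (qev M) generic_mx = M.
Proof. by move=> hM; apply/matrixP => i j; rewrite !mxE qev_pi. Qed.

Lemma peval_generic t : peval generic_mx t = \pi_A t.
Proof.
apply: cringP => R M hM; have [f hf] := qev_lrmorphism hM.
rewrite -hf peval_map qev_pi //; congr (peval _ t).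
by rewrite -[RHS]qev_generic //; apply/matrixP => i j; rewrite !mxE hf.
Qed.

Lemma cring_hom_eq (R : comAlgType K) (f g : {lrmorphism A -> R}) :
  map_mx f generic_mx = map_mx g generic_mx -> f =1 g.
Proof. by move=> e x; rewrite -[x]reprK -peval_generic !peval_map e. Qed.

End Ring.
End Semantic.

Section BaseChange.
Variables (k K : fieldType) (i : {rmorphism k -> K}) (G : groupFunctor k) (n : nat) (r : linear_rep G n.+1).
Hypothesis fc : faithful_closed r.

Definition bcP (R : comAlgType K) (M : 'M[R]_n.+1) := inG r (M : 'M[restr i R]_n.+1).

Lemma bcP1 : bcP (1%:M : 'M[K^o]_n.+1).
Proof. exact: inG1. Qed.

Definition bcM0 : {M0 : 'M[K^o]_n.+1 | @bcP K^o M0} := exist _ _ bcP1.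

(** The coordinate ring of the base change is taken as the polynomial functions, with coefficients
    in K, on its points, rather than as a tensor product with K; the generic matrix is then the
    universal point. *)
Definition bc_ring : comAlgType K := cring (P := @bcP) bcM0.

Lemma bc_generic : bcP (generic_mx (P := @bcP) bcM0 : 'M[bc_ring]_n.+1).
Proof.
apply/(inGP fc) => t ht; apply: cringP => R M hM.
have [f hf] := qev_lrmorphism (P := @bcP) bcM0 hM.
rewrite -!hf rmorph0.
transitivity (peval (map_mx (restr_map i f) (generic_mx (P := @bcP) bcM0 : 'M[restr i bc_ring]_n.+1)) t).
  exact: (peval_map (restr_map i f : {lrmorphism restr i bc_ring -> restr i R})).
have -> : map_mx (restr_map i f) (generic_mx (P := @bcP) bcM0 : 'M[restr i bc_ring]_n.+1) = (M : 'M[restr i R]_n.+1).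
  rewrite -[RHS](qev_generic (P := @bcP) bcM0 hM).
  by apply/matrixP => a b; rewrite !mxE /restr_map hf.
by have /(inGP fc)/(_ t ht) := hM.
Qed.

Definition bc_point : base_change i G bc_ring := sval (cid bc_generic).

Lemma bc_pointE : (r (restr i bc_ring) bc_point : 'M[bc_ring]_n.+1) = generic_mx (P := @bcP) bcM0.
Proof. by rewrite /bc_point; case: cid. Qed.

Lemma bc_fmap (R : comAlgType K) (f : {lrmorphism bc_ring -> R}) :
  r (restr i R) (fmap (base_change i G) f bc_point) =
  map_mx f (generic_mx (P := @bcP) bcM0 : 'M[bc_ring]_n.+1).
Proof. by rewrite -bc_pointE [LHS]rep_nat. Qed.

Lemma bc_represents : represents bc_point.
Proof.
move=> R g; have hM : @bcP R (r (restr i R) g) by exists g.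
have [f hf] := qev_lrmorphism (P := @bcP) bcM0 hM; exists f.
have ef : map_mx f (generic_mx (P := @bcP) bcM0 : 'M[bc_ring]_n.+1) = r (restr i R) g.
  by rewrite -[RHS](qev_generic (P := @bcP) bcM0 hM); apply/matrixP => a b; rewrite !mxE hf.
split; first by apply: fc.1; rewrite bc_fmap.
move=> f' e'; apply: cring_hom_eq; rewrite ef -e'.
by rewrite bc_fmap.
Qed.

End BaseChange.

(** * Vector groups, their coordinate rings and their representations *)

Definition addg (V : zmodType) : Type := V.
HB.instance Definition _ (V : zmodType) := Choice.on (addg V).
HB.instance Definition _ (V : zmodType) :=
  isGroup.Build (addg V) (@addrA V) (@add0r V) (@addr0 V) (@addNr V) (@addrN V).

Section VectorGroup.
Variables (K : fieldType) (d : nat).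

Definition vg_points (R : comAlgType K) : groupType := addg 'rV[R]_d.
Definition vg_map (R S : comAlgType K) (f : {lrmorphism R -> S}) (v : vg_points R) : vg_points S :=
  map_mx f (v : 'rV[R]_d).
Fact vg_mapM (R S : comAlgType K) (f : {lrmorphism R -> S}) :
  {morph vg_map f : x y / (x * y)%g}.
Proof. by move=> x y; exact: map_mxD. Qed.
Fact vg_map_id (R : comAlgType K) (f : {lrmorphism R -> R}) : f =1 id -> vg_map f =1 id.
Proof. by move=> f1 v; apply/rowP => j; rewrite mxE f1. Qed.
Fact vg_map_comp (R S T : comAlgType K) (f : {lrmorphism R -> S})
      (g : {lrmorphism S -> T}) (h : {lrmorphism R -> T}) :
  h =1 g \o f -> vg_map h =1 vg_map g \o vg_map f.
Proof. by move=> e v; apply/rowP => j; rewrite !mxE e. Qed.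

Definition vector_group : groupFunctor K := GroupFunctor vg_mapM vg_map_id vg_map_comp.
Local Notation U := vector_group.

Definition vg_ring : comAlgType K := mpoly.mpoly d K.
Definition vg_var (i : 'I_d) : vg_ring := mpoly.mpolyX K (mpoly.mnm1 i).
Definition vg_univ : U vg_ring := (\row_i vg_var i : 'rV[vg_ring]_d).

Lemma vg_hom (R : comAlgType K) (x : 'I_d -> R) :
  exists f : {lrmorphism vg_ring -> R}, forall i, f (vg_var i) = x i.
Proof.
pose f0 : {rmorphism vg_ring -> R} := mpoly.mmap (in_alg R) x.
have l : scalable f0 by move=> c p; rewrite /f0 /= mpoly.mmapZ mulr_algl.
pose f : {lrmorphism vg_ring -> R} := HB.pack (f0 : vg_ring -> R) (GRing.RMorphism.class f0)
  (GRing.isScalable.Build _ _ _ _ _ l).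
by exists f => i; rewrite /f /= mpoly.mmapX mpoly.mmap1U.
Qed.

Lemma vg_gen (P : vg_ring -> Prop) : P 0 -> P 1 -> (forall (c : K) x y, P x -> P y -> P (c *: x + y)) ->
  (forall x y, P x -> P y -> P (x * y)) -> (forall i, P (vg_var i)) -> forall x, P x.
Proof.
move=> P0 P1 PL PM PX x; elim/mpoly.mpolyind: x => [|c m p _ _ Pp]; first exact: P0.
apply: PL => //; rewrite mpoly.mpolyXE_id.
apply: big_ind => // i _; elim: (mpoly.fun_of_multinom m i) => [|e IH]; first by rewrite expr0.
by rewrite exprS; apply: PM; [exact: PX | exact: IH].
Qed.

Lemma vg_represents : represents vg_univ.
Proof.
move=> R g; have [f hf] := vg_hom (fun i => (g : 'rV[R]_d) 0 i); exists f; split.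
  by apply/rowP => i; rewrite !mxE hf.
move=> f' e x; elim/vg_gen: x => [||c x y ex ey|x y ex ey|i].
- by rewrite !rmorph0.
- by rewrite !rmorph1.
- by rewrite !linearP /= ex ey.
- by rewrite !rmorphM /= ex ey.
- by rewrite hf -e !mxE.
Qed.

Lemma vg_affine : affine_algebraic_group U.
Proof.
exists vg_ring, vg_univ; split; first exact: vg_represents.
exists [seq vg_var i | i <- enum 'I_d] => B [B1 BL BM] sB x.
have B0 : 0 \in B by have := BL (-1) 1 1 B1 B1; rewrite scaleN1r addNr.
elim/vg_gen: x => [||c x y ex ey|x y ex ey|i] //; first exact: BL.
  exact: BM.
by apply: sB; apply: map_f; rewrite mem_enum.
Qed.

Lemma vg_reduced : reduced_group U.
Proof.
exists vg_ring, vg_univ; split; first exact: vg_represents.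
move=> x m /eqP; rewrite -[x]/(x : mpoly.mpoly d K).
by move=> e; apply/eqP; move: e; rewrite [_ == _](expf_eq0 (x : mpoly.mpoly d K)) => /andP[].
Qed.

(** The zero ideal is a point of every nonempty open set, so disjoint nonempty open sets do not
    exist. *)
Lemma domain_connected (A : comNzRingType) : (forall x y : A, x * y == 0 -> (x == 0) || (y == 0)) ->
  connected [set: spec A].
Proof.
move=> dom.
have z1 : idealr_closed (fun x : A => x == 0).
  split; [by rewrite unfold_in /= eqxx| by rewrite unfold_in /= oner_eq0|].
  by move=> a x y; rewrite !unfold_in /= => /eqP -> /eqP ->; rewrite mulr0 addr0.
have z2 : prime_idealr_closed (fun x : A => x == 0).
  by move=> x y; rewrite !unfold_in /=; apply: dom.
pose eta : spec A := Spec z1 z2.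
have oeta (O : set (spec A)) p : open O -> O p -> O eta.
  move=> [E _ <-] [a Ea ap]; exists a => //=; rewrite /eta unfold_in /=.
  apply: contra ap => /eqP ->; by case: (spec_ideal p).
move=> B [p Bp] [C oC eC] [D cD eD].
rewrite setTI in eC; rewrite setTI in eD; subst C.
apply/seteqP; split=> // q _; apply: contrapT => nBq.
have Be := oeta _ _ oC Bp.
have oB : open (~` B)%classic by rewrite eD openC.
by have := oeta _ _ oB nBq.
Qed.

Lemma vg_connected : connected_group U.
Proof.
exists vg_ring, vg_univ; split; first exact: vg_represents.
apply: domain_connected => x y; rewrite -[x]/(x : mpoly.mpoly d K) -[y]/(y : mpoly.mpoly d K).
by rewrite [_ == _](mulf_eq0 (x : mpoly.mpoly d K)).
Qed.

End VectorGroup.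

Section Unipotent.
Variables (K : fieldType) (d m : nat).
Hypothesis ch0 : [pchar K] =i pred0.
Variable rho : linear_rep (vector_group K d) m.+1.
Local Notation C := (map_mx (in_alg {poly K})).

Definition vg_pt (R : comAlgType K) (a : R) (i : 'I_d) : vector_group K d R := (a *: delta_mx 0 i : 'rV[R]_d)%R.

Lemma vg_pt_map (R S : comAlgType K) (f : {lrmorphism R -> S}) a i :
  rho S (vg_pt (f a) i) = map_mx f (rho R (vg_pt a i)).
Proof.
rewrite -rep_nat; congr (rho S _); apply/rowP => j.
by rewrite !mxE rmorphM rmorph_nat.
Qed.

Lemma vg_pt_horner (R : comAlgType K) (a : R) i :
  map_mx (hev a) (rho {poly K} (vg_pt ('X : {poly K}) i)) = rho R (vg_pt a i).
Proof. by rewrite -vg_pt_map; congr (rho R (vg_pt _ i)); apply: hevX. Qed.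

Lemma hev_const (R : comAlgType K) (a : R) (w : 'cV[K]_m.+1) : map_mx (hev a) (C w) = map_mx (in_alg R) w.
Proof. by apply/colP => l; rewrite mxE [X in hev _ X]mxE [RHS]mxE; apply: hevA. Qed.

Lemma map_in_alg_reg (w : 'cV[K]_m.+1) : map_mx (in_alg K^o) w = w.
Proof. by apply/colP => l; rewrite mxE; apply: mulr1. Qed.

Lemma vg_ptD (R : comAlgType K) (a b : R) i :
  rho R (vg_pt (a + b)%R i) = rho R (vg_pt a i) *m rho R (vg_pt b i).
Proof. by rewrite -rep_appM; congr (rho R _); rewrite /vg_pt scalerDl. Qed.

Lemma vg_ptC (R : comAlgType K) (a b : R) i j :
  rho R (vg_pt a i) *m rho R (vg_pt b j) = rho R (vg_pt b j) *m rho R (vg_pt a i).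
Proof. by rewrite -!rep_appM; congr (rho R _); apply: addrC. Qed.

Definition fixedK (w : 'cV[K]_m.+1) i := forall a : K^o, rho K^o (vg_pt a i) *m w = w.

Lemma hevK (a : K^o) p : hev a p = p.[a].
Proof.
elim/poly_ind: p => [|p c IH]; first by rewrite rmorph0 horner0.
rewrite rmorphD rmorphM /= hevX hevC IH hornerMXaddC.
by congr (_ + _); apply: mulr1.
Qed.

Lemma poly_eq0_nat (p : {poly K}) : (forall a, p.[a] = 0) -> p = 0.
Proof.
move=> h; apply/eqP/negPn/negP => p0.
have := @max_poly_roots _ p [seq i%:R | i <- iota 0 (size p)] p0; rewrite size_map size_iota ltnn.
move=> /(_ _ _)/wrap[]//.
  by apply/allP => x _; apply/rootP.
rewrite map_inj_in_uniq ?iota_uniq // => i j _ _ e.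
wlog le : i j e / (i <= j)%N.
  by move=> H; case: (leqP i j) => [/H|/ltnW/H h']; [exact | symmetry; apply: h'].
have /eqP := esym e; rewrite -subr_eq0 -natrB // (pcharf0P K).1 // subn_eq0 => le'.
by apply/eqP; rewrite eqn_leq le.
Qed.

(** The vector q(t) = rho(t e_j) w is polynomial in t and rho(a e_j) shifts t by a, so its
    coefficient of highest degree is fixed. Commutativity preserves the invariance obtained
    before. *)
Lemma fixedK_step (w : 'cV[K]_m.+1) (j : 'I_d) : w != 0 -> exists2 w', w' != 0 &
  fixedK w' j /\ forall i, fixedK w i -> fixedK w' i.
Proof.
move=> w0; have [q qE] : exists q, q = rho {poly K} (vg_pt ('X : {poly K}) j) *m C w by eexists.
have qa (a : K^o) : map_mx (hev a) q = rho K^o (vg_pt a j) *m w.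
  by rewrite qE map_mxM vg_pt_horner hev_const map_in_alg_reg.
have q0 : q != 0.
  apply: contraNneq w0 => e; have := qa 0; rewrite e map_mx0.
  have -> : vg_pt (0 : K^o) j = 1%g by apply: scale0r.
  by rewrite rep_app1 mul1mx => <-.
have [i0 hi0] : exists i0, q i0 0 != 0.
  apply: contrapT => /forallNP h; case/eqP: q0; apply/colP => l; rewrite [RHS]mxE.
  by apply/eqP/negPn/negP/h.
pose i1 := [arg max_(i > i0) size (q i 0%R)]%N.
have [hmax q1] : (forall i, (size (q i 0%R) <= size (q i1 0%R))%N) /\ q i1 0 != 0.
  rewrite /i1; case: arg_maxnP => // i _ h; split=> [l|]; first exact: h.
  by rewrite -size_poly_gt0; apply: leq_trans (h i0 isT); rewrite size_poly_gt0.
pose D := (size (q i1 0%R)).-1.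
have sD l : (size (q l 0%R) <= D.+1)%N by rewrite /D prednK ?size_poly_gt0.
pose w' : 'cV[K]_m.+1 := \col_l (q l 0%R)`_D.
have cA (A : 'M[K]_m.+1) : (\col_l ((C A *m q) l 0)`_D : 'cV_m.+1) = A *m w'.
  apply/colP => l; rewrite !mxE coef_sum; apply: eq_bigr => s _.
  by rewrite !mxE mulr_algl coefZ.
have rC (a : K^o) i : rho {poly K} (vg_pt (a%:A) i) = C (rho K^o (vg_pt a i)).
  exact: (vg_pt_map (@base_alg K {poly K})).
exists w'.
  by apply: contraNneq q1 => /colP/(_ i1); rewrite !mxE => e; rewrite -lead_coef_eq0 lead_coefE e.
split=> [a|i hi a].
  have e : C (rho K^o (vg_pt a j)) *m q = map_mx (hev ('X + a%:A)) q.
    by rewrite qE -rC mulmxA -vg_ptD map_mxM vg_pt_horner addrC hev_const.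
  rewrite -[LHS](cA (rho K^o (vg_pt a j))) e; apply/colP => l; rewrite !mxE.
  have -> : hev ('X + a%:A) (q l 0) = q l 0 \Po ('X - (- a)%:P).
    elim/poly_ind: (q l 0) => [|p c IH]; first by rewrite rmorph0 comp_poly0.
    rewrite rmorphD rmorphM /= hevX hevC IH comp_polyD comp_polyM comp_polyX comp_polyC.
    by rewrite polyCN opprK !alg_polyC.
  have s2 : size ('X - (- a)%:P) = 2%N by rewrite size_XsubC.
  have := sD l; rewrite leq_eqVlt => /orP[/eqP sz|lt]; last first.
    by rewrite !nth_default // ?size_comp_poly2 // -ltnS.
  have -> : D = (size (q l 0)).-1 by rewrite sz.
  rewrite -[RHS]lead_coefE -[in LHS](size_comp_poly2 (q l 0) s2) -lead_coefE lead_coef_comp ?s2 //.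
  by rewrite lead_coefXsubC expr1n mulr1.
rewrite -[LHS](cA (rho K^o (vg_pt a i))) qE -rC mulmxA vg_ptC -mulmxA rC -map_mxM hi -qE.
by apply/colP => l; rewrite !mxE.
Qed.

(** Once all coordinates are treated over K, invariance under K-points gives polynomial identities,
    K being infinite, and these specialize to points of every algebra. *)
Lemma vg_fixed : exists2 v : 'cV[K]_m.+1, v != 0 & fixed_vector rho v.
Proof.
have [w w0 hw] : exists2 w, w != 0 & forall i, fixedK w i.
  have h (s : seq 'I_d) : exists2 w, w != 0 & forall i, i \in s -> fixedK w i.
    elim: s => [|j s [w w0 hw]].
      exists (const_mx 1) => //; apply/eqP => /colP/(_ 0); rewrite !mxE => /eqP.
      by rewrite oner_eq0.
    have [w' w'0 [h1 h2]] := fixedK_step j w0; exists w' => // i.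
    by rewrite inE => /orP[/eqP -> //|/hw/h2].
  by have [w w0 hw] := h (enum 'I_d); exists w => // i; apply: hw; rewrite mem_enum.
exists w => // R x.
have fX i : rho {poly K} (vg_pt 'X i) *m C w = C w.
  apply/colP => l; apply/eqP; rewrite -subr_eq0; apply/eqP/poly_eq0_nat => a.
  rewrite -[LHS](hevK (a : K^o)) rmorphB /=; apply/eqP; rewrite subr_eq0; apply/eqP.
  have e : map_mx (hev (a : K^o)) (rho {poly K} (vg_pt 'X i) *m C w) = map_mx (hev (a : K^o)) (C w).
    rewrite map_mxM vg_pt_horner hev_const map_in_alg_reg; exact: hw.
  by have /colP/(_ l) := e; rewrite mxE [RHS]mxE.
have fa i (a : R) : rho R (vg_pt a i) *m map_mx (in_alg R) w = map_mx (in_alg R) w.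
  by have := congr1 (map_mx (hev a)) (fX i); rewrite map_mxM vg_pt_horner hev_const.
have h (s : seq 'I_d) : rho R (\sum_(i <- s) vg_pt ((x : 'rV[R]_d) 0 i) i : 'rV[R]_d) *m map_mx (in_alg R) w = map_mx (in_alg R) w.
  elim: s => [|i' s IH]; first by rewrite big_nil (rep_app1 rho R) mul1mx.
  rewrite big_cons -[(_ + _ : 'rV[R]_d)]/((vg_pt ((x : 'rV[R]_d) 0 i')%R i') * (\sum_(i <- s) vg_pt ((x : 'rV[R]_d) 0 i) i : 'rV[R]_d))%g.
  by rewrite rep_appM -mulmxA IH fa.
rewrite -[RHS](h (index_enum 'I_d)); congr (rho R _ *m _); exact: row_sum_delta.
Qed.

End Unipotent.

Lemma vg_unipotent (K : fieldType) d : [pchar K] =i pred0 -> unipotent_group (vector_group K d).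
Proof. by move=> ch0 m rho; apply: vg_fixed. Qed.

Section TruncatedLog.
Variables (k : fieldType) (T : nat).

(** Truncation of (exp X - 1)/X, so that [expP] is exp X - 1 through degree T + 1, the terms kept in
    [expm T.+2]. *)
Definition expV : {poly k} := \poly_(m < T.+1) ((m.+1)`!%:R)^-1.
Definition expP : {poly k} := 'X * expV.

Lemma expV0 : expV.[0] = 1.
Proof. by rewrite horner_coef0 coef_poly /= factS fact0 invr1. Qed.

(* A compositional inverse of exp - 1 modulo X^m. *)
Lemma truncated_log m : exists Q S : {poly k}, Q \Po expP = 'X + S * 'X^m.
Proof.
elim: m => [|m [Q [S e]]]; first by exists 0, (- 'X); rewrite comp_poly0 expr0 mulr1 subrr.
exists (Q - S.[0] *: 'X^m).
have /factor_theorem[S' eS] : root (S - S.[0] *: expV ^+ m) 0.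
  by rewrite /root hornerD hornerN hornerZ horner_exp expV0 expr1n mulr1 subrr.
exists S'; have -> : S' * 'X^(m.+1) = (S - S.[0] *: expV ^+ m) * 'X^m.
  by rewrite eS polyC0 subr0 -mulrA exprS.
rewrite comp_polyB comp_polyZ comp_Xn_poly e /expP exprMn mulrBl -addrA; congr (_ + (_ - _)).
by rewrite -scalerAl mulrC.
Qed.
End TruncatedLog.

Section HornerMx.
Variables (k : fieldType) (R : comAlgType k) (n : nat) (M : 'M[R]_n.+1).
Definition hmx (p : {poly k}) : 'M[R]_n.+1 := horner_mx M (map_poly (in_alg R) p).
Lemma hmx_comp p q : horner_mx (hmx p) (map_poly (in_alg R) q) = hmx (q \Po p).
Proof.
elim/poly_ind: q => [|q c IH]; first by rewrite comp_poly0 /hmx !rmorph0.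
rewrite comp_polyD comp_polyM comp_polyX comp_polyC /hmx !rmorphD !rmorphM /= -/(hmx _) IH.
by rewrite map_polyX map_polyC /= horner_mx_X !horner_mx_C.
Qed.

Lemma expm_hmx T : M ^+ T.+2 = 0 -> expm T.+2 M - 1 = hmx (expP k T).
Proof.
move=> M0; rewrite /expm big_ord_recl expr0 /invfact fact0 invr1 !scale1r addrC addKr.
rewrite /hmx /expP /expV rmorphM rmorphM /= map_polyX horner_mx_X poly_def !rmorph_sum mulr_sumr.
apply: eq_bigr => m _; rewrite -mul_polyC !rmorphM /= map_polyC horner_mx_C !rmorphXn /= map_polyX horner_mx_X.
by rewrite -[X in M * X]/(_ *m _) mul_scalar_mx -scalerAr -exprS.
Qed.
End HornerMx.

Section LemmaR.
Variables (k : fieldType) (G : groupFunctor k) (n : nat) (r : linear_rep G n.+1).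
Hypothesis fc : faithful_closed r.
Hypothesis ch0 : [pchar k] =i pred0.
Local Notation N := n.+1.

Definition Gstable p (W : 'M[k]_(p, N * N)) := forall (R : comAlgType k) (g : G R) X,
  memW W X -> inR W (mxvec (Ad r g (map_mx (in_alg R) X))).

Lemma GstableR p (W : 'M[k]_(p, N * N)) (R : comAlgType k) (g : G R) X :
  Gstable W -> inR W (mxvec X) -> inR W (mxvec (Ad r g X)).
Proof.
move=> sW /inR_gen[a ea].
have -> : X = \sum_i a i *: map_mx (in_alg R) (vec_mx (row i W)).
  apply: (can_inj mxvecK); rewrite ea linear_sum; apply: eq_bigr => i _.
  by rewrite linearZ /= -map_mxvec vec_mxK.
rewrite !linear_sum; apply: inR_sum => i _; rewrite !linearZ /=; apply: inRZ; apply: sW.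
by rewrite /memW vec_mxK row_sub.
Qed.

Lemma Gstable_eqmx p q (W : 'M[k]_(p, N * N)) (W' : 'M[k]_(q, N * N)) : (W :=: W')%MS -> Gstable W -> Gstable W'.
Proof.
move=> e sW R g X hX; apply: (inR_sub (W := W)); first by rewrite e.
by apply: sW; rewrite /memW e.
Qed.

Section Group.
Variables (d : nat) (B : 'M[k]_(d, N * N)) (T : nat).
Hypotheses (fB : row_free B) (Bgg : (B <= gg r)%MS) (nB : nilw B T.+1).
Hypothesis cB : forall X Y, memW B X -> memW B Y -> X *m Y = Y *m X.
Hypothesis sB : Gstable B.

Let nB' (R : comAlgType k) (X Y : 'M[R]_N) i j : inR B (mxvec X) -> inR B (mxvec Y) ->
  (T.+2 <= i + j)%N -> X ^+ i * Y ^+ j = 0.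
Proof. by move=> hX hY h; apply: (nil_pow nB); rewrite // ltnW. Qed.

Section Points.
Variable R : comAlgType k.
Implicit Types v w : 'rV[R]_d.

Definition lin v : 'M[R]_N := vec_mx (v *m map_mx (in_alg R) B).
Lemma lin_linear : linear lin.
Proof. by move=> a v w; rewrite /lin mulmxDl -scalemxAl linearP. Qed.
HB.instance Definition _ := GRing.isLinear.Build R _ _ _ lin lin_linear.

Lemma lin_in v : inR B (mxvec (lin v)). Proof. by exists v; rewrite vec_mxK. Qed.

Lemma lin_comm v w : lin v *m lin w = lin w *m lin v.
Proof.
have e u : lin u = \sum_i u 0 i *: map_mx (in_alg R) (vec_mx (row i B)).
  rewrite /lin mulmx_sum_row linear_sum; apply: eq_bigr => i _.
  by rewrite linearZ /= -map_row -map_vec_mx.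
rewrite !e mulmx_suml mulmx_sumr; apply: eq_bigr => i _.
rewrite mulmx_sumr mulmx_suml; apply: eq_bigr => j _.
rewrite -!scalemxAl -!scalemxAr !scalerA mulrC -!map_mxM cB //.
all: by rewrite /memW vec_mxK row_sub.
Qed.

Definition vexp v := expm T.+2 (lin v).

Lemma vexpD v w : vexp (v + w) = vexp v *m vexp w.
Proof.
rewrite /vexp linearD; apply: expmD => //; first exact: lin_comm.
by move=> i j; apply: nB'; apply: lin_in.
Qed.

Lemma vexp0 : vexp 0 = 1%:M. Proof. by rewrite /vexp linear0 expm0. Qed.
End Points.

Lemma lin_map (R S : comAlgType k) (f : {lrmorphism R -> S}) (v : 'rV[R]_d) : map_mx f (lin v) = lin (map_mx f v).
Proof.
rewrite /lin map_vec_mx map_mxM; congr (vec_mx (_ *m _)); apply/matrixP => i j.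
by rewrite !mxE; apply: rmorph_alg.
Qed.

Lemma vexp_map (R S : comAlgType k) (f : {lrmorphism R -> S}) (v : 'rV[R]_d) : map_mx f (vexp v) = vexp (map_mx f v).
Proof. by rewrite /vexp expm_map lin_map. Qed.

Lemma vexp_deriv i : map_mx (@deriv k) (vexp ('X *: delta_mx 0 i : 'rV[{poly k}]_d)) =
  lin (delta_mx 0 i : 'rV[{poly k}]_d) *m vexp ('X *: delta_mx 0 i).
Proof.
set A := lin (delta_mx 0 i).
have hA : A = map_mx (in_alg {poly k}) (vec_mx (row i B)).
  by rewrite /A /lin -rowE -map_row map_vec_mx.
have AT : A ^+ T.+2 = 0 by rewrite -[LHS]mulr1 -(expr0 A); apply: nB'; rewrite ?addn0 //; apply: lin_in.
have eE : vexp ('X *: delta_mx 0 i : 'rV[{poly k}]_d) = \sum_(m < T.+2) (((m`!)%:R^-1 : k) *: 'X^m) *: A ^+ m.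
  rewrite /vexp linearZ /= -/A; apply: eq_bigr => m _; rewrite exprZn scalerA.
  by rewrite mulr_algl.
rewrite eE map_mx_sum.
have hd (m : 'I_T.+2) : map_mx (@deriv k) ((((m`!)%:R^-1 : k) *: 'X^m) *: A ^+ m) =
    (((m`!)%:R^-1 : k) *: 'X^m)^`() *: A ^+ m.
  have -> : A ^+ m = map_mx (in_alg {poly k}) (vec_mx (row i B) ^+ m) by rewrite hA rmorphXn.
  apply/matrixP => a b; rewrite [RHS]mxE mxE [in LHS]mxE [in LHS]mxE [in RHS]mxE /=.
  by rewrite derivM alg_polyC derivC mulr0 addr0.
rewrite (eq_bigr _ (fun m _ => hd m)) big_ord_recl expr0 -[X in _ *: X]mulr1 linearZ /= derivC scaler0 scale0r add0r.
rewrite [RHS]mulmx_sumr [RHS]big_ord_recr /= -scalemxAr -[A *m A ^+ T.+1]/(A * _) -exprS AT scaler0 addr0.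
apply: eq_bigr => m _; rewrite -scalemxAr -[A *m A ^+ m]/(A * _) -exprS; congr (_ *: _).
rewrite linearZ /= derivXn /= -scaler_nat scalerA; congr (_ *: _).
by rewrite factS natrM invfM mulrAC mulVf ?mul1r // (pcharf0P k).1.
Qed.

(** Over k[t] the curve exp(t X) solves an equation with coefficient in gg and starts at 1, so
    [inG_ode] puts it in G. Specializing t and multiplying the commuting factors gives exp of any
    v. *)
Lemma vexp_inG (R : comAlgType k) (v : 'rV[R]_d) : inG r (vexp v).
Proof.
have hX i : inG r (vexp ('X *: delta_mx 0 i : 'rV[{poly k}]_d)).
  have DM : forall x y : {poly k}, deriv (x * y) = deriv x * y + x * deriv y by move=> x y; apply: derivM.
  have sep (f : {poly k}) : (forall m, hev (0 : k^o) (iter m (@deriv k) f) = 0) -> f = 0.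
    move=> h; apply/polyP => m; rewrite coef0; have := h m.
    have h0 (q : {poly k}) : hev (0 : k^o) q = q`_0.
      rewrite -horner_coef0; elim/poly_ind: q => [|q c IH]; first by rewrite rmorph0 horner0.
      by rewrite rmorphD rmorphM /= hevX hevC mulr0 add0r hornerMXaddC mulr0 add0r; apply: mulr1.
    rewrite h0 -[iter _ _ _]/(derivn m f) coef_derivn addn0 ffactnn -mulr_natr => /eqP.
    by rewrite mulf_eq0 (pcharf0P k).1 // -[m`! == 0%N]negbK -lt0n fact_gt0 orbF => /eqP.
  apply: (inG_ode fc DM sep (Y := lin (delta_mx 0 i : 'rV[{poly k}]_d))).
  - exact: vexp_deriv.
  - by apply: (inR_sub Bgg); apply: lin_in.
  - rewrite vexp_map.
    have -> : map_mx (hev (0 : k^o)) ('X *: delta_mx 0 i : 'rV[{poly k}]_d) = 0.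
      by apply/rowP => j; rewrite !mxE rmorphM /= hevX mul0r.
    by rewrite vexp0; apply: inG1.
rewrite [v]row_sum_delta; elim: (index_enum _) => [|i s IH]; first by rewrite big_nil vexp0; apply: inG1.
rewrite big_cons vexpD; apply: inGM => //.
have := inG_map (hev (v 0 i)) (hX i); rewrite vexp_map.
congr (inG _ (vexp _)); apply/rowP => j; rewrite !mxE rmorphM /= hevX rmorph_nat //.
Qed.

Section BC.
Variables (K : fieldType) (iota : {rmorphism k -> K}).
Local Notation U := (vector_group K d).

Definition jmap (R : comAlgType K) (v : U R) : base_change iota G R :=
  sval (cid (@vexp_inG (restr iota R) v)).

Lemma jmapE (R : comAlgType K) (v : U R) : r (restr iota R) (jmap v) = @vexp (restr iota R) v.
Proof. by rewrite /jmap; case: cid. Qed.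

Fact jmapM (R : comAlgType K) : {morph @jmap R : x y / (x * y)%g}.
Proof. by move=> x y; apply: fc.1; rewrite [RHS]rep_appM !jmapE; apply: vexpD. Qed.

Fact jmap_nat (R S : comAlgType K) (f : {lrmorphism R -> S}) (x : U R) :
  jmap (fmap U f x) = fmap (base_change iota G) f (jmap x).
Proof.
apply: fc.1; rewrite jmapE [RHS]rep_nat jmapE.
by rewrite (vexp_map (restr_map iota f : {lrmorphism restr iota R -> restr iota S})).
Qed.

Definition jhom : groupFunctorHom U (base_change iota G) := GroupFunctorHom jmapM jmap_nat.

Lemma jhom_normal : normal_image jhom.
Proof.
move=> R g v; have h : inR B (mxvec (Ad r (g : G (restr iota R)) (@lin (restr iota R) v))).
  by apply: GstableR => //; apply: lin_in.
have [v' ev'] := h; exists v'; apply: fc.1.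
rewrite [RHS]rep_appM rep_appM !jmapE -/(Ad r (g : G (restr iota R)) _).
rewrite /vexp /expm linear_sum; apply: eq_bigr => m _; rewrite linearZ /=; congr (_ *: _).
have -> : @lin (restr iota R) v' = Ad r (g : G (restr iota R)) (@lin (restr iota R) v).
  by rewrite /lin -ev' mxvecK.
elim: (nat_of_ord m) => [|e IH]; first by rewrite !expr0 /Ad mulmx1 repVr.
by rewrite !exprS AdM IH.
Qed.

(** The coordinates of v are regular functions of exp(v): the truncated logarithm recovers [lin v],
    and [pinvmx B] reads off its coordinates along the independent rows of B. *)
Lemma jhom_closed : closed_immersion jhom.
Proof.
have hM : bcP iota r (@vexp (restr iota (vg_ring K d)) (vg_univ K d) : 'M[vg_ring K d]_N).
  exact: vexp_inG.
have [f hf] := qev_lrmorphism (P := @bcP _ _ iota G n r) (bcM0 iota r) hM.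
exists (bc_ring iota r), (vg_ring K d), (bc_point iota fc), (vg_univ K d), f.
pose gm : 'M[bc_ring iota r]_N := generic_mx (P := @bcP _ _ iota G n r) (bcM0 iota r).
have ef : map_mx f gm = @vexp (restr iota (vg_ring K d)) (vg_univ K d).
  rewrite -[RHS](qev_generic (P := @bcP _ _ iota G n r) (bcM0 iota r) hM).
  by apply/matrixP => a b; rewrite !mxE hf.
split; [exact: bc_represents | exact: vg_represents | |].
  by apply: fc.1; rewrite bc_fmap jmapE.
pose V := restr iota (vg_ring K d).
pose v : 'rV[V]_d := vg_univ K d.
have [Q [S eQ]] := truncated_log k T T.+2.
have nil : lin v ^+ T.+2 = 0.
  by rewrite -[LHS]mulr1 -(expr0 (lin v)); apply: nB'; rewrite ?addn0 //; apply: lin_in.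
have elin : lin v = horner_mx (vexp v - 1) (map_poly (in_alg V) Q).
  rewrite expm_hmx // hmx_comp eQ /hmx !rmorphD rmorphM rmorphM /= map_polyX horner_mx_X.
  by rewrite map_polyXn rmorphXn /= horner_mx_X nil mulr0 addr0.
have [Z eZ] : exists Z : 'M[bc_ring iota r]_N, map_mx f Z = lin v.
  exists (horner_mx (gm - 1) (map_poly (in_alg (bc_ring iota r) \o iota) Q)).
  have e1 : map_mx f (gm - 1) = vexp v - 1 by rewrite map_mxB ef; congr (_ - _); exact: map_mx1.
  rewrite map_horner_mx e1 elin; congr (horner_mx _ _).
  by rewrite -map_poly_comp; apply: eq_map_poly => a /=; exact: (rmorph_alg f (iota a)).
move=> b; elim/vg_gen: b => [||c x y [a <-] [a' <-]|x y [a <-] [a' <-]|i].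
- by exists 0; rewrite rmorph0.
- by exists 1; rewrite rmorph1.
- by exists (c *: a + a'); rewrite linearP.
- by exists (a * a'); rewrite rmorphM.
have ev : v = mxvec (lin v) *m map_mx (in_alg V) (pinvmx B).
  by rewrite vec_mxK -mulmxA -map_mxM mulmxVp // map_mx1 mulmx1.
exists (\sum_j mxvec Z 0 j * (iota (pinvmx B j i))%:A).
have := congr1 (fun w : 'rV[V]_d => w 0 i) ev; rewrite /v /vg_univ mxE => ->.
rewrite rmorph_sum mxE; apply: eq_bigr => j _; rewrite rmorphM /= -eZ -map_mxvec !mxE.
by rewrite rmorph_alg.
Qed.
End BC.
End Group.

(** Otherwise exp W would be a nontrivial connected normal unipotent subgroup. Engel's theorem
    passes from nilpotent elements to nilpotent words, which makes the exponential polynomial. *)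
Theorem no_unipotent_ideal p (W : 'M[k]_(p, N * N)) : reductive_group G -> (W <= gg r)%MS ->
  (forall X Y, memW W X -> memW W Y -> X *m Y = Y *m X) ->
  (forall X, memW W X -> exists e, X ^+ e = 0) -> Gstable W -> W = 0.
Proof.
move=> [K [iota [_ hU]]] Wgg cW nW sW.
pose B := row_base W.
have eB : (B :=: W)%MS by apply: eq_row_base.
have mB X : memW B X -> memW W X by rewrite /memW eB.
have cB X Y : memW B X -> memW B Y -> X *m Y = Y *m X by move=> /mB hX /mB; apply: cW.
have [T nT] : exists T, nilw B T.
  apply: engel => [X Y hX hY|X /mB]; last exact: nW.
  by rewrite /comm [X * Y]cB // subrr memW0.
have nB : nilw B T.+1 by apply: nilw_le nT.
have Bgg : (B <= gg r)%MS by rewrite eB.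
have fB : row_free B by apply: row_base_free.
have sB : Gstable B by apply: Gstable_eqmx sW; apply: eqmx_sym.
have chK := pchar0_fmorph iota ch0.
have triv := hU _ _ (vg_affine K _) (@jhom_closed _ _ _ fB Bgg nB cB K iota) (@jhom_normal _ _ _ Bgg nB cB sB K iota)
  (vg_reduced K _) (vg_connected K _) (@vg_unipotent K _ chK).
apply/eqP; rewrite -mxrank_eq0 -leqn0 leqNgt; apply/negP => d0.
have := triv K^o (const_mx 1 : 'rV[K^o]_(\rank W)); move/rowP/(_ (Ordinal d0)).
by rewrite mxE => /eqP; rewrite -[X in _ == X]/((0 : 'rV[K^o]_(\rank W)) 0 (Ordinal d0)) mxE oner_eq0.
Qed.

End LemmaR.

(** * Semisimplicity of [gg, gg] and rigidity *)

Section Structure.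
Variables (R : comNzRingType) (N m : nat).
Definition cm (A B : 'M[R]_N) := A *m B - B *m A.

Lemma cm_linear_l B : linear (cm^~ B).
Proof. by move=> a X Y; rewrite /cm mulmxDl mulmxDr -scalemxAl -scalemxAr scalerBr opprD addrACA. Qed.
Lemma cm_linear_r A : linear (cm A).
Proof. by move=> a X Y; rewrite /cm mulmxDl mulmxDr -scalemxAl -scalemxAr scalerBr opprD addrACA. Qed.
HB.instance Definition _ A := GRing.isLinear.Build R _ _ _ (cm A) (cm_linear_r A).

Lemma cm_antisym A B : cm A B = - cm B A. Proof. by rewrite /cm opprB. Qed.

Lemma cm_jacobi A B C : cm (cm A B) C = cm A (cm B C) - cm B (cm A C).
Proof.
rewrite /cm !mulmxBl !mulmxBr !mulmxA.
move: (A *m B *m C) (B *m A *m C) (C *m A *m B) (C *m B *m A) (A *m C *m B) (B *m C *m A) => a b c d e f.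
by apply/matrixP => i j; rewrite !mxE; ring.
Qed.

Variables (b : 'I_m -> 'M[R]_N) (x : 'I_m -> 'M[R]_m).
Definition el (u : 'rV[R]_m) : 'M[R]_N := \sum_i u 0 i *: b i.
Lemma el_linear : linear el.
Proof. by move=> a u v; rewrite /el scaler_sumr -big_split; apply: eq_bigr => i _ /=; rewrite !mxE scalerDl scalerA. Qed.
HB.instance Definition _ := GRing.isLinear.Build R _ _ _ el el_linear.

Lemma el_delta i : el (delta_mx 0 i) = b i.
Proof.
rewrite /el (bigD1 i) //= mxE !eqxx scale1r big1 ?addr0 // => j ji.
by rewrite mxE (negPf ji) andbF scale0r.
Qed.

Hypothesis bx : forall i j, cm (b i) (b j) = el (row j (x i)).

Lemma el_br u v : el (br x u v) = cm (el u) (el v).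
Proof.
rewrite /br /adv mulmx_sumr linear_sum.
have -> : cm (el u) (el v) = \sum_i u 0 i *: cm (b i) (el v).
  have -> : cm (el u) (el v) = - cm (el v) (el u) by rewrite cm_antisym.
  rewrite {2}/el linear_sum -sumrN; apply: eq_bigr => i _.
  by rewrite linearZ /= [cm (el v) _]cm_antisym scalerN opprK.
apply: eq_bigr => i _; rewrite -scalemxAr linearZ /=; congr (_ *: _).
rewrite mulmx_sum_row linear_sum /= {2}/el linear_sum; apply: eq_bigr => j _.
by rewrite !linearZ /= bx.
Qed.

Hypothesis injel : injective el.

Lemma lie_of_matrices : lie x.
Proof.
split=> u v; first by apply: injel; rewrite linearN /= !el_br cm_antisym.
apply/row_matrixP => i; rewrite !rowE; set w := delta_mx 0 i.
rewrite -[LHS]/(br x (br x u v) w); apply: injel.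
have -> : w *m (adv x v *m adv x u - adv x u *m adv x v) = br x u (br x v w) - br x v (br x u w).
  by rewrite /br mulmxBr !mulmxA.
by rewrite linearB /= !el_br cm_jacobi.
Qed.

Lemma kill_aut (C C' : 'M[R]_m) (Phi : 'M[R]_N -> 'M[R]_N) : C *m C' = 1%:M ->
  (forall A B, Phi (cm A B) = cm (Phi A) (Phi B)) -> (forall u, el (u *m C) = Phi (el u)) ->
  kill x = C *m kill x *m C^T.
Proof.
move=> CC' PM PE; rewrite -(kill_chg x CC').
have h u v : br x (u *m C) (v *m C) = br x u v *m C by apply: injel; rewrite el_br !PE -PM el_br.
have e i : chg C C' x i = x i.
  apply/row_matrixP => j; rewrite !rowE /chg !mulmxA.
  rewrite -[_ *m C *m adv x _]/(br x (row i C) (delta_mx 0 j *m C)) rowE h -mulmxA CC' mulmx1.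
  by rewrite /br adv_delta.
by apply/matrixP => i j; rewrite !mxE !e.
Qed.

Lemma centralizer_zero (K' : 'M[R]_m) u : kill x *m K' = 1%:M -> (forall v, br x u v = 0) -> u = 0.
Proof.
move=> KK' h; have a0 : adv x u = 0 by apply/row_matrixP => i; rewrite rowE row0 [LHS]h.
have : u *m kill x = 0.
  apply/rowP => j; have := killE x u (delta_mx 0 j).
  by rewrite a0 mul0mx mxtrace0 trmx_delta -colE mxE => ->; rewrite mxE.
by move=> e; rewrite -[u]mulmx1 -KK' mulmxA e mul0mx.
Qed.

End Structure.

Section Functionals.
Variables (k : fieldType).

(** Functionals R -> k separate points, so the equations of W can be tested after them; statements
    proved over k thus extend to R. *)
Lemma inR_functional (R : comAlgType k) p q (W : 'M[k]_(p, q)) (v : 'rV[R]_q) :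
  (forall f : {linear R -> k^o}, ((map_mx f v : 'rV[k]_q) <= W)%MS) -> inR W v.
Proof.
move=> h; apply/inR_coker; apply/rowP => j; rewrite [RHS]mxE; apply: contrapT => /eqP e0.
have [f hf] := functional_neq0 e0.
have := h f; rewrite submxE => /eqP/rowP/(_ j); rewrite [RHS]mxE => e.
suff : f ((v *m map_mx (in_alg R) (cokermx W)) 0 j) = 0 by rewrite hf => /eqP; rewrite oner_eq0.
rewrite -[RHS]e !mxE linear_sum; apply: eq_bigr => l _.
by rewrite !mxE mulr_algr linearZ mulrC.
Qed.

Lemma functional_mulmx (R : comAlgType k) p q s (f : {linear R -> k^o}) (A : 'M[R]_(p, q)) (B : 'M[k]_(q, s)) :
  map_mx f (A *m map_mx (in_alg R) B) = (map_mx f A : 'M[k]_(p, q)) *m B.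
Proof.
apply/matrixP => i j; rewrite !mxE linear_sum; apply: eq_bigr => l _.
by rewrite !mxE mulr_algr linearZ mulrC.
Qed.

Lemma functional_mulmxl (R : comAlgType k) p q s (f : {linear R -> k^o}) (A : 'M[k]_(p, q)) (B : 'M[R]_(q, s)) :
  map_mx f (map_mx (in_alg R) A *m B) = A *m (map_mx f B : 'M[k]_(q, s)).
Proof.
apply/matrixP => i j; rewrite !mxE linear_sum; apply: eq_bigr => l _.
by rewrite !mxE mulr_algl linearZ.
Qed.

Lemma functional_zero (R : comAlgType k) (a : R) : (forall f : {linear R -> k^o}, f a = 0) -> a = 0.
Proof.
move=> h; apply: contrapT => /eqP a0; have [f hf] := functional_neq0 a0.
by have := h f; rewrite hf => /eqP; rewrite oner_eq0.
Qed.

Lemma trace_map_mx_lin (R : comAlgType k) q (f : {linear R -> k^o}) (A : 'M[R]_q) : f (\tr A) = \tr (map_mx f A).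
Proof. by rewrite /mxtrace linear_sum; apply: eq_bigr => i _; rewrite mxE. Qed.

Lemma inR_linear_down (R : comAlgType k) p q (W : 'M[k]_(p, q)) (f : {linear R -> k^o}) (v : 'rV[R]_q) :
  inR W v -> ((map_mx f v : 'rV[k]_q) <= W)%MS.
Proof. by move=> [a ->]; rewrite functional_mulmx submxMl. Qed.

End Functionals.

Section Reductive.
Variables (k : fieldType) (G : groupFunctor k) (n : nat) (r : linear_rep G n.+1).
Hypothesis fc : faithful_closed r.
Hypothesis ch0 : [pchar k] =i pred0.
Hypothesis redG : reductive_group G.
Local Notation N := n.+1.
Local Notation gg := (gg r).
Local Notation A_ R := (map_mx (in_alg R)).

Lemma regE p q (M : 'M[k]_(p, q)) : A_ k^o M = M.
Proof. by apply/matrixP => i j; rewrite mxE; apply: mulr1. Qed.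

Lemma map_cm (R S : comNzRingType) (f : {rmorphism R -> S}) (X Y : 'M[R]_N) :
  map_mx f (cm X Y) = cm (map_mx f X) (map_mx f Y).
Proof. by rewrite /cm map_mxB !map_mxM. Qed.

Lemma Ad_cm (R : comAlgType k) (g : G R) X Y : Ad r g (cm X Y) = cm (Ad r g X) (Ad r g Y).
Proof. by rewrite /cm linearB /= !AdM. Qed.

Lemma AdK (R : comAlgType k) (g : G R) X : Ad r g (Ad r (g^-1)%g X) = X.
Proof. by rewrite /Ad invgK !mulmxA repVr mul1mx -mulmxA repVr mulmx1. Qed.

Lemma AdVK (R : comAlgType k) (g : G R) X : Ad r (g^-1)%g (Ad r g X) = X.
Proof. by rewrite -{2}[g]invgK AdK. Qed.

Lemma Gstable_gg : Gstable r gg.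
Proof. by move=> R g X hX; apply: (Ad_gg fc); rewrite -map_mxvec; apply: inR_base. Qed.

Section Dsnd.
Variable R : comAlgType k.
Definition dsnd (x : dual R) : R := x.2.
Fact dsnd_linear : linear dsnd. Proof. by []. Qed.
HB.instance Definition _ := GRing.isLinear.Build k (dual R) R _ dsnd dsnd_linear.
End Dsnd.

(** The point 1 + e X over the dual numbers sends Y to Y + e [X, Y], whose e-part must lie in W. *)
Lemma Gstable_ad p (W : 'M[k]_(p, N * N)) X Y : Gstable r W -> memW gg X -> memW W Y -> memW W (cm X Y).
Proof.
move=> sW hX hY.
have [g eg] : inG r (dualmx (1%:M : 'M[k^o]_N) (X : 'M[k^o]_N)).
  apply/(inG_tangent fc).
  have -> : mxvec (X : 'M[k^o]_N) = A_ k^o (mxvec X) by apply/rowP => j; rewrite [RHS]mxE; symmetry; apply: mulr1.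
  exact: inR_base.
have c1 : dualmx (1%:M : 'M[k^o]_N) 0 = 1%:M.
  by apply/matrixP => i j; rewrite !mxE; case: (i == j).
have eg' : r _ (g^-1)%g = dualmx (1%:M : 'M[k^o]_N) (- (X : 'M[k^o]_N)).
  have gP : r _ g *m dualmx (1%:M : 'M[k^o]_N) (- (X : 'M[k^o]_N)) = 1%:M.
    by rewrite eg dualmxM !mul1mx mulmx1 addNr c1.
  by rewrite -[LHS]mulmx1 -gP mulmxA repV mul1mx.
have := inR_linear (@dsnd k^o) (sW _ g Y hY).
rewrite /Ad eg eg'.
have -> : A_ (dual k^o) Y = dualmx (Y : 'M[k^o]_N) 0.
  by apply/matrixP => i j; rewrite !mxE; congr (_, _); [apply: mulr1 | apply: mulr0].
rewrite !dualmxM mulmx0 add0r mul1mx mulmx1 mulmxN map_mxvec.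
set M := dualmx _ _; have -> : map_mx (@dsnd k^o) M = A_ k^o (cm X Y).
  rewrite regE; apply/matrixP => i j.
  rewrite mxE [M i j]mxE /dsnd /=.
  by rewrite mulmx1 addrC.
by rewrite -map_mxvec; apply: inR_down.
Qed.

Lemma glbrE (u v : 'rV[k]_(N * N)) : glbr u v = mxvec (cm (vec_mx u) (vec_mx v)).
Proof. by []. Qed.

Definition cspan p q (U : 'M[k]_(p, N * N)) (V : 'M[k]_(q, N * N)) : 'M[k]_(N * N) := bspan (@glbr k n) U V.

Lemma cspan_in p q (U : 'M[k]_(p, N * N)) (V : 'M[k]_(q, N * N)) X Y :
  memW U X -> memW V Y -> memW (cspan U V) (cm X Y).
Proof.
move=> hX hY; rewrite /memW -[X]mxvecK -[Y]mxvecK -glbrE.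
by apply: bspan_in => //; [exact: glbr_linear_l | exact: glbr_linear_r].
Qed.

Lemma inR_gens (R : comAlgType k) p (W : 'M[k]_(p, N * N)) (X : 'M[R]_N) : inR W (mxvec X) ->
  exists a : 'I_p -> R, X = \sum_i a i *: A_ R (vec_mx (row i W)).
Proof.
move=> /inR_gen[a ea]; exists a; apply: (can_inj mxvecK); rewrite ea linear_sum; apply: eq_bigr => i _.
by rewrite linearZ /= -map_mxvec vec_mxK.
Qed.

Lemma cm_suml (R : comNzRingType) (I : Type) (s : seq I) (F : I -> 'M[R]_N) Y :
  cm (\sum_(i <- s) F i) Y = \sum_(i <- s) cm (F i) Y.
Proof. by rewrite cm_antisym linear_sum -sumrN; apply: eq_bigr => i _; rewrite [RHS]cm_antisym. Qed.

Lemma cmZl (R : comNzRingType) (a : R) (X Y : 'M[R]_N) : cm (a *: X) Y = a *: cm X Y.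
Proof. by rewrite cm_antisym linearZ /= cm_antisym scalerN opprK. Qed.

Lemma cm0l (R : comNzRingType) (Y : 'M[R]_N) : cm 0 Y = 0.
Proof. by rewrite /cm mul0mx mulmx0 subr0. Qed.

Lemma row_memW p (W : 'M[k]_(p, N * N)) i : memW W (vec_mx (row i W)).
Proof. by rewrite /memW vec_mxK row_sub. Qed.

Lemma cm_zeroR (R : comAlgType k) p (W : 'M[k]_(p, N * N)) (X Y : 'M[R]_N) :
  (forall Z, memW W Z -> cm X (A_ R Z) = 0) -> inR W (mxvec Y) -> cm X Y = 0.
Proof.
move=> h /inR_gens[a ->]; rewrite linear_sum big1 // => i _; rewrite linearZ /= h ?scaler0 //.
exact: row_memW.
Qed.

Lemma inR_cspan (R : comAlgType k) p q (U : 'M[k]_(p, N * N)) (V : 'M[k]_(q, N * N)) (X Y : 'M[R]_N) :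
  inR U (mxvec X) -> inR V (mxvec Y) -> inR (cspan U V) (mxvec (cm X Y)).
Proof.
move=> /inR_gens[a ->] /inR_gens[c ->]; rewrite cm_suml linear_sum; apply: inR_sum => i _.
rewrite cmZl !linear_sum; apply: inR_sum => j _; rewrite !linearZ /=; apply: inRZ; apply: inRZ.
rewrite -map_cm -map_mxvec; apply: inR_base; apply: cspan_in; exact: row_memW.
Qed.

Lemma cspan_gens p q (U : 'M[k]_(p, N * N)) (V : 'M[k]_(q, N * N)) X : memW (cspan U V) X ->
  exists c : 'M[k]_(p, q), X = \sum_i \sum_j c i j *: cm (vec_mx (row i U)) (vec_mx (row j V)).
Proof.
move=> /bspan_sum[c e]; exists c; apply: (can_inj mxvecK); rewrite e linear_sum; apply: eq_bigr => i _.
by rewrite linear_sum; apply: eq_bigr => j _; rewrite linearZ.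
Qed.

Lemma Gstable_cspan p q (U : 'M[k]_(p, N * N)) (V : 'M[k]_(q, N * N)) :
  Gstable r U -> Gstable r V -> Gstable r (cspan U V).
Proof.
move=> sU sV R g X /cspan_gens[c ->]; rewrite map_mx_sum !linear_sum; apply: inR_sum => i _.
rewrite map_mx_sum !linear_sum; apply: inR_sum => j _; rewrite map_mxZ !linearZ /=; apply: inRZ.
rewrite map_cm Ad_cm; apply: inR_cspan; [apply: sU | apply: sV]; exact: row_memW.
Qed.

(** X is a sum of brackets [Y, Z] with Z commuting with X, hence tr([Y, Z] X^e) = 0 and all power
    traces of X vanish. *)
Lemma nilp_cspan p q (U : 'M[k]_(p, N * N)) (V : 'M[k]_(q, N * N)) X : memW (cspan U V) X ->
  (forall Y, memW V Y -> X *m Y = Y *m X) -> X ^+ N = 0.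
Proof.
move=> hX cX; apply: nilp_of_traces => // -[//|e] _; rewrite exprS -[X * _]/(X *m _).
have [c {1}->] := cspan_gens hX; rewrite mulmx_suml raddf_sum big1 // => i _ /=.
rewrite mulmx_suml raddf_sum big1 // => j _ /=; rewrite -scalemxAl mxtraceZ /cm mulmxBl raddfB /=.
set Y := vec_mx _; set Z := vec_mx _.
have cZ : Z *m X ^+ e = X ^+ e *m Z.
  have hZ : X *m Z = Z *m X by apply: cX; apply: row_memW.
  by have : GRing.comm Z (X ^+ e) by apply: commrX; apply: esym.
by rewrite -mulmxA cZ mulmxA mxtrace_mulC mulmxA subrr mulr0.
Qed.

Definition ss := row_base (cspan gg gg).
Local Notation m := (\rank (cspan gg gg)).
Definition sb (i : 'I_m) : 'M[k]_N := vec_mx (row i ss).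
Definition sx (i : 'I_m) : 'M[k]_m := \matrix_(j, l) (mxvec (cm (sb i) (sb j)) *m pinvmx ss) 0 l.

Lemma memW_ss X : memW ss X = memW (cspan gg gg) X.
Proof. by rewrite /memW eq_row_base. Qed.

Lemma Gstable_ss : Gstable r ss.
Proof.
apply: Gstable_eqmx (Gstable_cspan Gstable_gg Gstable_gg); apply: eqmx_sym; exact: eq_row_base.
Qed.

Lemma cspan_gg_sub : (cspan gg gg <= gg)%MS.
Proof.
apply: bspanP => u v hu hv; rewrite glbrE; apply: (Gstable_ad Gstable_gg); rewrite /memW vec_mxK //.
Qed.

Lemma ss_sub : (ss <= gg)%MS.
Proof. by rewrite eq_row_base cspan_gg_sub. Qed.

Lemma ss_perfectR (R : comAlgType k) (X Y : 'M[R]_N) : inR gg (mxvec X) -> inR gg (mxvec Y) ->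
  inR ss (mxvec (cm X Y)).
Proof. by move=> hX hY; apply: inR_sub (inR_cspan hX hY); rewrite eq_row_base. Qed.

Lemma elE (R : comAlgType k) (u : 'rV[R]_m) : mxvec (el (fun i => A_ R (sb i)) u) = u *m A_ R ss.
Proof.
rewrite /el linear_sum mulmx_sum_row; apply: eq_bigr => i _.
by rewrite linearZ /= -map_mxvec vec_mxK map_row.
Qed.

Lemma inR_el (R : comAlgType k) (X : 'M[R]_N) : inR ss (mxvec X) <-> exists u, X = el (fun i => A_ R (sb i)) u.
Proof.
split=> [[u e]|[u ->]]; last by exists u; rewrite elE.
by exists u; apply: (can_inj mxvecK); rewrite elE.
Qed.

Lemma el_inj (R : comAlgType k) : injective (el (fun i => A_ R (sb i))).
Proof.
move=> u v e; have : u *m A_ R ss = v *m A_ R ss by rewrite -!elE e.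
move/(congr1 (mulmx^~ (A_ R (pinvmx ss)))); rewrite -!mulmxA -map_mxM mulmxVp ?row_base_free //.
by rewrite map_mx1 !mulmx1.
Qed.

Lemma sbx i j : cm (sb i) (sb j) = el sb (row j (sx i)).
Proof.
have -> : row j (sx i) = mxvec (cm (sb i) (sb j)) *m pinvmx ss by apply/rowP => l; rewrite !mxE.
apply: (can_inj mxvecK).
have h : (mxvec (cm (sb i) (sb j)) <= ss)%MS.
  rewrite eq_row_base; apply: cspan_in; apply: submx_trans (ss_sub); exact: row_memW.
rewrite -{1}(mulmxKpV h) /el linear_sum mulmx_sum_row; apply: eq_bigr => l _.
by rewrite linearZ /= vec_mxK.
Qed.

Lemma sbxR (R : comAlgType k) i j : cm (A_ R (sb i)) (A_ R (sb j)) = el (fun i => A_ R (sb i)) (row j (A_ R (sx i))).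
Proof.
rewrite -map_cm sbx /el map_mx_sum; apply: eq_bigr => l _; rewrite map_mxZ.
by rewrite !mxE.
Qed.

Lemma sb_inj : injective (el sb).
Proof.
have := @el_inj k^o; have -> // : (fun i => A_ k^o (sb i)) = sb by apply/funext => i; apply: regE.
Qed.

Lemma sx_lie : lie sx. Proof. exact: lie_of_matrices sbx sb_inj. Qed.

Lemma elss u : mxvec (el sb u) = u *m ss.
Proof.
have := @elE k^o u; rewrite regE; have -> // : (fun i => A_ k^o (sb i)) = sb by apply/funext => i; apply: regE.
Qed.

Lemma sub_ss (W : 'M[k]_m) X : memW (W *m ss) X <-> exists2 u, (u <= W)%MS & X = el sb u.
Proof.
split=> [/submxP[D e]|[u /submxP[D ->] ->]]; last by rewrite /memW elss -mulmxA submxMl.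
exists (D *m W); first exact: submxMl.
by apply: (can_inj mxvecK); rewrite elss e mulmxA.
Qed.

Lemma Ad_matrix (R : comAlgType k) (g : G R) : exists C : 'M[R]_m,
  forall v, el (fun i => A_ R (sb i)) (v *m C) = Ad r g (el (fun i => A_ R (sb i)) v).
Proof.
have /fin_all_exists[c hc] : forall i, exists c, Ad r g (A_ R (sb i)) = el (fun i => A_ R (sb i)) c.
  by move=> i; apply/inR_el; apply: Gstable_ss; apply: row_memW.
exists (\matrix_i c i) => v; rewrite mulmx_sum_row [X in Ad r g X]/el !linear_sum; apply: eq_bigr => i _.
by rewrite !linearZ /= rowK hc.
Qed.

(** Ad g is an automorphism of s over R and preserves its Killing form, hence the radical, whose
    equations are defined over k. *)
Lemma radical_stable : Gstable r (kermx (kill sx) *m ss).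
Proof.
move=> R g X /sub_ss[u hu ->].
have [[C eC] [C' eC']] := (Ad_matrix g, Ad_matrix (g^-1)%g).
have CC' : C *m C' = 1%:M.
  by apply/row_matrixP => i; apply: el_inj; rewrite !rowE mulmxA eC' eC AdVK mulmx1.
have kE := kill_aut (@sbxR R) (@el_inj R) CC' (Ad_cm g) eC.
have kA : kill (fun i => A_ R (sx i)) = A_ R (kill sx).
  by apply/matrixP => i j; rewrite !mxE -map_mxM trace_map_mx.
have u0 : A_ R u *m A_ R (kill sx) = 0 by rewrite -map_mxM (sub_kermxP hu) map_mx0.
have uC0 : A_ R u *m C *m A_ R (kill sx) = 0.
  have e : C *m A_ R (kill sx) = A_ R (kill sx) *m C'^T.
    by rewrite -kA [in RHS]kE -!mulmxA -trmx_mul (mulmx1C CC') trmx1 mulmx1.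
  by rewrite -mulmxA e mulmxA u0 mul0mx.
have [a ea] : inR (kermx (kill sx)) (A_ R u *m C) by apply/inR_ker.
have -> : A_ R (el sb u) = el (fun i => A_ R (sb i)) (A_ R u).
  by rewrite /el map_mx_sum; apply: eq_bigr => i _; rewrite map_mxZ !mxE.
by rewrite -eC elE ea; exists a; rewrite -mulmxA -map_mxM.
Qed.

Lemma brspan_stable W : ideal sx W -> Gstable r (W *m ss) -> Gstable r (brspan sx W W *m ss).
Proof.
move=> _ sW R g X hX; have sC := Gstable_cspan sW sW.
have inC u v : (u <= W)%MS -> (v <= W)%MS -> memW (cspan (W *m ss) (W *m ss)) (el sb (br sx u v)).
  by move=> hu hv; rewrite (el_br sbx); apply: cspan_in; apply/sub_ss; [exists u | exists v].
have hX' : memW (cspan (W *m ss) (W *m ss)) X.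
  have [u hu ->] := (sub_ss _ _).1 hX; have [c ->] := bspan_sum hu.
  rewrite /memW elss mulmx_suml; apply: summx_sub => i _; rewrite mulmx_suml; apply: summx_sub => j _.
  by rewrite -scalemxAl -elss; apply: scalemx_sub; apply: inC; apply: row_sub.
apply: inR_sub (sC R g X hX').
apply: bspanP => u v hu hv; rewrite glbrE.
have /sub_ss[u' hu' ->] : memW (W *m ss) (vec_mx u) by rewrite /memW vec_mxK.
have /sub_ss[v' hv' ->] : memW (W *m ss) (vec_mx v) by rewrite /memW vec_mxK.
rewrite -(el_br sbx) -/(memW _ _); apply/sub_ss; exists (br sx u' v') => //.
by apply: bspan_in => //; [exact: br_linear_l | exact: br_linear_r].
Qed.

(** A nonzero radical would contain a nonzero G-stable abelian ideal a. The elements of [gg, a] are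
    nilpotent by [nilp_cspan], so [gg, a] = 0 by reductivity. Then a is central and inside [gg, gg],
    so its elements are nilpotent as well and a = 0. *)
Theorem killing_nondegenerate : kill sx \in unitmx.
Proof.
have [K [iota _]] := redG.
rewrite -row_free_unit -kermx_eq0; apply/negPn/negP => k0.
have [W [W0 _ iW sW abW]] := abelian_descent iota ch0 sx_lie (P := fun W => Gstable r (W *m ss))
  brspan_stable k0 (radical_ideal sx_lie) radical_stable (fun u v hu hv => radical_null hu hv).
set a := W *m ss in sW.
have a_ss : (a <= ss)%MS by apply: submxMl.
have a_gg : (a <= gg)%MS by apply: submx_trans a_ss ss_sub.
have a_comm X Y : memW a X -> memW a Y -> X *m Y = Y *m X.
  move=> /sub_ss[u hu ->] /sub_ss[v hv ->]; apply/eqP; rewrite -subr_eq0 -/(cm _ _) -(el_br sbx) abW //.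
  by rewrite linear0.
have n1_a : (cspan gg a <= a)%MS.
  by apply: bspanP => u v hu hv; rewrite glbrE; apply: (Gstable_ad sW); rewrite /memW vec_mxK.
have n1_0 : cspan gg a = 0.
  apply: (no_unipotent_ideal fc ch0 redG).
  - exact: submx_trans n1_a a_gg.
  - by move=> X Y hX hY; apply: a_comm; [apply: submx_trans hX n1_a | apply: submx_trans hY n1_a].
  - move=> X hX; exists N; apply: (nilp_cspan hX) => Y hY; apply: a_comm => //.
    exact: submx_trans hX n1_a.
  - exact: Gstable_cspan Gstable_gg sW.
have a_central X Y : memW gg X -> memW a Y -> X *m Y = Y *m X.
  move=> hX hY; apply/eqP; rewrite -subr_eq0 -/(cm _ _) -mxvec_eq0 -submx0 -n1_0.
  exact: cspan_in.
have : a = 0.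
  apply: (no_unipotent_ideal fc ch0 redG a_gg a_comm) => // X hX; exists N.
  have : memW ss X by apply: submx_trans hX a_ss.
  by rewrite memW_ss => /nilp_cspan; apply => Y hY; rewrite (a_central Y X).
move=> /eqP; rewrite /a => /eqP e; case/eqP: W0; apply: (row_free_inj (row_base_free (cspan gg gg))).
by rewrite mul0mx.
Qed.

Lemma center_exists : exists z : 'M[k]_(N * N), forall X : 'M[k]_N, memW z X <->
  memW gg X /\ forall Y, memW gg Y -> cm X Y = 0.
Proof.
have [||z hz] := @subspace_mx k (N * N) (fun v => memW gg (vec_mx v) /\ forall Y, memW gg Y -> cm (vec_mx v) Y = 0).
- by rewrite /memW vec_mxK sub0mx; split=> // Y _; rewrite linear0 cm0l.
- move=> c u v [hu cu] [hv cv]; rewrite linearP; split; first exact: memWP.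
  by move=> Y hY; rewrite cm_linear_l cu // cv // scaler0 addr0.
by exists z => X; rewrite {1}/memW -hz mxvecK.
Qed.

(** The matrices X with this property form a G-stable space of central elements; taking for w the
    powers of X shows them nilpotent, so reductivity leaves only 0. The condition is linear in X,
    hence can be tested on functional images of a matrix over L. *)
Lemma nilcenter_zero (z : 'M[k]_(N * N)) :
  (forall X : 'M[k]_N, memW z X <-> memW gg X /\ forall Y, memW gg Y -> cm X Y = 0) ->
  forall X : 'M[k]_N, memW z X -> (forall w : 'M[k]_N, (forall Y, memW z Y -> cm w Y = 0) -> \tr (X *m w) = 0) -> X = 0.
Proof.
move=> hz X0 hX0 tX0.
have [||W hW] := @subspace_mx k (N * N) (fun v => memW z (vec_mx v) /\
   forall w : 'M[k]_N, (forall Y, memW z Y -> cm w Y = 0) -> \tr (vec_mx v *m w) = 0).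
- by rewrite /memW vec_mxK sub0mx; split=> // Y _; rewrite linear0 mul0mx mxtrace0.
- move=> c u v [hu cu] [hv cv]; rewrite linearP; split; first exact: memWP.
  by move=> Y hY; rewrite mulmxDl -scalemxAl mxtraceD mxtraceZ cu // cv // mulr0 addr0.
have {}hW (X : 'M[k]_N) : memW W X <-> memW z X /\ forall w, (forall Y, memW z Y -> cm w Y = 0) -> \tr (X *m w) = 0.
  by rewrite {1}/memW -hW mxvecK.
suff W0 : W = 0.
  have : memW W X0 by apply/hW.
  by rewrite /memW W0 submx0 mxvec_eq0 => /eqP.
have z_gg (X : 'M[k]_N) : memW z X -> memW gg X by case/hz.
have z_comm (X Y : 'M[k]_N) : memW z X -> memW gg Y -> X *m Y = Y *m X.
  by move=> /hz[_ h] /h/eqP; rewrite subr_eq0 => /eqP.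
have stz (R : comAlgType k) (g : G R) (X : 'M[k]_N) : memW z X -> inR z (mxvec (Ad r g (A_ R X))).
  move=> hX; have [gX cX] := (hz X).1 hX; apply: inR_functional => f; rewrite map_mxvec; apply/hz; split.
    rewrite /memW -map_mxvec; apply: inR_linear_down; apply: Gstable_gg gX.
  move=> Y hY; rewrite /cm -functional_mulmx -functional_mulmxl -raddfB /=.
  have -> : Ad r g (A_ R X) *m A_ R Y - A_ R Y *m Ad r g (A_ R X) = Ad r g (cm (A_ R X) (Ad r (g^-1)%g (A_ R Y))).
    by rewrite Ad_cm AdK.
  rewrite (cm_zeroR (W := gg)) ?linear0 ?map_mx0 ?raddf0 //; last exact: Gstable_gg.
  by move=> Z hZ; rewrite -map_cm cX // map_mx0.
apply: (no_unipotent_ideal fc ch0 redG).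
- apply/row_subP => i; have := row_memW W i; rewrite hW => -[/z_gg].
  by rewrite /memW vec_mxK.
- by move=> X Y /hW[hX _] /hW[/z_gg hY _]; apply: z_comm.
- move=> X /hW[hX tX]; exists N; apply: nilp_of_traces => // -[//|e] _; rewrite exprS.
  apply: tX => Y hY; apply/eqP; rewrite subr_eq0; apply/eqP.
  have hXY : X *m Y = Y *m X by apply: z_comm => //; apply: z_gg.
  by have : GRing.comm Y (X ^+ e) by apply: commrX; apply: esym.
move=> R g X /hW[hX tX]; apply: inR_functional => f; rewrite map_mxvec; apply/hW; split.
  by rewrite /memW -map_mxvec; apply: inR_linear_down; apply: stz.
move=> w cw; rewrite -functional_mulmx -[LHS]trace_map_mx_lin.
have -> : \tr (Ad r g (A_ R X) *m A_ R w) = \tr (A_ R X *m Ad r (g^-1)%g (A_ R w)).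
  by rewrite /Ad invgK -!mulmxA mxtrace_mulC !mulmxA.
suff -> : \tr (A_ R X *m Ad r (g^-1)%g (A_ R w)) = 0 by rewrite linear0.
apply: functional_zero => h; rewrite trace_map_mx_lin functional_mulmxl; apply: tX => Y hY.
rewrite /cm -functional_mulmx -functional_mulmxl -raddfB /=.
have -> : Ad r (g^-1)%g (A_ R w) *m A_ R Y - A_ R Y *m Ad r (g^-1)%g (A_ R w) = Ad r (g^-1)%g (cm (A_ R w) (Ad r g (A_ R Y))).
  by rewrite Ad_cm AdVK.
rewrite (cm_zeroR (W := z)) ?linear0 ?map_mx0 ?raddf0 //; last exact: stz.
by move=> Z hZ; rewrite -map_cm cw // map_mx0.
Qed.

End Reductive.

Section LinearMaps.
Variables (k : fieldType) (R S : comAlgType k) (f : {linear R -> S}).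
Lemma linear_mulmxr p q s (A : 'M[R]_(p, q)) (B : 'M[k]_(q, s)) :
  map_mx f (A *m map_mx (in_alg R) B) = map_mx f A *m map_mx (in_alg S) B.
Proof.
apply/matrixP => i j; rewrite !mxE linear_sum; apply: eq_bigr => l _.
by rewrite !mxE !mulr_algr linearZ.
Qed.
Lemma linear_mulmxl p q s (A : 'M[k]_(p, q)) (B : 'M[R]_(q, s)) :
  map_mx f (map_mx (in_alg R) A *m B) = map_mx (in_alg S) A *m map_mx f B.
Proof.
apply/matrixP => i j; rewrite !mxE linear_sum; apply: eq_bigr => l _.
by rewrite !mxE !mulr_algl linearZ.
Qed.
End LinearMaps.

Section PolyMaps.
Variables (k : fieldType) (L : splittingFieldType k).
Definition dpoly (p : polyk L) : polyk L := deriv (p : {poly L}).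
Fact dpoly_linear : linear dpoly.
Proof.
move=> a p q; rewrite -[a *: p + q]/((a%:A *: (p : {poly L}) + (q : {poly L}))) /dpoly.
exact: (linearP (@deriv L)).
Qed.
HB.instance Definition _ := GRing.isLinear.Build k (polyk L) (polyk L) _ dpoly dpoly_linear.
Lemma dpolyM p q : dpoly (p * q) = dpoly p * q + p * dpoly q.
Proof. exact: derivM. Qed.

Definition pcoef (i : nat) (p : polyk L) : L := (p : {poly L})`_i.
Fact pcoef_linear i : linear (pcoef i).
Proof.
move=> a p q; rewrite /pcoef -[a *: p + q]/((a%:A *: (p : {poly L}) + (q : {poly L}))).
by rewrite coefD coefZ mulr_algl.
Qed.
HB.instance Definition _ i := GRing.isLinear.Build k (polyk L) L _ (pcoef i) (pcoef_linear i).

Definition peval0 (p : polyk L) : L := (p : {poly L}).[0].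
Fact peval0_linear : linear peval0.
Proof.
move=> a p q; rewrite /peval0 -[a *: p + q]/((a%:A *: (p : {poly L}) + (q : {poly L}))).
by rewrite hornerD hornerZ mulr_algl.
Qed.
Fact peval0_monoid : monoid_morphism peval0.
Proof. by split=> [|p q]; rewrite /peval0 ?hornerE // hornerM. Qed.
HB.instance Definition _ := GRing.isLinear.Build k (polyk L) L _ peval0 peval0_linear.
HB.instance Definition _ := GRing.isMonoidMorphism.Build (polyk L) L peval0 peval0_monoid.
End PolyMaps.

Lemma coefM_top (F : fieldType) (p s : {poly F}) a b : (size p <= a.+1)%N -> (size s <= b.+1)%N ->
  (p * s)`_(a + b) = p`_a * s`_b /\ (size (p * s)%R <= (a + b).+1)%N.
Proof.
move=> hp hs; split; last first.
  by apply: leq_trans (size_polyMleq _ _) _; move: hp hs; move: (size p) (size s) => x y; lia.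
have lta : (a < (a + b).+1)%N by rewrite ltnS leq_addr.
rewrite coefM (bigD1 (Ordinal lta)) //= addKn big1 ?addr0 // => i /eqP ne.
have [lt|le] := ltnP a i.
  by rewrite [p`_i]nth_default ?mul0r //; apply: leq_trans hp lt.
have lti : (i < a)%N.
  by rewrite ltn_neqAle le andbT; apply/eqP => e; apply: ne; apply: val_inj.
rewrite [s`_ _]nth_default ?mulr0 //; apply: leq_trans hs _.
by move: lti; lia.
Qed.

Lemma size_deriv_le (F : fieldType) (p : {poly F}) : (size (deriv p) <= size p)%N.
Proof. by have [->|/lt_size_deriv/ltnW //] := eqVneq p 0; rewrite derivC size_poly0. Qed.

Lemma deriv_eq0_const (F : fieldType) (p : {poly F}) : [pchar F] =i pred0 -> deriv p = 0 -> p = p.[0]%:P.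
Proof.
move=> ch e; apply/polyP => -[|i]; rewrite coefC /=; first by rewrite horner_coef0.
have := congr1 (fun q : {poly F} => q`_i) e; rewrite coef_deriv coef0 -mulr_natr => /eqP.
by rewrite mulf_eq0 (pcharf0P F).1 // orbF => /eqP.
Qed.

Section Rigidity.
Variables (k : fieldType) (G : groupFunctor k) (n : nat) (r : linear_rep G n.+1).
Hypothesis fc : faithful_closed r.
Hypothesis ch0 : [pchar k] =i pred0.
Hypothesis redG : reductive_group G.
Variable L : splittingFieldType k.
Local Notation N := n.+1.
Local Notation R := (polyk L).
Local Notation A_ R := (map_mx (in_alg R)).

Local Notation sbr := (@sb _ _ _ r).
Local Notation sxr := (@sx _ _ _ r).

Let chL : [pchar L] =i pred0 := pchar0_fmorph (in_alg L) ch0.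

Lemma ss_commR (S : comAlgType k) (Z : 'M[S]_N) : (forall i, cm Z (A_ S (sbr i)) = 0) ->
  forall Y, inR (ss r) (mxvec Y) -> cm Z Y = 0.
Proof.
move=> h Y /inR_el[u ->]; rewrite /el linear_sum big1 // => i _.
by rewrite linearZ /= h scaler0.
Qed.

Lemma kill_map (S : comAlgType k) : kill (fun i => A_ S (sxr i)) = A_ S (kill sxr).
Proof. by apply/matrixP => i j; rewrite !mxE -map_mxM trace_map_mx. Qed.

(** For Y in gg the bracket [Z, Y] lies in s, and by the Jacobi identity it commutes with s, whose
    centre is trivial by nondegeneracy of the Killing form. *)
Lemma centralizer_ss (S : comAlgType k) (Z : 'M[S]_N) : inR (gg r) (mxvec Z) ->
  (forall i, cm Z (A_ S (sbr i)) = 0) -> forall Y, memW (gg r) Y -> cm Z (A_ S Y) = 0.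
Proof.
move=> hZ cZ Y hY.
have hYR : inR (gg r) (mxvec (A_ S Y)) by rewrite -map_mxvec; apply: inR_base.
have [u eu] := (inR_el _ _).1 (ss_perfectR hZ hYR).
suff u0 : u = 0 by rewrite eu u0 linear0.
have KK : kill (fun i => A_ S (sxr i)) *m A_ S (invmx (kill sxr)) = 1%:M.
  by rewrite kill_map -map_mxM mulmxV ?map_mx1 //; apply: (killing_nondegenerate fc ch0 redG).
apply: (centralizer_zero KK) => v; apply: (@el_inj _ _ _ r S).
rewrite (el_br (@sbxR _ _ _ r fc S)) linear0 -eu {1}/el linear_sum big1 // => i _.
rewrite linearZ /= cm_jacobi cZ linear0 subr0 (ss_commR cZ) ?scaler0 //.
apply: ss_perfectR => //; rewrite -map_mxvec; apply: inR_base.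
by apply: submx_trans (ss_sub fc); apply: row_memW.
Qed.

Lemma map_mx_deriv (A B : 'M[R]_N) :
  map_mx (@dpoly k L) (A *m B) = map_mx (@dpoly k L) A *m B + A *m map_mx (@dpoly k L) B.
Proof.
apply/matrixP => i j; rewrite !mxE linear_sum -big_split; apply: eq_bigr => l _ /=.
by rewrite !mxE dpolyM.
Qed.

Lemma iter_nilpotent (M : 'M[L]_N) e : M ^+ e = 0 -> \tr M = 0.
Proof.
move=> h; apply: (mxtrace_nilp (N := e)); rewrite -h.
by elim: e {h} => [|e IH]; rewrite ?expr0 // iterS IH exprS.
Qed.

(* If d' = Z d then the e-th derivative of d is P_e d, where the coefficient of t^(qe) in P_e
   is the e-th power of the top coefficient of Z; so that coefficient is nilpotent. *)
Lemma top_nilpotent (d d' Z : 'M[R]_N) q : d *m d' = 1%:M -> map_mx (@dpoly k L) d = Z *m d ->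
  (forall i j, size (Z i j : {poly L}) <= q.+1)%N -> exists e, (map_mx (@pcoef k L q) Z) ^+ e = 0.
Proof.
move=> dd' ed szZ.
pose P := fix P e : 'M[R]_N := if e is e'.+1 then map_mx (@dpoly k L) (P e') + P e' *m Z else 1%:M.
have eP e : iter e (map_mx (@dpoly k L)) d = P e *m d.
  elim: e => [|e IH] /=; first by rewrite mul1mx.
  by rewrite IH map_mx_deriv ed mulmxDl mulmxA.
have topP e : (forall i j, size (P e i j : {poly L}) <= (q * e).+1)%N /\
    map_mx (@pcoef k L (q * e)) (P e) = (map_mx (@pcoef k L q) Z) ^+ e.
  elim: e => [|e [IH1 IH2]].
    split=> [i j|]; first by rewrite muln0 mxE; case: (i == j); rewrite ?size_poly1 ?size_poly0.
    by apply/matrixP => i j; rewrite muln0 !mxE; case: (i == j); rewrite /pcoef ?coef1 ?coef0.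
  split=> [i j|].
    rewrite /= mxE; apply: leq_trans (size_polyD _ _) _; rewrite geq_max; apply/andP; split.
      rewrite mxE; apply: leq_trans (size_deriv_le _) _.
      by apply: leq_trans (leq_trans (IH1 i j) _); rewrite ?ltnS ?leq_mul2l ?leqnSn ?orbT.
    rewrite mxE; apply: leq_trans (size_sum _ _ _) _; apply/bigmax_leqP => l _.
    by have [_] := coefM_top (IH1 i l) (szZ l j); rewrite mulnSr.
  have eS : P e.+1 = map_mx (@dpoly k L) (P e) + P e *m Z by [].
  apply/matrixP => i j; rewrite exprSr -IH2 [RHS]mxE mulnSr [LHS]mxE eS [X in pcoef _ X]mxE linearD /=.
  have -> : pcoef (q * e + q) (map_mx (@dpoly k L) (P e) i j) = 0.
    rewrite mxE /pcoef coef_deriv nth_default ?mul0rn //; apply: leq_trans (IH1 i j) _.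
    by rewrite ltnS leq_addr.
  rewrite add0r mxE linear_sum; apply: eq_bigr => l _; rewrite !mxE.
  by have [h _] := coefM_top (IH1 i l) (szZ l j); apply: h.
have [e he] : exists e, forall i j, (size (d i j : {poly L}) <= e)%N.
  exists (\max_i \max_j size (d i j : {poly L})) => i j.
  by apply: leq_trans (leq_bigmax i); apply: (@leq_bigmax _ (fun j => size (d i j : {poly L})) j).
exists e; have [_ <-] := topP e.
have -> : P e = 0.
  rewrite -[P e]mulmx1 -dd' mulmxA -eP.
  have -> : iter e (map_mx (@dpoly k L)) d = 0; last by rewrite mul0mx.
  apply/matrixP => i j; rewrite mxE.
  have -> : iter e (map_mx (@dpoly k L)) d i j = iter e (@deriv L) (d i j : {poly L}).
    by elim: (e) => // f IH; rewrite /= mxE IH.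
  have := he i j; move: (d i j : {poly L}) => p.
  elim: (e) p => [|f IH] p sp; first by apply/eqP; rewrite -size_poly_eq0 -leqn0.
  rewrite iterSr IH //; have [->|p0] := eqVneq p 0; first by rewrite derivC size_poly0.
  by rewrite -ltnS; apply: leq_trans sp; apply: lt_size_deriv.
by apply/matrixP => i j; rewrite !mxE linear0.
Qed.

(** The logarithmic derivative Z of d lies in gg and commutes with s, hence with gg. Its top
    coefficient is nilpotent by [top_nilpotent]; its images under functionals L -> k satisfy the
    conditions of [nilcenter_zero], so it is 0. Thus Z = 0 and d is constant. *)
Theorem rigidity (d : G R) : (forall i, r R d *m A_ R (sbr i) = A_ R (sbr i) *m r R d) ->
  map_mx (@peval0 k L) (r R d) = 1%:M -> r R d = 1%:M.
Proof.
move=> cd d0; pose D := @dpoly k L.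
pose Z := map_mx D (r R d) *m r R (d^-1)%g.
have hZ : inR (gg r) (mxvec Z) by apply: (log_derivative fc (@dpolyM k L)).
have ed : map_mx D (r R d) = Z *m r R d by rewrite /Z -mulmxA repV mulmx1.
suff Z0 : Z = 0.
  have D0 : map_mx D (r R d) = 0 by rewrite ed Z0 mul0mx.
  apply/matrixP => i j; have /matrixP/(_ i j) := D0; rewrite [LHS]mxE [RHS]mxE => /(deriv_eq0_const chL) ->.
  have /matrixP/(_ i j) := d0; rewrite [LHS]mxE [RHS]mxE /peval0 => ->.
  by rewrite mxE; case: (i == j).
have cZ i : cm Z (A_ R (sbr i)) = 0.
  have e1 : r R (d^-1)%g *m A_ R (sbr i) = A_ R (sbr i) *m r R (d^-1)%g.
    rewrite -[LHS]mulmx1 -(repVr r d) mulmxA -[_ *m r R d]mulmxA -cd !mulmxA repV mul1mx.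
    by [].
  apply/eqP; rewrite subr_eq0; apply/eqP.
  rewrite /Z -mulmxA e1 !mulmxA; congr (_ *m _).
  by rewrite -linear_mulmxr cd linear_mulmxl.
have cZg := centralizer_ss hZ cZ.
have [z hz] := center_exists r.
apply/eqP/negPn/negP => Z0.
have [q szZ [i0 [j0 Zq0]]] : exists2 q, (forall i j, size (Z i j : {poly L}) <= q.+1)%N &
    exists i j, pcoef q (Z i j) != 0.
  pose s (t : 'I_N * 'I_N) := size (Z t.1 t.2 : {poly L}).
  have [i0 [j0 h0]] : exists i j, Z i j != 0.
    apply: contrapT => /forallNP h; case/eqP: Z0; apply/matrixP => i j; rewrite [RHS]mxE.
    by apply/eqP/negPn/negP => h'; apply: (h i); exists j.
  pose t := [arg max_(t > (i0, j0)) s t]%N.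
  have [tmax t1] : (forall u, (s u <= s t)%N) /\ (0 < s t)%N.
    rewrite /t; case: arg_maxnP => // u _ h; split=> [v|]; first exact: h.
    by apply: leq_trans (h (i0, j0) isT); rewrite size_poly_gt0.
  exists (s t).-1; first by move=> i j; rewrite prednK //; apply: (tmax (i, j)).
  by exists t.1, t.2; rewrite /pcoef -lead_coefE lead_coef_eq0 -size_poly_gt0.
pose Zq := map_mx (@pcoef k L q) Z.
have [e nilZ] := top_nilpotent (repVr r d) ed szZ.
suff Zq_0 : Zq = 0 by case/eqP: Zq0; have /matrixP/(_ i0 j0) := Zq_0; rewrite !mxE.
have fz (f : {linear L -> k^o}) : memW z (map_mx f Zq : 'M[k]_N).
  pose F : {linear R -> k^o} := f \o @pcoef k L q.
  have eF : map_mx f Zq = map_mx F Z by apply/matrixP => i j; rewrite !mxE.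
  apply/hz; split; first by rewrite /memW eF -map_mxvec; apply: inR_linear_down.
  move=> Y hY; rewrite /cm eF -functional_mulmx -functional_mulmxl -raddfB /=.
  by have := cZg Y hY; rewrite /cm => ->; apply: map_mx0.
have fZ (f : {linear L -> k^o}) : (map_mx f Zq : 'M[k]_N) = 0.
  apply: (nilcenter_zero fc ch0 redG hz (fz f)) => w cw.
  rewrite -functional_mulmx -trace_map_mx_lin.
  suff -> : \tr (Zq *m A_ L w) = 0 by rewrite linear0.
  (* w commutes with all functional images of [Zq], hence with [Zq]; a nilpotent matrix times a
     commuting one has trace 0. *)
  have cZw : GRing.comm Zq (A_ L w).
    apply/eqP; rewrite -subr_eq0; apply/eqP/matrixP => i j; rewrite [RHS]mxE.
    apply: functional_zero => h.
    have : map_mx h (Zq *m A_ L w - A_ L w *m Zq) = 0.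
      rewrite raddfB /= functional_mulmx functional_mulmxl -[_ - _]/(cm _ _) cm_antisym.
      by rewrite (cw _ (fz h)) oppr0.
    by move/matrixP/(_ i j); rewrite !mxE.
  apply: (iter_nilpotent (e := e)); rewrite -[_ *m _]/(Zq * A_ L w) exprMn_comm //.
  by rewrite nilZ mul0r.
apply/matrixP => i j; rewrite [RHS]mxE; apply: functional_zero => f.
by have /matrixP/(_ i j) := fZ f; rewrite !mxE.
Qed.

End Rigidity.

(** * Galois descent over L[t] *)

Section Hilbert90.
Variables (k : fieldType) (L : splittingFieldType k) (m : nat).
Local Notation Gam := (gal_of {:L}).
Local Notation sg s := (map_mx (map_poly (s : L -> L))).

(** Dedekind's independence of automorphisms: the matrix of conjugates of a basis has independent
    rows, so some combination of its columns is the indicator of the identity. *)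
Lemma galois_functional : exists n (a lam : 'I_n -> L), forall s : Gam,
  \sum_i lam i * s (a i) = (s == 1%g)%:R.
Proof.
pose n := \dim {:L}; pose a (i : 'I_n) : L := (vbasis {:L})`_i.
pose A : 'M[L]_(#|{: Gam}|, n) := \matrix_(i, j) (enum_val i : Gam) (a j).
have fA : row_free A.
  rewrite -kermx_eq0; apply/eqP/row_matrixP => i0; rewrite row0.
  set u := row i0 _; have u0 : u *m A = 0 by rewrite /u -row_mul mulmx_ker row0.
  pose c (s : Gam) : L := u 0 (enum_rank s).
  have h : forall s, c s = 0.
    move=> s; apply: (@gal_independent _ L {:L} predT c) => // y _.
    rewrite (coord_vbasis (memvf y)).
    transitivity (\sum_(s : Gam) \sum_j coord (vbasis {:L}) j y *: (c s * s (a j))).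
      apply: eq_bigr => t _; rewrite linear_sum mulr_sumr; apply: eq_bigr => j _.
      by rewrite linearZ /= scalerAr.
    rewrite exchange_big big1 // => j _; rewrite -scaler_sumr.
    suff -> : \sum_(t : Gam) c t * t (a j) = 0 by rewrite scaler0.
    have /rowP/(_ j) := u0; rewrite !mxE => e; rewrite -[RHS]e.
    rewrite (reindex (@enum_val _ {: Gam})) /=; last by apply: onW_bij; apply: enum_val_bij.
    by apply: eq_bigr => i _; rewrite /c !mxE enum_valK.
  by apply/rowP => i; rewrite [RHS]mxE; have := h (enum_val i); rewrite /c enum_valK.
pose lam := pinvmx A *m (delta_mx (enum_rank (1%g : Gam)) 0 : 'cV_(#|{: Gam}|)).
have eA : A *m lam = delta_mx (enum_rank (1%g : Gam)) 0 by rewrite mulmxA mulmxVp // mul1mx.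
exists n, a, (fun i => lam i 0) => s.
have /colP/(_ (enum_rank s)) := eA; rewrite mxE mxE eqxx andbT (inj_eq enum_rank_inj) => <-.
by apply: eq_bigr => i _; rewrite [A _ _]mxE enum_rankK mulrC.
Qed.

Variable C : Gam -> 'M[{poly L}]_m.
Hypothesis C1 : C 1%g = 1%:M.
Hypothesis CM : forall x y : Gam, C (x * y)%g = sg y (C x) *m C y.

Definition inv_row (v : 'rV[{poly L}]_m) := forall s : Gam, sg s v *m C s = v.

Lemma inv_rowB (q : {poly L}) v w : (forall s : Gam, map_poly s q = q) -> inv_row v -> inv_row w ->
  inv_row (w - q *: v).
Proof. by move=> hq hv hw s; rewrite map_mxB map_mxZ [X in _ - X *: _](hq s) mulmxBl -scalemxAl hv hw. Qed.

Lemma sgM (x y : Gam) p (v : 'M[{poly L}]_(p, m)) : sg (x * y)%g v = sg y (sg x v).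
Proof.
apply/matrixP => i j; rewrite !mxE; apply/polyP => e; rewrite !coef_map.
exact: galM_full.
Qed.

Lemma trace_inv (v : 'rV[{poly L}]_m) : inv_row (\sum_(s : Gam) sg s v *m C s).
Proof.
move=> y; rewrite map_mx_sum mulmx_suml [RHS](reindex_inj (mulIg y)) /=.
by apply: eq_bigr => x _; rewrite map_mxM CM sgM mulmxA.
Qed.

Lemma detC_const (s : Gam) : exists2 u, u != 0 & \det (C s) = u%:P.
Proof.
have e : \det (sg s (C s^-1%g)) * \det (C s) = 1 by rewrite -det_mulmx -CM mulVg C1 det1.
have : \det (C s) \is a GRing.unit by apply/unitrP; exists (\det (sg s (C s^-1%g))); split; [exact: e | rewrite mulrC; exact: e].
rewrite poly_unitE => /andP[/eqP sz]; have /eqP/size_poly1P[u u0 ->] := sz.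
by exists u.
Qed.

Lemma det_semi (Q : 'M[{poly L}]_m) : (forall i, inv_row (row i Q)) ->
  forall s : Gam, map_poly (s : L -> L) (\det Q) * \det (C s) = \det Q.
Proof.
move=> hQ s; rewrite -[map_poly _ _]/((map_poly (s : {rmorphism L -> L})) _) -det_map_mx -det_mulmx.
by congr (\det _); apply/row_matrixP => i; rewrite row_mul -[RHS](hQ i s) map_row.
Qed.

(** By Cramer's rule its determinant is the i-th coordinate of v along the rows of P, times det
    P. *)
Definition repl (P : 'M[{poly L}]_m) i (v : 'rV[{poly L}]_m) : 'M_m := \matrix_(a, b) if a == i then v 0 b else P a b.

Lemma det_repl P i v : \det (repl P i v) = (v *m \adj P) 0 i.
Proof.
rewrite (expand_det_row _ i) mxE; apply: eq_bigr => j _; rewrite !mxE eqxx; congr (_ * _).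
rewrite /cofactor; congr (_ * \det _); apply/matrixP => a b; rewrite !mxE.
by rewrite eq_sym (negPf (neq_lift _ _)).
Qed.

Lemma repl_row P i : repl P i (row i P) = P.
Proof. by apply/matrixP => a b; rewrite mxE; case: eqP => [->|//]; rewrite mxE. Qed.

Lemma repl_inv P i v : (forall i, inv_row (row i P)) -> inv_row v -> forall j, inv_row (row j (repl P i v)).
Proof.
move=> hP hv j; have -> : row j (repl P i v) = if j == i then v else row j P.
  by apply/rowP => b; rewrite !mxE; case: ifP; rewrite ?mxE.
by case: ifP.
Qed.

(** The twisted traces of a_i e_j are invariant, and the coefficients [lam] recombine them into the
    standard basis, so they have full rank over L(t). *)
Lemma inv_full : exists P : 'M[{poly L}]_m, (forall i, inv_row (row i P)) /\ \det P != 0.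
Proof.
have [n [a [lam hlam]]] := galois_functional.
pose M i : 'M[{poly L}]_m := \sum_(s : Gam) (s (a i))%:P *: C s.
have invM i j : inv_row (row j (M i)).
  have -> : row j (M i) = \sum_(s : Gam) sg s ((a i)%:P *: delta_mx 0 j) *m C s.
    rewrite /M linear_sum; apply: eq_bigr => s _; rewrite linearZ /= map_mxZ /= map_polyC /=.
    by rewrite map_delta_mx -scalemxAl rowE.
  exact: trace_inv.
have sumM : \sum_i (lam i)%:P *: M i = 1%:M.
  transitivity (\sum_(s : Gam) (\sum_i lam i * s (a i))%:P *: C s).
    rewrite /M; under eq_bigr => i _ do rewrite scaler_sumr.
    rewrite exchange_big; apply: eq_bigr => s _; rewrite rmorph_sum scaler_suml; apply: eq_bigr => i _.
    by rewrite scalerA -polyCM.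
  rewrite (bigD1 1%g) //= hlam eqxx scale1r C1 big1 ?addr0 // => s s1.
  by rewrite hlam (negPf s1) scale0r.
pose T := ('I_n * 'I_m)%type.
pose B : 'M[{poly L}]_(#|{: T}|, m) := \matrix_t row (enum_val t).2 (M (enum_val t).1).
pose F := map_mx (@tofrac {poly L}).
have fB : row_full (F _ _ B).
  rewrite -sub1mx -[1%:M](map_mx1 (@tofrac {poly L})) -sumM map_mx_sum; apply: summx_sub => i _.
  rewrite map_mxZ; apply: scalemx_sub; apply/row_subP => j.
  have -> : row j (map_mx (@tofrac {poly L}) (M i)) = row (enum_rank ((i, j) : T)) (F _ _ B).
    by rewrite /F -!map_row rowK enum_rankK.
  exact: row_sub.
exists (rowsub (fullrankfun fB) B); split.
  move=> i; rewrite row_rowsub rowK; exact: invM.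
have := fullrowsub_unit fB; rewrite unitmxE unitfE.
have -> : rowsub (fullrankfun fB) (F _ _ B) = F _ _ (rowsub (fullrankfun fB) B).
  by apply/matrixP => i j; rewrite !mxE.
by rewrite det_map_mx tofrac_eq0.
Qed.

(** Take an invariant family of full rank with det P of least degree. Dividing a Cramer determinant
    by det P leaves the determinant of another invariant family, hence 0. So the rows of P generate
    all invariants over L[t], in particular the twisted traces, which recombine into the standard
    basis. *)
Theorem hilbert90_poly : exists P P' : 'M[{poly L}]_m, P *m P' = 1%:M /\ forall s : Gam, sg s P *m C s = P.
Proof.
pose ok d := `[< exists P : 'M[{poly L}]_m, [/\ (forall i, inv_row (row i P)), \det P != 0 & size (\det P) = d] >].
have exok : exists d, ok d.
  by have [P [h1 h2]] := inv_full; exists (size (\det P)); apply/asboolP; exists P.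
have [d0 /asboolP[P [invP P0 szP]] dmin] := ex_minnP exok.
have div v : inv_row v -> exists w, v = w *m P.
  move=> hv; pose dl i := \det (repl P i v).
  have hmod i : dl i %% \det P = 0.
    apply/eqP/negPn/negP => r0; pose q := dl i %/ \det P.
    have ltr : (size (dl i %% \det P)%R < size (\det P))%N by rewrite ltn_modp.
    (* Both determinants transform by the constant det C_s, so uniqueness of division makes q Galois
       invariant, and subtracting q times a row of P keeps v invariant. *)
    have qs (s : Gam) : map_poly s q = q.
      have [u u0 eu] := detC_const s.
      have e1 := det_semi invP s; have e2 := det_semi (repl_inv i invP hv) s.
      have e3 : dl i = map_poly s q * \det P + u%:P * map_poly s (dl i %% \det P).
        rewrite -{1}[dl i]/(\det (repl P i v)) -e2 -/(dl i) {1}(divp_eq (dl i) (\det P)) -/q.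
        rewrite rmorphD rmorphM /= mulrDl -mulrA e1 eu; congr (_ + _); exact: mulrC.
      rewrite {2}/q e3 divp_addl_mul_small // mul_polyC size_scale //.
      by rewrite size_map_poly.
    have hv' := inv_rowB qs (invP i) hv.
    have ed : \det (repl P i (v - q *: row i P)) = dl i %% \det P.
      rewrite det_repl mulmxBl mxE -det_repl -scalemxAl !mxE.
      have -> : \sum_j row i P 0 j * \adj P j i = (row i P *m \adj P) 0 i by rewrite [RHS]mxE.
      rewrite -det_repl repl_row -/(dl i) {1}(divp_eq (dl i) (\det P)) -/q.
      by rewrite addrAC subrr add0r.
    have := dmin (size (dl i %% \det P)); rewrite leqNgt -szP ltr => /(_ _)/negP; apply; last by [].
    apply/asboolP; exists (repl P i (v - q *: row i P)); rewrite ed; split=> //.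
    exact: repl_inv.
  exists (\row_i (dl i %/ \det P)).
  have e : v *m \adj P = \det P *: \row_i (dl i %/ \det P).
    apply/rowP => i; rewrite -det_repl -/(dl i) !mxE {1}(divp_eq (dl i) (\det P)) hmod addr0.
    exact: mulrC.
  have e2 : \det P *: v = \det P *: (\row_i (dl i %/ \det P) *m P).
    by rewrite scalemxAl -e -mulmxA mul_adj_mx mul_mx_scalar.
  apply/rowP => j; have /rowP/(_ j) := e2; rewrite mxE [RHS]mxE.
  by move/(mulfI P0).
have [n [a [lam hlam]]] := galois_functional.
have trP i j : exists w, \sum_(s : Gam) sg s ((a i)%:P *: delta_mx 0 j : 'rV[{poly L}]_m) *m C s = w *m P.
  by apply: div; apply: trace_inv.
have /fin_all_exists[w hw] : forall t : 'I_n * 'I_m, exists w,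
    \sum_(s : Gam) sg s ((a t.1)%:P *: delta_mx 0 t.2 : 'rV[{poly L}]_m) *m C s = w *m P by move=> t; apply: trP.
pose X : 'M[{poly L}]_m := \matrix_j (\sum_i (lam i)%:P *: w (i, j)).
have XP : X *m P = 1%:M.
  apply/row_matrixP => j; rewrite row_mul rowK mulmx_suml rowE mulmx1.
  transitivity (\sum_i (lam i)%:P *: \sum_(s : Gam) ((s (a i))%:P *: (delta_mx 0 j *m C s)) : 'rV_m).
    apply: eq_bigr => i _; rewrite -scalemxAl -(hw (i, j)); congr (_ *: _); apply: eq_bigr => s _ /=.
    by rewrite map_mxZ /= map_polyC /= map_delta_mx -scalemxAl.
  under eq_bigr => i _ do rewrite scaler_sumr.
  rewrite exchange_big (bigD1 1%g) //= [X in _ + X]big1 ?addr0.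
    under eq_bigr => i _ do rewrite scalerA -polyCM.
    by rewrite -scaler_suml -rmorph_sum hlam eqxx scale1r C1 mulmx1.
  move=> s s1; under eq_bigr => i _ do rewrite scalerA -polyCM.
  by rewrite -scaler_suml -rmorph_sum hlam (negPf s1) scale0r.
exists P, X; split; first exact: mulmx1C.
by move=> s; apply/row_matrixP => i; rewrite row_mul -[RHS](invP i s) map_row.
Qed.

End Hilbert90.

(** L is generated over k by one element, whose minimal polynomial has a root in K. *)
Lemma galois_embedding (k : fieldType) (K : closedFieldType) (iota : {rmorphism k -> K})
  (L : splittingFieldType k) : galois 1 {:L} -> inhabited {rmorphism L -> K}.
Proof.
move=> /and3P[_ sepL _]; pose z := separable_generator 1%AS {:L}%AS.
have gen y : exists p : {poly k}, y = (map_poly (in_alg L) p).[z].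
  have hy : y \in <<1; z>>%VS by rewrite -(eq_adjoin_separable_generator sepL (sub1v _)) memvf.
  have /polyOver1P[q eq] := Fadjoin_polyOver 1%AS z y.
  by exists q; rewrite -eq Fadjoin_poly_eq.
have /polyOver1P[mp emp] := minPolyOver 1%AS z.
have [al ral] : exists al, root (map_poly iota mp) al.
  by apply/closed_rootP; rewrite size_map_poly -(size_map_poly (in_alg L)) -emp size_minPoly.
have wd (p : {poly k}) : (map_poly (in_alg L) p).[z] = 0 -> (map_poly iota p).[al] = 0.
  move=> pz; have : minPoly 1 z %| map_poly (in_alg L) p.
    apply: minPoly_dvdp; last exact/rootP.
    by apply/polyOverP => i; rewrite coef_map /=; apply/vlineP; exists p`_i.
  rewrite emp dvdp_map => /(dvdpP _ _)[q ->].
  by rewrite rmorphM hornerM (rootP ral) mulr0.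
have hP y : {p : {poly k} | y = (map_poly (in_alg L) p).[z]} by apply: cid.
pose phi y := (map_poly iota (sval (hP y))).[al].
have phiE p y : y = (map_poly (in_alg L) p).[z] -> phi y = (map_poly iota p).[al].
  move=> e; apply/eqP; rewrite -subr_eq0 /phi -hornerN -hornerD -rmorphB; apply/eqP/wd.
  by rewrite rmorphB hornerD hornerN -e -(svalP (hP y)) subrr.
have phiB : zmod_morphism phi.
  move=> x y; rewrite (phiE (sval (hP x) - sval (hP y))) ?rmorphB ?hornerD ?hornerN //.
  by rewrite -!(svalP (hP _)).
have phiM : monoid_morphism phi.
  split; first by rewrite (phiE 1) ?rmorph1 ?hornerC.
  move=> x y; rewrite (phiE (sval (hP x) * sval (hP y))) ?rmorphM ?hornerM //.
  by rewrite -!(svalP (hP _)).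
pose Phi : {rmorphism L -> K} := HB.pack phi (GRing.isZmodMorphism.Build _ _ phi phiB)
  (GRing.isMonoidMorphism.Build _ _ phi phiM).
by exists.
Qed.

Section OdeDescent.
Variables (L : fieldType) (K : closedFieldType) (jL : {rmorphism L -> K}).
Hypothesis chL : [pchar L] =i pred0.
Variables (m : nat) (Phi c : 'I_m -> 'I_m -> {poly L}) (n : nat) (b : 'I_m -> 'M[L]_n).
Variable g : 'M[fps L]_n.

Lemma solves_map : solves Phi c b g ->
  solves (fun i j => map_poly jL (Phi i j)) (fun i j => map_poly jL (c i j)) (fun i => map_mx jL (b i))
    (map_mx (fmap_fps jL) g).
Proof.
move=> [h1 h2 h3].
have eS p q (A : 'M[{poly L}]_(p, q)) : map_mx (@pfps K) (map_mx (map_poly jL) A) = map_mx (fmap_fps jL) (map_mx (@pfps L) A).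
  by apply/matrixP => i j; rewrite !mxE fmap_fps_pfps.
have eC p q (A : 'M[L]_(p, q)) : map_mx (@polyC K) (map_mx jL A) = map_mx (map_poly jL) (map_mx (@polyC L) A).
  by apply/matrixP => i j; rewrite !mxE map_polyC.
have eY : Ysys (fun i j => map_poly jL (c i j)) (fun i => map_mx jL (b i)) = map_mx (map_poly jL) (Ysys c b).
  rewrite /Ysys map_mx_sum; apply: eq_bigr => i _; rewrite map_mx_sum; apply: eq_bigr => j _.
  by rewrite [RHS]map_mxZ -eC; congr (_ *: map_mx _ _); rewrite map_mxB !map_mxM.
have ee j : esys (fun i j => map_poly jL (Phi i j)) (fun i => map_mx jL (b i)) j = map_mx (map_poly jL) (esys Phi b j).
  by rewrite /esys map_mx_sum; apply: eq_bigr => i _; rewrite map_mxZ -eC.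
split=> [|i j|j].
- rewrite eY eS -map_mxM -h1; apply/matrixP => i j; rewrite !mxE.
  by symmetry; apply: fmap_fps_deriv.
- by rewrite mxE /= h2 rmorph_nat.
- by rewrite ee eC !eS -!map_mxM h3.
Qed.

Theorem ode_polynomial_descent : solves Phi c b g -> exists h : 'M[{poly L}]_n, g = map_mx (@pfps L) h.
Proof.
move=> /solves_map/(ode_polynomial (pchar0_fmorph jL chL))[h [h' [eh _]]].
exists (\matrix_(i, j) \poly_(l < size (h i j)) fcoef (g i j) l).
apply/matrixP => i j; apply: fpsP => l; rewrite !mxE /= coef_poly; case: ltnP => // le.
have /matrixP/(_ i j) := eh; rewrite !mxE => /(congr1 (fun f => fcoef f l)) /=.
by rewrite nth_default // => /eqP; rewrite fmorph_eq0 => /eqP.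
Qed.
End OdeDescent.

Section LieFacts.
(** A functional vanishing on all brackets is represented by some h for the Killing form; invariance
    makes h central, and nondegeneracy makes it zero. *)
Lemma killing_perfect (k : fieldType) m (x : 'I_m -> 'M[k]_m) : lie x -> kill x \in unitmx ->
  forall u : 'rV_m, (u <= brspan x 1%:M 1%:M)%MS.
Proof.
move=> lx uK.
suff c0 : cokermx (brspan x 1%:M 1%:M) = 0 by move=> u; rewrite submxE c0 mulmx0.
set B := brspan _ _ _; apply/trmx_inj/row_matrixP => j0; rewrite trmx0 row0.
set f := row j0 _.
have hf u v : br x u v *m f^T = 0.
  have : (br x u v <= B)%MS.
    by apply: bspan_in; [exact: br_linear_l | exact: br_linear_r | |]; apply: submx1.
  by rewrite submxE => /eqP e; rewrite /f tr_row trmxK colE mulmxA e mul0mx.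
pose h := f *m (invmx (kill x))^T.
have eh : f^T = kill x *m h^T by rewrite /h trmx_mul trmxK mulmxA mulmxV // mul1mx.
suff h0 : h = 0 by apply: trmx_inj; rewrite eh h0 !trmx0 mulmx0.
have KK : kill x *m invmx (kill x) = 1%:M by rewrite mulmxV.
have key (u v : 'rV[k]_m) : (u *m kill x *m (br x v h)^T) 0 0 = 0.
  have := hf u v; rewrite eh mulmxA => /matrixP/(_ 0 0); rewrite [RHS]mxE killE => e.
  rewrite killE; case: (lx) => _ lx2; rewrite -[RHS]e !lx2 mulmxBl mulmxBr !raddfB /=.
  rewrite -[adv x v *m adv x u *m _]mulmxA [X in _ = X - _]mxtrace_mulC -!mulmxA.
  by [].
have bv (v : 'rV[k]_m) : br x v h = 0.
  have : (kill x)^T *m (br x v h)^T = 0.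
    have ksym : (kill x)^T = kill x by apply/matrixP => p q; rewrite !mxE mxtrace_mulC.
    apply/colP => i; rewrite [RHS]mxE -[RHS](key (delta_mx 0 i) v) ksym -mulmxA -rowE.
    by rewrite [RHS]mxE.
  move/(congr1 (mulmx (invmx (kill x)^T))); rewrite mulmxA mulVmx ?unitmx_tr // mul1mx mulmx0.
  by move/(congr1 trmx); rewrite trmxK trmx0.
have hv (v : 'rV[k]_m) : br x h v = 0 by case: (lx) => -> _; rewrite bv oppr0.
have a0 : adv x h = 0 by apply/row_matrixP => i; rewrite rowE row0 -[LHS]/(br x h _) hv.
have hk : h *m kill x = 0.
  apply/rowP => j; have := killE x h (delta_mx 0 j).
  by rewrite a0 mul0mx mxtrace0 trmx_delta -colE mxE => ->; rewrite mxE.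
by rewrite -[h]mulmx1 -KK mulmxA hk mul0mx.
Qed.

(** D kills the structure constants, so differentiating the automorphism identity of F and
    transporting the result back by F' gives the derivation identity. *)
Lemma automorphism_derivation (R : comNzRingType) m (x : 'I_m -> 'M[R]_m) (D : R -> R)
  (DD : {morph D : a b / a + b}) (DM : forall a b, D (a * b) = D a * b + a * D b)
  (Dx : forall i a b, D (x i a b) = 0) (F F' : 'M[R]_m) :
  F *m F' = 1%:M -> (forall u v, br x (u *m F) (v *m F) = br x u v *m F) ->
  derivation x (F' *m map_mx D F).
Proof.
move=> FF' aut; have F'F := mulmx1C FF'.
have D0 : D 0 = 0 by apply: (@addrI _ (D 0)); rewrite -DD !addr0.
have Dsum (I : Type) (s : seq I) (f : I -> R) : D (\sum_(i <- s) f i) = \sum_(i <- s) D (f i).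
  exact: (big_morph D DD D0).
have DMx p q t (A : 'M[R]_(p, q)) (B : 'M[R]_(q, t)) : map_mx D (A *m B) = map_mx D A *m B + A *m map_mx D B.
  by apply/matrixP => i j; rewrite !mxE Dsum -big_split; apply: eq_bigr => l _; rewrite !mxE DM.
have Dadv (u : 'rV[R]_m) : map_mx D (adv x u) = adv x (map_mx D u).
  apply/matrixP => i j; rewrite mxE /adv !summxE Dsum; apply: eq_bigr => l _.
  by rewrite !mxE DM Dx mulr0 addr0.
have autm u : F *m adv x (u *m F) = adv x u *m F.
  by apply/row_matrixP => i; rewrite !rowE !mulmxA -[LHS]/(br x (u *m F) (delta_mx 0 i *m F)) aut.
have base (i : 'I_m) : let u := (delta_mx 0 i : 'rV[R]_m) in
    map_mx D F *m adv x (u *m F) + F *m adv x (u *m map_mx D F) = adv x u *m map_mx D F.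
  move=> u; have := congr1 (map_mx D) (autm u); rewrite !DMx Dadv DMx.
  have D1 : D 1 = 0 by apply: (@addrI _ (D 1)); rewrite addr0 -[in RHS](mulr1 1) DM mulr1 mul1r.
  have -> : map_mx D u = 0 by apply/rowP => j; rewrite !mxE; case: (_ && _).
  rewrite mul0mx add0r => ->.
  have -> : map_mx D (adv x u) = 0 by rewrite Dadv; have -> : map_mx D u = 0 by [apply/rowP => j; rewrite !mxE; case: (_ && _)]; rewrite linear0.
  by rewrite mul0mx add0r.
have lin u : map_mx D F *m adv x (u *m F) + F *m adv x (u *m map_mx D F) = adv x u *m map_mx D F.
  have step a v w : map_mx D F *m adv x (v *m F) + F *m adv x (v *m map_mx D F) = adv x v *m map_mx D F ->
      map_mx D F *m adv x (w *m F) + F *m adv x (w *m map_mx D F) = adv x w *m map_mx D F ->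
      let z := a *: v + w in
      map_mx D F *m adv x (z *m F) + F *m adv x (z *m map_mx D F) = adv x z *m map_mx D F.
    move=> ev ew /=; rewrite !mulmxDl -!scalemxAl !linearP /= [in RHS]mulmxDl -scalemxAl -ev -ew scalerDr.
    by rewrite addrACA.
  rewrite [u]row_sum_delta; elim: (index_enum _) => [|i s IH].
    by rewrite big_nil !mul0mx linear0 !mulmx0 mul0mx addr0.
  by rewrite big_cons; apply: step => //; apply: base.
move=> w; have := congr1 (mulmx F') (lin (w *m F')).
rewrite mulmxDr -[w *m F' *m F]mulmxA F'F mulmx1 !mulmxA F'F mul1mx => e.
have e2 : F' *m adv x (w *m F') = adv x w *m F'.
  by rewrite -[LHS]mulmx1 -FF' !mulmxA -[F' *m _ *m F]mulmxA -autm mulmxA F'F mul1mx -mulmxA F'F mulmx1.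
by rewrite -e2 -e.
Qed.
End LieFacts.

(** * Conclusion *)

Section Maps.
Variables (R S : comNzRingType) (f : {rmorphism R -> S}) (m : nat).
Implicit Types x : 'I_m -> 'M[R]_m.

Lemma map_adv x u : map_mx f (adv x u) = adv (fun i => map_mx f (x i)) (map_mx f u).
Proof. by rewrite /adv map_mx_sum; apply: eq_bigr => i _; rewrite map_mxZ mxE. Qed.

Lemma map_chg Q Q' x i : map_mx f (chg Q Q' x i) = chg (map_mx f Q) (map_mx f Q') (fun i => map_mx f (x i)) i.
Proof. by rewrite /chg !map_mxM map_adv map_row. Qed.

Lemma map_kill x : map_mx f (kill x) = kill (fun i => map_mx f (x i)).
Proof. by apply/matrixP => i j; rewrite !mxE -map_mxM trace_map_mx. Qed.

Lemma lie_inj x : injective f -> lie (fun i => map_mx f (x i)) -> lie x.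
Proof.
move=> finj /lieP[h1 h2]; apply/lieP; split=> [i j l|i j q l]; apply: finj.
  by have := h1 i j l; rewrite !mxE rmorphN.
have := h2 i j q l; under eq_bigr => p _ do rewrite !mxE -rmorphM.
under [in RHS]eq_bigr => p _ do rewrite !mxE -rmorphM.
under [X in _ - X]eq_bigr => p _ do rewrite !mxE -rmorphM.
by rewrite -!rmorph_sum -rmorphB.
Qed.

Lemma map_el N (b : 'I_m -> 'M[R]_N) u : map_mx f (el b u) = el (fun i => map_mx f (b i)) (map_mx f u).
Proof. by rewrite /el map_mx_sum; apply: eq_bigr => i _; rewrite map_mxZ mxE. Qed.
End Maps.

Lemma chg_chg (R : comNzRingType) m (x : 'I_m -> 'M[R]_m) Q Q' P P' i :
  chg Q Q' (chg P P' x) i = chg (Q *m P) (P' *m Q') x i.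
Proof. by rewrite {1}/chg adv_chg -row_mul /chg !mulmxA. Qed.

(** Bases that differ by an automorphism have the same structure constants. Applied to a basis and
    its Galois conjugate, this makes the constants of an invariant basis Galois invariant. *)
Lemma aut_chg (R : comNzRingType) m (x : 'I_m -> 'M[R]_m) (Q Q' P P' C : 'M[R]_m) i :
  (forall u v, br x (u *m C) (v *m C) = br x u v *m C) -> Q *m C = P -> P *m P' = 1%:M -> Q *m Q' = 1%:M ->
  chg P P' x i = chg Q Q' x i.
Proof.
move=> aut QC PP' QQ'; have Q'Q := mulmx1C QQ'.
have autm u : C *m adv x (u *m C) = adv x u *m C.
  by apply/row_matrixP => j; rewrite !rowE !mulmxA -[LHS]/(br x (u *m C) (delta_mx 0 j *m C)) aut.
have CP' : C *m P' = Q' by rewrite -[LHS]mul1mx -Q'Q -mulmxA [Q *m _]mulmxA QC PP' mulmx1.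
by rewrite /chg -{1 2}QC row_mul -[Q *m C *m _]mulmxA autm !mulmxA -[_ *m C *m P']mulmxA CP'.
Qed.

Section FunctorFacts.
Variables (k : fieldType) (G : groupFunctor k).
Lemma fmap1 (R S : comAlgType k) (f : {lrmorphism R -> S}) : fmap G f 1%g = 1%g.
Proof. by apply: (mulgI (fmap G f 1%g)); rewrite -fmapM !mulg1. Qed.
Lemma fmapV (R S : comAlgType k) (f : {lrmorphism R -> S}) x : fmap G f (x^-1)%g = (fmap G f x)^-1%g.
Proof. by apply: (mulgI (fmap G f x)); rewrite -fmapM !mulgV fmap1. Qed.
End FunctorFacts.

Section Evaluation0.
Variables (k : fieldType) (L : splittingFieldType k) (G : groupFunctor k).
Local Notation R := (polyk L).

Definition at0 : G R -> G L := fmap G (@peval0 k L : {lrmorphism R -> L}).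

Lemma at0_const g : at0 (fmap G (@polyC_k k L : {lrmorphism L -> R}) g) = g.
Proof.
rewrite /at0 -[LHS](@fmap_comp k G _ _ _ _ _ (idfun : {lrmorphism L -> L})) ?fmap_id // => a.
by rewrite /= /peval0 /polyC_k hornerC.
Qed.

Lemma at0_act s g : at0 (act_poly s g) = act_field s (at0 g).
Proof.
pose h : {lrmorphism R -> L} := @peval0 k L \o gal_poly s.
transitivity (fmap G h g); first by symmetry; apply: fmap_comp.
apply: fmap_comp => p; rewrite /h /= /peval0 /gal_poly.
by rewrite -[0 in LHS](rmorph0 (s : {rmorphism L -> L})) horner_map.
Qed.
End Evaluation0.

Lemma fcoef_zero (L : comNzRingType) : exists f : {rmorphism fps L -> L}, forall p, f p = fcoef p 0.
Proof.
have fB : zmod_morphism (fun p : fps L => fcoef p 0) by [].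
have fM : monoid_morphism (fun p : fps L => fcoef p 0) by split=> // p q; apply: fcoef0M.
pose f : {rmorphism fps L -> L} := HB.pack (fun p : fps L => fcoef p 0)
  (GRing.isZmodMorphism.Build _ _ _ fB) (GRing.isMonoidMorphism.Build _ _ _ fM).
by exists f.
Qed.

Lemma fixed_poly (k : fieldType) (L : splittingFieldType k) (p : {poly L}) : galois 1 {:L} ->
  (forall s : gal_of {:L}, map_poly (s : L -> L) p = p) -> exists q : {poly k}, p = map_poly (in_alg L) q.
Proof.
move=> /galois_fixedField gal hp; apply/polyOver1P/polyOverP => i.
have : p`_i \in fixedField 'Gal({:L} / 1)%g.
  by apply/fixedFieldP; rewrite ?memvf // => s _; rewrite -{2}(hp s) coef_map.
by rewrite gal.
Qed.

Section Descent.
Variables (k : fieldType) (G : groupFunctor k) (n : nat) (r : linear_rep G n.+1).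
Hypothesis fc : faithful_closed r.
Hypothesis ch0 : [pchar k] =i pred0.
Hypothesis redG : reductive_group G.
Variable L : splittingFieldType k.
Hypothesis galL : galois 1 {:L}.
Local Notation N := n.+1.
Local Notation R := (polyk L).
Local Notation A_ R := (map_mx (in_alg R)).
Local Notation m := (\rank (cspan (gg r) (gg r))).
Local Notation sbr := (@sb _ _ _ r).
Local Notation sxr := (@sx _ _ _ r).
Local Notation bS S := (fun i : 'I_m => A_ S (sbr i)).
Local Notation xS S := (fun i : 'I_m => A_ S (sxr i)).

Let chL : [pchar L] =i pred0 := pchar0_fmorph (in_alg L) ch0.

Lemma mapA (S S' : comAlgType k) (f : {lrmorphism S -> S'}) p q (M : 'M[k]_(p, q)) : map_mx f (A_ S M) = A_ S' M.
Proof. by apply/matrixP => i j; rewrite !mxE; apply: rmorph_alg. Qed.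

Section AdC.
Variable S : comAlgType k.
(** Coordinates are rows, so products are reversed; the cocycle rule for c then becomes the rule
    that [hilbert90_poly] expects. *)
Definition AdC (g : G S) : 'M[S]_m := sval (cid (Ad_matrix fc g)).
Lemma AdCE g v : el (bS S) (v *m AdC g) = Ad r g (el (bS S) v).
Proof. by rewrite /AdC; case: cid => C /= ->. Qed.
Lemma AdC_uniq g C : (forall i, el (bS S) (row i C) = Ad r g (A_ S (sbr i))) -> C = AdC g.
Proof.
move=> h; apply/row_matrixP => i; apply: (@el_inj _ _ _ r S).
by rewrite h [in RHS]rowE AdCE el_delta.
Qed.
Lemma AdCM g h : AdC (g * h)%g = AdC h *m AdC g.
Proof.
symmetry; apply: AdC_uniq => i; rewrite row_mul AdCE rowE AdCE el_delta /Ad invMg !rep_appM.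
by rewrite !mulmxA.
Qed.
Lemma AdC1 : AdC 1%g = 1%:M.
Proof.
symmetry; apply: AdC_uniq => i; rewrite rowE mulmx1 el_delta /Ad invg1 !rep_app1.
by rewrite mul1mx mulmx1.
Qed.
Lemma AdC_aut g u v : br (xS S) (u *m AdC g) (v *m AdC g) = br (xS S) u v *m AdC g.
Proof.
apply: (@el_inj _ _ _ r S); rewrite (el_br (@sbxR _ _ _ r fc S)) !AdCE (el_br (@sbxR _ _ _ r fc S)).
by rewrite Ad_cm.
Qed.
End AdC.

Lemma AdC_map (S S' : comAlgType k) (f : {lrmorphism S -> S'}) (g : G S) :
  AdC (fmap G f g) = map_mx f (AdC g).
Proof.
symmetry; apply: AdC_uniq => i; rewrite -map_row.
have -> : el (bS S') (map_mx f (row i (AdC g))) = map_mx f (el (bS S) (row i (AdC g))).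
  by rewrite map_el /el; apply: eq_bigr => j _; rewrite mapA.
by rewrite rowE AdCE el_delta /Ad !map_mxM mapA -fmapV !rep_nat.
Qed.

Lemma el_deriv (u : 'rV[R]_m) :
  map_mx (@dpoly k L) (el (bS R) u) = el (bS R) (map_mx (@dpoly k L) u).
Proof.
apply: (can_inj mxvecK).
by rewrite -map_mxvec (@elE _ _ _ r R u) (linear_mulmxr (@dpoly k L)) (@elE _ _ _ r R).
Qed.

Lemma lie_xS (S : comAlgType k) : lie (xS S).
Proof. exact: lie_of_matrices (@sbxR _ _ _ r fc S) (@el_inj _ _ _ r S). Qed.

Lemma kill_xS (S : comAlgType k) : kill (xS S) *m A_ S (invmx (kill sxr)) = 1%:M.
Proof.
by rewrite kill_map -map_mxM mulmxV ?map_mx1 //; apply: (killing_nondegenerate fc ch0 redG).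
Qed.

(** An invariant basis P has structure constants in k[t]; the matrix Q that makes them constant has
    entries in k[t] too, so the basis Q P is still invariant. *)
Lemma constant_form (c : gal_of {:L} -> 'M[{poly L}]_m) :
  c 1%g = 1%:M -> (forall x y, c (x * y)%g = map_mx (map_poly (y : L -> L)) (c x) *m c y) ->
  (forall s u v, br (xS R) (u *m c s) (v *m c s) = br (xS R) u v *m c s) ->
  exists E E' : 'M[{poly L}]_m, [/\ E *m E' = 1%:M,
    forall s : gal_of {:L}, map_mx (map_poly (s : L -> L)) E *m c s = E &
    forall i a b, (size (chg E E' (xS R) i a b : {poly L}) <= 1)%N].
Proof.
move=> c1 cM caut; have [P [P' [PP' hP]]] := hilbert90_poly c1 cM.
pose x1 := chg P P' (xS R).
have x1fix (s : gal_of {:L}) i : map_mx (map_poly (s : L -> L)) (x1 i) = x1 i.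
  have e0 : (fun i => map_mx (gal_poly s) (xS R i)) = xS R by apply/funext => j; apply: mapA.
  rewrite -[LHS]/(map_mx (gal_poly s) (chg P P' (xS R) i)) map_chg e0.
  symmetry; apply: (aut_chg _ (caut s) (hP s) PP').
  by rewrite -map_mxM PP' map_mx1.
have hx i : exists M : 'M[{poly k}]_m, x1 i = map_mx (map_poly (in_alg L)) M.
  have hq a b : {q : {poly k} | x1 i a b = map_poly (in_alg L) q}.
    by apply: cid; apply: fixed_poly => // s; have /matrixP/(_ a b) := x1fix s i; rewrite mxE.
  exists (\matrix_(a, b) sval (hq a b)); apply/matrixP => a b; rewrite [RHS]mxE [X in map_poly _ X]mxE.
  exact: (svalP (hq a b)).
have [xk hxk] := fin_all_exists hx.
have x1E : x1 = (fun i => map_mx (map_poly (in_alg L)) (xk i)) by apply/funext.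
have lxk : lie xk.
  apply: (@lie_inj _ _ (map_poly (in_alg L))); first exact: map_poly_inj.
  by rewrite -x1E; apply: lie_chg PP' (lie_xS R).
have uxk : unimodular xk.
  apply/size_poly1P; rewrite -(size_map_poly (in_alg L)).
  rewrite -[map_poly _ _]/((map_poly (in_alg L) : {rmorphism _ -> _}) _) -det_map_mx map_kill -x1E.
  rewrite /x1 (kill_chg _ PP') !det_mulmx det_tr.
  have : \det P * \det (kill (xS R)) * \det P \is a GRing.unit.
    have uP : \det P \is a GRing.unit by apply/unitrP; exists (\det P'); rewrite -!det_mulmx PP' (mulmx1C PP') det1.
    have uK : \det (kill (xS R) : 'M[{poly L}]_m) \is a GRing.unit.
      apply/unitrP; exists (\det (A_ R (invmx (kill sxr)) : 'M[{poly L}]_m)).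
      by rewrite -!det_mulmx (kill_xS R) (mulmx1C (kill_xS R)) det1.
    by rewrite !unitrM uP uK.
  by rewrite poly_unitE => /andP[].
have [K [iota _]] := redG.
have [Q [Q' [QQ' sz]]] := lie_poly_constant iota ch0 lxk uxk.
pose q (M : 'M[{poly k}]_m) := map_mx (map_poly (in_alg L)) M.
exists (q Q *m P), (P' *m q Q'); split.
- by rewrite -mulmxA [P *m _]mulmxA PP' mul1mx -map_mxM QQ' map_mx1.
- move=> s; rewrite map_mxM -mulmxA hP; congr (_ *m _).
  apply/matrixP => a b; rewrite !mxE; apply/polyP => i; rewrite !coef_map /=.
  by rewrite linearZ /= rmorph1.
- move=> i a b; rewrite -chg_chg -/x1 x1E.
  have := map_chg (map_poly (in_alg L)) Q Q' xk i; rewrite -/(q Q) -/(q Q') => <-.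
  by rewrite mxE size_map_poly.
Qed.

(* An automorphism Phi over L[t] with Phi(0) = 1 is Ad of a solution of the differential equation
   g' = Y g, g(0) = 1, where ad Y is the logarithmic derivative of Phi. *)
Lemma integrate_automorphism (F F' : 'M[{poly L}]_m) : F *m F' = 1%:M ->
  (forall u v, br (xS R) (u *m F) (v *m F) = br (xS R) u v *m F) ->
  map_mx (fun p : {poly L} => p.[0]) F = 1%:M ->
  exists a : G R, AdC a = F /\ map_mx (@peval0 k L) (r R a) = 1%:M.
Proof.
move=> FF' aut F0; have F'F := mulmx1C FF'.
have Dx (i a b : 'I_m) : deriv (xS R i a b : {poly L}) = 0.
  rewrite mxE -[in_alg R _]/((sxr i a b)%:A *: (1 : {poly L})).
  by rewrite derivZ -polyC1 derivC scaler0.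
have dD := automorphism_derivation (@derivD L) (@derivM L) Dx FF' aut.
have [y ey] := derivation_inner (lie_xS R) (kill_xS R) dD.
have DF : map_mx (@deriv L) F = F *m adv (xS R) y by rewrite -ey mulmxA FF' mul1mx.
pose Y : 'M[R]_N := el (bS R) y.
have elY u : el (bS R) (u *m adv (xS R) y) = cm Y (el (bS R) u).
  by rewrite -[u *m _]/(br _ y u) (el_br (@sbxR _ _ _ r fc R)).
pose bL i : 'M[L]_N := A_ L (sbr i).
have CbL (M : 'M[k]_N) : map_mx (@polyC L) (A_ L M) = A_ R M.
  exact: (mapA (@polyC_k k L : {lrmorphism L -> R})).
pose Ph i j := F j i.
(* s is perfect, so Y can be written by brackets of basis elements, the shape required by [Ysys]. *)
have /fin_all_exists[w hw] : forall l : 'I_m, exists c : 'M[k]_m, sbr l = \sum_i \sum_j c i j *: cm (sbr i) (sbr j).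
  move=> l; have := killing_perfect (sx_lie fc) (killing_nondegenerate fc ch0 redG) (delta_mx 0 l).
  move/bspan_sum => [c ec]; exists c; rewrite -[LHS]el_delta ec linear_sum; apply: eq_bigr => i _.
  rewrite linear_sum; apply: eq_bigr => j _; rewrite linearZ /= (el_br (sbx fc)) !row1 !el_delta //.
pose cc i j : {poly L} := \sum_l (y 0 l : {poly L}) * (in_alg R (w l i j) : {poly L}).
have eY : Ysys cc bL = Y.
  rewrite /Y /el; under [RHS]eq_bigr => l _ do rewrite hw map_mx_sum scaler_sumr.
  rewrite exchange_big; apply: eq_bigr => i _.
  under [RHS]eq_bigr => l _ do rewrite map_mx_sum scaler_sumr.
  rewrite exchange_big; apply: eq_bigr => j _; rewrite /cc scaler_suml; apply: eq_bigr => l _.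
  rewrite map_mxZ scalerA; congr (_ *: _).
  by rewrite -CbL; congr (map_mx _ _); rewrite /cm map_mxB !map_mxM.
have eE j : esys Ph bL j = el (bS R) (row j F).
  by rewrite /esys /el; apply: eq_bigr => i _; rewrite /Ph mxE CbL.
pose S := map_mx (@pfps L).
have [f0 f0E] := fcoef_zero L.
have [g [Dg g0]] := ode_exists chL (S _ _ (Y : 'M[{poly L}]_N)).
have g1 : map_mx f0 g = 1%:M by apply/matrixP => i j; rewrite !mxE f0E g0.
have S0 p q (M : 'M[{poly L}]_(p, q)) : map_mx f0 (S _ _ M) = map_mx (fun p : {poly L} => p.[0]) M.
  by apply/matrixP => i j; rewrite !mxE f0E horner_coef0.
have Sinj p q : injective (S p q).
  by move=> A B /matrixP e; apply/matrixP => i j; apply: pfps_inj; have := e i j; rewrite !mxE.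
have ev0A (M : 'M[k]_N) : map_mx (@peval0 k L) (A_ R M) = A_ L M by apply: mapA.
have ev0el u : map_mx (@peval0 k L) (el (bS R) u) = el bL (map_mx (@peval0 k L) u).
  by rewrite map_el /el; apply: eq_bigr => i _; rewrite ev0A.
(* The difference of the two sides solves the equation of g and vanishes at t = 0, hence is 0:
   conjugation by g induces F. *)
have inter j : S _ _ (esys Ph bL j) *m g = g *m S _ _ (map_mx (@polyC L) (bL j)).
  apply/eqP; rewrite -subr_eq0; apply/eqP; apply: (ode_unique chL (Y := S _ _ (Y : 'M[{poly L}]_N))).
    rewrite map_mxB /= !DM Dg DSC mulmx0 addr0 DS eE.
    have -> : map_mx (@deriv L) (el (bS R) (row j F) : 'M[{poly L}]_N) = cm Y (el (bS R) (row j F)).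
      rewrite -elY -row_mul -DF.
      by rewrite -[LHS]/(map_mx (@dpoly k L) (el (bS R) (row j F))) el_deriv map_row.
    rewrite /cm map_mxB /= !map_mxM mulmxBl mulmxBr !mulmxA.
    by rewrite subrK.
  move=> a b; suff : map_mx f0 (S _ _ (esys Ph bL j) *m g - g *m S _ _ (map_mx (@polyC L) (bL j))) = 0.
    by move/matrixP/(_ a b); rewrite mxE [RHS]mxE f0E.
  rewrite map_mxB /= !map_mxM g1 mulmx1 mul1mx !S0 eE CbL -[X in X - _]/(map_mx (@peval0 k L) _).
  rewrite -[X in _ - X]/(map_mx (@peval0 k L) _) ev0el ev0A map_row.
  by rewrite -[map_mx _ F]/(map_mx (fun p : {poly L} => p.[0]) F) F0 rowE mulmx1 el_delta subrr.
have sol : solves Ph cc bL g by split=> //; rewrite eY.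
have [K [iota _]] := redG.
have [jL] := galois_embedding iota galL.
have [h eh] := ode_polynomial_descent jL chL sol.
have hD : map_mx (@dpoly k L) (h : 'M[R]_N) = Y *m (h : 'M[R]_N).
  by apply: (@Sinj N N); rewrite -[LHS]DS -[map_mx (@pfps L) h]eh Dg eh -map_mxM.
have h0 : map_mx (@peval0 k L) (h : 'M[R]_N) = 1%:M.
  by rewrite -g1 eh S0.
have hinter j : el (bS R) (row j F) *m (h : 'M[R]_N) = (h : 'M[R]_N) *m A_ R (sbr j).
  by apply: (@Sinj N N); rewrite /S -eE -CbL !map_mxM -[map_mx (@pfps L) h]eh; apply: inter.
have sep (f : R) : (forall e, peval0 (iter e (@dpoly k L) f) = 0) -> f = 0.
  move=> hf; apply/polyP => e; rewrite coef0; have := hf e.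
  rewrite /peval0 horner_coef0 -[iter _ _ _]/(derivn e (f : {poly L})) coef_derivn addn0 ffactnn -mulr_natr => /eqP.
  by rewrite mulf_eq0 (pcharf0P L).1 // -[e`! == 0%N]negbK -lt0n fact_gt0 orbF => /eqP.
have [a ea] : inG r (h : 'M[R]_N).
  apply: (inG_ode fc (@dpolyM k L) sep hD); last by rewrite h0; apply: inG1.
  by apply: (inR_sub (ss_sub fc)); apply/inR_el; exists y.
exists a; split; last by rewrite ea.
symmetry; apply: AdC_uniq => i; rewrite /Ad ea -hinter -ea -mulmxA repVr mulmx1 //.
Qed.

Theorem cocycle_constant (c : cocycle (poly_points L G)) : exists a : G R, forall s,
  fmap G (@polyC_k k L : {lrmorphism L -> R}) (at0 (val c s)) = (a^-1 * val c s * act_poly s a)%g.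
Proof.
pose C s := AdC (val c s : G R).
have c1 : val c 1%g = 1%g :> G R.
  apply: (mulgI (val c 1%g : G R)); rewrite mulg1 -{3}[1%g]mulg1 cocycleM.
  by congr (_ * _)%g; symmetry; apply: act_poly1.
have C1 : C 1%g = 1%:M by rewrite /C c1 AdC1.
have Cact s (g : G R) : AdC (act_poly s g) = map_mx (map_poly (s : L -> L)) (AdC g).
  exact: (AdC_map (gal_poly s : {lrmorphism R -> R})).
have CM x y : C (x * y)%g = map_mx (map_poly (y : L -> L)) (C x) *m C y.
  by rewrite /C cocycleM AdCM -Cact.
have [E [E' [EE' hE szE]]] := constant_form C1 CM (fun s => AdC_aut (val c s : G R)).
pose h : {rmorphism {poly L} -> {poly L}} := (@polyC L \o horner_eval 0).
have hC0 s : map_mx h (C s) = AdC (fmap G (@polyC_k k L : {lrmorphism L -> R}) (at0 (val c s : G R))).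
  by rewrite AdC_map AdC_map -map_mx_comp; apply/matrixP => i j; rewrite !mxE.
have hh (M : 'M[k]_m) : map_mx h (A_ R M : 'M[{poly L}]_m) = A_ R M.
  rewrite -{2}(mapA (@polyC_k k L : {lrmorphism L -> R}) M) -(mapA (@peval0 k L : {lrmorphism R -> L}) M).
  by apply/matrixP => i j; rewrite !mxE.
pose E0 := map_mx h E; pose E0' := map_mx h E'.
have EE0 : E0 *m E0' = 1%:M by rewrite -map_mxM EE' map_mx1.
have [E'E E0'E] := (mulmx1C EE', mulmx1C EE0).
have x2E i : chg E0 E0' (xS R) i = chg E E' (xS R) i.
  transitivity (map_mx h (chg E E' (xS R) i)).
    rewrite map_chg; have -> // : (fun i => map_mx h (xS R i)) = xS R by apply/funext => j; apply: hh.
  apply/matrixP => a b; rewrite mxE /h /= /horner_eval.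
  by rewrite {2}[chg E E' (xS R) i a b](size1_polyC (szE i a b)) -horner_coef0.
(* E and E(0) lead to the same structure constants, so F = E(0)^-1 E is an automorphism, with F(0) =
   1. *)
pose F := E0' *m E; pose F' := E' *m E0.
have FF' : F *m F' = 1%:M by rewrite /F /F' -mulmxA [E *m _]mulmxA EE' mul1mx.
have F'F := mulmx1C FF'.
have F0 : map_mx h F = 1%:M.
  rewrite /F map_mxM; have -> : map_mx h E0' = E0' by apply/matrixP => a b; rewrite !mxE /h /= /horner_eval hornerC.
  exact: E0'E.
have brE (P P' : 'M[{poly L}]_m) u v : P *m P' = 1%:M -> br (chg P P' (xS R)) u v *m P = br (xS R) (u *m P) (v *m P).
  by move=> /mulmx1C P'P; rewrite br_chg -mulmxA P'P mulmx1.
have aut u v : br (xS R) (u *m F) (v *m F) = br (xS R) u v *m F.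
  rewrite /F !mulmxA -(brE _ _ _ _ EE') -[chg E E' _](_ : chg E0 E0' (xS R) = _); last by apply/funext.
  have := brE E0 E0' (u *m E0') (v *m E0') EE0.
  rewrite -[u *m E0' *m E0]mulmxA -[v *m E0' *m E0]mulmxA E0'E !mulmx1 => <-.
  by rewrite -[_ *m E0 *m E0']mulmxA EE0 mulmx1.
have [|a [ea a0]] := integrate_automorphism FF' aut.
  apply/matrixP => i j; have /matrixP/(_ i j) := F0; rewrite [LHS]mxE /h /= /horner_eval => e.
  rewrite [LHS]mxE; apply: polyC_inj; rewrite e !mxE.
  by case: (i == j).
exists a => s; pose c0 := fmap G (@polyC_k k L : {lrmorphism L -> R}) (at0 (val c s : G R)).
pose c' : G R := (a^-1 * val c s * act_poly s a)%g.
(* E trivializes Ad c and E(0) trivializes Ad c(0), so F is a coboundary between the two. *)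
have rel : map_mx (map_poly (s : L -> L)) F *m C s = map_mx h (C s) *m F.
  have sh M : map_mx (map_poly (s : L -> L)) (map_mx h M) = map_mx h (map_mx (map_poly (s : L -> L)) M) :> 'M_m.
    apply/matrixP => i j; rewrite !mxE /h /= /horner_eval map_polyC /=; congr (_%:P).
    by rewrite -[in RHS](rmorph0 (s : {rmorphism L -> L})) horner_map.
  rewrite /F map_mxM -mulmxA hE.
  have e1 : map_mx (map_poly (s : L -> L)) E0 *m map_mx h (C s) = E0 by rewrite sh -map_mxM hE.
  have e2 : map_mx (map_poly (s : L -> L)) E0' *m map_mx (map_poly (s : L -> L)) E0 = 1%:M by rewrite -map_mxM E0'E map_mx1.
  rewrite !mulmxA; congr (_ *m _); rewrite -[map_mx h (C s)]mul1mx -e2 -[_ *m _ *m map_mx h (C s)]mulmxA e1.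
  by rewrite -mulmxA EE0 mulmx1.
have AdV (g : G R) : AdC g *m AdC (g^-1)%g = 1%:M by rewrite -AdCM mulVg AdC1.
have Ac' : AdC c' = AdC c0.
  rewrite /c' !AdCM Cact ea -/(C s) mulmxA rel -hC0 -mulmxA -{1}ea AdV mulmx1 //.
(* So far c' and c0 agree only under [AdC]: their quotient centralizes s. It equals 1 at t = 0, and
   rigidity makes it trivial. *)
suff d1 : (c' * c0^-1)%g = 1%g by rewrite -/c0 -/c' -[c']mulg1 -(mulVg c0) mulgA d1 mul1g.
apply: fc.1; rewrite rep_app1; apply: (rigidity fc ch0 redG).
  move=> i; have e : Ad r (c' * c0^-1)%g (A_ R (sbr i)) = A_ R (sbr i).
    rewrite -{1}[A_ R (sbr i)](el_delta (bS R)) -AdCE AdCM Ac' -AdCM mulgV AdC1 mulmx1 el_delta //.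
  by rewrite -{2}e /Ad -!mulmxA repV mulmx1.
have at0a : at0 a = 1%g by apply: fc.1; rewrite rep_app1 rep_nat.
have -> : map_mx (@peval0 k L) (r R (c' * c0^-1)%g) = r L (at0 (c' * c0^-1)%g) by rewrite rep_nat.
rewrite /at0 fmapM fmapV -!/(at0 _) at0_const /c' /at0 !fmapM fmapV -!/(at0 _) at0_act at0a.
have -> : act_field s (1 : G L)%g = 1%g by apply: fmap1.
by rewrite invg1 mul1g mulg1 mulgV rep_app1.
Qed.

End Descent.

Theorem theorem1p2 (k : fieldType) (char0 : [pchar k] =i pred0)
    (G : groupFunctor k) (affG : affine_algebraic_group G)
    (connG : connected_group G) (redG : reductive_group G)
    (L : splittingFieldType k) (galL : galois 1 {:L}) :
  bijective (H1_map (const_points L G)).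
Proof.
have [n [r fc]] := embedding affG.
(* Evaluation at 0 is equivariant and undoes the inclusion of constants, so it carries a coboundary
   over L[t] to one over L. *)
have inj : injective (H1_map (const_points L G)).
  elim/quotW => c; elim/quotW => d; rewrite !H1_map_pi => /eqmodP/asboolP[a ha].
  apply/eqmodP/asboolP; exists (at0 a) => s.
  have := congr1 (@at0 k L G) (ha s); rewrite !ffunE /at0 !fmapM fmapV -!/(at0 _) !at0_const.
  by rewrite at0_act.
(* The preimage is the class of c(0). *)
have surj y : exists x, H1_map (const_points L G) x = y.
  elim/quotW: y => c; have [a ha] := cocycle_constant fc char0 redG galL c.
  have c0P : cocycle_pred (M := field_points L G) [ffun s => at0 (val c s : G (polyk L))].
    apply/forallP => x; apply/forallP => y; rewrite !ffunE cocycleM /at0 fmapM -!/(at0 _).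
    by rewrite at0_act.
  exists (\pi_(H1 (field_points L G)) (Sub [ffun s => at0 (val c s : G (polyk L))] c0P : cocycle (field_points L G)))%qT.
  rewrite H1_map_pi; apply/eqmodP/cohomologous_imp_sym/asboolP; exists a => s.
  rewrite /cocycle_map SubK ffunE SubK ffunE; exact: ha.
have hs y : {x | H1_map (const_points L G) x = y} by apply: cid.
exists (fun y => sval (hs y)) => [x|y]; last exact: (svalP (hs y)).
by apply: inj; apply: (svalP (hs _)).
Qed.
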